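(* Let $k\in\mathbb{N}$ and $m\in\mathbb{Z}$. Then for every integer $N\geq 1$, as $n\to\infty$, \begin{align*} a_{m,k}(n)&=(2\pi)^{-\frac{k}{2}} \sum_{\ell=1}^N d_{m,k}(\ell)\, n^{-\frac{2+2\ell+k}{4}} \left(\pi \sqrt{\frac{k}{6} } \right)^{1+\ell+\frac{k}{2}} I_{-1-\ell-\frac{k}{2}}\left(\pi \sqrt{\frac{2kn}{3}}\right)\\ &\quad +O\left(n^{-1-\frac{N}{2}-\frac{k}{4}} e^{\pi\sqrt{\frac{2kn}{3}}}\right), \end{align*} where $I_\nu$ is the usual $I$-Bessel function and the implied constant in the error term depends on $k$ and $m$ (and $N$).
   Context: Let $q=e^{2\pi i\tau}$ with $\tau$ in the upper half-plane, $\zeta=e^{2\pi i w}$, $\zeta^{1/2}:=e^{\pi i w}$, $q^{\alpha}:=e^{2\pi i \alpha\tau}$. Define $\theta_1(w;\tau):=i\zeta^{1/2}q^{1/8}\prod_{n\geq1}(1-q^n)(1-\zeta q^n)(1-\zeta^{-1}q^{n-1})$, $\eta(\tau):=q^{1/24}\prod_{n\ge1}(1-q^n)$, and $h_k(w;\tau):=\dfrac{i}{\theta_1(w;\tau)\eta(\tau)^{k-3}}$. The integers $a_{m,k}(n)$ ($n\ge0$, $m\in\mathbb{Z}$) are defined by the expansion $$q^{\frac{k}{24}}\left(\zeta^{1/2}-\zeta^{-1/2}\right)h_k(w;\tau)=\sum_{n\ge0,\,m\in\mathbb{Z}}a_{m,k}(n)\zeta^m q^n,\qquad |\zeta q|,|\zeta^{-1}q|<1.$$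 For $m\in\mathbb{Z}$ define the false theta function $\vartheta_m(q):=(1+q^{|m|})\sum_{n\ge0}(-1)^nq^{\frac{n(n+1)}{2}+n|m|}-1$. The numbers $d_{m,k}(\ell)$ are defined by the asymptotic expansion, with $q=e^{-z}$ and $z\to0$ ($\mathrm{Re}(z)>0$), $$q^{\frac{k}{24}}\vartheta_m(q)=\sum_{\ell=1}^N d_{m,k}(\ell)z^\ell+O(z^{N+1})\quad\text{for every } N\ge1,$$ i.e. $q^{k/24}\vartheta_m(q)=e^{-kz/24}\vartheta_m(e^{-z})$. *)

(* Defs.v *)
From Stdlib Require Export Reals ZArith.
From Coquelicot Require Export Coquelicot.
Open Scope R_scope.

Definition Cexp (z : C) : C :=
  (exp (Re z) * cos (Im z), exp (Re z) * sin (Im z)).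

Definition Cpowz (x : C) (p : Z) : C :=
  if (0 <=? p)%Z then Cpow x (Z.to_nat p) else Cinv (Cpow x (Z.to_nat (- p))).

(* Total operators: limits and sums in C taken on real and imaginary parts. *)
Definition CLim_seq (u : nat -> C) : C :=
  (real (Lim_seq (fun n => Re (u n))), real (Lim_seq (fun n => Im (u n)))).

Definition CSeries (u : nat -> C) : C :=
  (Series (fun n => Re (u n)), Series (fun n => Im (u n))).

Fixpoint Cprod (f : nat -> C) (N : nat) : C :=
  match N with
  | O => RtoC 1
  | S N' => Cmult (Cprod f N') (f (S N'))
  end.

(* prod_{n >= 1} f n *)
Definition Cprod_inf (f : nat -> C) : C := CLim_seq (Cprod f).

(* qpow alpha tau = q^alpha = e^{2 pi i alpha tau}.  Also used for the powers of
   zeta: zeta = qpow 1 w and zeta^{1/2} = qpow (1/2) w. *)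
Definition qpow (alpha : R) (tau : C) : C :=
  Cexp (RtoC (2 * PI * alpha) * Ci * tau)%C.

Definition theta1 (w tau : C) : C :=
  let q := qpow 1 tau in
  let zeta := qpow 1 w in
  (Ci * qpow (1 / 2) w * qpow (1 / 8) tau *
   Cprod_inf (fun n => (1 - Cpow q n) * (1 - zeta * Cpow q n)
                       * (1 - / zeta * Cpow q (n - 1))))%C.

Definition eta (tau : C) : C :=
  (qpow (1 / 24) tau * Cprod_inf (fun n => 1 - Cpow (qpow 1 tau) n))%C.

Definition h (k : nat) (w tau : C) : C :=
  (Ci / (theta1 w tau * Cpowz (eta tau) (Z.of_nat k - 3)))%C.

(* sum_{0 <= n <= N} sum_{-N <= m <= N} f m n *)
Definition square_sum {G : AbelianMonoid} (f : Z -> nat -> G) (N : nat) : G :=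
  sum_n (fun n => sum_n (fun j => f (Z.of_nat j - Z.of_nat N)%Z n) (2 * N)) N.

(* The double series over m in Z, n >= 0 converges absolutely, with sum s. *)
Definition is_double_sum (f : Z -> nat -> C) (s : C) : Prop :=
  (exists B : R, forall N : nat, square_sum (fun m n => Cmod (f m n)) N <= B) /\
  filterlim (square_sum f) eventually (locally s).

(* The point zeta = 1 is excluded: it is a removable singularity of the left
   side (0 times a pole of h), where the total division of C has no meaning.
   It is the only zero of theta1 in the domain. *)
Definition is_expansion_coeffs (k : nat) (a : Z -> nat -> Z) : Prop :=
  forall w tau : C,
    0 < Im tau ->
    Cmod (qpow 1 w * qpow 1 tau)%C < 1 ->
    Cmod (/ qpow 1 w * qpow 1 tau)%C < 1 ->
    qpow 1 w <> RtoC 1 ->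
    is_double_sum
      (fun m n => RtoC (IZR (a m n)) * Cpowz (qpow 1 w) m * Cpow (qpow 1 tau) n)%C
      (qpow (INR k / 24) tau * (qpow (1 / 2) w - qpow (- (1 / 2)) w) * h k w tau)%C.

Definition false_theta (m : Z) (q : C) : C :=
  ((1 + Cpow q (Z.abs_nat m)) *
   CSeries (fun n => RtoC ((-1) ^ n) * Cpow q (n * (n + 1) / 2 + n * Z.abs_nat m))
   - 1)%C.

(* Asymptotic expansion as z -> 0 with Re z > 0, uniform in each closed sector
   |Im z| <= K Re z.  Uniformity in the whole half-plane fails: for m = 0 and
   z -> 2 pi i / M from the right, |false_theta| is of order sqrt M. *)
Definition is_asymptotic_coeffs (m : Z) (k : nat) (d : nat -> C) : Prop :=
  forall (N : nat) (K : R), (1 <= N)%nat ->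
    exists B delta : R, 0 < delta /\
      forall z : C, 0 < Re z -> Rabs (Im z) <= K * Re z -> Cmod z < delta ->
        Cmod (Cexp (- (RtoC (INR k / 24) * z)) * false_theta m (Cexp (- z))
              - sum_n_m (fun l => d l * Cpow z l) 1 N)%C
        <= B * Cmod z ^ (N + 1).

(* 1 / Gamma(s) by Gauss's formula: the limit of
   s (s+1) ... (s+n) / (n! n^s), valid for every real s; it vanishes at the
   poles 0, -1, -2, ... of Gamma. *)
Definition rGamma (s : R) : R :=
  real (Lim_seq (fun n =>
    prod_f_R0 (fun i => s + INR i) n / (INR (fact n) * Rpower (INR n) s))).

(* I_nu(x) = sum_j (x/2)^(2j+nu) / (j! Gamma(j+nu+1)), for x > 0 and real nu. *)
Definition BesselI (nu x : R) : R :=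
  Series (fun j =>
    Rpower (x / 2) (2 * INR j + nu) / INR (fact j) * rGamma (INR j + nu + 1)).

(* Main.v *)
(* Write q = e^{-z}.  Comparing the Laurent coefficients in zeta of
   (q)^2 / ((zeta q) (q / zeta)) with those of its translate under zeta -> zeta q gives a
   three-term recurrence, also satisfied by the false theta functions; a Casoratian argument and
   the value at zeta = 1 identify the two solutions, so that sum_n a_{m,k}(n) q^n is
   (q)^{-k} theta_m(q).  The product (q) is transformed under z -> 4 pi^2 / z by integrating the
   quasimodularity of E_2, obtained from the partial fractions of 1 / sinh^2 and coth.  Cauchy's
   formula on Re z = x with x = sqrt (k pi^2 / (6 n)) then leaves, on the arc |Im z| <= 28 x, the
   integrals of z^{l + k/2} e^{k pi^2 / (6 z) + n z}; expanding e^{k pi^2 / (6 z)} reduces them to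
   inverse Laplace transforms of powers of z, which are limits of the binomial coefficients of
   (1 - q)^{-alpha}, that is, of Gauss's formula for 1 / Gamma.  On the remaining arcs
   |1 - q| is large compared with 1 - |q| and the integrand is exponentially smaller. *)

Require Import Defs.
From Stdlib Require Import Lra Lia Psatz.

(** * Convergence of complex sequences and series *)

(** No theory of holomorphic functions is used: identities between analytic functions come from
    derivatives along segments, and contour integrals are pairs of real integrals over t on the line
    x + i t; no contour is ever moved. Two obstacles shape the argument. The lattice sum of E_2
    converges only conditionally, so exchanging its two summations needs a telescoping correction;
    what that correction leaves at infinity is the term 1/(2z), hence the factor z^{1/2} in the
    transformation of (q). And the Bessel functions have negative index -1 - l - k/2, so their first
    terms contain 1/Gamma at negative arguments, where inversion by absolutely convergent integrals
    fails; these finitely many terms are estimated away instead of being inverted. The slope 28 of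
    the major arc is 4 times 7, where 7 comes from |1 - e^{-w}| >= |w|/7: from its ends on, |1 - q|
    >= 4x. This saves 3k/(4x) in the exponent on the minor arcs, and it keeps the error of the
    Bessel integrals at order exp(5nx/4), against a main size of exp(2nx). *)

Definition Ccv (u : nat -> C) (l : C) : Prop :=
  is_lim_seq (fun n => Cmod (u n - l)%C) 0.

(** The upper bound is excluded, so that splitting and telescoping need no special case at 0.
    [sum_n] includes its bound, hence the successors wherever the two meet. *)
Fixpoint csum (f : nat -> C) (n : nat) : C :=
  match n with
  | O => RtoC 0
  | S p => (csum f p + f p)%C
  end.

Lemma Ceq (a b : C) : Re a = Re b -> Im a = Im b -> a = b.
Proof. destruct a, b; simpl; intros; subst; reflexivity. Qed.

Lemma im_le_Cmod (c : C) : Rabs (Im c) <= Cmod c.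
Proof.
  apply Rle_trans with (2 := Rmax_Cmod c). apply Rmax_r.
Qed.

Lemma Cmod_le_re_im (c : C) : Cmod c <= Rabs (Re c) + Rabs (Im c).
Proof.
  replace c with (RtoC (Re c) + Ci * RtoC (Im c))%C at 1.
  - apply Rle_trans with (1 := Cmod_triangle _ _).
    rewrite Cmod_mult, Cmod_Ci, !Cmod_R. lra.
  - apply Ceq; simpl; ring.
Qed.

Lemma Cmod_minus_sym (a b : C) : Cmod (a - b) = Cmod (b - a).
Proof. replace (a - b)%C with (- (b - a))%C by ring. apply Cmod_opp. Qed.

Lemma Cmod_minus_triangle (a b c : C) : Cmod (a - c) <= Cmod (a - b) + Cmod (b - c).
Proof.
  replace (a - c)%C with ((a - b) + (b - c))%C by ring. apply Cmod_triangle.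
Qed.

Lemma Cmod_triangle_minus (a b : C) : Cmod (a - b) <= Cmod a + Cmod b.
Proof. unfold Cminus. rewrite <- (Cmod_opp b). apply Cmod_triangle. Qed.

Lemma Cmod_ge_minus (a b : C) : Cmod a - Cmod b <= Cmod (a + b).
Proof.
  assert (H := Cmod_triangle (a + b) (- b)). rewrite Cmod_opp in H.
  replace (a + b + - b)%C with a in H by ring. lra.
Qed.

Lemma lim0_le (u v : nat -> R) :
  eventually (fun n => 0 <= u n <= v n) -> is_lim_seq v 0 -> is_lim_seq u 0.
Proof.
  intros H Hv. apply is_lim_seq_le_le_loc with (u := fun _ => 0) (w := v); auto.
  apply is_lim_seq_const.
Qed.

Lemma Ccv_of_le (u : nat -> C) (l : C) (v : nat -> R) :
  eventually (fun n => Cmod (u n - l) <= v n) -> is_lim_seq v 0 -> Ccv u l.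
Proof.
  intros [N H] Hv. apply lim0_le with (2 := Hv). exists N. intros n Hn.
  split; [apply Cmod_ge_0 | auto].
Qed.

Lemma Ccv_const (c : C) : Ccv (fun _ => c) c.
Proof.
  apply is_lim_seq_ext with (fun _ => 0).
  - intros n. replace (c - c)%C with (RtoC 0) by ring. now rewrite Cmod_0.
  - apply is_lim_seq_const.
Qed.

Lemma Ccv_ext_loc (u v : nat -> C) (l : C) :
  eventually (fun n => u n = v n) -> Ccv u l -> Ccv v l.
Proof.
  intros [N H]. apply is_lim_seq_ext_loc. exists N. intros n Hn. now rewrite H.
Qed.

Lemma Ccv_ext (u v : nat -> C) (l : C) : (forall n, u n = v n) -> Ccv u l -> Ccv v l.
Proof. intros H. apply Ccv_ext_loc. exists O. auto. Qed.

Lemma is_lim_seq_sum0 (u v : nat -> R) :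
  is_lim_seq u 0 -> is_lim_seq v 0 -> is_lim_seq (fun n => u n + v n) 0.
Proof.
  intros Hu Hv. replace (Finite 0) with (Finite (0 + 0)) by (f_equal; ring).
  now apply is_lim_seq_plus'.
Qed.

Lemma is_lim_seq_scal0 (c : R) (u : nat -> R) :
  is_lim_seq u 0 -> is_lim_seq (fun n => c * u n) 0.
Proof.
  intros Hu. replace (Finite 0) with (Rbar_mult c 0) by (simpl; f_equal; ring).
  now apply is_lim_seq_scal_l.
Qed.

Lemma Ccv_plus (u v : nat -> C) (l m : C) :
  Ccv u l -> Ccv v m -> Ccv (fun n => u n + v n)%C (l + m)%C.
Proof.
  intros Hu Hv. eapply Ccv_of_le. 2: exact (is_lim_seq_sum0 _ _ Hu Hv).
  exists O. intros n _.
  replace (u n + v n - (l + m))%C with ((u n - l) + (v n - m))%C by ring.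
  apply Cmod_triangle.
Qed.

Lemma Ccv_scal (c : C) (u : nat -> C) (l : C) :
  Ccv u l -> Ccv (fun n => c * u n)%C (c * l)%C.
Proof.
  intros Hu. eapply Ccv_of_le. 2: exact (is_lim_seq_scal0 (Cmod c) _ Hu).
  exists O. intros n _. replace (c * u n - c * l)%C with (c * (u n - l))%C by ring.
  rewrite Cmod_mult. lra.
Qed.

Lemma Ccv_opp (u : nat -> C) (l : C) : Ccv u l -> Ccv (fun n => - u n)%C (- l)%C.
Proof.
  intros H. replace (- l)%C with (RtoC (-1) * l)%C by ring.
  apply Ccv_ext with (fun n => RtoC (-1) * u n)%C. intros; ring. now apply Ccv_scal.
Qed.

Lemma Ccv_minus (u v : nat -> C) (l m : C) :
  Ccv u l -> Ccv v m -> Ccv (fun n => u n - v n)%C (l - m)%C.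
Proof. intros Hu Hv. apply Ccv_plus; auto. now apply Ccv_opp. Qed.

Lemma Ccv_bounded (u : nat -> C) (l : C) :
  Ccv u l -> eventually (fun n => Cmod (u n) <= Cmod l + 1).
Proof.
  intros H. apply is_lim_seq_spec in H. destruct (H (mkposreal 1 Rlt_0_1)) as [N HN].
  exists N. intros n Hn. specialize (HN n Hn). simpl in HN.
  rewrite Rminus_0_r, Rabs_pos_eq in HN by apply Cmod_ge_0.
  replace (u n) with (l + (u n - l))%C by ring.
  apply Rle_trans with (1 := Cmod_triangle _ _). lra.
Qed.

Lemma Ccv_mult (u v : nat -> C) (l m : C) :
  Ccv u l -> Ccv v m -> Ccv (fun n => u n * v n)%C (l * m)%C.
Proof.
  intros Hu Hv.
  apply Ccv_of_le with
    (fun n => (Cmod l + 1) * Cmod (v n - m) + Cmod m * Cmod (u n - l)).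
  - destruct (Ccv_bounded u l Hu) as [N HN]. exists N. intros n Hn.
    replace (u n * v n - l * m)%C with (u n * (v n - m) + m * (u n - l))%C by ring.
    apply Rle_trans with (1 := Cmod_triangle _ _). rewrite !Cmod_mult.
    apply Rplus_le_compat_r. apply Rmult_le_compat_r. apply Cmod_ge_0. now apply HN.
  - apply is_lim_seq_sum0; now apply is_lim_seq_scal0.
Qed.

Lemma Ccv_unique (u : nat -> C) (l m : C) : Ccv u l -> Ccv u m -> l = m.
Proof.
  intros Hl Hm. assert (H := Ccv_minus _ _ _ _ Hl Hm). unfold Ccv in H.
  assert (E : Cmod (l - m) = 0).
  { assert (H2 : is_lim_seq (fun _ : nat => Cmod (l - m)) 0).
    { apply is_lim_seq_ext with (2 := H). intros n. rewrite <- Cmod_opp. f_equal. ring. }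
    assert (H3 := is_lim_seq_unique _ _ H2). rewrite Lim_seq_const in H3. congruence. }
  apply Cmod_eq_0 in E. replace l with ((l - m) + m)%C by ring. rewrite E. ring.
Qed.

Lemma Ccv_incr_1 (u : nat -> C) (l : C) : Ccv (fun n => u (S n)) l <-> Ccv u l.
Proof. split; apply (is_lim_seq_incr_1 (fun n => Cmod (u n - l))). Qed.

Lemma Ccv_Re (u : nat -> C) (l : C) : Ccv u l -> is_lim_seq (fun n => Re (u n)) (Re l).
Proof.
  intros H. apply is_lim_seq_ext with (fun n => (Re (u n) - Re l) + Re l).
  intros; ring. replace (Finite (Re l)) with (Finite (0 + Re l)) by (f_equal; ring).
  apply is_lim_seq_plus'. 2: apply is_lim_seq_const.
  apply is_lim_seq_abs_0. apply lim0_le with (2 := H). exists O. intros n _. split.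
  apply Rabs_pos. apply (re_le_Cmod (u n - l)).
Qed.

Lemma Ccv_Im (u : nat -> C) (l : C) : Ccv u l -> is_lim_seq (fun n => Im (u n)) (Im l).
Proof.
  intros H. apply is_lim_seq_ext with (fun n => (Im (u n) - Im l) + Im l).
  intros; ring. replace (Finite (Im l)) with (Finite (0 + Im l)) by (f_equal; ring).
  apply is_lim_seq_plus'. 2: apply is_lim_seq_const.
  apply is_lim_seq_abs_0. apply lim0_le with (2 := H). exists O. intros n _. split.
  apply Rabs_pos. apply (im_le_Cmod (u n - l)).
Qed.

Lemma lim_abs_diff0 (u : nat -> R) (l : R) :
  is_lim_seq u l -> is_lim_seq (fun n => Rabs (u n - l)) 0.
Proof.
  intros H. replace (Finite 0) with (Rbar_abs (Finite 0)) by (simpl; now rewrite Rabs_R0).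
  apply is_lim_seq_abs. replace 0 with (l - l) by ring.
  apply is_lim_seq_minus'. exact H. apply is_lim_seq_const.
Qed.

Lemma Ccv_Re_Im (u : nat -> C) (l : C) :
  is_lim_seq (fun n => Re (u n)) (Re l) -> is_lim_seq (fun n => Im (u n)) (Im l) ->
  Ccv u l.
Proof.
  intros H1 H2. eapply Ccv_of_le.
  2: exact (is_lim_seq_sum0 _ _ (lim_abs_diff0 _ _ H1) (lim_abs_diff0 _ _ H2)).
  exists O. intros n _. apply Cmod_le_re_im.
Qed.

Lemma Ccv_RtoC (u : nat -> R) (l : R) : is_lim_seq u l -> Ccv (fun n => RtoC (u n)) (RtoC l).
Proof. intros H. apply Ccv_Re_Im; simpl; auto. apply is_lim_seq_const. Qed.

Lemma Ccv_Cmod_le (u : nat -> C) (l : C) (B : R) :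
  eventually (fun n => Cmod (u n) <= B) -> Ccv u l -> Cmod l <= B.
Proof.
  intros [N HN] H. apply Rnot_lt_le. intros Hlt.
  apply is_lim_seq_spec in H.
  assert (He : 0 < Cmod l - B) by lra.
  destruct (H (mkposreal _ He)) as [M HM]. simpl in HM.
  specialize (HM (max N M) (Nat.le_max_r _ _)). specialize (HN (max N M) (Nat.le_max_l _ _)).
  rewrite Rminus_0_r, Rabs_pos_eq in HM by apply Cmod_ge_0.
  assert (T := Cmod_triangle (l - u (max N M)) (u (max N M))).
  replace (l - u (max N M) + u (max N M))%C with l in T by ring.
  rewrite Cmod_minus_sym in T. lra.
Qed.

Lemma Ccv_CLim_seq (u : nat -> C) (l : C) : Ccv u l -> CLim_seq u = l.
Proof.
  intros H. apply Ceq; simpl.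
  - now rewrite (is_lim_seq_unique _ _ (Ccv_Re _ _ H)).
  - now rewrite (is_lim_seq_unique _ _ (Ccv_Im _ _ H)).
Qed.

Lemma csum_ext (f g : nat -> C) (n : nat) :
  (forall i, (i < n)%nat -> f i = g i) -> csum f n = csum g n.
Proof.
  induction n as [|n IH]; intros H; simpl; auto.
  rewrite IH by (intros; apply H; lia). now rewrite H by lia.
Qed.

Lemma csum_plus (f g : nat -> C) (n : nat) :
  csum (fun i => f i + g i)%C n = (csum f n + csum g n)%C.
Proof. induction n as [|n IH]; simpl; [|rewrite IH]; ring. Qed.

Lemma csum_minus (f g : nat -> C) (n : nat) :
  csum (fun i => f i - g i)%C n = (csum f n - csum g n)%C.
Proof. induction n as [|n IH]; simpl; [|rewrite IH]; ring. Qed.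

Lemma csum_scal (c : C) (f : nat -> C) (n : nat) :
  csum (fun i => c * f i)%C n = (c * csum f n)%C.
Proof. induction n as [|n IH]; simpl; [|rewrite IH]; ring. Qed.

Lemma csum_add (f : nat -> C) (n m : nat) :
  csum f (n + m) = (csum f n + csum (fun i => f (n + i)%nat) m)%C.
Proof.
  induction m as [|m IH].
  - rewrite Nat.add_0_r. simpl. ring.
  - rewrite Nat.add_succ_r. simpl. rewrite IH. ring.
Qed.

Lemma csum_S (f : nat -> C) (n : nat) : csum f (S n) = (csum f n + f n)%C.
Proof. reflexivity. Qed.

Lemma csum_S_l (f : nat -> C) (n : nat) :
  csum f (S n) = (f O + csum (fun i => f (S i)) n)%C.
Proof. change (S n) with (1 + n)%nat. rewrite csum_add. simpl. ring. Qed.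

Lemma csum_rev (f : nat -> C) (n : nat) :
  csum f n = csum (fun i => f (n - 1 - i)%nat) n.
Proof.
  induction n as [|n IH]; simpl; auto.
  change (csum (fun i => f (n - 0 - i)%nat) n + f (n - 0 - n)%nat)%C
    with (csum (fun i => f (n - 0 - i)%nat) (S n)).
  rewrite csum_S_l, Nat.sub_0_r, Nat.sub_0_r, IH, Cplus_comm. f_equal.
  apply csum_ext. intros i Hi. f_equal. lia.
Qed.

Lemma csum_Re (f : nat -> C) (n : nat) : Re (csum f (S n)) = sum_n (fun i => Re (f i)) n.
Proof.
  induction n as [|n IH].
  - rewrite sum_O. apply Rplus_0_l.
  - rewrite sum_Sn, <- IH. reflexivity.
Qed.

Lemma csum_Im (f : nat -> C) (n : nat) : Im (csum f (S n)) = sum_n (fun i => Im (f i)) n.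
Proof.
  induction n as [|n IH].
  - rewrite sum_O. apply Rplus_0_l.
  - rewrite sum_Sn, <- IH. reflexivity.
Qed.

Lemma csum_sum_n (f : nat -> C) (n : nat) : sum_n f n = csum f (S n).
Proof.
  induction n as [|n IH].
  - rewrite sum_O. simpl. now rewrite Cplus_0_l.
  - rewrite sum_Sn, IH. reflexivity.
Qed.

Lemma Cmod_csum_le (f : nat -> C) (b : nat -> R) (n : nat) :
  (forall i, (i <= n)%nat -> Cmod (f i) <= b i) -> Cmod (csum f (S n)) <= sum_n b n.
Proof.
  induction n as [|n IH]; intros H.
  - rewrite sum_O. simpl. rewrite Cplus_0_l. now apply H.
  - rewrite sum_Sn. change (csum f (S (S n))) with (csum f (S n) + f (S n))%C.
    apply Rle_trans with (1 := Cmod_triangle _ _). apply Rplus_le_compat.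
    apply IH. intros; apply H; lia. apply H; lia.
Qed.

Lemma Cmod_csum_le_const (f : nat -> C) (B : R) (n : nat) :
  (forall i, (i < n)%nat -> Cmod (f i) <= B) -> Cmod (csum f n) <= INR n * B.
Proof.
  induction n as [|n IH]; intros H.
  - simpl. rewrite Cmod_0. lra.
  - rewrite S_INR. simpl csum. apply Rle_trans with (1 := Cmod_triangle _ _).
    assert (H1 := H n (Nat.lt_succ_diag_r n)).
    assert (H2 : Cmod (csum f n) <= INR n * B) by (apply IH; intros; apply H; lia). lra.
Qed.

Lemma ex_series_Cmod_le (f : nat -> C) (b : nat -> R) :
  (forall n, Cmod (f n) <= b n) -> ex_series b -> ex_series (fun n => Cmod (f n)).
Proof.
  intros H Hb. apply (ex_series_le (V := R_CompleteNormedModule)) with (2 := Hb). intros n.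
  change (Rabs (Cmod (f n)) <= b n). rewrite Rabs_pos_eq; auto. apply Cmod_ge_0.
Qed.

Lemma ex_series_Rle (a b : nat -> R) :
  (forall n, 0 <= a n <= b n) -> ex_series b -> ex_series a.
Proof.
  intros H Hb. apply (ex_series_le (V := R_CompleteNormedModule)) with (2 := Hb). intros n.
  change (Rabs (a n) <= b n). rewrite Rabs_pos_eq; apply H.
Qed.

(** Absolute convergence is not asked for, so that a closed form of the partial sums or a
    conditionally convergent expansion also determines the total operator [CSeries]. *)
Lemma Ccv_csum_CSeries (f : nat -> C) (l : C) : Ccv (csum f) l -> CSeries f = l.
Proof.
  intros H. apply Ccv_incr_1 in H. apply Ceq; simpl; apply is_series_unique.
  - assert (H1 := Ccv_Re _ _ H). unfold is_series.
    apply (is_lim_seq_ext _ _ _ (csum_Re f)) in H1. exact H1.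
  - assert (H1 := Ccv_Im _ _ H). unfold is_series.
    apply (is_lim_seq_ext _ _ _ (csum_Im f)) in H1. exact H1.
Qed.

Lemma CSeries_cv (f : nat -> C) :
  ex_series (fun n => Cmod (f n)) -> Ccv (csum f) (CSeries f).
Proof.
  intros H. apply Ccv_incr_1. apply Ccv_Re_Im; simpl.
  - apply is_lim_seq_ext with (1 := fun n => eq_sym (csum_Re f n)).
    apply Series_correct. apply (ex_series_le (V := R_CompleteNormedModule)) with (2 := H). intros n. apply re_le_Cmod.
  - apply is_lim_seq_ext with (1 := fun n => eq_sym (csum_Im f n)).
    apply Series_correct. apply (ex_series_le (V := R_CompleteNormedModule)) with (2 := H). intros n. apply im_le_Cmod.
Qed.

Lemma CSeries_ext (f g : nat -> C) : (forall n, f n = g n) -> CSeries f = CSeries g.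
Proof. intros H. apply Ceq; simpl; apply Series_ext; intros; now rewrite H. Qed.

Lemma CSeries_scal (c : C) (f : nat -> C) :
  ex_series (fun n => Cmod (f n)) -> CSeries (fun n => c * f n)%C = (c * CSeries f)%C.
Proof.
  intros H. apply Ccv_csum_CSeries. apply Ccv_ext with (fun n => c * csum f n)%C.
  intros; now rewrite csum_scal. apply Ccv_scal. now apply CSeries_cv.
Qed.

Lemma CSeries_plus (f g : nat -> C) :
  ex_series (fun n => Cmod (f n)) -> ex_series (fun n => Cmod (g n)) ->
  CSeries (fun n => f n + g n)%C = (CSeries f + CSeries g)%C.
Proof.
  intros Hf Hg. apply Ccv_csum_CSeries. apply Ccv_ext with (fun n => csum f n + csum g n)%C.
  intros; now rewrite csum_plus. apply Ccv_plus; now apply CSeries_cv.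
Qed.

Lemma ex_series_Cmod_plus (f g : nat -> C) :
  ex_series (fun n => Cmod (f n)) -> ex_series (fun n => Cmod (g n)) ->
  ex_series (fun n => Cmod (f n + g n)).
Proof.
  intros Hf Hg. apply ex_series_Cmod_le with (fun n => Cmod (f n) + Cmod (g n)).
  intros; apply Cmod_triangle. now apply (ex_series_plus (V := R_NormedModule)).
Qed.

Lemma ex_series_Rscal (c : R) (b : nat -> R) : ex_series b -> ex_series (fun n => c * b n).
Proof. intros H. now apply (ex_series_scal (V := R_NormedModule) c). Qed.

Lemma ex_series_Cmod_scal (c : C) (f : nat -> C) :
  ex_series (fun n => Cmod (f n)) -> ex_series (fun n => Cmod (c * f n)).
Proof.
  intros Hf. apply ex_series_Cmod_le with (fun n => Cmod c * Cmod (f n)).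
  intros; rewrite Cmod_mult; lra. now apply ex_series_Rscal.
Qed.

Lemma CSeries_finite (f : nat -> C) (n : nat) :
  (forall m, (n <= m)%nat -> f m = 0) -> CSeries f = csum f n.
Proof.
  intros H. apply Ccv_csum_CSeries. apply Ccv_ext_loc with (fun _ => csum f n).
  2: apply Ccv_const.
  exists n. intros m Hm. replace m with (n + (m - n))%nat by lia.
  rewrite csum_add, (csum_ext (fun i => f (n + i)%nat) (fun _ => 0 * 0)%C).
  rewrite csum_scal. ring. intros i _. rewrite H by lia. ring.
Qed.

Lemma sum_n_le_Series (b : nat -> R) (n : nat) :
  (forall i, 0 <= b i) -> ex_series b -> sum_n b n <= Series b.
Proof.
  intros H Hb. apply is_lim_seq_incr_compare. apply Series_correct; auto.
  intros m. rewrite sum_Sn. change (sum_n b m <= sum_n b m + b (S m)).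
  specialize (H (S m)). lra.
Qed.

Lemma Cmod_CSeries_le (f : nat -> C) (b : nat -> R) :
  (forall n, Cmod (f n) <= b n) -> ex_series b -> Cmod (CSeries f) <= Series b.
Proof.
  intros H Hb. assert (Hf := ex_series_Cmod_le _ _ H Hb).
  eapply Ccv_Cmod_le. 2: apply Ccv_incr_1, CSeries_cv; auto.
  exists O. intros n _. apply Rle_trans with (sum_n b n).
  apply Cmod_csum_le; auto. apply sum_n_le_Series; auto.
  intros i. apply Rle_trans with (2 := H i). apply Cmod_ge_0.
Qed.

Lemma ex_series_shift (b : nat -> R) (M : nat) :
  ex_series b -> ex_series (fun n => b (M + n)%nat).
Proof. apply (ex_series_incr_n (V := R_NormedModule)). Qed.

Lemma CSeries_split (f : nat -> C) (M : nat) :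
  ex_series (fun n => Cmod (f n)) ->
  CSeries f = (csum f M + CSeries (fun n => f (M + n)%nat))%C.
Proof.
  intros H. apply Ccv_csum_CSeries.
  assert (H1 := CSeries_cv (fun n => f (M + n)%nat) (ex_series_shift _ M H)).
  assert (H2 := Ccv_plus _ _ _ _ (Ccv_const (csum f M)) H1).
  apply (is_lim_seq_incr_n _ M).
  apply is_lim_seq_ext with (2 := H2). intros n. rewrite Nat.add_comm. now rewrite csum_add.
Qed.

Lemma CSeries_S (f : nat -> C) :
  ex_series (fun n => Cmod (f n)) ->
  CSeries f = (f O + CSeries (fun n => f (S n)))%C.
Proof. intros H. rewrite (CSeries_split f 1) by auto. simpl. ring. Qed.

Lemma Series_tail_lim (b : nat -> R) :
  ex_series b -> is_lim_seq (fun M => Series (fun n => b (S M + n)%nat)) 0.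
Proof.
  intros H. apply is_lim_seq_ext with (fun M => Series b - sum_n b M).
  - intros M. rewrite (Series_incr_n b (S M)); auto; try lia. simpl pred.
    rewrite <- sum_n_Reals. ring.
  - replace (Finite 0) with (Finite (Series b - Series b)) by (f_equal; ring).
    apply is_lim_seq_minus'. apply is_lim_seq_const. now apply Series_correct.
Qed.

(** Dominated convergence for series: past index [M] both tails are below eps/4, and the finitely
    many remaining terms converge one by one. Every exchange of a limit with a sum below goes
    through this: Fubini, the partial fractions and the limit at zeta = 1. *)
Lemma tannery (f : nat -> nat -> C) (g : nat -> C) (b : nat -> R) :
  eventually (fun N => forall m, Cmod (f N m) <= b m) -> ex_series b ->
  (forall m, Ccv (fun N => f N m) (g m)) ->
  Ccv (fun N => CSeries (f N)) (CSeries g).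
Proof.
  intros [N0 HN0] Hb Hlim.
  assert (Hg : forall m, Cmod (g m) <= b m).
  { intros m. eapply Ccv_Cmod_le. 2: apply Hlim. exists N0. intros; now apply HN0. }
  assert (Hgs := ex_series_Cmod_le _ _ Hg Hb).
  apply is_lim_seq_spec. intros [eps He]. simpl.
  assert (T := Series_tail_lim b Hb). apply is_lim_seq_spec in T.
  assert (He4 : 0 < eps / 4) by lra. destruct (T (mkposreal _ He4)) as [M HM].
  specialize (HM M (Nat.le_refl _)). simpl in HM.
  assert (Hc : Ccv (fun N => csum (f N) (S M)) (csum g (S M))).
  { clear HM. generalize (S M). intros p. induction p as [|p IH]; simpl.
    apply Ccv_const. now apply Ccv_plus. }
  apply is_lim_seq_spec in Hc. destruct (Hc (mkposreal _ He4)) as [N1 HN1]. simpl in HN1.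
  exists (max N0 N1). intros N HN. rewrite Rminus_0_r, Rabs_pos_eq by apply Cmod_ge_0.
  assert (HNN : (N0 <= N)%nat) by lia.
  assert (Hf := ex_series_Cmod_le _ _ (HN0 N HNN) Hb).
  rewrite (CSeries_split (f N) (S M)), (CSeries_split g (S M)) by auto.
  assert (HNN1 : (N1 <= N)%nat) by lia. specialize (HN1 N HNN1).
  rewrite Rminus_0_r, Rabs_pos_eq in HN1 by apply Cmod_ge_0.
  assert (B1 := Cmod_CSeries_le (fun n => f N (S M + n)%nat) (fun n => b (S M + n)%nat)
    (fun n => HN0 N HNN _) (ex_series_shift _ _ Hb)).
  assert (B2 := Cmod_CSeries_le (fun n => g (S M + n)%nat) (fun n => b (S M + n)%nat)
    (fun n => Hg _) (ex_series_shift _ _ Hb)).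
  rewrite Rminus_0_r in HM. apply Rabs_def2 in HM.
  simpl Nat.add in HM, B1, B2 |- *.
  set (u := csum (f N) (S M)) in *. set (v := csum g (S M)) in *.
  set (r := CSeries (fun n => f N (S (M + n)))) in *.
  set (t := CSeries (fun n => g (S (M + n)))) in *.
  replace (u + r - (v + t))%C with ((u - v) + (r - t))%C by ring.
  apply Rle_lt_trans with (1 := Cmod_triangle _ _).
  change (Cmod (u - v) < eps / 4) in HN1.
  assert (H3 := Cmod_triangle_minus r t). lra.
Qed.

Lemma CSeries_csum (f : nat -> nat -> C) (N : nat) :
  (forall n, ex_series (fun m => Cmod (f m n))) ->
  ex_series (fun m => Cmod (csum (f m) N)) /\
  CSeries (fun m => csum (f m) N) = csum (fun n => CSeries (fun m => f m n)) N.
Proof.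
  intros H. induction N as [|N [IH1 IH2]]; simpl.
  - split.
    + exists 0. apply filterlim_ext with (fun _ => 0).
      intros n. induction n. now rewrite sum_O, Cmod_0.
      rewrite sum_Sn, <- IHn, Cmod_0. change (0 = 0 + 0). ring.
      apply filterlim_const.
    + rewrite (CSeries_finite _ 0); auto.
  - split. now apply ex_series_Cmod_plus. rewrite CSeries_plus by auto. now rewrite IH2.
Qed.

(** The rows cut at N converge to the full rows and are dominated by the absolute row sums, so
    [tannery] applies in the row index. *)
Lemma CSeries_fubini (f : nat -> nat -> C) :
  (forall m, ex_series (fun n => Cmod (f m n))) ->
  ex_series (fun m => Series (fun n => Cmod (f m n))) ->
  Ccv (csum (fun n => CSeries (fun m => f m n))) (CSeries (fun m => CSeries (f m))).
Proof.
  intros H1 H2.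
  assert (Hb : forall m N, Cmod (csum (f m) N) <= Series (fun n => Cmod (f m n))).
  { intros m N. destruct N.
    - simpl. rewrite Cmod_0. apply Rle_trans with (sum_n (fun n => Cmod (f m n)) 0).
      rewrite sum_O. apply Cmod_ge_0. apply sum_n_le_Series; auto. intros; apply Cmod_ge_0.
    - apply Rle_trans with (sum_n (fun n => Cmod (f m n)) N).
      apply Cmod_csum_le. intros; lra. apply sum_n_le_Series; auto. intros; apply Cmod_ge_0. }
  assert (Hc : forall n, ex_series (fun m => Cmod (f m n))).
  { intros n. apply ex_series_Cmod_le with (2 := H2). intros m.
    apply Rle_trans with (sum_n (fun n => Cmod (f m n)) n).
    - destruct n. rewrite sum_O. lra. rewrite sum_Sn. unfold plus; simpl.
      assert (0 <= sum_n (fun n => Cmod (f m n)) n). 2: lra.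
      apply Rle_trans with (Cmod (csum (f m) (S n))). apply Cmod_ge_0.
      apply Cmod_csum_le. intros; lra.
    - apply sum_n_le_Series; auto. intros; apply Cmod_ge_0. }
  apply Ccv_ext with (fun N => CSeries (fun m => csum (f m) N)).
  - intros N. now apply CSeries_csum.
  - apply tannery with (b := fun m => Series (fun n => Cmod (f m n))); auto.
    exists O. auto. intros m. now apply CSeries_cv.
Qed.

Lemma CSeries_fubini_prod (f : nat -> nat -> C) (a b : nat -> R) :
  (forall m n, Cmod (f m n) <= a m * b n) -> ex_series a -> ex_series b ->
  Ccv (csum (fun n => CSeries (fun m => f m n))) (CSeries (fun m => CSeries (f m))) /\
  Ccv (csum (fun m => CSeries (f m))) (CSeries (fun m => CSeries (f m))).
Proof.
  intros H Ha Hb.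
  assert (E : forall m, ex_series (fun n => Cmod (f m n))).
  { intros m. apply ex_series_Cmod_le with (1 := H m). now apply ex_series_Rscal. }
  assert (E2 : forall m, 0 <= Series (fun n => Cmod (f m n)) <= Series b * a m).
  { intros m. split.
    - apply Rle_trans with (sum_n (fun n => Cmod (f m n)) 0). rewrite sum_O. apply Cmod_ge_0.
      apply sum_n_le_Series; auto. intros; apply Cmod_ge_0.
    - rewrite Rmult_comm, <- Series_scal_l. apply Series_le. 2: now apply ex_series_Rscal.
      intros n. split. apply Cmod_ge_0. apply H. }
  assert (E3 := ex_series_Rle _ _ E2 (ex_series_Rscal _ _ Ha)).
  split.
  - now apply CSeries_fubini.
  - apply CSeries_cv. apply ex_series_Cmod_le with (2 := E3). intros m.
    apply Cmod_CSeries_le; auto. intros; lra.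
Qed.

(** The bridge from the square partial sums of [is_double_sum] to iterated series: bounded absolute
    square sums make every row and the series of absolute rows converge, and then the squares
    themselves tend to the iterated sum. *)
Lemma square_sums_cv (f : nat -> nat -> C) (B : R) :
  (forall N, sum_n (fun m => sum_n (fun n => Cmod (f m n)) N) N <= B) ->
  (forall m, ex_series (fun n => Cmod (f m n))) /\
  ex_series (fun m => Series (fun n => Cmod (f m n))) /\
  Ccv (fun N => csum (fun m => csum (f m) (S N)) (S N)) (CSeries (fun m => CSeries (f m))).
Proof.
  intros HB.
  assert (Hmono : forall (u : nat -> R) N M, (forall i, 0 <= u i) -> (N <= M)%nat ->
     sum_n u N <= sum_n u M).
  { intros u N M Hu HNM. induction HNM. lra. rewrite sum_Sn. unfold plus; simpl.
    specialize (Hu (S m)). lra. }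
  assert (Hpos : forall (u : nat -> R) N, (forall i, 0 <= u i) -> 0 <= sum_n u N).
  { intros u N Hu. induction N. rewrite sum_O; auto. rewrite sum_Sn. unfold plus; simpl.
    specialize (Hu (S N)). lra. }
  assert (Hle : forall (u v : nat -> R) N, (forall i, (i <= N)%nat -> u i <= v i) ->
     sum_n u N <= sum_n v N).
  { intros u v N Hu. induction N. rewrite !sum_O; auto. rewrite !sum_Sn. unfold plus; simpl.
    apply Rplus_le_compat. apply IHN; auto. apply Hu; auto. }
  assert (Hc : forall m n, 0 <= Cmod (f m n)) by (intros; apply Cmod_ge_0).
  assert (Hex : forall u : nat -> R, (forall i, 0 <= u i) -> (forall N, sum_n u N <= B) ->
     ex_series u /\ Series u <= B).
  { intros u Hu HuB. assert (E : ex_series u).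
    { apply (ex_finite_lim_seq_incr (sum_n u) B). intros n; apply Hmono; auto. exact HuB. }
    split; auto. apply Series_correct in E.
    apply (is_lim_seq_le (sum_n u) (fun _ => B) (Series u) B); auto.
    apply is_lim_seq_const. }
  (* A piece of row m up to N lies in the square of side max m N. *)
  assert (Hrow : forall m N, sum_n (fun n => Cmod (f m n)) N <= B).
  { intros m N. apply Rle_trans with (2 := HB (max m N)).
    apply Rle_trans with (sum_n (fun n => Cmod (f m n)) (max m N)).
    apply Hmono; auto; lia.
    set (g := fun m0 => sum_n (fun n => Cmod (f m0 n)) (max m N)).
    change (g m <= sum_n g (max m N)).
    apply Rle_trans with (sum_n g m).
    - destruct m. rewrite sum_O; lra. rewrite sum_Sn. unfold plus; simpl.
      assert (0 <= sum_n g m). apply Hpos. intros i. unfold g. now apply Hpos. lra.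
    - apply Hmono. intros i. unfold g. now apply Hpos. lia. }
  assert (E1 : forall m, ex_series (fun n => Cmod (f m n))) by (intros m; now apply Hex).
  assert (E2 : ex_series (fun m => Series (fun n => Cmod (f m n)))).
  { apply Hex.
    - intros m. apply Rle_trans with (sum_n (fun n => Cmod (f m n)) 0).
      rewrite sum_O. apply Hc. apply sum_n_le_Series; auto.
    - intros N.
      apply (is_lim_seq_le_loc (fun M => sum_n (fun m => sum_n (fun n => Cmod (f m n)) M) N)
        (fun _ => B) (sum_n (fun m => Series (fun n => Cmod (f m n))) N) B).
      + exists N. intros M HM. apply Rle_trans with (2 := HB M). apply Hmono; auto.
      + induction N.
        * apply is_lim_seq_ext with (fun M => sum_n (fun n => Cmod (f O n)) M).
          intros; now rewrite sum_O. rewrite sum_O. apply Series_correct; auto.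
        * rewrite sum_Sn. apply is_lim_seq_ext with (fun M =>
            sum_n (fun m => sum_n (fun n => Cmod (f m n)) M) N + sum_n (fun n => Cmod (f (S N) n)) M).
          intros; now rewrite sum_Sn.
          apply is_lim_seq_plus'; auto. apply Series_correct; auto.
      + apply is_lim_seq_const. }
  split; auto. split; auto.
  (* A square sum is written as a full series over m whose rows are cut at N and vanish beyond N,
     which is the form that [tannery] accepts. *)
  apply Ccv_ext with (fun N => CSeries (fun m => if (m <? S N)%nat then csum (f m) (S N) else 0)).
  { intros N. rewrite (CSeries_finite _ (S N)).
    - apply csum_ext. intros i Hi. apply Nat.ltb_lt in Hi. now rewrite Hi.
    - intros m Hm. apply Nat.ltb_ge in Hm. now rewrite Hm. }
  apply tannery with (b := fun m => Series (fun n => Cmod (f m n))); auto.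
  - exists O. intros N _ m. destruct (m <? S N)%nat.
    + apply Rle_trans with (sum_n (fun n => Cmod (f m n)) N).
      apply Cmod_csum_le. intros; lra. apply sum_n_le_Series; auto.
    + rewrite Cmod_0. apply Rle_trans with (sum_n (fun n => Cmod (f m n)) 0).
      rewrite sum_O. apply Hc. apply sum_n_le_Series; auto.
  - intros m. apply Ccv_ext_loc with (fun N => csum (f m) (S N)).
    + exists m. intros N HN. assert (H : (m <? S N)%nat = true) by (apply Nat.ltb_lt; lia).
      now rewrite H.
    + apply Ccv_incr_1. now apply CSeries_cv.
Qed.

(** * The complex exponential and logarithm along curves *)

Lemma exp_le (x y : R) : x <= y -> exp x <= exp y.
Proof. intros [H|H]. left; now apply exp_increasing. rewrite H; lra. Qed.

Lemma Cexp_plus (a b : C) : Cexp (a + b) = (Cexp a * Cexp b)%C.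
Proof.
  destruct a as [a1 a2], b as [b1 b2]. apply Ceq; unfold Cexp; simpl.
  - rewrite exp_plus, cos_plus. ring.
  - rewrite exp_plus, sin_plus. ring.
Qed.

Lemma Cexp_0 : Cexp 0 = 1.
Proof. apply Ceq; unfold Cexp; simpl; rewrite exp_0, ?cos_0, ?sin_0; ring. Qed.

Lemma Cmod_Cexp (z : C) : Cmod (Cexp z) = exp (Re z).
Proof.
  unfold Cmod, Cexp; simpl.
  replace (_ + _) with (exp (Re z) * exp (Re z)).
  - apply sqrt_square. left; apply exp_pos.
  - assert (H := sin2_cos2 (Im z)). unfold Rsqr in H.
    transitivity (exp (Re z) * exp (Re z) * (sin (Im z) * sin (Im z) + cos (Im z) * cos (Im z))).
    rewrite H; ring. ring.
Qed.

Lemma Cexp_neq_0 (z : C) : Cexp z <> 0.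
Proof. apply Cmod_gt_0. rewrite Cmod_Cexp. apply exp_pos. Qed.

Lemma Cexp_opp (z : C) : Cexp (- z) = (/ Cexp z)%C.
Proof.
  assert (H : (Cexp (- z) * Cexp z)%C = 1).
  { rewrite <- Cexp_plus. replace (- z + z)%C with (RtoC 0) by ring. apply Cexp_0. }
  replace (Cexp (- z)) with (Cexp (- z) * Cexp z * / Cexp z)%C.
  rewrite H. ring. field. apply Cexp_neq_0.
Qed.

Lemma Cexp_minus (a b : C) : Cexp (a - b) = (Cexp a / Cexp b)%C.
Proof. unfold Cminus. now rewrite Cexp_plus, Cexp_opp. Qed.

Lemma Cexp_INR (n : nat) (z : C) : Cexp (RtoC (INR n) * z) = Cpow (Cexp z) n.
Proof.
  induction n as [|n IH].
  - simpl. rewrite Cmult_0_l. apply Cexp_0.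
  - rewrite Cpow_S, <- IH, <- Cexp_plus. f_equal. rewrite S_INR, RtoC_plus. ring.
Qed.

Lemma Cexp_RtoC (x : R) : Cexp (RtoC x) = RtoC (exp x).
Proof. apply Ceq; unfold Cexp; simpl; rewrite ?cos_0, ?sin_0; ring. Qed.

Lemma Cexp_2PI : Cexp (RtoC (2 * PI) * Ci) = 1.
Proof.
  apply Ceq; unfold Cexp; simpl; rewrite !Rmult_0_r, Rmult_0_l, !Rmult_1_r;
  rewrite Rminus_0_r, Rplus_0_r, exp_0, ?cos_2PI, ?sin_2PI; ring.
Qed.

Lemma Cexp_PI : Cexp (RtoC PI * Ci) = RtoC (-1).
Proof.
  apply Ceq; unfold Cexp; simpl; rewrite !Rmult_0_r, Rmult_0_l, !Rmult_1_r;
  rewrite Rminus_0_r, Rplus_0_r, exp_0, ?cos_PI, ?sin_PI; ring.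
Qed.

(** The principal branch on the right half-plane, where [atan] gives the argument without
    correction. Only points of positive real part matter: z itself, its positive multiples, and 1 -
    w with |w| < 1. *)
Definition Clog (z : C) : C := (ln (Cmod z), atan (Im z / Re z)).

Definition Cpw (z : C) (a : R) : C := Cexp (RtoC a * Clog z).

Lemma Re_pos_neq_0 (z : C) : 0 < Re z -> z <> 0.
Proof. intros H E. rewrite E in H. simpl in H. lra. Qed.

Lemma Re_le_Cmod (z : C) : Re z <= Cmod z.
Proof. apply Rle_trans with (2 := re_le_Cmod z). apply Rle_abs. Qed.

Lemma Re_inv_pos (z : C) : 0 < Re z -> 0 < Re (/ z).
Proof.
  intros H. simpl. unfold Rdiv. apply Rmult_lt_0_compat; auto.
  apply Rinv_0_lt_compat. unfold Re in H. nra.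
Qed.

Lemma Cexp_Clog (z : C) : 0 < Re z -> Cexp (Clog z) = z.
Proof.
  intros H. assert (Hz := Re_pos_neq_0 z H). apply Cmod_gt_0 in Hz.
  unfold Cexp, Clog. cbn [Re Im fst snd]. rewrite exp_ln by auto.
  rewrite cos_atan, sin_atan.
  assert (E : Cmod z = Re z * sqrt (1 + (Im z / Re z)²)).
  { unfold Cmod. rewrite <- (sqrt_Rsqr (Re z)) at 1 by lra.
    rewrite <- sqrt_mult_alt by apply Rle_0_sqr. f_equal.
    change (fst z) with (Re z). change (snd z) with (Im z). unfold Rsqr. field. lra. }
  assert (Hs : 0 < sqrt (1 + (Im z / Re z)²)).
  { apply sqrt_lt_R0. assert (0 <= (Im z / Re z)²) by apply Rle_0_sqr. lra. }
  rewrite E. apply Ceq; cbn [Re Im fst snd].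
  - change (fst z) with (Re z). field. lra.
  - change (fst z) with (Re z). change (snd z) with (Im z). field. lra.
Qed.

Lemma Clog_RtoC (x : R) : 0 < x -> Clog (RtoC x) = RtoC (ln x).
Proof.
  intros H. unfold Clog. rewrite Cmod_R, Rabs_pos_eq by lra. simpl.
  unfold Rdiv. rewrite Rmult_0_l, atan_0. reflexivity.
Qed.

Lemma Clog_scal (c : R) (z : C) : 0 < c -> 0 < Re z ->
  Clog (RtoC c * z) = (RtoC (ln c) + Clog z)%C.
Proof.
  intros Hc Hz. assert (Hz0 := Re_pos_neq_0 z Hz). apply Cmod_gt_0 in Hz0.
  unfold Clog. rewrite Cmod_mult, Cmod_R, Rabs_pos_eq, ln_mult by lra.
  apply Ceq; simpl. reflexivity. rewrite Rplus_0_l. f_equal.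
  unfold Re, Im in *. field. split; nra.
Qed.

Lemma Cmod_Cpw (z : C) (a : R) : Cmod (Cpw z a) = Rpower (Cmod z) a.
Proof. unfold Cpw. rewrite Cmod_Cexp. unfold Rpower. f_equal. simpl. ring. Qed.

Lemma Cpw_plus (z : C) (a b : R) : Cpw z (a + b) = (Cpw z a * Cpw z b)%C.
Proof. unfold Cpw. rewrite <- Cexp_plus. f_equal. rewrite RtoC_plus. ring. Qed.

Lemma Cpw_INR (z : C) (n : nat) : 0 < Re z -> Cpw z (INR n) = Cpow z n.
Proof. intros H. unfold Cpw. now rewrite Cexp_INR, Cexp_Clog. Qed.

Lemma Cpw_opp (z : C) (a : R) : Cpw z (- a) = (/ Cpw z a)%C.
Proof. unfold Cpw. rewrite <- Cexp_opp. f_equal. rewrite RtoC_opp. ring. Qed.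

Lemma Cpw_scal (c : R) (z : C) (a : R) : 0 < c -> 0 < Re z ->
  Cpw (RtoC c * z) a = (RtoC (Rpower c a) * Cpw z a)%C.
Proof.
  intros Hc Hz. unfold Cpw, Rpower. rewrite Clog_scal by auto.
  rewrite <- Cexp_RtoC, <- Cexp_plus. f_equal. rewrite RtoC_mult. ring.
Qed.

(** * Derivatives of complex functions of a real variable, and the mean value inequality *)

Definition Cderiv (f : R -> C) (t : R) (l : C) : Prop :=
  is_derive (fun s => Re (f s)) t (Re l) /\ is_derive (fun s => Im (f s)) t (Im l).

Lemma is_derive_eq (f : R -> R) (t l l' : R) : is_derive f t l -> l = l' -> is_derive f t l'.
Proof. intros H E. now rewrite <- E. Qed.

Lemma is_derive_rmult (u v : R -> R) (t du dv : R) :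
  is_derive u t du -> is_derive v t dv ->
  is_derive (fun s => u s * v s) t (du * v t + u t * dv).
Proof.
  intros Hu Hv. apply (is_derive_mult u v t du dv Hu Hv). intros; apply Rmult_comm.
Qed.

Lemma is_derive_rplus (u v : R -> R) (t du dv : R) :
  is_derive u t du -> is_derive v t dv -> is_derive (fun s => u s + v s) t (du + dv).
Proof. intros Hu Hv. now apply (is_derive_plus u v). Qed.

Lemma is_derive_rminus (u v : R -> R) (t du dv : R) :
  is_derive u t du -> is_derive v t dv -> is_derive (fun s => u s - v s) t (du - dv).
Proof. intros Hu Hv. now apply (is_derive_minus u v). Qed.

Lemma is_derive_rcomp (g u : R -> R) (t dg du : R) :
  is_derive g (u t) dg -> is_derive u t du -> is_derive (fun s => g (u s)) t (dg * du).
Proof.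
  intros Hg Hu. apply is_derive_eq with (1 := is_derive_comp g u t dg du Hg Hu).
  apply Rmult_comm.
Qed.

Lemma Cderiv_eq (f : R -> C) (t : R) (l l' : C) : Cderiv f t l -> l = l' -> Cderiv f t l'.
Proof. intros H E. now rewrite <- E. Qed.

Lemma Cderiv_ext (f g : R -> C) (t : R) (l : C) :
  (forall s, f s = g s) -> Cderiv f t l -> Cderiv g t l.
Proof.
  intros H [H1 H2]. split.
  - apply is_derive_ext with (2 := H1). intros; now rewrite H.
  - apply is_derive_ext with (2 := H2). intros; now rewrite H.
Qed.

Lemma Cderiv_const (c : C) (t : R) : Cderiv (fun _ => c) t 0.
Proof. split; simpl; apply (is_derive_const (V := R_NormedModule)). Qed.

Lemma Cderiv_id (t : R) : Cderiv (fun s => RtoC s) t 1.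
Proof.
  split; simpl. apply (is_derive_id (K := R_AbsRing)).
  apply (is_derive_const (V := R_NormedModule)).
Qed.

Lemma Cderiv_plus (f g : R -> C) (t : R) (l m : C) :
  Cderiv f t l -> Cderiv g t m -> Cderiv (fun s => f s + g s)%C t (l + m)%C.
Proof. intros [H1 H2] [H3 H4]; split; simpl; now apply is_derive_rplus. Qed.

Lemma Cderiv_mult (f g : R -> C) (t : R) (l m : C) :
  Cderiv f t l -> Cderiv g t m -> Cderiv (fun s => f s * g s)%C t (l * g t + f t * m)%C.
Proof.
  intros [H1 H2] [H3 H4]; split; simpl.
  - eapply is_derive_eq.
    apply is_derive_rminus; apply is_derive_rmult; eassumption. unfold Re, Im; ring.
  - eapply is_derive_eq.
    apply is_derive_rplus; apply is_derive_rmult; eassumption. unfold Re, Im; ring.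
Qed.

Lemma Cderiv_scal (c : C) (f : R -> C) (t : R) (l : C) :
  Cderiv f t l -> Cderiv (fun s => c * f s)%C t (c * l)%C.
Proof.
  intros H. eapply Cderiv_eq. apply Cderiv_mult. apply Cderiv_const. exact H. cbv beta. ring.
Qed.

Lemma Cderiv_opp (f : R -> C) (t : R) (l : C) :
  Cderiv f t l -> Cderiv (fun s => - f s)%C t (- l)%C.
Proof.
  intros H. apply Cderiv_ext with (fun s => RtoC (-1) * f s)%C. intros; ring.
  apply Cderiv_eq with (RtoC (-1) * l)%C. now apply Cderiv_scal. ring.
Qed.

Lemma Cderiv_minus (f g : R -> C) (t : R) (l m : C) :
  Cderiv f t l -> Cderiv g t m -> Cderiv (fun s => f s - g s)%C t (l - m)%C.
Proof. intros. apply Cderiv_plus; auto. now apply Cderiv_opp. Qed.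

Lemma Cderiv_line (a b : C) (t : R) : Cderiv (fun s => a + RtoC s * b)%C t b.
Proof.
  eapply Cderiv_eq. apply Cderiv_plus. apply Cderiv_const.
  apply Cderiv_mult. apply Cderiv_id. apply Cderiv_const. cbv beta. ring.
Qed.

Lemma Cderiv_pow_ray (q : C) (n : nat) (t : R) :
  Cderiv (fun s => Cpow (RtoC s * q) (S n)) t (RtoC (INR (S n)) * Cpow (RtoC t * q) n * q)%C.
Proof.
  assert (DL : forall t, Cderiv (fun s => RtoC s * q)%C t q).
  { intros s. apply Cderiv_ext with (fun s => 0 + RtoC s * q)%C. intros; ring. apply Cderiv_line. }
  induction n as [|n IH].
  - apply Cderiv_ext with (fun s => RtoC s * q)%C. intros; simpl; ring.
    eapply Cderiv_eq. apply DL. simpl. ring.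
  - apply Cderiv_ext with (fun s => (RtoC s * q) * Cpow (RtoC s * q) (S n))%C.
    intros; now rewrite <- Cpow_S. eapply Cderiv_eq. apply Cderiv_mult. apply DL. apply IH.
    cbv beta. rewrite (S_INR (S n)), RtoC_plus, !Cpow_S. ring.
Qed.

Lemma Cderiv_csum (f : nat -> R -> C) (l : nat -> C) (t : R) (n : nat) :
  (forall i, (i < n)%nat -> Cderiv (f i) t (l i)) ->
  Cderiv (fun s => csum (fun i => f i s) n) t (csum l n).
Proof.
  induction n as [|n IH]; intros H; simpl. apply Cderiv_const.
  apply Cderiv_plus. apply IH. intros; apply H; lia. apply H; lia.
Qed.

Lemma Cderiv_exp (f : R -> C) (t : R) (l : C) :
  Cderiv f t l -> Cderiv (fun s => Cexp (f s)) t (l * Cexp (f t))%C.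
Proof.
  intros [H1 H2]. split.
  - apply (is_derive_ext (fun s => exp (Re (f s)) * cos (Im (f s)))). reflexivity.
    eapply is_derive_eq. apply is_derive_rmult.
    apply is_derive_rcomp with (2 := H1). apply is_derive_exp.
    apply is_derive_rcomp with (2 := H2). apply is_derive_cos.
    simpl. unfold Re, Im. ring.
  - apply (is_derive_ext (fun s => exp (Re (f s)) * sin (Im (f s)))). reflexivity.
    eapply is_derive_eq. apply is_derive_rmult.
    apply is_derive_rcomp with (2 := H1). apply is_derive_exp.
    apply is_derive_rcomp with (2 := H2). apply is_derive_sin.
    simpl. unfold Re, Im. ring.
Qed.

Lemma Cmod_sqr (z : C) : Cmod z * Cmod z = Re z * Re z + Im z * Im z.
Proof. assert (H := Cmod2_alt z). nra. Qed.

Lemma is_derive_sumsq (u v : R -> R) (t du dv : R) :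
  is_derive u t du -> is_derive v t dv ->
  is_derive (fun s => u s * u s + v s * v s) t (2 * (u t * du + v t * dv)).
Proof.
  intros Hu Hv. eapply is_derive_eq.
  apply is_derive_rplus; apply is_derive_rmult; eassumption. ring.
Qed.

Lemma is_derive_rinv (u : R -> R) (t du : R) :
  is_derive u t du -> u t <> 0 -> is_derive (fun s => / u s) t (- du / (u t) ^ 2).
Proof. intros Hu H. exact (is_derive_inv u t du Hu H). Qed.

Lemma Cderiv_inv (f : R -> C) (t : R) (l : C) :
  Cderiv f t l -> f t <> 0 -> Cderiv (fun s => / f s)%C t (- l / (f t * f t))%C.
Proof.
  intros [H1 H2] Hn.
  assert (Hp : 0 < Re (f t) * Re (f t) + Im (f t) * Im (f t)).
  { rewrite <- Cmod_sqr. apply Cmod_gt_0 in Hn. nra. }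
  assert (Hd := is_derive_sumsq _ _ _ _ _ H1 H2).
  assert (Hi := is_derive_rinv _ _ _ Hd (Rgt_not_eq _ _ Hp)). cbv beta in Hi.
  assert (E : (- l / (f t * f t))%C =
    (- l * Cconj (f t) * Cconj (f t) *
     RtoC (/ (Re (f t) * Re (f t) + Im (f t) * Im (f t))) *
     RtoC (/ (Re (f t) * Re (f t) + Im (f t) * Im (f t))))%C).
  { assert (E1 : (/ f t)%C =
      (Cconj (f t) * RtoC (/ (Re (f t) * Re (f t) + Im (f t) * Im (f t))))%C).
    { apply Ceq; simpl; unfold Re, Im in *; field; nra. }
    unfold Cdiv. replace (/ (f t * f t))%C with (/ f t * / f t)%C by (field; auto). rewrite E1. ring. }
  apply Cderiv_eq with (2 := eq_sym E). split.
  - apply (is_derive_ext (fun s => Re (f s) * / (Re (f s) * Re (f s) + Im (f s) * Im (f s)))).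
    { intros s. simpl. unfold Re, Im, Rdiv. f_equal. f_equal. ring. }
    eapply is_derive_eq. apply is_derive_rmult; eassumption.
    cbn [Re Im fst snd Cmult Copp Cconj RtoC]. unfold Re, Im in *. field. nra.
  - apply (is_derive_ext (fun s => (-1 * Im (f s)) * / (Re (f s) * Re (f s) + Im (f s) * Im (f s)))).
    { intros s. simpl. unfold Re, Im, Rdiv.
      replace (fst (f s) * (fst (f s) * 1) + snd (f s) * (snd (f s) * 1)) with
        (fst (f s) * fst (f s) + snd (f s) * snd (f s)) by ring. ring. }
    eapply is_derive_eq. apply is_derive_rmult. apply is_derive_rmult.
    apply (is_derive_const (V := R_NormedModule)). eassumption. eassumption.
    cbn [Re Im fst snd Cmult Copp Cconj RtoC zero]. unfold Re, Im in *.
    change (zero : R) with 0. field. nra.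
Qed.

Lemma Cderiv_log (f : R -> C) (t : R) (l : C) :
  Cderiv f t l -> 0 < Re (f t) -> Cderiv (fun s => Clog (f s)) t (l / f t)%C.
Proof.
  intros [H1 H2] Hp.
  assert (Hq : 0 < Re (f t) * Re (f t) + Im (f t) * Im (f t)) by nra.
  assert (Hd := is_derive_sumsq _ _ _ _ _ H1 H2). split.
  - apply (is_derive_ext (fun s => / 2 * ln (Re (f s) * Re (f s) + Im (f s) * Im (f s)))
      (fun s => Re (Clog (f s)))).
    { intros s. simpl. unfold Cmod.
      replace (fst (f s) ^ 2 + snd (f s) ^ 2) with
        (Re (f s) * Re (f s) + Im (f s) * Im (f s)) by (unfold Re, Im; ring).
      set (y := Re (f s) * Re (f s) + Im (f s) * Im (f s)).
      assert (Hy : 0 <= y) by (unfold y; nra).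
      destruct Hy as [Hy|Hy].
      - rewrite <- (sqrt_sqrt y) at 1 by lra.
        rewrite ln_mult by (apply sqrt_lt_R0; lra). field.
      (* [is_derive_ext] wants equality at every s, also where f s = 0; there both sides are the
         default value 0 of [ln]. *)
      - rewrite <- Hy, sqrt_0. unfold ln. destruct (Rlt_dec 0 0) as [r|r]; [destruct (Rlt_irrefl _ r) | ring]. }
    eapply is_derive_eq. apply is_derive_rmult.
    apply (is_derive_const (V := R_NormedModule)).
    apply is_derive_rcomp with (2 := Hd). apply is_derive_ln. exact Hq.
    change (zero : R) with 0. simpl. unfold Re, Im in *. field. nra.
  - apply (is_derive_ext (fun s => atan (Im (f s) * / Re (f s)))
      (fun s => Im (Clog (f s)))). reflexivity.
    eapply is_derive_eq. eapply (is_derive_rcomp atan).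
    apply is_derive_atan. apply is_derive_rmult. eassumption.
    apply is_derive_rinv. eassumption. lra.
    simpl. unfold Re, Im, Rsqr in *. field. repeat split; nra.
Qed.

Lemma Cderiv_pw (f : R -> C) (t : R) (l : C) (a : R) :
  Cderiv f t l -> 0 < Re (f t) ->
  Cderiv (fun s => Cpw (f s) a) t (RtoC a * (l / f t) * Cpw (f t) a)%C.
Proof.
  intros H Hp. unfold Cpw.
  apply (Cderiv_exp (fun s => RtoC a * Clog (f s))%C). apply Cderiv_scal.
  now apply Cderiv_log.
Qed.

(** The real and the imaginary part have different intermediate points, which costs the factor 2.
    This replaces uniqueness theorems for analytic functions: a quantity whose derivative along a
    segment is arbitrarily small keeps its initial value. *)
Lemma mean_value_le (f : R -> C) (f' : R -> C) (B : R) :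
  (forall t, 0 <= t <= 1 -> Cderiv f t (f' t)) ->
  (forall t, 0 <= t <= 1 -> Cmod (f' t) <= B) ->
  Cmod (f 1 - f 0) <= 2 * B.
Proof.
  intros Hd HB.
  assert (Hm : Rmin 0 1 = 0 /\ Rmax 0 1 = 1) by (split; [apply Rmin_left | apply Rmax_right]; lra).
  destruct Hm as [Hm1 Hm2].
  apply Rle_trans with (1 := Cmod_le_re_im _).
  destruct (MVT_gen (fun s => Re (f s)) 0 1 (fun t => Re (f' t))) as [c1 [Hc1 E1]].
  { rewrite Hm1, Hm2. intros x Hx. apply Hd. lra. }
  { rewrite Hm1, Hm2. intros x Hx.
    apply continuity_pt_filterlim, (ex_derive_continuous (fun s => Re (f s))).
    eexists. apply Hd. lra. }
  destruct (MVT_gen (fun s => Im (f s)) 0 1 (fun t => Im (f' t))) as [c2 [Hc2 E2]].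
  { rewrite Hm1, Hm2. intros x Hx. apply Hd. lra. }
  { rewrite Hm1, Hm2. intros x Hx.
    apply continuity_pt_filterlim, (ex_derive_continuous (fun s => Im (f s))).
    eexists. apply Hd. lra. }
  rewrite Hm1, Hm2 in *.
  change (Re (f 1 - f 0)%C) with (Re (f 1) - Re (f 0)).
  change (Im (f 1 - f 0)%C) with (Im (f 1) - Im (f 0)).
  rewrite E1, E2, !Rminus_0_r, !Rmult_1_r.
  assert (H1 := re_le_Cmod (f' c1)). assert (H2 := im_le_Cmod (f' c2)).
  assert (H3 := HB c1 Hc1). assert (H4 := HB c2 Hc2). lra.
Qed.

Lemma Cmod_Cexp_le (z : C) : Cmod (Cexp z) <= exp (Cmod z).
Proof.
  rewrite Cmod_Cexp. apply exp_le. apply Re_le_Cmod.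
Qed.

Lemma Cexp_minus_1_le (u : C) : Cmod (Cexp u - 1) <= 2 * (Cmod u * exp (Cmod u)).
Proof.
  replace (Cexp u) with (Cexp (0 + RtoC 1 * u)) by (f_equal; ring).
  replace (RtoC 1) with (Cexp (0 + RtoC 0 * u)) at 2.
  2: { rewrite <- Cexp_0. f_equal. ring. }
  apply (mean_value_le (fun t => Cexp (0 + RtoC t * u)) (fun t => u * Cexp (0 + RtoC t * u))%C).
  - intros t _. apply Cderiv_exp. apply Cderiv_line.
  - intros t Ht. rewrite Cmod_mult. apply Rmult_le_compat_l. apply Cmod_ge_0.
    apply Rle_trans with (1 := Cmod_Cexp_le _). apply exp_le.
    rewrite Cplus_0_l, Cmod_mult, Cmod_R, Rabs_pos_eq by lra.
    assert (H := Cmod_ge_0 u). nra.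
Qed.

Lemma Cexp_taylor1_le (u : C) :
  Cmod (Cexp u - 1 - u) <= 4 * (Cmod u * Cmod u * exp (Cmod u)).
Proof.
  replace (Cexp u - 1 - u)%C with
    ((Cexp (0 + RtoC 1 * u) - (0 + RtoC 1 * u)) - (Cexp (0 + RtoC 0 * u) - (0 + RtoC 0 * u)))%C.
  2: { replace (0 + 1 * u)%C with u by ring. replace (0 + 0 * u)%C with (RtoC 0) by ring.
       rewrite Cexp_0. ring. }
  replace (4 * _) with (2 * (2 * (Cmod u * Cmod u * exp (Cmod u)))) by ring.
  apply (mean_value_le (fun t => Cexp (0 + RtoC t * u) - (0 + RtoC t * u))%C
    (fun t => u * Cexp (0 + RtoC t * u) - u)%C).
  - intros t _. apply Cderiv_minus. apply Cderiv_exp. apply Cderiv_line. apply Cderiv_line.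
  - intros t Ht. rewrite Cplus_0_l.
    replace (u * Cexp (RtoC t * u) - u)%C with (u * (Cexp (RtoC t * u) - 1))%C by ring.
    rewrite Cmod_mult.
    assert (Hu := Cmod_ge_0 u).
    assert (H := Cexp_minus_1_le (RtoC t * u)).
    rewrite Cmod_mult, Cmod_R, Rabs_pos_eq in H by lra.
    assert (Hm : t * Cmod u <= Cmod u) by nra.
    assert (He : exp (t * Cmod u) <= exp (Cmod u)) by (now apply exp_le).
    assert (Hpos := exp_pos (t * Cmod u)).
    assert (0 <= t * Cmod u) by nra.
    apply Rle_trans with (Cmod u * (2 * (t * Cmod u * exp (t * Cmod u)))).
    apply Rmult_le_compat_l; auto.
    apply Rle_trans with (Cmod u * (2 * (Cmod u * exp (Cmod u)))). 2: lra.
    apply Rmult_le_compat_l; auto. apply Rmult_le_compat_l. lra.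
    apply Rmult_le_compat; auto; lra.
Qed.

Lemma Ccv_Cexp (u : nat -> C) (l : C) : Ccv u l -> Ccv (fun n => Cexp (u n)) (Cexp l).
Proof.
  intros H.
  apply Ccv_of_le with (fun n => (Cmod (Cexp l) * (2 * exp 1)) * Cmod (u n - l)).
  - apply is_lim_seq_spec in H. destruct (H (mkposreal 1 Rlt_0_1)) as [N HN].
    exists N. intros n Hn. specialize (HN n Hn). simpl in HN.
    rewrite Rminus_0_r, Rabs_pos_eq in HN by apply Cmod_ge_0.
    replace (Cexp (u n)) with (Cexp (l + (u n - l))) by (f_equal; ring).
    rewrite Cexp_plus.
    replace (Cexp l * Cexp (u n - l) - Cexp l)%C with (Cexp l * (Cexp (u n - l) - 1))%C by ring.
    rewrite Cmod_mult, Rmult_assoc. apply Rmult_le_compat_l. apply Cmod_ge_0.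
    apply Rle_trans with (1 := Cexp_minus_1_le _).
    assert (He : exp (Cmod (u n - l)) <= exp 1) by (apply exp_le; lra).
    assert (Hm := Cmod_ge_0 (u n - l)). nra.
  - now apply is_lim_seq_scal0.
Qed.

Lemma Clog_lipschitz (a b : C) (c : R) : 0 < c -> c <= Re a -> c <= Re b ->
  Cmod (Clog a - Clog b) <= 2 * (Cmod (a - b) / c).
Proof.
  intros Hc Ha Hb.
  replace a with (b + RtoC 1 * (a - b))%C at 1 by ring.
  replace (Clog b) with (Clog (b + RtoC 0 * (a - b))) by (f_equal; ring).
  assert (Hre : forall t, 0 <= t <= 1 -> c <= Re (b + RtoC t * (a - b))%C).
  { intros t Ht. simpl. unfold Re in *. nra. }
  apply (mean_value_le (fun t => Clog (b + RtoC t * (a - b)))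
    (fun t => (a - b) / (b + RtoC t * (a - b)))%C).
  - intros t Ht. apply Cderiv_log. apply Cderiv_line. specialize (Hre t Ht). lra.
  - intros t Ht. specialize (Hre t Ht).
    assert (Hn : (b + RtoC t * (a - b))%C <> 0) by (apply Re_pos_neq_0; lra).
    rewrite Cmod_div by auto. unfold Rdiv. apply Rmult_le_compat_l. apply Cmod_ge_0.
    apply Rinv_le_contravar; auto. apply Rle_trans with (1 := Hre). apply Re_le_Cmod.
Qed.

Lemma Clog_1 : Clog 1 = 0.
Proof. rewrite Clog_RtoC by lra. now rewrite ln_1. Qed.

Lemma Re_1_minus_ge (w : C) (r : R) : Cmod w <= r -> 1 - r <= Re (1 - w)%C.
Proof. intros H. simpl. assert (H2 := Re_le_Cmod w). unfold Re in H2. lra. Qed.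

Lemma Clog_1_minus_le (w : C) (r : R) : r < 1 -> Cmod w <= r ->
  Cmod (Clog (1 - w)) <= 2 / (1 - r) * Cmod w.
Proof.
  intros Hr Hw.
  assert (H := Clog_lipschitz (1 - w) 1 (1 - r)).
  rewrite Clog_1 in H. replace (Clog (1 - w) - 0)%C with (Clog (1 - w)) in H by ring.
  replace (1 - w - 1)%C with (- w)%C in H by ring. rewrite Cmod_opp in H.
  replace (2 / (1 - r) * Cmod w) with (2 * (Cmod w / (1 - r))) by (field; lra).
  apply H. lra. now apply Re_1_minus_ge. simpl.
  assert (H0 := Cmod_ge_0 w). lra.
Qed.

Lemma Ccv_Clog (u : nat -> C) (l : C) (c : R) : 0 < c ->
  (forall n, c <= Re (u n)) -> c <= Re l -> Ccv u l -> Ccv (fun n => Clog (u n)) (Clog l).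
Proof.
  intros Hc Hu Hl H. apply Ccv_of_le with (fun n => (2 / c) * Cmod (u n - l)).
  - exists O. intros n _. replace (2 / c * Cmod (u n - l)) with (2 * (Cmod (u n - l) / c))
      by (field; lra).
    now apply Clog_lipschitz.
  - now apply is_lim_seq_scal0.
Qed.

(** * Partial fractions by repeated doubling *)

(** Up to PI/3 the cosine is at least 1/2, so sin u >= u/2; beyond, sin u >= sqrt 3 / 2 > 17/20,
    while u/4 <= PI/6. The range reaches past PI/2 because u will be half of an angle of up to 4 PI
    / 3. *)
Lemma sin_ge_quarter (u : R) : 0 <= u <= 2 * PI / 3 -> u / 4 <= sin u.
Proof.
  intros Hu. assert (HPI := PI_RGT_0). assert (HP4 := PI_4).
  assert (Hs3 : 17 / 10 < sqrt 3).
  { replace (17 / 10) with (sqrt (Rsqr (17 / 10))) by (apply sqrt_Rsqr; lra).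
    apply sqrt_lt_1_alt. unfold Rsqr. lra. }
  destruct (Rle_lt_dec u (PI / 3)) as [H|H].
  - destruct (Req_dec u 0) as [E|E]. rewrite E, sin_0. lra.
    destruct (MVT_cor2 sin cos 0 u) as [c [E1 Hc]]. lra.
    intros; apply derivable_pt_lim_sin.
    rewrite sin_0, !Rminus_0_r in E1. rewrite E1.
    assert (cos (PI / 3) <= cos c) by (apply cos_decr_1; lra).
    rewrite cos_PI3 in H0. nra.
  - assert (17 / 20 <= sin u). 2: lra.
    destruct (Rle_lt_dec u (PI / 2)) as [H2|H2].
    + assert (sin (PI / 3) <= sin u) by (apply sin_incr_1; lra).
      rewrite sin_PI3 in H0. lra.
    + assert (sin (2 * PI / 3) <= sin u) by (apply sin_decr_1; lra).
      replace (2 * PI / 3) with (2 * (PI / 3)) in H0 by field.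
      rewrite sin_2PI3 in H0. lra.
Qed.

Lemma sin_sqr_ge (b : R) : Rabs b <= 4 * PI / 3 -> b * b / 64 <= sin (b / 2) * sin (b / 2).
Proof.
  intros Hb. destruct (Rle_lt_dec 0 b) as [H|H].
  - rewrite Rabs_pos_eq in Hb by auto. assert (H1 := sin_ge_quarter (b / 2)).
    assert (b / 2 / 4 <= sin (b / 2)) by (apply H1; lra). nra.
  - rewrite Rabs_left in Hb by auto. assert (H1 := sin_ge_quarter (- (b / 2))).
    assert (- (b / 2) / 4 <= sin (- (b / 2))) by (apply H1; lra).
    rewrite sin_neg in H0. nra.
Qed.

Lemma one_minus_exp_ge (a : R) : 0 <= a <= 1 -> a / 2 <= 1 - exp (- a).
Proof.
  intros Ha. assert (H : 1 + a <= exp a) by apply exp_ineq1_le.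
  rewrite exp_Ropp. assert (/ exp a <= / (1 + a)) by (apply Rinv_le_contravar; lra).
  assert (/ (1 + a) <= 1 - a / 2). 2: lra.
  apply Rmult_le_reg_l with (1 + a). lra. rewrite Rinv_r by lra. nra.
Qed.

Lemma Cmod_sqr_1_minus_Cexp (w : C) :
  Cmod (1 - Cexp (- w)) * Cmod (1 - Cexp (- w)) =
  (1 - exp (- Re w)) * (1 - exp (- Re w)) +
  4 * exp (- Re w) * (sin (Im w / 2) * sin (Im w / 2)).
Proof.
  rewrite Cmod_sqr. unfold Cexp. simpl.
  change (fst w) with (Re w). change (snd w) with (Im w).
  rewrite cos_neg, sin_neg. set (e := exp (- Re w)).
  assert (H := sin2_cos2 (Im w)). unfold Rsqr in H.
  assert (H2 : cos (Im w) = 1 - 2 * (sin (Im w / 2) * sin (Im w / 2))).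
  { replace (Im w) with (2 * (Im w / 2)) at 1 by field. rewrite cos_2a_sin. ring. }
  transitivity (1 - 2 * e * cos (Im w) +
    e * e * (sin (Im w) * sin (Im w) + cos (Im w) * cos (Im w))).
  unfold Im. ring. rewrite H, H2. ring.
Qed.

Lemma Cmod_1_minus_Cexp_ge (w : C) : 0 <= Re w <= 1 -> Rabs (Im w) <= 4 * PI / 3 ->
  Cmod w / 7 <= Cmod (1 - Cexp (- w)).
Proof.
  intros Hr Hi.
  assert (H1 := Cmod_sqr_1_minus_Cexp w). assert (H2 := one_minus_exp_ge _ Hr).
  assert (H3 := sin_sqr_ge _ Hi). assert (H4 := Cmod_sqr w).
  assert (H5 : / 3 <= exp (- Re w)).
  { rewrite exp_Ropp. apply Rinv_le_contravar. apply exp_pos.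
    apply Rle_trans with (exp 1). apply exp_le; lra. apply exp_le_3. }
  assert (H6 := Cmod_ge_0 w). assert (H7 := Cmod_ge_0 (1 - Cexp (- w))).
  apply Rnot_lt_le. intros Hlt.
  assert (Cmod (1 - Cexp (- w)) * Cmod (1 - Cexp (- w)) < (Cmod w / 7) * (Cmod w / 7)) by nra.
  assert (0 <= sin (Im w / 2) * sin (Im w / 2)) by nra.
  assert (Re w * Re w / 4 <= (1 - exp (- Re w)) * (1 - exp (- Re w))) by nra.
  assert (4 / 3 * (Im w * Im w / 64) <= 4 * exp (- Re w) * (sin (Im w / 2) * sin (Im w / 2))) by nra.
  nra.
Qed.

Lemma ex_series_inv_sq : ex_series (fun n => / (INR (S n) * INR (S n))).
Proof.
  assert (Hp : forall n, 0 < INR (S n)) by (intros; apply lt_0_INR; lia).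
  apply (ex_finite_lim_seq_incr _ 2).
  - intros n. rewrite sum_Sn. unfold plus; simpl Hierarchy.AbelianMonoid.plus.
    assert (H := Hp (S n)). simpl. 
    assert (0 < / (INR (S (S n)) * INR (S (S n)))) by (apply Rinv_0_lt_compat; nra).
    simpl in H0. lra.
  - assert (H : forall n, sum_n (fun n => / (INR (S n) * INR (S n))) n <= 2 - / INR (S n)).
    { induction n as [|n IH].
      - rewrite sum_O. simpl. lra.
      - rewrite sum_Sn. change (sum_n (fun n => / (INR (S n) * INR (S n))) n +
          / (INR (S (S n)) * INR (S (S n))) <= 2 - / INR (S (S n))).
        assert (H1 := Hp n). assert (E : INR (S (S n)) = INR (S n) + 1) by (rewrite (S_INR (S n)); ring).
        rewrite E in *. set (x := INR (S n)) in *.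
        assert (/ ((x + 1) * (x + 1)) <= / x - / (x + 1)). 2: lra.
        replace (/ x - / (x + 1)) with (/ (x * (x + 1))) by (field; lra).
        apply Rinv_le_contravar; nra. }
    intros n. apply Rle_trans with (1 := H n).
    assert (0 < / INR (S n)) by (apply Rinv_0_lt_compat, Hp). lra.
Qed.

Lemma ex_series_eventually_le (a b : nat -> R) :
  eventually (fun n => 0 <= a n <= b n) -> ex_series b -> ex_series a.
Proof.
  intros [N HN] Hb. apply (ex_series_incr_n (V := R_NormedModule) a N).
  apply ex_series_Rle with (fun n => b (N + n)%nat). intros; apply HN; lia.
  now apply ex_series_shift.
Qed.

Lemma Ccv_inv (u : nat -> C) (l : C) : Ccv u l -> l <> 0 -> Ccv (fun n => / u n)%C (/ l)%C.
Proof.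
  intros H Hl. assert (Hl' := Hl). apply Cmod_gt_0 in Hl'.
  apply Ccv_of_le with (fun n => (2 / (Cmod l * Cmod l)) * Cmod (u n - l)).
  - assert (He : 0 < Cmod l / 2) by lra.
    apply is_lim_seq_spec in H. destruct (H (mkposreal _ He)) as [N HN].
    exists N. intros n Hn. specialize (HN n Hn). simpl in HN.
    rewrite Rminus_0_r, Rabs_pos_eq in HN by apply Cmod_ge_0.
    assert (Hu : Cmod l / 2 <= Cmod (u n)).
    { assert (T := Cmod_triangle (l - u n) (u n)).
      replace (l - u n + u n)%C with l in T by ring. rewrite Cmod_minus_sym in T. lra. }
    assert (Hu0 : u n <> 0) by (apply Cmod_gt_0; lra).
    replace (/ u n - / l)%C with (- (u n - l) / (u n * l))%C by (field; auto).
    rewrite Cmod_div, Cmod_opp, Cmod_mult.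
    2: { apply Cmod_gt_0. rewrite Cmod_mult. nra. }
    unfold Rdiv. rewrite Rmult_comm. apply Rmult_le_compat_r. apply Cmod_ge_0.
    rewrite <- (Rinv_inv 2), <- Rinv_mult. apply Rinv_le_contravar; nra.
  - now apply is_lim_seq_scal0.
Qed.

Lemma Ccv_div (u v : nat -> C) (l m : C) : Ccv u l -> Ccv v m -> m <> 0 ->
  Ccv (fun n => u n / v n)%C (l / m)%C.
Proof. intros. apply Ccv_mult; auto. now apply Ccv_inv. Qed.

Lemma Ccv_difference_quotient (h : nat -> R) (u : C) :
  (forall n, 0 < h n) -> is_lim_seq h 0 ->
  Ccv (fun n => (1 - Cexp (- (RtoC (h n) * u))) / RtoC (h n))%C u.
Proof.
  intros Hp Hl.
  apply Ccv_of_le with (fun n => 4 * (Cmod u * Cmod u * exp (Cmod u)) * h n).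
  2: now apply is_lim_seq_scal0.
  apply is_lim_seq_spec in Hl. destruct (Hl (mkposreal 1 Rlt_0_1)) as [N HN].
  exists N. intros n Hn. specialize (HN n Hn). simpl in HN. specialize (Hp n).
  rewrite Rminus_0_r, Rabs_pos_eq in HN by lra.
  assert (Hh : RtoC (h n) <> 0) by (intros E; apply RtoC_inj in E; lra).
  replace ((1 - Cexp (- (RtoC (h n) * u))) / RtoC (h n) - u)%C with
    (- (Cexp (- (RtoC (h n) * u)) - 1 - (- (RtoC (h n) * u))) / RtoC (h n))%C by (field; auto).
  rewrite Cmod_div, Cmod_opp, Cmod_R, Rabs_pos_eq by (auto; lra).
  apply Rmult_le_reg_r with (h n); auto. unfold Rdiv. rewrite Rmult_assoc, Rinv_l by lra.
  rewrite Rmult_1_r. apply Rle_trans with (1 := Cexp_taylor1_le _).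
  rewrite Cmod_opp, Cmod_mult, Cmod_R, Rabs_pos_eq by lra.
  assert (Hu := Cmod_ge_0 u).
  assert (He : exp (h n * Cmod u) <= exp (Cmod u)) by (apply exp_le; nra).
  replace (4 * (h n * Cmod u * (h n * Cmod u) * exp (h n * Cmod u))) with
    (4 * (h n * h n * (Cmod u * Cmod u)) * exp (h n * Cmod u)) by ring.
  replace (4 * (Cmod u * Cmod u * exp (Cmod u)) * h n * h n) with
    (4 * (h n * h n * (Cmod u * Cmod u)) * exp (Cmod u)) by ring.
  apply Rmult_le_compat_l; auto.
  assert (0 <= h n * h n * (Cmod u * Cmod u)) by (apply Rmult_le_pos; nra). lra.
Qed.

Definition tpi : C := (RtoC (2 * PI) * Ci)%C.

Lemma Cexp_tpi_INR (n : nat) : Cexp (RtoC (INR n) * tpi) = 1.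
Proof. rewrite Cexp_INR. unfold tpi. rewrite Cexp_2PI. apply Cpow_1_l. Qed.

Definition half_pow (p : nat) : R := (/ 2) ^ p.

Lemma half_pow_pos (p : nat) : 0 < half_pow p.
Proof. apply pow_lt. lra. Qed.

Lemma half_pow_lim : is_lim_seq half_pow 0.
Proof. apply is_lim_seq_geom. rewrite Rabs_pos_eq; lra. Qed.

Lemma half_pow_INR (p : nat) : half_pow p * INR (2 ^ p) = 1.
Proof.
  unfold half_pow. rewrite pow_INR, <- Rpow_mult_distr. simpl INR.
  replace (/ 2 * (1 + 1)) with 1 by field. apply pow1.
Qed.

Lemma Cexp_half_neq_1 (y : C) (p r : nat) : Cexp (- y) <> 1 ->
  Cexp (- (RtoC (half_pow p) * (y + RtoC (INR r) * tpi))) <> 1.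
Proof.
  intros H E. apply H.
  transitivity (Cpow (Cexp (- (RtoC (half_pow p) * (y + RtoC (INR r) * tpi)))) (2 ^ p)).
  2: rewrite E; apply Cpow_1_l.
  rewrite <- Cexp_INR.
  replace (RtoC (INR (2 ^ p)) * - (RtoC (half_pow p) * (y + RtoC (INR r) * tpi)))%C
    with (- (RtoC (half_pow p * INR (2 ^ p))) * (y + RtoC (INR r) * tpi))%C
    by (rewrite RtoC_mult; ring).
  rewrite half_pow_INR.
  replace (- (1) * (y + RtoC (INR r) * tpi))%C with (- y - RtoC (INR r) * tpi)%C by ring.
  rewrite Cexp_minus, Cexp_tpi_INR. field.
Qed.

Section Doubling.

Variables (f : C -> C) (lam : C).
Hypothesis f_double : forall v, Cexp (- v) <> 1 ->
  f v = (lam * (f (RtoC (/ 2) * v) + f (RtoC (/ 2) * (v + tpi))))%C.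
Hypothesis f_period : forall v, f (v + tpi)%C = f v.

(** Each duplication splits the residue r modulo 2^p into r and r + 2^p modulo 2^{p+1}; the shift of
    the second one is exactly the half period because 2^{-p} 2^p = 1. *)
Lemma doubling_iter (y : C) (p : nat) : Cexp (- y) <> 1 ->
  f y = (Cpow lam p *
    csum (fun r => f (RtoC (half_pow p) * (y + RtoC (INR r) * tpi))%C) (2 ^ p))%C.
Proof.
  intros Hy. induction p as [|p IH].
  - simpl. rewrite Cplus_0_l, Cmult_1_l. f_equal. unfold half_pow. simpl. ring.
  - rewrite IH. simpl Nat.pow. rewrite Nat.add_0_r, csum_add.
    rewrite (csum_ext (fun r => f (RtoC (half_pow p) * (y + RtoC (INR r) * tpi))%C)
      (fun r => lam * (f (RtoC (half_pow (S p)) * (y + RtoC (INR r) * tpi)) +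
                       f (RtoC (half_pow (S p)) * (y + RtoC (INR (2 ^ p + r)) * tpi))))%C).
    + rewrite csum_scal, csum_plus, Cpow_S. ring.
    + intros r _. rewrite f_double by now apply Cexp_half_neq_1. f_equal. f_equal.
      * f_equal. unfold half_pow. simpl. rewrite RtoC_mult. ring.
      * f_equal. unfold half_pow at 2. simpl. fold (half_pow p).
        rewrite plus_INR, RtoC_plus.
        replace tpi with (RtoC (half_pow p * INR (2 ^ p)) * tpi)%C at 2
          by (rewrite half_pow_INR; ring).
        rewrite !RtoC_mult. ring.
Qed.

(** Periodicity moves the upper half of the residues to negative multiples, pairing r with -(r + 1).
    Then all rescaled points stay near the segment from -PI i to PI i, away from the other poles,
    and a uniform majorant exists. *)
Lemma doubling_iter_pairs (y : C) (p : nat) : Cexp (- y) <> 1 ->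
  f y = (Cpow lam (S p) *
    csum (fun r => f (RtoC (half_pow (S p)) * (y + RtoC (INR r) * tpi)) +
                   f (RtoC (half_pow (S p)) * (y - RtoC (INR (S r)) * tpi)))%C (2 ^ p))%C.
Proof.
  intros Hy. rewrite (doubling_iter y (S p)) by auto. f_equal.
  simpl Nat.pow. rewrite Nat.add_0_r, csum_add, csum_plus. f_equal.
  rewrite csum_rev. apply csum_ext. intros r Hr.
  rewrite <- (f_period (RtoC (half_pow (S p)) * (y - RtoC (INR (S r)) * tpi))%C). f_equal.
  replace tpi with (RtoC (half_pow (S p) * INR (2 ^ S p)) * tpi)%C at 3
    by (rewrite half_pow_INR; ring).
  replace (INR (2 ^ p + (2 ^ p - 1 - r))) with (INR (2 ^ S p) - INR (S r)).
  2: { rewrite <- minus_INR by (simpl; lia). f_equal. simpl. lia. }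
  rewrite RtoC_minus, RtoC_mult. ring.
Qed.

End Doubling.

(** [sigma] is 1 / (4 sinh^2 (y/2)) and [kappa] is coth (y/2) / 2, written in q = e^{-y} so that
    their duplication formulas are rational identities in the square root of q. *)
Definition sigma (y : C) : C := (Cexp (- y) / ((1 - Cexp (- y)) * (1 - Cexp (- y))))%C.
Definition kappa (y : C) : C := ((1 + Cexp (- y)) / (RtoC 2 * (1 - Cexp (- y))))%C.

Lemma Cexp_double (v : C) :
  Cexp (- v) = (Cexp (- (RtoC (/ 2) * v)) * Cexp (- (RtoC (/ 2) * v)))%C /\
  Cexp (- (RtoC (/ 2) * (v + tpi))) = (- Cexp (- (RtoC (/ 2) * v)))%C.
Proof.
  split.
  - rewrite <- Cexp_plus. f_equal. apply Ceq; simpl; field.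
  - replace (- (RtoC (/ 2) * (v + tpi)))%C with (- (RtoC (/ 2) * v) - RtoC PI * Ci)%C.
    + rewrite Cexp_minus, Cexp_PI. unfold Cdiv.
      replace (/ RtoC (-1))%C with (RtoC (-1)). ring. rewrite <- RtoC_inv by (intro; lra). f_equal. field.
    + unfold tpi. apply Ceq; simpl; field.
Qed.

Lemma one_minus_sqr_neq_0 (w : C) : (w * w)%C <> 1 -> (1 - w)%C <> 0 /\ (1 + w)%C <> 0.
Proof.
  intros H; split; intros E; apply H.
  - replace w with (1 - (1 - w))%C by ring. rewrite E. ring.
  - replace w with ((1 + w) - 1)%C by ring. rewrite E. ring.
Qed.

Lemma Cminus_neq_0 (a b : C) : a <> b -> (a - b)%C <> 0.
Proof. intros H E. apply H. replace a with ((a - b) + b)%C by ring. rewrite E. ring. Qed.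

Lemma sigma_double (v : C) : Cexp (- v) <> 1 ->
  sigma v = (RtoC (/ 4) * (sigma (RtoC (/ 2) * v) + sigma (RtoC (/ 2) * (v + tpi))))%C.
Proof.
  intros H. unfold sigma. destruct (Cexp_double v) as [E1 E2]. rewrite E2. rewrite E1 in *.
  set (w := Cexp (- (RtoC (/ 2) * v))) in *.
  destruct (one_minus_sqr_neq_0 _ H) as [H1 H2].
  assert (H3 : (1 - w * w)%C <> 0) by (apply Cminus_neq_0; auto).
  rewrite RtoC_inv by (intro; lra). field. repeat split; auto.
  replace (1 - - w)%C with (1 + w)%C by ring; auto.
Qed.

Lemma kappa_double (v : C) : Cexp (- v) <> 1 ->
  kappa v = (RtoC (/ 2) * (kappa (RtoC (/ 2) * v) + kappa (RtoC (/ 2) * (v + tpi))))%C.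
Proof.
  intros H. unfold kappa. destruct (Cexp_double v) as [E1 E2]. rewrite E2. rewrite E1 in *.
  set (w := Cexp (- (RtoC (/ 2) * v))) in *.
  destruct (one_minus_sqr_neq_0 _ H) as [H1 H2].
  assert (H3 : (1 - w * w)%C <> 0) by (apply Cminus_neq_0; auto).
  rewrite RtoC_inv by (intro; lra). field. repeat split; auto.
  replace (1 - - w)%C with (1 + w)%C by ring; auto.
Qed.

Lemma Cexp_opp_period (v : C) : Cexp (- (v + tpi)) = Cexp (- v).
Proof.
  replace (- (v + tpi))%C with (- v - tpi)%C by ring. rewrite Cexp_minus. unfold tpi.
  rewrite Cexp_2PI. field.
Qed.

Lemma PI_gt_3 : 3 < PI.
Proof. assert (H := PI2_3_2). lra. Qed.

Lemma RtoC_neq_0 (x : R) : x <> 0 -> RtoC x <> 0.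
Proof. intros H E. apply RtoC_inj in E. auto. Qed.

Lemma INR_S_pos (n : nat) : 0 < INR (S n).
Proof. apply lt_0_INR. lia. Qed.

(** The box in which [Cmod_1_minus_Cexp_ge] applies to h u. *)
Definition in_range (h : R) (u : C) : Prop :=
  0 <= h * Re u <= 1 /\ Rabs (h * Im u) <= 4 * PI / 3.

Lemma Cmod_difference_quotient_ge (h : R) (u : C) : 0 < h -> in_range h u ->
  Cmod u / 7 <= Cmod ((1 - Cexp (- (RtoC h * u))) / RtoC h).
Proof.
  intros Hh [H1 H2]. rewrite Cmod_div, Cmod_R, Rabs_pos_eq by (try apply RtoC_neq_0; lra).
  assert (H := Cmod_1_minus_Cexp_ge (RtoC h * u)%C).
  rewrite Cmod_mult, Cmod_R, (Rabs_pos_eq h) in H by lra.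
  apply Rmult_le_reg_l with h; auto. unfold Rdiv in *.
  replace (h * (Cmod (1 - Cexp (- (RtoC h * u))) * / h)) with
    (Cmod (1 - Cexp (- (RtoC h * u)))) by (field; lra).
  rewrite <- Rmult_assoc. apply H.
  - replace (Re (RtoC h * u)) with (h * Re u) by (simpl; unfold Re; ring). auto.
  - replace (Im (RtoC h * u)) with (h * Im u) by (simpl; unfold Im; ring). auto.
Qed.

Definition upper (y : C) (r : nat) : C := (y + RtoC (INR r) * tpi)%C.
Definition lower (y : C) (r : nat) : C := (y - RtoC (INR r) * tpi)%C.

Lemma Re_upper (y : C) (r : nat) : Re (upper y r) = Re y.
Proof. unfold upper, tpi, Re, Im. simpl. ring. Qed.
Lemma Im_upper (y : C) (r : nat) : Im (upper y r) = Im y + INR r * (2 * PI).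
Proof. unfold upper, tpi, Re, Im. simpl. ring. Qed.
Lemma Re_lower (y : C) (r : nat) : Re (lower y r) = Re y.
Proof. unfold lower, tpi, Re, Im. simpl. ring. Qed.
Lemma Im_lower (y : C) (r : nat) : Im (lower y r) = Im y - INR r * (2 * PI).
Proof. unfold lower, tpi, Re, Im. simpl. ring. Qed.

Lemma upper_neq_0 (y : C) (r : nat) : Cexp (- y) <> 1 -> upper y r <> 0.
Proof.
  intros H E. apply H. rewrite <- (Cexp_tpi_INR r). f_equal.
  replace (- y)%C with (RtoC (INR r) * tpi - upper y r)%C by (unfold upper; ring).
  rewrite E. ring.
Qed.

Lemma lower_neq_0 (y : C) (r : nat) : Cexp (- y) <> 1 -> lower y r <> 0.
Proof.
  intros H E. apply H.
  replace (- y)%C with (- (RtoC (INR r) * tpi) - lower y r)%C by (unfold lower; ring).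
  rewrite E. replace (- (RtoC (INR r) * tpi) - 0)%C with (- (RtoC (INR r) * tpi))%C by ring.
  rewrite Cexp_opp, Cexp_tpi_INR. field.
Qed.

Lemma eventually_scaled_le (c e : R) : 0 < e -> eventually (fun p => half_pow (S p) * c <= e).
Proof.
  intros He.
  assert (H : is_lim_seq (fun p => c * half_pow (S p)) 0).
  { apply is_lim_seq_scal0. apply (is_lim_seq_incr_1 half_pow). apply half_pow_lim. }
  apply is_lim_seq_spec in H. destruct (H (mkposreal e He)) as [N HN].
  exists N. intros p Hp. specialize (HN p Hp). simpl in HN. apply Rabs_def2 in HN. lra.
Qed.

(** With h = 2^{-(p+1)} and r < 2^p, the lattice part contributes at most 2 PI (r + 1) h <= PI; the
    remaining PI/3 of the box absorbs h Im y for large p. *)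
Lemma eventually_in_range (y : C) : 0 <= Re y ->
  eventually (fun p => forall r, (r < 2 ^ p)%nat ->
    in_range (half_pow (S p)) (upper y r) /\ in_range (half_pow (S p)) (lower y (S r))).
Proof.
  intros Hy. assert (HPI := PI_RGT_0).
  destruct (eventually_scaled_le (Re y) 1) as [N1 H1]; try lra.
  destruct (eventually_scaled_le (Rabs (Im y)) (PI / 3)) as [N2 H2]; try lra.
  exists (max N1 N2). intros p Hp r Hr.
  assert (Hh := half_pow_pos (S p)).
  specialize (H1 p ltac:(lia)). specialize (H2 p ltac:(lia)).
  assert (E : half_pow (S p) * INR (2 ^ p) = / 2).
  { assert (E := half_pow_INR p). unfold half_pow in *. simpl pow. rewrite Rmult_assoc, E. ring. }
  assert (Hr1 : INR (S r) <= INR (2 ^ p)) by (apply le_INR; lia).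
  assert (Hr2 : 0 <= INR r) by apply pos_INR. rewrite S_INR in Hr1.
  assert (E3 : half_pow (S p) * INR r <= / 2) by nra.
  assert (E4 : half_pow (S p) * INR (S r) <= / 2) by (rewrite S_INR; nra).
  assert (E5 : 0 <= half_pow (S p) * INR r) by nra.
  assert (E6 : 0 <= half_pow (S p) * INR (S r)) by (rewrite S_INR; nra).
  assert (Hi : Rabs (half_pow (S p) * Im y) <= PI / 3)
    by (rewrite Rabs_mult, (Rabs_pos_eq (half_pow (S p))); lra).
  unfold in_range. rewrite Re_upper, Re_lower, Im_upper, Im_lower.
  assert (0 <= half_pow (S p) * Re y) by nra.
  split; (split; [lra|]).
  - replace (half_pow (S p) * (Im y + INR r * (2 * PI))) with
      (half_pow (S p) * Im y + half_pow (S p) * INR r * (2 * PI)) by ring.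
    apply Rle_trans with (1 := Rabs_triang _ _). rewrite (Rabs_pos_eq (_ * _ * _)) by nra. nra.
  - replace (half_pow (S p) * (Im y - INR (S r) * (2 * PI))) with
      (half_pow (S p) * Im y + - (half_pow (S p) * INR (S r) * (2 * PI))) by ring.
    apply Rle_trans with (1 := Rabs_triang _ _).
    rewrite Rabs_Ropp, (Rabs_pos_eq (_ * _ * _)) by nra. nra.
Qed.

Lemma ex_series_upper_lower (y : C) :
  ex_series (fun r => / (Cmod (upper y r) * Cmod (upper y r)) +
                      / (Cmod (lower y (S r)) * Cmod (lower y (S r)))).
Proof.
  assert (HPI := PI_gt_3).
  apply ex_series_eventually_le with (fun r => 2 * / (INR (S r) * INR (S r))).
  2: apply ex_series_Rscal, ex_series_inv_sq.
  destruct (INR_unbounded (Cmod y + 1)) as [N HN]. exists N. intros r Hr.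
  assert (HNr : INR N <= INR r) by now apply le_INR.
  assert (Hu : INR (S r) <= Cmod (upper y r)).
  { unfold upper. rewrite Cplus_comm. apply Rle_trans with (2 := Cmod_ge_minus _ _).
    unfold tpi. rewrite !Cmod_mult, Cmod_Ci, !Cmod_R, !Rabs_pos_eq by (try apply pos_INR; lra).
    rewrite S_INR. assert (0 <= INR r) by apply pos_INR. nra. }
  assert (Hl : INR (S r) <= Cmod (lower y (S r))).
  { unfold lower. rewrite Cmod_minus_sym. unfold Cminus.
    apply Rle_trans with (2 := Cmod_ge_minus _ _). rewrite Cmod_opp.
    unfold tpi. rewrite !Cmod_mult, Cmod_Ci, !Cmod_R, !Rabs_pos_eq by (try apply pos_INR; lra).
    rewrite S_INR. assert (0 <= INR r) by apply pos_INR. nra. }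
  assert (Hp := INR_S_pos r).
  assert (/ (Cmod (upper y r) * Cmod (upper y r)) <= / (INR (S r) * INR (S r)))
    by (apply Rinv_le_contravar; nra).
  assert (/ (Cmod (lower y (S r)) * Cmod (lower y (S r))) <= / (INR (S r) * INR (S r)))
    by (apply Rinv_le_contravar; nra).
  assert (0 < / (Cmod (upper y r) * Cmod (upper y r))) by (apply Rinv_0_lt_compat; nra).
  assert (0 < / (Cmod (lower y (S r)) * Cmod (lower y (S r)))) by (apply Rinv_0_lt_compat; nra).
  lra.
Qed.

Lemma half_pow_S_lim : is_lim_seq (fun p => half_pow (S p)) 0.
Proof. apply (is_lim_seq_incr_1 half_pow). apply half_pow_lim. Qed.

(** After rescaling, this quantity stands where the limit has u itself: it tends to u with h, and in
    the box it is at least |u|/7. *)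
Definition dquot (h : R) (u : C) : C := ((1 - Cexp (- (RtoC h * u))) / RtoC h)%C.

Lemma dquot_cv (u : C) : Ccv (fun p => dquot (half_pow (S p)) u) u.
Proof.
  apply (Ccv_difference_quotient (fun p => half_pow (S p))). intros; apply half_pow_pos.
  apply half_pow_S_lim.
Qed.

Lemma Cexp_scaled_cv (u : C) : Ccv (fun p => Cexp (- (RtoC (half_pow (S p)) * u))) 1.
Proof.
  rewrite <- Cexp_0. apply Ccv_Cexp. replace (RtoC 0) with (- (RtoC 0 * u))%C by ring.
  apply Ccv_opp. apply Ccv_mult. apply Ccv_RtoC, half_pow_S_lim. apply Ccv_const.
Qed.

Lemma dquot_neq_0 (h : R) (u : C) : 0 < h -> in_range h u -> u <> 0 ->
  dquot h u <> 0 /\ (1 - Cexp (- (RtoC h * u)))%C <> 0.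
Proof.
  intros Hh Hr Hu. assert (H := Cmod_difference_quotient_ge h u Hh Hr).
  fold (dquot h u) in H. apply Cmod_gt_0 in Hu.
  assert (Hd : dquot h u <> 0) by (apply Cmod_gt_0; lra). split; auto.
  intros E. apply Hd. unfold dquot. rewrite E. unfold Cdiv. ring.
Qed.

Section Expansion.

Variables (f : C -> C) (lam : C) (g : C -> C -> C) (y : C) (B : R).
Hypothesis f_double : forall v, Cexp (- v) <> 1 ->
  f v = (lam * (f (RtoC (/ 2) * v) + f (RtoC (/ 2) * (v + tpi))))%C.
Hypothesis f_period : forall v, f (v + tpi)%C = f v.
Hypothesis Re_y : 0 <= Re y.
Hypothesis Hy : Cexp (- y) <> 1.

Let pair p r := (Cpow lam (S p) *
  (f (RtoC (half_pow (S p)) * upper y r) + f (RtoC (half_pow (S p)) * lower y (S r))))%C.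

Hypothesis pair_bound : eventually (fun p => forall r, (r < 2 ^ p)%nat ->
  Cmod (pair p r) <= B * (/ (Cmod (upper y r) * Cmod (upper y r)) +
                          / (Cmod (lower y (S r)) * Cmod (lower y (S r))))).
Hypothesis pair_cv : forall r, Ccv (fun p => pair p r) (g (upper y r) (lower y (S r))).

(** At every level p the finite sum of pairs equals f y exactly. Extended by 0 beyond 2^p it is
    dominated by inverse squares of lattice distances, so the level can go to infinity term by
    term. *)
Lemma doubling_expansion :
  Ccv (csum (fun r => g (upper y r) (lower y (S r)))) (f y).
Proof.
  set (b := fun r => Rabs B * (/ (Cmod (upper y r) * Cmod (upper y r)) +
                          / (Cmod (lower y (S r)) * Cmod (lower y (S r))))).
  assert (Hpow : forall r, eventually (fun p => (r < 2 ^ p)%nat)).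
  { intros r. exists r. intros p Hp. apply Nat.le_lt_trans with p; auto.
    apply Nat.pow_gt_lin_r. lia. }
  assert (Hb : ex_series b) by (apply ex_series_Rscal, ex_series_upper_lower).
  assert (Hb0 : forall r, 0 <= / (Cmod (upper y r) * Cmod (upper y r)) +
                          / (Cmod (lower y (S r)) * Cmod (lower y (S r)))).
  { intros r. assert (H1 := upper_neq_0 y r Hy). assert (H2 := lower_neq_0 y (S r) Hy).
    apply Cmod_gt_0 in H1. apply Cmod_gt_0 in H2.
    apply Rplus_le_le_0_compat; left; apply Rinv_0_lt_compat; nra. }
  assert (Hg : forall r, Cmod (g (upper y r) (lower y (S r))) <= b r).
  { intros r. eapply Ccv_Cmod_le. 2: apply pair_cv.
    destruct pair_bound as [N1 H1]. destruct (Hpow r) as [N2 H2].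
    exists (max N1 N2). intros p Hp. apply Rle_trans with (1 := H1 p ltac:(lia) r (H2 p ltac:(lia))).
    unfold b. apply Rmult_le_compat_r; auto. apply Rle_abs. }
  set (T := fun p r => if (r <? 2 ^ p)%nat then pair p r else RtoC 0).
  assert (HT : forall p, CSeries (T p) = f y).
  { intros p. rewrite (CSeries_finite _ (2 ^ p)).
    - rewrite (doubling_iter_pairs f lam f_double f_period y p Hy), <- csum_scal.
      apply csum_ext. intros r Hr. unfold T. apply Nat.ltb_lt in Hr. now rewrite Hr.
    - intros r Hr. unfold T. apply Nat.ltb_ge in Hr. now rewrite Hr. }
  assert (HC : Ccv (fun p => CSeries (T p)) (CSeries (fun r => g (upper y r) (lower y (S r))))).
  { apply tannery with (b := b); auto.
    - destruct pair_bound as [N1 H1]. exists N1. intros p Hp r. unfold T, b.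
      destruct (Nat.ltb_spec r (2 ^ p)) as [Hr|Hr].
      + apply Rle_trans with (1 := H1 p Hp r Hr). apply Rmult_le_compat_r; auto. apply Rle_abs.
      + rewrite Cmod_0. apply Rmult_le_pos; auto. apply Rabs_pos.
    - intros r. apply Ccv_ext_loc with (2 := pair_cv r). destruct (Hpow r) as [N2 H2].
      exists N2. intros p Hp. unfold T. specialize (H2 p Hp). apply Nat.ltb_lt in H2.
      now rewrite H2. }
  assert (E : f y = CSeries (fun r => g (upper y r) (lower y (S r)))).
  { apply Ccv_unique with (2 := HC). apply Ccv_ext with (fun _ => f y).
    intros; now rewrite HT. apply Ccv_const. }
  rewrite E. apply CSeries_cv. now apply ex_series_Cmod_le with b.
Qed.

End Expansion.

Lemma RtoC_pow_S_quarter (p : nat) :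
  Cpow (RtoC (/ 4)) (S p) = (RtoC (half_pow (S p)) * RtoC (half_pow (S p)))%C.
Proof.
  rewrite <- RtoC_pow, <- RtoC_mult. f_equal. unfold half_pow. rewrite <- Rpow_mult_distr.
  f_equal. field.
Qed.

Lemma sigma_scaled (h : R) (u : C) : 0 < h -> in_range h u -> u <> 0 ->
  (RtoC h * RtoC h * sigma (RtoC h * u))%C =
  (Cexp (- (RtoC h * u)) / (dquot h u * dquot h u))%C.
Proof.
  intros Hh Hr Hu. destruct (dquot_neq_0 h u Hh Hr Hu) as [_ H].
  unfold sigma, dquot. field. split; auto. apply RtoC_neq_0. lra.
Qed.

(** The addition formula of coth. It is applied to the two members of a pair, whose sum u + v does
    not depend on r; the numerator is then bounded and only the product of the denominators grows
    with r. *)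
Lemma kappa_scaled (h : R) (u v : C) : 0 < h -> in_range h u -> in_range h v ->
  u <> 0 -> v <> 0 ->
  (RtoC h * (kappa (RtoC h * u) + kappa (RtoC h * v)))%C =
  (dquot h (u + v) / (dquot h u * dquot h v))%C.
Proof.
  intros Hh Hu Hv Hu0 Hv0. destruct (dquot_neq_0 h u Hh Hu Hu0) as [_ H1].
  destruct (dquot_neq_0 h v Hh Hv Hv0) as [_ H2].
  unfold kappa, dquot.
  replace (- (RtoC h * (u + v)))%C with (- (RtoC h * u) + - (RtoC h * v))%C by ring.
  rewrite Cexp_plus. field. repeat split; auto; try (apply RtoC_neq_0; lra).
Qed.

Lemma Cmod_Cexp_opp_le_1 (h : R) (u : C) : in_range h u -> Cmod (Cexp (- (RtoC h * u))) <= 1.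
Proof.
  intros [H _]. rewrite Cmod_Cexp, <- exp_0. apply exp_le. simpl. unfold Re in H. lra.
Qed.

Lemma sigma_scaled_le (h : R) (u : C) : 0 < h -> in_range h u -> u <> 0 ->
  Cmod (RtoC h * RtoC h * sigma (RtoC h * u)) <= 49 * / (Cmod u * Cmod u).
Proof.
  intros Hh Hr Hu. rewrite sigma_scaled by auto.
  destruct (dquot_neq_0 h u Hh Hr Hu) as [Hd _].
  assert (H := Cmod_difference_quotient_ge h u Hh Hr). fold (dquot h u) in H.
  assert (H1 := Cmod_Cexp_opp_le_1 h u Hr). apply Cmod_gt_0 in Hu.
  rewrite Cmod_div, Cmod_mult.
  2: { apply Cmod_gt_0. rewrite Cmod_mult. apply Cmod_gt_0 in Hd. nra. }
  apply Rle_trans with (1 * / (Cmod u / 7 * (Cmod u / 7))).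
  - apply Rmult_le_compat; auto. apply Cmod_ge_0.
    left. apply Rinv_0_lt_compat. nra. apply Rinv_le_contravar; nra.
  - right. field. lra.
Qed.

Lemma sigma_expansion_pairs (y : C) : 0 <= Re y -> Cexp (- y) <> 1 ->
  Ccv (csum (fun r => / (upper y r * upper y r) + / (lower y (S r) * lower y (S r)))%C) (sigma y).
Proof.
  intros Hr Hy.
  apply (doubling_expansion sigma (RtoC (/ 4)) (fun u v => / (u * u) + / (v * v))%C y 49); auto.
  - exact sigma_double.
  - intros v. unfold sigma. now rewrite Cexp_opp_period.
  - destruct (eventually_in_range y Hr) as [N HN]. exists N. intros p Hp r Hrp.
    destruct (HN p Hp r Hrp) as [H1 H2]. assert (Hh := half_pow_pos (S p)).
    rewrite RtoC_pow_S_quarter, Cmult_plus_distr_l.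
    apply Rle_trans with (1 := Cmod_triangle _ _). rewrite Rmult_plus_distr_l.
    apply Rplus_le_compat; apply sigma_scaled_le; auto.
    now apply upper_neq_0. now apply lower_neq_0.
  - intros r. assert (Hu := upper_neq_0 y r Hy). assert (Hl := lower_neq_0 y (S r) Hy).
    apply Ccv_ext_loc with (fun p =>
      Cexp (- (RtoC (half_pow (S p)) * upper y r)) /
        (dquot (half_pow (S p)) (upper y r) * dquot (half_pow (S p)) (upper y r)) +
      Cexp (- (RtoC (half_pow (S p)) * lower y (S r))) /
        (dquot (half_pow (S p)) (lower y (S r)) * dquot (half_pow (S p)) (lower y (S r))))%C.
    + destruct (eventually_in_range y Hr) as [N HN]. exists (max N r). intros p Hp.
      assert (Hrp : (r < 2 ^ p)%nat).
      { apply Nat.le_lt_trans with p. lia. apply Nat.pow_gt_lin_r. lia. }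
      destruct (HN p ltac:(lia) r Hrp) as [H1 H2]. assert (Hh := half_pow_pos (S p)).
      rewrite RtoC_pow_S_quarter, Cmult_plus_distr_l.
      now rewrite <- !sigma_scaled by auto.
    + replace (/ (upper y r * upper y r) + / (lower y (S r) * lower y (S r)))%C with
        (1 / (upper y r * upper y r) + 1 / (lower y (S r) * lower y (S r)))%C by (field; auto).
      assert (Hm : forall u : C, u <> 0 -> (u * u)%C <> 0).
      { intros u Hu0. now apply Cmult_neq_0. }
      apply Ccv_plus; apply Ccv_div; auto; try apply Cexp_scaled_cv; apply Ccv_mult; apply dquot_cv.
Qed.

Lemma dquot_le (h : R) (u : C) : 0 < h -> h * Cmod u <= 1 -> Cmod (dquot h u) <= 6 * Cmod u.
Proof.
  intros Hh Hu. unfold dquot. rewrite Cmod_div, Cmod_R, Rabs_pos_eq by (try apply RtoC_neq_0; lra).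
  rewrite Cmod_minus_sym. assert (H := Cexp_minus_1_le (- (RtoC h * u))).
  rewrite Cmod_opp, Cmod_mult, Cmod_R, (Rabs_pos_eq h) in H by lra.
  assert (He : exp (h * Cmod u) <= 3).
  { apply Rle_trans with (exp 1). now apply exp_le. apply exp_le_3. }
  apply Rmult_le_reg_r with h; auto. unfold Rdiv. rewrite Rmult_assoc, Rinv_l, Rmult_1_r by lra.
  apply Rle_trans with (1 := H). assert (H2 := Cmod_ge_0 u). assert (0 <= h * Cmod u) by nra. nra.
Qed.

(** Single terms 1/(y + 2 PI i r) are not summable, but in a pair the sum of the two points is the
    constant s = 2y - 2 PI i, so a pair is of order 1/|uv|. The majorant 6 |s| 49 combines
    [dquot_le] in the numerator with two factors 7 below. *)
Lemma kappa_expansion_pairs (y : C) : 0 <= Re y -> Cexp (- y) <> 1 ->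
  Ccv (csum (fun r => / upper y r + / lower y (S r))%C) (kappa y).
Proof.
  intros Hr Hy. set (s := (RtoC 2 * y - tpi)%C).
  assert (Hs : forall r, (upper y r + lower y (S r))%C = s).
  { intros r. unfold upper, lower, s. rewrite S_INR, RtoC_plus. ring. }
  assert (Hlam : forall p, Cpow (RtoC (/ 2)) (S p) = RtoC (half_pow (S p))).
  { intros p. now rewrite <- RtoC_pow. }
  apply (doubling_expansion kappa (RtoC (/ 2)) (fun u v => / u + / v)%C y (6 * Cmod s * 49)); auto.
  - exact kappa_double.
  - intros v. unfold kappa. now rewrite Cexp_opp_period.
  - destruct (eventually_in_range y Hr) as [N HN].
    destruct (eventually_scaled_le (Cmod s) 1 Rlt_0_1) as [N1 HN1].
    exists (max N N1). intros p Hp r Hrp.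
    destruct (HN p ltac:(lia) r Hrp) as [H1 H2]. assert (Hh := half_pow_pos (S p)).
    assert (Hu := upper_neq_0 y r Hy). assert (Hl := lower_neq_0 y (S r) Hy).
    rewrite Hlam, kappa_scaled, Hs by auto.
    destruct (dquot_neq_0 _ _ Hh H1 Hu) as [Hd1 _]. destruct (dquot_neq_0 _ _ Hh H2 Hl) as [Hd2 _].
    rewrite Cmod_div, Cmod_mult.
    2: { apply Cmod_gt_0. rewrite Cmod_mult. apply Cmod_gt_0 in Hd1. apply Cmod_gt_0 in Hd2. nra. }
    assert (B1 := dquot_le (half_pow (S p)) s Hh (HN1 p ltac:(lia))).
    assert (B2 := Cmod_difference_quotient_ge _ _ Hh H1).
    assert (B3 := Cmod_difference_quotient_ge _ _ Hh H2).
    fold (dquot (half_pow (S p)) (upper y r)) in B2.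
    fold (dquot (half_pow (S p)) (lower y (S r))) in B3.
    apply Cmod_gt_0 in Hu. apply Cmod_gt_0 in Hl. apply Cmod_gt_0 in Hd1. apply Cmod_gt_0 in Hd2.
    set (a := Cmod (upper y r)) in *. set (b := Cmod (lower y (S r))) in *.
    apply Rle_trans with (6 * Cmod s * / (a / 7 * (b / 7))).
    + apply Rmult_le_compat; auto. apply Cmod_ge_0. left. apply Rinv_0_lt_compat. nra.
      apply Rinv_le_contravar. nra. apply Rmult_le_compat; lra.
    + replace (/ (a / 7 * (b / 7))) with (49 * (/ a * / b)) by (field; lra).
      rewrite !Rinv_mult. rewrite <- Rmult_assoc. apply Rmult_le_compat_l.
      assert (H0 := Cmod_ge_0 s). nra.
      assert (0 < / a) by now apply Rinv_0_lt_compat.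
      assert (0 < / b) by now apply Rinv_0_lt_compat. nra.
  - intros r. assert (Hu := upper_neq_0 y r Hy). assert (Hl := lower_neq_0 y (S r) Hy).
    apply Ccv_ext_loc with (fun p => dquot (half_pow (S p)) (upper y r + lower y (S r)) /
      (dquot (half_pow (S p)) (upper y r) * dquot (half_pow (S p)) (lower y (S r))))%C.
    + destruct (eventually_in_range y Hr) as [N HN]. exists (max N r). intros p Hp.
      assert (Hrp : (r < 2 ^ p)%nat).
      { apply Nat.le_lt_trans with p. lia. apply Nat.pow_gt_lin_r. lia. }
      destruct (HN p ltac:(lia) r Hrp) as [H1 H2]. assert (Hh := half_pow_pos (S p)).
      now rewrite Hlam, kappa_scaled by auto.
    + replace (/ upper y r + / lower y (S r))%C with
        ((upper y r + lower y (S r)) / (upper y r * lower y (S r)))%C by (field; auto).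
      apply Ccv_div. apply dquot_cv. apply Ccv_mult; apply dquot_cv.
      now apply Cmult_neq_0.
Qed.

(** Doubling produces the pairs r, -(r + 1); the symmetric pairs r + 1, -(r + 1) arise by shifting
    one of the two sequences, which frees the central term A 0 and adds a boundary term that tends
    to 0. *)
Lemma regroup_pairs (A B : nat -> C) (l : C) :
  Ccv (csum (fun r => A r + B (S r))%C) l -> Ccv A 0 ->
  Ccv (csum (fun r => A (S r) + B (S r))%C) (l - A O)%C.
Proof.
  intros H HA.
  apply Ccv_ext with (fun N => csum (fun r => A r + B (S r))%C N + A N - A O)%C.
  - intros N. rewrite !csum_plus.
    assert (E : (csum A N + A N)%C = (A O + csum (fun i => A (S i)) N)%C).
    { rewrite <- csum_S_l. reflexivity. }
    replace (csum A N + csum (fun i => B (S i)) N + A N - A O)%C with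
      ((csum A N + A N) + csum (fun i => B (S i)) N - A O)%C by ring.
    rewrite E. ring.
  - replace (l - A O)%C with (l + 0 - A O)%C by ring.
    apply Ccv_minus. now apply Ccv_plus. apply Ccv_const.
Qed.

Lemma INR_lim_inv : is_lim_seq (fun n => / INR (S n)) 0.
Proof.
  apply (is_lim_seq_incr_1 (fun n => / INR n)).
  replace (Finite 0) with (Rbar_inv p_infty) by reflexivity.
  apply is_lim_seq_inv. apply is_lim_seq_INR. discriminate.
Qed.

Lemma inv_upper_cv (y : C) : Ccv (fun r => / upper y r)%C 0.
Proof.
  assert (HPI := PI_gt_3).
  apply Ccv_of_le with (fun r => / INR (S r)). 2: apply INR_lim_inv.
  destruct (INR_unbounded (Cmod y + 1)) as [N HN]. exists N. intros r Hr.
  assert (HNr : INR N <= INR r) by now apply le_INR.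
  assert (Hu : INR (S r) <= Cmod (upper y r)).
  { unfold upper. rewrite Cplus_comm. apply Rle_trans with (2 := Cmod_ge_minus _ _).
    unfold tpi. rewrite !Cmod_mult, Cmod_Ci, !Cmod_R, !Rabs_pos_eq by (try apply pos_INR; lra).
    rewrite S_INR. assert (0 <= INR r) by apply pos_INR. nra. }
  assert (Hp := INR_S_pos r).
  replace (/ upper y r - 0)%C with (/ upper y r)%C by ring.
  rewrite Cmod_inv. apply Rinv_le_contravar; auto. apply Cmod_gt_0. lra.
Qed.

Lemma upper_0 (y : C) : upper y 0 = y.
Proof. unfold upper. simpl. ring. Qed.

Lemma kappa_expansion (y : C) : 0 <= Re y -> Cexp (- y) <> 1 ->
  Ccv (csum (fun r => / upper y (S r) + / lower y (S r))%C) (kappa y - / y)%C.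
Proof.
  intros Hr Hy.
  assert (H := regroup_pairs (fun r => / upper y r)%C (fun r => / lower y r)%C _
    (kappa_expansion_pairs y Hr Hy) (inv_upper_cv y)).
  cbv beta in H. now rewrite upper_0 in H.
Qed.

Lemma sigma_expansion (y : C) : 0 <= Re y -> Cexp (- y) <> 1 ->
  Ccv (csum (fun r => / (upper y (S r) * upper y (S r)) + / (lower y (S r) * lower y (S r)))%C)
    (sigma y - / (y * y))%C.
Proof.
  intros Hr Hy.
  assert (HA : Ccv (fun r => / (upper y r * upper y r))%C 0).
  { replace (RtoC 0) with (0 * 0)%C by ring.
    apply Ccv_ext with (fun r => / upper y r * / upper y r)%C.
    - intros r. assert (Hu := upper_neq_0 y r Hy). field. auto.
    - apply Ccv_mult; apply inv_upper_cv. }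
  assert (H := regroup_pairs (fun r => / (upper y r * upper y r))%C
    (fun r => / (lower y r * lower y r))%C _ (sigma_expansion_pairs y Hr Hy) HA).
  cbv beta in H. now rewrite upper_0 in H.
Qed.

Definition zeta2 : R := Series (fun n => / (INR (S n) * INR (S n))).

(** * Transformation of the logarithm of Euler's product *)

(** At y = PI i, where [sigma] is -1/4, all lattice points are odd multiples of PI i. The expansion
    becomes the sum of 1/(2r + 1)^2 = PI^2/8, and the even squares contribute a quarter of the whole
    sum. *)
Lemma zeta2_value : zeta2 = PI * PI / 6.
Proof.
  assert (HPI := PI_RGT_0).
  set (y := (RtoC PI * Ci)%C).
  assert (Ey : Cexp (- y) = RtoC (-1)).
  { unfold y. rewrite Cexp_opp, Cexp_PI. rewrite <- RtoC_inv by (intro; lra). f_equal. field. }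
  assert (H : Ccv (csum (fun r => / (upper y r * upper y r) + / (lower y (S r) * lower y (S r)))%C)
    (sigma y)).
  { apply sigma_expansion_pairs. unfold y. simpl. lra. rewrite Ey.
    intros E. apply RtoC_inj in E. lra. }
  assert (Es : sigma y = RtoC (- / 4)).
  { unfold sigma. rewrite Ey. apply Ceq; simpl; field. }
  rewrite Es in H.
  assert (Ho : is_lim_seq (sum_n (fun r => / ((2 * INR r + 1) * (2 * INR r + 1)))) (PI * PI / 8)).
  { apply Ccv_incr_1 in H. assert (H2 := Ccv_Re _ _ H). change (Re (RtoC (- / 4))) with (- / 4) in H2.
    apply (is_lim_seq_scal_l _ (- (PI * PI / 2))) in H2.
    replace (Finite (PI * PI / 8)) with (Rbar_mult (- (PI * PI / 2)) (- / 4))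
      by (simpl; f_equal; field).
    apply is_lim_seq_ext with (2 := H2). intros N.
    rewrite csum_Re, <- (sum_n_mult_l (K := R_Ring)). apply sum_n_ext. intros r.
    assert (0 <= INR r) by apply pos_INR.
    assert (E1 : (upper y r * upper y r)%C = RtoC (- (PI * PI * ((2 * INR r + 1) * (2 * INR r + 1))))).
    { unfold upper, y, tpi. apply Ceq; simpl; ring. }
    assert (E2 : (lower y (S r) * lower y (S r))%C = RtoC (- (PI * PI * ((2 * INR r + 1) * (2 * INR r + 1))))).
    { unfold lower, y, tpi. rewrite S_INR. apply Ceq; simpl; ring. }
    rewrite E1, E2, <- RtoC_inv, <- RtoC_plus. simpl. unfold mult; simpl. field. split; lra.
    nra. }
  assert (Hz : is_lim_seq (sum_n (fun n => / (INR (S n) * INR (S n)))) zeta2)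
    by (apply Series_correct, ex_series_inv_sq).
  assert (E : forall N, sum_n (fun n => / (INR (S n) * INR (S n))) (2 * N + 1) =
    sum_n (fun r => / ((2 * INR r + 1) * (2 * INR r + 1))) N +
    / 4 * sum_n (fun n => / (INR (S n) * INR (S n))) N).
  { induction N as [|N IH].
    - change (2 * 0 + 1)%nat with 1%nat. rewrite sum_Sn, !sum_O. unfold plus; simpl. field.
    - replace (2 * S N + 1)%nat with (S (S (2 * N + 1))) by lia.
      rewrite !sum_Sn, IH.
      set (s := sum_n (fun r => / ((2 * INR r + 1) * (2 * INR r + 1))) N).
      set (s' := sum_n (fun n => / (INR (S n) * INR (S n))) N).
      change (s + / 4 * s' + / (INR (S (S (2 * N + 1))) * INR (S (S (2 * N + 1)))) +
          / (INR (S (S (S (2 * N + 1)))) * INR (S (S (S (2 * N + 1))))) =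
        s + / ((2 * INR (S N) + 1) * (2 * INR (S N) + 1)) +
          / 4 * (s' + / (INR (S (S N)) * INR (S (S N))))).
      assert (E1 : INR (S (S (2 * N + 1))) = 2 * INR (S N) + 1)
        by (replace (S (S (2 * N + 1))) with (2 * S N + 1)%nat by lia;
            rewrite plus_INR, mult_INR; simpl; ring).
      assert (E2 : INR (S (S (S (2 * N + 1)))) = 2 * INR (S (S N)))
        by (replace (S (S (S (2 * N + 1)))) with (2 * S (S N))%nat by lia;
            rewrite mult_INR; simpl; ring).
      rewrite E1, E2. assert (Hp := INR_S_pos N). assert (Hp2 := INR_S_pos (S N)).
      field. split; lra. }
  assert (L1 : is_lim_seq (fun N => sum_n (fun n => / (INR (S n) * INR (S n))) (2 * N + 1)) zeta2).
  { apply (is_lim_seq_subseq _ _ (fun N => (2 * N + 1)%nat)) in Hz; auto.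
    apply eventually_subseq. intros; lia. }
  assert (L2 : is_lim_seq (fun N => sum_n (fun n => / (INR (S n) * INR (S n))) (2 * N + 1))
    (PI * PI / 8 + / 4 * zeta2)).
  { apply is_lim_seq_ext with (1 := fun N => eq_sym (E N)).
    apply is_lim_seq_plus'; auto. apply (is_lim_seq_scal_l _ (/ 4)) in Hz. exact Hz. }
  apply is_lim_seq_unique in L1. apply is_lim_seq_unique in L2. rewrite L1 in L2.
  injection L2. intros. lra.
Qed.

Lemma ex_series_exp_geom (x : R) : 0 < x -> ex_series (fun n => exp (- (INR n * x))).
Proof.
  intros Hx. apply ex_series_ext with (fun n => (exp (- x)) ^ n).
  - intros n. induction n as [|n IH].
    + simpl. rewrite Rmult_0_l, Ropp_0, exp_0. reflexivity.
    + simpl pow. rewrite IH, <- exp_plus, S_INR. f_equal. ring.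
  - apply ex_series_geom. rewrite Rabs_pos_eq by (left; apply exp_pos).
    rewrite <- exp_0. apply exp_increasing. lra.
Qed.

Lemma ex_series_n_exp (x : R) : 0 < x ->
  ex_series (fun n => INR (S n) * exp (- (INR (S n) * x))).
Proof.
  intros Hx. apply ex_series_Rle with (fun n => 2 / x * exp (- (INR n * (x / 2)))).
  2: { apply ex_series_Rscal, ex_series_exp_geom. lra. }
  intros n. assert (Hn := INR_S_pos n). assert (He := exp_pos (- (INR (S n) * x))). split. nra.
  assert (H : INR (S n) * (x / 2) <= exp (INR (S n) * (x / 2))).
  { apply Rle_trans with (1 + INR (S n) * (x / 2)). lra. apply exp_ineq1_le. }
  replace (- (INR (S n) * x)) with (- (INR (S n) * (x / 2)) + - (INR (S n) * (x / 2))) by field.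
  rewrite exp_plus. set (e := exp (- (INR (S n) * (x / 2)))) in *.
  assert (He2 : 0 < e) by apply exp_pos.
  assert (Hee : exp (INR (S n) * (x / 2)) * e = 1).
  { unfold e. rewrite <- exp_plus, <- exp_0. f_equal. ring. }
  assert (Hle : e <= exp (- (INR n * (x / 2)))).
  { apply exp_le. rewrite S_INR. lra. }
  apply Rle_trans with (2 / x * e).
  - replace (INR (S n) * (e * e)) with (2 / x * (INR (S n) * (x / 2) * e * e)) by (field; lra).
    apply Rmult_le_compat_l. apply Rdiv_le_0_compat; lra. nra.
  - apply Rmult_le_compat_l; auto. apply Rdiv_le_0_compat; lra.
Qed.

Lemma Cmod_Cexp_opp (z : C) : Cmod (Cexp (- z)) = exp (- Re z).
Proof. rewrite Cmod_Cexp. reflexivity. Qed.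

Definition mul_nat (n : nat) (z : C) : C := (RtoC (INR n) * z)%C.

Lemma Re_mul_nat (n : nat) (z : C) : Re (mul_nat n z) = INR n * Re z.
Proof. unfold mul_nat, Re. simpl. ring. Qed.

Lemma Re_mul_S_ge (n : nat) (z : C) (x : R) : 0 < x -> x <= Re z ->
  x <= Re (mul_nat (S n) z) /\ INR (S n) * x <= Re (mul_nat (S n) z).
Proof.
  intros Hx Hz. rewrite Re_mul_nat. assert (0 <= INR n) by apply pos_INR. rewrite S_INR. nra.
Qed.

Lemma Cexp_opp_small (z : C) (x : R) : 0 < x -> x <= Re z ->
  Cmod (Cexp (- z)) <= exp (- x) /\ exp (- x) < 1 /\
  1 - exp (- x) <= Cmod (1 - Cexp (- z)) /\ (1 - Cexp (- z))%C <> 0 /\ Cexp (- z) <> 1.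
Proof.
  intros Hx Hz.
  assert (H1 : Cmod (Cexp (- z)) <= exp (- x)) by (rewrite Cmod_Cexp_opp; apply exp_le; lra).
  assert (H2 : exp (- x) < 1) by (rewrite <- exp_0; apply exp_increasing; lra).
  assert (H3 : 1 - exp (- x) <= Cmod (1 - Cexp (- z))).
  { assert (H := Cmod_ge_minus 1 (- Cexp (- z))). rewrite Cmod_1, Cmod_opp in H.
    unfold Cminus. lra. }
  assert (H4 : (1 - Cexp (- z))%C <> 0) by (apply Cmod_gt_0; lra).
  repeat split; auto. intros E. apply H4. rewrite E. ring.
Qed.

(** The Lambert series of the divisor sums at q = e^{-z}, indexed from n + 1. Up to the factor of
    the inner derivative, these terms are the derivatives of the logarithms of 1 - q^{n+1}. *)
Definition lambert (z : C) (n : nat) : C :=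
  (RtoC (INR (S n)) * Cexp (- mul_nat (S n) z) / (1 - Cexp (- mul_nat (S n) z)))%C.

Lemma lambert_le (z : C) (x : R) (n : nat) : 0 < x -> x <= Re z ->
  Cmod (lambert z n) <= / (1 - exp (- x)) * (INR (S n) * exp (- (INR (S n) * x))).
Proof.
  intros Hx Hz. destruct (Re_mul_S_ge n z x Hx Hz) as [H1 H2].
  destruct (Cexp_opp_small _ x Hx H1) as [_ [A2 [A3 [A4 _]]]].
  unfold lambert. rewrite Cmod_div, Cmod_mult, Cmod_R, Rabs_pos_eq by (auto; apply pos_INR).
  unfold Rdiv. rewrite (Rmult_comm _ (/ _)). apply Rmult_le_compat.
  - left. apply Rinv_0_lt_compat. now apply Cmod_gt_0.
  - apply Rmult_le_pos. apply pos_INR. apply Cmod_ge_0.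
  - apply Rinv_le_contravar; lra.
  - apply Rmult_le_compat_l. apply pos_INR. rewrite Cmod_Cexp_opp. apply exp_le. lra.
Qed.

Lemma Cgeom_cv (w : C) : Cmod w < 1 -> Ccv (csum (Cpow w)) (/ (1 - w))%C.
Proof.
  intros Hw.
  assert (Hn : (1 - w)%C <> 0).
  { apply Cmod_gt_0. assert (H := Cmod_ge_minus 1 (- w)). rewrite Cmod_1, Cmod_opp in H.
    unfold Cminus. lra. }
  assert (E : forall N, csum (Cpow w) N = ((1 - Cpow w N) / (1 - w))%C).
  { induction N as [|N IH]; simpl csum. simpl. field; auto.
    rewrite IH, Cpow_S. field; auto. }
  apply Ccv_of_le with (fun N => / Cmod (1 - w) * Cmod w ^ N).
  - exists O. intros N _. rewrite E.
    replace ((1 - Cpow w N) / (1 - w) - / (1 - w))%C with (- Cpow w N / (1 - w))%C by (field; auto).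
    rewrite Cmod_div, Cmod_opp, Cmod_pow by auto. unfold Rdiv. lra.
  - apply is_lim_seq_scal0. apply is_lim_seq_geom. rewrite Rabs_pos_eq; auto. apply Cmod_ge_0.
Qed.

Lemma Cgeom_S_cv (w : C) : Cmod w < 1 ->
  Ccv (csum (fun n => Cpow w (S n))) (w / (1 - w))%C.
Proof.
  intros Hw. apply Ccv_ext with (fun N => w * csum (Cpow w) N)%C.
  - intros N. now rewrite <- csum_scal.
  - apply Ccv_scal. now apply Cgeom_cv.
Qed.

Lemma Cgeom_deriv_cv (w : C) :
  Cmod w < 1 -> is_lim_seq (fun N => INR (S N) * Cmod w ^ N) 0 ->
  Ccv (csum (fun n => RtoC (INR (S n)) * Cpow w (S n))%C) (w / ((1 - w) * (1 - w)))%C.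
Proof.
  intros Hw Hl.
  assert (Hn : (1 - w)%C <> 0).
  { apply Cmod_gt_0. assert (H := Cmod_ge_minus 1 (- w)). rewrite Cmod_1, Cmod_opp in H.
    unfold Cminus. lra. }
  assert (E : forall N, csum (fun n => RtoC (INR (S n)) * Cpow w (S n))%C N =
    (w / ((1 - w) * (1 - w)) + Cpow w N * (RtoC (INR N) * w * w - RtoC (INR (S N)) * w) / ((1 - w) * (1 - w)))%C).
  { induction N as [|N IH].
    - simpl. field; auto.
    - rewrite csum_S, IH, !Cpow_S, !S_INR, !RtoC_plus. field; auto. }
  apply Ccv_of_le with (fun N => 2 / (Cmod (1 - w) * Cmod (1 - w)) * (INR (S N) * Cmod w ^ N)).
  2: now apply is_lim_seq_scal0.
  exists O. intros N _. rewrite E.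
  set (c := (w / ((1 - w) * (1 - w)))%C).
  match goal with |- Cmod (c + ?a - c) <= _ => replace (c + a - c)%C with a by ring end.
  assert (Hn' := Hn). apply Cmod_gt_0 in Hn'.
  rewrite Cmod_div, !Cmod_mult, Cmod_pow by (apply Cmult_neq_0; auto).
  unfold Rdiv.
  assert (H : Cmod (RtoC (INR N) * w * w - RtoC (INR (S N)) * w) <= 2 * INR (S N)).
  { apply Rle_trans with (1 := Cmod_triangle_minus _ _).
    rewrite !Cmod_mult, !Cmod_R, !Rabs_pos_eq by apply pos_INR.
    assert (H0 := Cmod_ge_0 w). assert (0 <= INR N) by apply pos_INR. rewrite S_INR.
    assert (Cmod w * Cmod w <= 1) by nra. nra. }
  assert (Hp : 0 <= Cmod w ^ N) by (apply pow_le, Cmod_ge_0).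
  assert (Hi : 0 < / (Cmod (1 - w) * Cmod (1 - w))) by (apply Rinv_0_lt_compat; nra).
  apply Rle_trans with (Cmod w ^ N * (2 * INR (S N)) * / (Cmod (1 - w) * Cmod (1 - w))).
  apply Rmult_le_compat_r. lra. apply Rmult_le_compat_l; auto. right; ring.
Qed.

Lemma Cexp_mul_nat (n : nat) (z : C) : Cexp (- mul_nat n z) = Cpow (Cexp (- z)) n.
Proof.
  rewrite <- Cexp_INR. f_equal. unfold mul_nat. ring.
Qed.

(** This is (1 - E_2)/24 at q = e^{-z}, in the form that has a lattice expansion. *)
Definition sigma_sum (z : C) : C := CSeries (fun m => sigma (mul_nat (S m) z)).

(** Both series sum the double series of n q^{mn}, over n first or over m first. The majorant
    separates the variables because (m + 1)(n + 1) >= m + (n + 1). *)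
Lemma sigma_sum_lambert (z : C) : 0 < Re z ->
  Ccv (csum (fun m => sigma (mul_nat (S m) z))) (sigma_sum z) /\
  Ccv (csum (lambert z)) (sigma_sum z).
Proof.
  intros Hz. set (x := Re z).
  set (f := fun m n => (RtoC (INR (S n)) * Cpow (Cexp (- mul_nat (S m) z)) (S n))%C).
  assert (Hf : forall m n, Cmod (f m n) <=
    exp (- (INR m * x)) * (INR (S n) * exp (- (INR (S n) * x)))).
  { intros m n. unfold f. rewrite Cmod_mult, Cmod_R, Rabs_pos_eq by apply pos_INR.
    rewrite <- Cexp_mul_nat, Cmod_Cexp_opp, !Re_mul_nat. fold x.
    replace (exp (- (INR m * x)) * (INR (S n) * exp (- (INR (S n) * x)))) with
      (INR (S n) * (exp (- (INR m * x)) * exp (- (INR (S n) * x)))) by ring.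
    apply Rmult_le_compat_l. apply pos_INR. rewrite <- exp_plus. apply exp_le.
    assert (0 <= INR n) by apply pos_INR. assert (0 <= INR m) by apply pos_INR.
    rewrite !S_INR. assert (0 <= INR n * INR m) by nra. unfold x in *. nra. }
  assert (Hsm : forall m, Cmod (Cexp (- mul_nat (S m) z)) < 1).
  { intros m. destruct (Re_mul_S_ge m z (Re z) Hz (Rle_refl _)) as [H1 _].
    destruct (Cexp_opp_small _ _ Hz H1) as [A [B _]]. lra. }
  assert (E1 : forall m, CSeries (f m) = sigma (mul_nat (S m) z)).
  { intros m. apply Ccv_csum_CSeries. unfold f, sigma. apply Cgeom_deriv_cv; auto.
    apply is_lim_seq_ext with (fun N => exp (Re (mul_nat (S m) z)) *
      (INR (S N) * exp (- (INR (S N) * Re (mul_nat (S m) z))))).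
    - intros N. rewrite <- Cmod_pow, <- Cexp_mul_nat, Cmod_Cexp_opp, (Re_mul_nat N).
      set (X := Re (mul_nat (S m) z)).
      replace (exp X * (INR (S N) * exp (- (INR (S N) * X)))) with
        (INR (S N) * (exp X * exp (- (INR (S N) * X)))) by ring.
      rewrite <- exp_plus. f_equal. f_equal. rewrite S_INR. ring.
    - apply is_lim_seq_scal0. apply ex_series_lim_0. apply ex_series_n_exp.
      destruct (Re_mul_S_ge m z (Re z) Hz (Rle_refl _)). lra. }
  assert (E2 : forall n, CSeries (fun m => f m n) = lambert z n).
  { intros n. apply Ccv_csum_CSeries. unfold f, lambert.
    apply Ccv_ext with (fun N => RtoC (INR (S n)) *
      csum (fun m => Cpow (Cexp (- mul_nat (S n) z)) (S m)) N)%C.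
    - intros N. rewrite <- csum_scal. apply csum_ext. intros m _. f_equal.
      rewrite <- !Cexp_mul_nat. f_equal. unfold mul_nat. ring.
    - unfold Cdiv. rewrite <- Cmult_assoc. apply Ccv_scal. apply Cgeom_S_cv. apply Hsm. }
  destruct (CSeries_fubini_prod f _ _ Hf (ex_series_exp_geom x Hz) (ex_series_n_exp x Hz)) as [F1 F2].
  assert (E3 : CSeries (fun m => CSeries (f m)) = sigma_sum z).
  { apply CSeries_ext. exact E1. }
  rewrite E3 in F1, F2. split.
  - apply Ccv_ext with (2 := F2). intros N. now apply csum_ext.
  - apply Ccv_ext with (2 := F1). intros N. now apply csum_ext.
Qed.

Definition pii : C := (RtoC PI * Ci)%C.

Lemma tpi_pii : tpi = (RtoC 2 * pii)%C.
Proof. unfold tpi, pii. rewrite RtoC_mult. ring. Qed.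

Lemma pii_sqr : (pii * pii)%C = RtoC (- (PI * PI)).
Proof. unfold pii. apply Ceq; simpl; ring. Qed.

Lemma pii_neq_0 : pii <> 0.
Proof.
  unfold pii. apply Cmult_neq_0. apply RtoC_neq_0. assert (H := PI_RGT_0). lra.
  intros E. injection E. lra.
Qed.

Lemma tpi_neq_0 : tpi <> 0.
Proof. rewrite tpi_pii. apply Cmult_neq_0. apply RtoC_neq_0; lra. apply pii_neq_0. Qed.

Lemma tpi_sqr : (tpi * tpi)%C = RtoC (- (4 * PI * PI)).
Proof. unfold tpi. apply Ceq; simpl; ring. Qed.

Section Transform.

Variable z : C.
Hypothesis Hz : 0 < Re z.

Let A (m : nat) : C := mul_nat (S m) z.
Let c := Re z / (Re z + Cmod z).

Lemma lattice_const_pos : 0 < c.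
Proof.
  unfold c. apply Rdiv_lt_0_compat; auto. assert (H := Cmod_ge_0 z). lra.
Qed.

(** The first bound is the real part. For the second, |rho| <= |a| + (m + 1)|z|, and the first bound
    gives (m + 1)|z| <= |a| |z| / Re z; together they produce the constant [c]. *)
Lemma lattice_ge (m : nat) (rho : R) :
  INR (S m) * Re z <= Cmod (A m + RtoC rho * Ci) /\ Rabs rho * c <= Cmod (A m + RtoC rho * Ci).
Proof.
  assert (Hp := INR_S_pos m). assert (H0 := Cmod_ge_0 z).
  set (a := (A m + RtoC rho * Ci)%C).
  assert (H1 : INR (S m) * Re z <= Cmod a).
  { apply Rle_trans with (2 := Re_le_Cmod a).
    assert (E : Re a = Re (A m)) by (unfold a, Re; generalize (A m); intros; simpl; ring).
    rewrite E. unfold A. rewrite Re_mul_nat. lra. }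
  split; auto.
  assert (H2 : Rabs rho <= Cmod a + INR (S m) * Cmod z).
  { assert (E : (RtoC rho * Ci)%C = (a - A m)%C) by (unfold a; ring).
    assert (H := Cmod_triangle_minus a (A m)). rewrite <- E, Cmod_mult, Cmod_Ci, Cmod_R in H.
    unfold A, mul_nat in H. rewrite Cmod_mult, Cmod_R, (Rabs_pos_eq (INR _)) in H by lra. lra. }
  unfold c. apply Rmult_le_reg_r with (Re z + Cmod z). lra.
  replace (Rabs rho * (Re z / (Re z + Cmod z)) * (Re z + Cmod z)) with (Rabs rho * Re z)
    by (field; lra).
  assert (Cmod a * Cmod z >= INR (S m) * Re z * Cmod z) by nra. nra.
Qed.

Lemma lattice_neq_0 (m : nat) (rho : R) : (A m + RtoC rho * Ci)%C <> 0.
Proof.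
  apply Cmod_gt_0. destruct (lattice_ge m rho) as [H _]. assert (Hp := INR_S_pos m). nra.
Qed.

(** The difference is PI^2 over a product of four lattice distances. Two of them are bounded below
    in terms of m and two in terms of r, which yields summability in both indices. Only rho + PI is
    bounded in terms of r: its modulus is at least PI (r + 1) for either sign of rho. *)
Lemma lattice_diff_le (m r : nat) (rho : R) : Rabs rho = 2 * PI * INR (S r) ->
  let a := (A m + RtoC rho * Ci)%C in
  Cmod (/ (a * a) - / (a * a + RtoC (PI * PI))) <=
  / (2 * (Re z * c) * (Re z * c)) * (/ (INR (S m) * INR (S m)) * / (INR (S r) * INR (S r))).
Proof.
  intros Hrho a. assert (HPI := PI_RGT_0).
  set (a1 := (A m + RtoC (rho - PI) * Ci)%C). set (a2 := (A m + RtoC (rho + PI) * Ci)%C).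
  assert (E : (a * a + RtoC (PI * PI))%C = (a1 * a2)%C).
  { unfold a, a1, a2. apply Ceq; simpl; ring. }
  rewrite E.
  assert (Na := lattice_neq_0 m rho). fold a in Na.
  assert (N1 := lattice_neq_0 m (rho - PI)). fold a1 in N1.
  assert (N2 := lattice_neq_0 m (rho + PI)). fold a2 in N2.
  replace (/ (a * a) - / (a1 * a2))%C with (RtoC (PI * PI) / (a * a * (a1 * a2)))%C.
  2: { replace (RtoC (PI * PI)) with (a1 * a2 - a * a)%C by (rewrite <- E; ring). field; auto. }
  destruct (lattice_ge m rho) as [G1 G2]. fold a in G1, G2.
  destruct (lattice_ge m (rho - PI)) as [G3 G4]. fold a1 in G3, G4.
  destruct (lattice_ge m (rho + PI)) as [G5 G6]. fold a2 in G5, G6.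
  assert (Hm := INR_S_pos m). assert (Hr := INR_S_pos r). assert (Hc := lattice_const_pos).
  assert (Hr1 : 1 <= INR (S r)) by (rewrite S_INR; assert (H := pos_INR r); lra).
  assert (R2 : PI * INR (S r) <= Rabs (rho + PI)).
  { assert (H := Rabs_triang (rho + PI) (- PI)). replace (rho + PI + - PI) with rho in H by ring.
    rewrite Rabs_Ropp, (Rabs_pos_eq PI) in H by lra. nra. }
  set (X := INR (S m) * Re z) in *. set (Y := PI * INR (S r) * c).
  assert (HX : 0 < X) by (unfold X; nra). assert (HY : 0 < Y) by (unfold Y; apply Rmult_lt_0_compat; nra).
  assert (B2 : 2 * Y <= Cmod a) by (rewrite Hrho in G2; unfold Y; lra).
  assert (B3 : Y <= Cmod a2) by (apply Rle_trans with (2 := G6); unfold Y; nra).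
  assert (HD : (2 * (X * Y) * (X * Y)) <= Cmod (a * a * (a1 * a2))).
  { rewrite !Cmod_mult.
    replace (2 * (X * Y) * (X * Y)) with ((X * (2 * Y)) * (X * Y)) by ring.
    apply Rmult_le_compat; try nra; apply Rmult_le_compat; lra. }
  rewrite Cmod_div by (repeat apply Cmult_neq_0; auto).
  rewrite Cmod_R, Rabs_pos_eq by nra.
  apply Rle_trans with (PI * PI * / (2 * (X * Y) * (X * Y))).
  - apply Rmult_le_compat_l. nra. apply Rinv_le_contravar; auto.
    apply Rmult_lt_0_compat; nra.
  - right. unfold X, Y. field. repeat split; lra.
Qed.

(* The double series of [G] converges only conditionally; [Bd] is a telescoping comparison
   term of the same order whose difference from [G] is absolutely summable. *)
Let G (m r : nat) : C :=
  (/ (upper (A m) (S r) * upper (A m) (S r)) + / (lower (A m) (S r) * lower (A m) (S r)))%C.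
Let Fh (m j : nat) : C :=
  (/ tpi * (/ (A m - RtoC (INR j + / 2) * tpi) - / (A m + RtoC (INR j + / 2) * tpi)))%C.
Let Bd (m r : nat) : C := (Fh m (S r) - Fh m r)%C.

Lemma upper_lattice (m r : nat) :
  upper (A m) r = (A m + RtoC (2 * PI * INR r) * Ci)%C.
Proof. unfold upper, tpi. rewrite !RtoC_mult. ring. Qed.

Lemma lower_lattice (m r : nat) :
  lower (A m) r = (A m + RtoC (- (2 * PI * INR r)) * Ci)%C.
Proof. unfold lower, tpi. rewrite RtoC_opp, !RtoC_mult. ring. Qed.

(** [Fh] sits at the midpoints between lattice points. The midpoints next to a lattice point u are u
    - PI i and u + PI i, whose product is u^2 + PI^2; so the difference of [Fh] imitates 1/u^2 up to
    fourth order. *)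
Lemma telescoping_term_eq (m r : nat) : Bd m r =
  (/ (upper (A m) (S r) * upper (A m) (S r) + RtoC (PI * PI)) +
   / (lower (A m) (S r) * lower (A m) (S r) + RtoC (PI * PI)))%C.
Proof.
  unfold Bd, Fh.
  assert (E1 : (A m - RtoC (INR (S r) + / 2) * tpi)%C = (lower (A m) (S r) - pii)%C)
    by (unfold lower, tpi, pii; apply Ceq; simpl; field).
  assert (E2 : (A m + RtoC (INR (S r) + / 2) * tpi)%C = (upper (A m) (S r) + pii)%C)
    by (unfold upper, tpi, pii; apply Ceq; simpl; field).
  assert (E3 : (A m - RtoC (INR r + / 2) * tpi)%C = (lower (A m) (S r) + pii)%C)
    by (unfold lower, tpi, pii; rewrite S_INR; apply Ceq; simpl; field).
  assert (E4 : (A m + RtoC (INR r + / 2) * tpi)%C = (upper (A m) (S r) - pii)%C)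
    by (unfold upper, tpi, pii; rewrite S_INR; apply Ceq; simpl; field).
  rewrite E1, E2, E3, E4.
  assert (N1 : (lower (A m) (S r) - pii)%C <> 0).
  { rewrite lower_lattice. assert (H := lattice_neq_0 m (- (2 * PI * INR (S r)) - PI)).
    intros E. apply H. rewrite <- E, RtoC_minus. unfold pii. ring. }
  assert (N2 : (upper (A m) (S r) + pii)%C <> 0).
  { rewrite upper_lattice. assert (H := lattice_neq_0 m ((2 * PI * INR (S r)) + PI)).
    intros E. apply H. rewrite <- E, RtoC_plus. unfold pii. ring. }
  assert (N3 : (lower (A m) (S r) + pii)%C <> 0).
  { rewrite lower_lattice. assert (H := lattice_neq_0 m (- (2 * PI * INR (S r)) + PI)).
    intros E. apply H. rewrite <- E, RtoC_plus. unfold pii. ring. }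
  assert (N4 : (upper (A m) (S r) - pii)%C <> 0).
  { rewrite upper_lattice. assert (H := lattice_neq_0 m ((2 * PI * INR (S r)) - PI)).
    intros E. apply H. rewrite <- E, RtoC_minus. unfold pii. ring. }
  replace (RtoC (PI * PI)) with (- (pii * pii))%C by (rewrite pii_sqr, RtoC_opp; ring).
  replace (upper (A m) (S r) * upper (A m) (S r) + - (pii * pii))%C with
    ((upper (A m) (S r) - pii) * (upper (A m) (S r) + pii))%C by ring.
  replace (lower (A m) (S r) * lower (A m) (S r) + - (pii * pii))%C with
    ((lower (A m) (S r) - pii) * (lower (A m) (S r) + pii))%C by ring.
  rewrite tpi_pii. field. repeat split; auto. apply pii_neq_0.
Qed.

Lemma lattice_minus_telescoping_le (m r : nat) : Cmod (G m r - Bd m r) <=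
  (/ ((Re z * c) * (Re z * c)) * / (INR (S m) * INR (S m))) * / (INR (S r) * INR (S r)).
Proof.
  rewrite telescoping_term_eq. unfold G. rewrite upper_lattice, lower_lattice.
  assert (HPI := PI_RGT_0). assert (Hr := INR_S_pos r). assert (Hm := INR_S_pos m).
  assert (Hc := lattice_const_pos).
  assert (H1 := lattice_diff_le m r (2 * PI * INR (S r))).
  assert (H2 := lattice_diff_le m r (- (2 * PI * INR (S r)))).
  rewrite Rabs_Ropp in H2. rewrite Rabs_pos_eq in H1, H2 by nra.
  specialize (H1 eq_refl). specialize (H2 eq_refl). cbv zeta in H1, H2.
  set (u := (A m + RtoC (2 * PI * INR (S r)) * Ci)%C) in *.
  set (l := (A m + RtoC (- (2 * PI * INR (S r))) * Ci)%C) in *.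
  match goal with |- Cmod ?x <= _ => replace x with
    ((/ (u * u) - / (u * u + RtoC (PI * PI))) + (/ (l * l) - / (l * l + RtoC (PI * PI))))%C by ring end.
  apply Rle_trans with (1 := Cmod_triangle _ _).
  replace (/ ((Re z * c) * (Re z * c)) * / (INR (S m) * INR (S m)) * / (INR (S r) * INR (S r))) with
   (/ (2 * (Re z * c) * (Re z * c)) * (/ (INR (S m) * INR (S m)) * / (INR (S r) * INR (S r))) +
    / (2 * (Re z * c) * (Re z * c)) * (/ (INR (S m) * INR (S m)) * / (INR (S r) * INR (S r))))
    by (field; repeat split; lra).
  lra.
Qed.

Lemma telescoping_cv_0 (m : nat) : Ccv (Fh m) 0.
Proof.
  replace (RtoC 0) with (/ tpi * (- (RtoC 0) - 0))%C by ring.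
  apply Ccv_scal. apply Ccv_minus.
  - apply Ccv_ext with (fun r => - / upper (- A m + pii) r)%C.
    + intros r.
      assert (E : upper (- A m + pii) r = (- (A m - RtoC (INR r + / 2) * tpi))%C).
      { unfold upper, tpi, pii. apply Ceq; simpl; field. }
      rewrite E.
      assert (N : (A m - RtoC (INR r + / 2) * tpi)%C <> 0).
      { assert (H := lattice_neq_0 m (- ((INR r + / 2) * (2 * PI)))). intros E2. apply H.
        rewrite <- E2. unfold tpi. apply Ceq; simpl; field. }
      field; auto.
    + apply Ccv_opp. apply inv_upper_cv.
  - apply Ccv_ext with (fun r => / upper (A m + pii) r)%C.
    + intros r. f_equal. unfold upper, tpi, pii. apply Ceq; simpl; field.
    + apply inv_upper_cv.
Qed.

Lemma Cexp_multiple_neq_1 (m : nat) : 0 < Re (A m) /\ Cexp (- A m) <> 1.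
Proof.
  destruct (Re_mul_S_ge m z (Re z) Hz (Rle_refl _)) as [H _].
  split. unfold A. lra. now apply (Cexp_opp_small _ _ Hz).
Qed.

(** In the row direction the correction telescopes to its starting value alone, since [Fh m]
    vanishes at infinity. *)
Lemma lattice_row_sum (m : nat) :
  Ccv (csum (fun r => G m r - Bd m r)%C) (sigma (A m) - / (A m * A m) + Fh m O)%C.
Proof.
  destruct (Cexp_multiple_neq_1 m) as [H1 H2].
  assert (H := sigma_expansion (A m) (Rlt_le _ _ H1) H2).
  apply Ccv_ext with (fun N => csum (G m) N - (Fh m N - Fh m O))%C.
  - intros N.
    assert (E : csum (Bd m) N = (Fh m N - Fh m O)%C).
    { induction N as [|N IH]. simpl. ring. rewrite csum_S, IH. unfold Bd. ring. }
    rewrite <- E. unfold Cminus at 2. rewrite csum_plus. unfold Cminus. f_equal.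
    rewrite (csum_ext (fun i => - Bd m i)%C (fun i => RtoC (-1) * Bd m i)%C) by (intros; ring).
    rewrite csum_scal. ring.
  - replace (sigma (A m) - / (A m * A m) + Fh m O)%C with
      (sigma (A m) - / (A m * A m) - (0 - Fh m O))%C by ring.
    apply Ccv_minus. exact H. apply Ccv_minus. apply telescoping_cv_0. apply Ccv_const.
Qed.

Let w : C := (RtoC (4 * PI * PI) / z)%C.

Lemma Re_dual_pos : 0 < Re w.
Proof.
  assert (HPI := PI_RGT_0). unfold w, Cdiv.
  replace (Re (RtoC (4 * PI * PI) * / z)) with (4 * PI * PI * Re (/ z)) by (unfold Re; simpl; ring).
  apply Rmult_lt_0_compat. nra. now apply Re_inv_pos.
Qed.

Lemma period_neq_0 : z <> 0.
Proof. now apply Re_pos_neq_0. Qed.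

Lemma dual_tpi : w = (- (tpi * tpi) / z)%C.
Proof. rewrite tpi_sqr. unfold w. rewrite RtoC_opp. unfold Cdiv. ring. Qed.

(** The modular symmetry: multiplication by 2 PI i / z exchanges the two periods, so a column of the
    lattice of z is a row of the lattice of w = 4 PI^2 / z. *)
Lemma dual_upper (rho : R) (m : nat) :
  upper (RtoC rho * w) (S m) = (tpi / z * (A m - RtoC rho * tpi))%C.
Proof. rewrite dual_tpi. unfold upper, A, mul_nat. field. apply period_neq_0. Qed.

Lemma dual_lower (rho : R) (m : nat) :
  lower (RtoC rho * w) (S m) = (- (tpi / z * (A m + RtoC rho * tpi)))%C.
Proof. rewrite dual_tpi. unfold lower, A, mul_nat. field. apply period_neq_0. Qed.

Lemma dual_multiple_facts (rho : R) : 0 < rho ->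
  0 < Re (RtoC rho * w) /\ Cexp (- (RtoC rho * w)) <> 1 /\ (RtoC rho * w)%C <> 0.
Proof.
  intros Hr. assert (Hw := Re_dual_pos).
  assert (H : 0 < Re (RtoC rho * w)).
  { replace (Re (RtoC rho * w)) with (rho * Re w) by (unfold Re; simpl; ring). nra. }
  split; auto. split. now apply (Cexp_opp_small _ _ H (Rle_refl _)). now apply Re_pos_neq_0.
Qed.

Let H (j : nat) : C :=
  ((kappa (RtoC (INR j + / 2) * w) - / (RtoC (INR j + / 2) * w)) / z)%C.

Lemma lattice_tpi_neq_0 (m : nat) (rho : R) :
  (A m - RtoC rho * tpi)%C <> 0 /\ (A m + RtoC rho * tpi)%C <> 0.
Proof.
  split.
  - assert (N := lattice_neq_0 m (- (rho * (2 * PI)))). intros E. apply N. rewrite <- E.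
    unfold tpi. rewrite RtoC_opp, !RtoC_mult. ring.
  - assert (N := lattice_neq_0 m (rho * (2 * PI))). intros E. apply N. rewrite <- E.
    unfold tpi. rewrite !RtoC_mult. ring.
Qed.

(** By duality, the sum over m of the midpoint terms is the expansion of coth at (j + 1/2) w,
    without its central pole. *)
Lemma telescoping_column_sum (j : nat) : Ccv (csum (fun m => Fh m j)) (H j).
Proof.
  assert (Hj : 0 < INR j + / 2) by (assert (J := pos_INR j); lra).
  destruct (dual_multiple_facts _ Hj) as [H1 [H2 H3]].
  assert (K := kappa_expansion _ (Rlt_le _ _ H1) H2).
  apply (Ccv_scal (/ z)) in K.
  replace (H j) with (/ z * (kappa (RtoC (INR j + / 2) * w) - / (RtoC (INR j + / 2) * w)))%C
    by (unfold H, Cdiv; ring).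
  apply Ccv_ext with (2 := K). intros N. rewrite <- csum_scal. apply csum_ext. intros m _.
  rewrite dual_upper, dual_lower. unfold Fh.
  destruct (lattice_tpi_neq_0 m (INR j + / 2)) as [N1 N2].
  assert (Nz := period_neq_0). assert (Nt := tpi_neq_0). field. repeat split; auto.
Qed.

Lemma lattice_column_sum (r : nat) : Ccv (csum (fun m => G m r))
  (- (RtoC (4 * PI * PI) / (z * z)) * sigma (mul_nat (S r) w)
   + RtoC (/ (4 * PI * PI)) * RtoC (/ (INR (S r) * INR (S r))))%C.
Proof.
  assert (HPI := PI_RGT_0). assert (Hr := INR_S_pos r).
  destruct (dual_multiple_facts _ Hr) as [H1 [H2 H3]].
  assert (K := sigma_expansion _ (Rlt_le _ _ H1) H2).
  assert (Nz := period_neq_0). assert (Nt := tpi_neq_0).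
  apply (Ccv_scal (tpi * tpi / (z * z))%C) in K.
  match goal with |- Ccv _ ?l => replace l with
    (tpi * tpi / (z * z) * (sigma (RtoC (INR (S r)) * w) -
       / ((RtoC (INR (S r)) * w) * (RtoC (INR (S r)) * w))))%C end.
  - apply Ccv_ext with (2 := K). intros N. rewrite <- csum_scal. apply csum_ext. intros m _.
    rewrite dual_upper, dual_lower. unfold G, upper, lower.
    destruct (lattice_tpi_neq_0 m (INR (S r))) as [N1 N2]. field. repeat split; auto.
  - unfold mul_nat. set (sg := sigma (RtoC (INR (S r)) * w)).
    assert (NR : RtoC (INR (S r)) <> 0) by (apply RtoC_neq_0; lra).
    assert (NP : RtoC PI <> 0) by (apply RtoC_neq_0; lra).
    rewrite tpi_sqr. unfold w.
    rewrite !RtoC_inv, RtoC_opp, !RtoC_mult by nra. field. repeat split; auto.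
Qed.

(** [kappa] tends to 1/2 far to the right. Unlike the row boundary, this one survives: it is the
    anomaly that makes E_2 only quasimodular. *)
Lemma telescoping_boundary_lim : Ccv H (/ (RtoC 2 * z))%C.
Proof.
  assert (Nz := period_neq_0). assert (Hw := Re_dual_pos). assert (Nw := Re_pos_neq_0 _ Hw).
  replace (/ (RtoC 2 * z))%C with (((1 + 0) / (RtoC 2 * (1 - 0)) - 0 * / w) * / z)%C.
  2: { assert (RtoC 2 <> 0) by (apply RtoC_neq_0; lra). field. repeat split; auto. }
  unfold H. apply Ccv_mult. 2: apply Ccv_const.
  assert (Ee : Ccv (fun j => Cexp (- (RtoC (INR j + / 2) * w))) 0).
  { apply Ccv_of_le with (fun j => exp (- (INR j * Re w))).
    - exists O. intros j _. replace (Cexp (- (RtoC (INR j + / 2) * w)) - 0)%C with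
        (Cexp (- (RtoC (INR j + / 2) * w))) by ring.
      rewrite Cmod_Cexp_opp. apply exp_le.
      replace (Re (RtoC (INR j + / 2) * w)) with ((INR j + / 2) * Re w) by (unfold Re; simpl; ring).
      lra.
    - apply ex_series_lim_0. now apply ex_series_exp_geom. }
  apply Ccv_minus.
  - unfold kappa. apply Ccv_div.
    + apply Ccv_plus. apply Ccv_const. exact Ee.
    + apply Ccv_scal. apply Ccv_minus. apply Ccv_const. exact Ee.
    + replace (RtoC 2 * (1 - 0))%C with (RtoC 2) by ring. apply RtoC_neq_0; lra.
  - apply Ccv_ext with (fun j => RtoC (/ (INR j + / 2)) * / w)%C.
    + intros j. assert (J := pos_INR j). rewrite RtoC_inv by lra. field. split; auto.
      apply RtoC_neq_0; lra.
    + apply Ccv_mult. 2: apply Ccv_const. apply (Ccv_RtoC _ 0).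
      apply is_lim_seq_incr_1. apply lim0_le with (2 := INR_lim_inv). exists O. intros n _.
      assert (Hn := INR_S_pos n). split. left. apply Rinv_0_lt_compat. lra.
      apply Rinv_le_contravar; lra.
Qed.

Lemma csum_zeta2 : Ccv (csum (fun n => RtoC (/ (INR (S n) * INR (S n))))) (RtoC (PI * PI / 6)).
Proof.
  rewrite <- zeta2_value. apply Ccv_incr_1. apply Ccv_Re_Im.
  - apply is_lim_seq_ext with (1 := fun n => eq_sym (csum_Re _ n)). simpl.
    apply Series_correct. apply ex_series_inv_sq.
  - apply is_lim_seq_ext with (fun _ => 0). 2: simpl; apply is_lim_seq_const.
    intros n. rewrite csum_Im. induction n as [|n IH]. now rewrite sum_O.
    rewrite sum_Sn, <- IH. simpl. unfold plus. simpl. ring.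
Qed.

(** The absolutely convergent sum [Delta] of the corrected lattice terms is evaluated by rows and by
    columns. Rows give [sigma_sum z] with -PI^2/(6 z^2) and H 0; columns give the dual sum with
    1/24, -1/(2z) and the same H 0, which cancels. *)
Lemma sigma_sum_transform :
  sigma_sum z = (RtoC (PI * PI / 6) / (z * z) + RtoC (/ 24) - / (RtoC 2 * z)
                 - RtoC (4 * PI * PI) / (z * z) * sigma_sum w)%C.
Proof.
  assert (Nz := period_neq_0). assert (HPI := PI_RGT_0).
  destruct (CSeries_fubini_prod (fun m r => G m r - Bd m r)%C
    (fun m => / ((Re z * c) * (Re z * c)) * / (INR (S m) * INR (S m)))
    (fun r => / (INR (S r) * INR (S r))) lattice_minus_telescoping_le) as [F1 F2].
  { apply ex_series_Rscal, ex_series_inv_sq. } { apply ex_series_inv_sq. }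
  set (Delta := CSeries (fun m => CSeries (fun r => G m r - Bd m r)%C)) in *.
  assert (L1 : Ccv (csum (fun m => sigma (A m) - / (A m * A m) + Fh m O)%C) Delta).
  { apply Ccv_ext with (2 := F2). intros N. apply csum_ext. intros m _.
    apply Ccv_csum_CSeries. apply lattice_row_sum. }
  assert (L2 : Ccv (csum (fun m => sigma (A m) - / (A m * A m) + Fh m O)%C)
    (sigma_sum z - / (z * z) * RtoC (PI * PI / 6) + H O)%C).
  { apply Ccv_ext with (fun N => csum (fun m => sigma (A m)) N -
      / (z * z) * csum (fun n => RtoC (/ (INR (S n) * INR (S n)))) N + csum (fun m => Fh m O) N)%C.
    - intros N. rewrite csum_plus, csum_minus, <- csum_scal. f_equal. f_equal.
      apply csum_ext. intros m _. assert (Hm := INR_S_pos m).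
      assert (RtoC (INR (S m)) <> 0) by (apply RtoC_neq_0; lra).
      unfold A, mul_nat. rewrite RtoC_inv, RtoC_mult by nra. field; auto.
    - apply Ccv_plus. apply Ccv_minus. now apply sigma_sum_lambert.
      apply Ccv_scal. apply csum_zeta2. apply telescoping_column_sum. }
  assert (D1 := Ccv_unique _ _ _ L1 L2).
  set (k := (- (RtoC (4 * PI * PI) / (z * z)))%C).
  assert (L3 : Ccv (csum (fun r => CSeries (fun m => G m r - Bd m r)%C))
    (k * sigma_sum w + RtoC (/ (4 * PI * PI)) * RtoC (PI * PI / 6) - (/ (RtoC 2 * z) - H O))%C).
  { apply Ccv_ext with (fun N => k * csum (fun r => sigma (mul_nat (S r) w)) N +
      RtoC (/ (4 * PI * PI)) * csum (fun n => RtoC (/ (INR (S n) * INR (S n)))) N -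
      (H N - H O))%C.
    - intros N. rewrite <- !csum_scal, <- csum_plus.
      replace (H N - H O)%C with (csum (fun r => H (S r) - H r)%C N).
      2: { induction N as [|N IH]. simpl. ring. rewrite csum_S, IH. ring. }
      rewrite <- csum_minus. apply csum_ext. intros r _. symmetry. apply Ccv_csum_CSeries.
      apply Ccv_ext with (fun N => csum (fun m => G m r) N -
        (csum (fun m => Fh m (S r)) N - csum (fun m => Fh m r) N))%C.
      + intros M. now rewrite <- !csum_minus.
      + apply Ccv_minus. apply lattice_column_sum. apply Ccv_minus; apply telescoping_column_sum.
    - apply Ccv_minus. apply Ccv_plus; apply Ccv_scal.
      apply sigma_sum_lambert. apply Re_dual_pos. apply csum_zeta2.
      apply Ccv_minus. apply telescoping_boundary_lim. apply Ccv_const. }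
  assert (D2 := Ccv_unique _ _ _ F1 L3). rewrite D1 in D2.
  set (S0 := sigma_sum z) in *. set (S1 := sigma_sum w) in *.
  replace S0 with ((S0 - / (z * z) * RtoC (PI * PI / 6) + H O) +
    / (z * z) * RtoC (PI * PI / 6) - H O)%C by ring.
  rewrite D2. unfold k.
  replace (RtoC (/ 24)) with (RtoC (/ (4 * PI * PI)) * RtoC (PI * PI / 6))%C.
  2: { rewrite <- RtoC_mult. f_equal. field. lra. }
  unfold Cdiv. ring.
Qed.

End Transform.

Definition logq (z : C) (n : nat) : C := Clog (1 - Cexp (- mul_nat (S n) z)).

(* [Cexp (Plog z)] is the inverse of Euler's product at [q = Cexp (- z)]. *)
Definition Plog (z : C) : C := (- CSeries (logq z))%C.

Lemma Re_1_minus_Cexp_pos (z : C) (n : nat) : 0 < Re z -> 0 < Re (1 - Cexp (- mul_nat (S n) z)).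
Proof.
  intros Hz. destruct (Re_mul_S_ge n z (Re z) Hz (Rle_refl _)) as [H1 _].
  destruct (Cexp_opp_small _ _ Hz H1) as [A [B _]].
  assert (H := Re_1_minus_ge _ _ A). lra.
Qed.

Lemma logq_le (z : C) (x : R) (n : nat) : 0 < x -> x <= Re z ->
  Cmod (logq z n) <= 2 / (1 - exp (- x)) * exp (- (INR (S n) * Re z)).
Proof.
  intros Hx Hz. assert (Hz' : 0 < Re z) by lra.
  destruct (Re_mul_S_ge n z x Hx Hz) as [H1 _].
  destruct (Cexp_opp_small _ _ Hx H1) as [A [B _]].
  rewrite <- Re_mul_nat, <- Cmod_Cexp_opp. now apply Clog_1_minus_le.
Qed.

Lemma ex_series_exp_S (x : R) : 0 < x -> ex_series (fun n => exp (- (INR (S n) * x))).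
Proof.
  intros Hx. apply ex_series_Rle with (2 := ex_series_exp_geom x Hx). intros n. split.
  left; apply exp_pos. apply exp_le. rewrite S_INR. nra.
Qed.

Lemma ex_series_logq (z : C) : 0 < Re z -> ex_series (fun n => Cmod (logq z n)).
Proof.
  intros Hz. eapply ex_series_Cmod_le. intros n. apply logq_le; [exact Hz | apply Rle_refl].
  apply ex_series_Rscal. now apply ex_series_exp_S.
Qed.

Lemma Plog_cv (z : C) : 0 < Re z -> Ccv (fun N => - csum (logq z) N)%C (Plog z).
Proof. intros Hz. apply Ccv_opp. apply CSeries_cv. now apply ex_series_logq. Qed.

Lemma Plog_small : exists K : R, 0 < K /\
  forall w : C, 1 <= Re w -> Cmod (Plog w) <= K * exp (- Re w).
Proof.
  assert (E1 := ex_series_exp_geom 1 Rlt_0_1).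
  assert (He : exp (- (1)) < 1) by (apply Rlt_le_trans with (exp 0); [apply exp_increasing; lra | rewrite exp_0; lra]).
  exists (2 / (1 - exp (- (1))) * Series (fun n => exp (- (INR n * 1)))). split.
  - apply Rmult_lt_0_compat. apply Rdiv_lt_0_compat; lra.
    apply Rlt_le_trans with (sum_n (fun n => exp (- (INR n * 1))) 0).
    rewrite sum_O. apply exp_pos. apply sum_n_le_Series; auto. intros; left; apply exp_pos.
  - intros w Hw. unfold Plog. rewrite Cmod_opp.
    replace (2 / (1 - exp (- (1))) * Series (fun n => exp (- (INR n * 1))) * exp (- Re w)) with
      (2 / (1 - exp (- (1))) * exp (- Re w) * Series (fun n => exp (- (INR n * 1)))) by ring.
    rewrite <- Series_scal_l. apply Cmod_CSeries_le. 2: now apply ex_series_Rscal.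
    intros n. apply Rle_trans with (1 := logq_le w 1 n Rlt_0_1 Hw).
    rewrite Rmult_assoc. apply Rmult_le_compat_l. apply Rdiv_le_0_compat; lra.
    rewrite <- exp_plus. apply exp_le. rewrite S_INR. assert (0 <= INR n) by apply pos_INR. nra.
Qed.

Lemma Cderiv_logq (g : R -> C) (t : R) (l : C) (n : nat) : Cderiv g t l -> 0 < Re (g t) ->
  Cderiv (fun s => logq (g s) n) t (l * lambert (g t) n)%C.
Proof.
  intros Hd Hp. assert (Hr := Re_1_minus_Cexp_pos (g t) n Hp).
  assert (Hn := Re_pos_neq_0 _ Hr).
  eapply Cderiv_eq.
  - apply (Cderiv_log (fun s => 1 - Cexp (- mul_nat (S n) (g s)))%C). 2: exact Hr.
    apply Cderiv_minus. apply Cderiv_const.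
    apply (Cderiv_exp (fun s => - mul_nat (S n) (g s))%C). apply Cderiv_opp.
    apply (Cderiv_scal (RtoC (INR (S n)))). exact Hd.
  - unfold lambert. cbv beta. field. auto.
Qed.

Lemma csum_tail_le (f : nat -> C) (l : C) (b : nat -> R) (N : nat) :
  Ccv (csum f) l -> (forall n, Cmod (f n) <= b n) -> ex_series b ->
  Cmod (l - csum f N) <= Series (fun n => b (N + n)%nat).
Proof.
  intros Hl Hf Hb. assert (E := ex_series_Cmod_le _ _ Hf Hb).
  rewrite <- (Ccv_csum_CSeries _ _ Hl), (CSeries_split f N E).
  replace (csum f N + CSeries (fun n => f (N + n)%nat) - csum f N)%C with
    (CSeries (fun n => f (N + n)%nat)) by ring.
  apply Cmod_CSeries_le. auto. now apply ex_series_shift.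
Qed.

(** By [sigma_sum_transform] the difference of the two sides has derivative 0 in z. The path is the
    segment from 2 PI, the fixed point of z -> 4 PI^2 / z, where both sides visibly agree; the term
    -1/(2z) integrates to half a logarithm. *)
Lemma Plog_transform (z : C) : 0 < Re z ->
  Plog z = (RtoC (PI * PI / 6) / z + RtoC (/ 2) * Clog (RtoC (/ (2 * PI)) * z)
            - RtoC (/ 24) * z + Plog (RtoC (4 * PI * PI) / z))%C.
Proof.
  intros Hz. assert (HPI := PI_RGT_0).
  set (D := (z - RtoC (2 * PI))%C).
  set (g := fun t : R => (RtoC (2 * PI) + RtoC t * D)%C).
  set (w := fun t : R => (RtoC (4 * PI * PI) / g t)%C).
  (* On the segment [x0] bounds Re g below and [M] bounds |g| above. Since Re w = 4 PI^2 Re g /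
     |g|^2, [x1] bounds Re w below, and [xs] serves both Lambert series in one summable majorant. *)
  set (x0 := Rmin (Re z) (2 * PI)).
  set (M := 2 * PI + Cmod z).
  set (x1 := 4 * PI * PI * x0 / (M * M)).
  set (xs := Rmin x0 x1).
  assert (Hx0 : 0 < x0) by (unfold x0; apply Rmin_glb_lt; lra).
  assert (HM : 0 < M) by (unfold M; assert (H := Cmod_ge_0 z); lra).
  assert (Hx1 : 0 < x1).
  { unfold x1. apply Rdiv_lt_0_compat. apply Rmult_lt_0_compat; nra. nra. }
  assert (Hxs : 0 < xs) by (unfold xs; now apply Rmin_glb_lt).
  assert (Hg : forall t, 0 <= t <= 1 -> x0 <= Re (g t)).
  { intros t Ht. replace (Re (g t)) with ((1 - t) * (2 * PI) + t * Re z)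
      by (unfold g, D, Re; simpl; ring).
    assert (x0 <= Re z) by apply Rmin_l. assert (x0 <= 2 * PI) by apply Rmin_r. nra. }
  assert (HgM : forall t, 0 <= t <= 1 -> Cmod (g t) <= M).
  { intros t Ht. replace (g t) with (RtoC (1 - t) * RtoC (2 * PI) + RtoC t * z)%C
      by (unfold g, D; rewrite RtoC_minus; ring).
    apply Rle_trans with (1 := Cmod_triangle _ _).
    rewrite !Cmod_mult, !Cmod_R, !Rabs_pos_eq by lra. unfold M.
    assert (H := Cmod_ge_0 z). nra. }
  assert (Hgn : forall t, 0 <= t <= 1 -> g t <> 0).
  { intros t Ht. apply Re_pos_neq_0. specialize (Hg t Ht). lra. }
  assert (Hw : forall t, 0 <= t <= 1 -> x1 <= Re (w t)).
  { intros t Ht. specialize (Hg t Ht). specialize (HgM t Ht). specialize (Hgn t Ht).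
    apply Cmod_gt_0 in Hgn.
    replace (Re (w t)) with (4 * PI * PI * Re (g t) / (Cmod (g t) * Cmod (g t))).
    - unfold x1. apply Rmult_le_compat. nra. left. apply Rinv_0_lt_compat. nra. nra.
      apply Rinv_le_contravar; nra.
    - assert (E := Cmod_sqr (g t)). rewrite E. unfold w. generalize dependent (g t).
      intros y Hy1 Hy2 Hy3 Hy4. unfold Re, Im in *. simpl. field. nra. }
  set (b := fun n => / (1 - exp (- xs)) * (INR (S n) * exp (- (INR (S n) * xs)))).
  assert (Hb : ex_series b) by (apply ex_series_Rscal; now apply ex_series_n_exp).
  set (eps := fun N => Series (fun n => b (S N + n)%nat)).
  assert (Heps : is_lim_seq eps 0) by now apply Series_tail_lim.
  (* The defect of the identity with both series cut at N: finite sums can be differentiated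
     termwise, and what remains of the derivative after [sigma_sum_transform] are two tails, bounded
     by [eps]. *)
  set (HN := fun N t => (- csum (logq (g t)) N + csum (logq (w t)) N
     - RtoC (PI * PI / 6) / g t + RtoC (/ 24) * g t
     - RtoC (/ 2) * Clog (RtoC (/ (2 * PI)) * g t))%C).
  set (K := Cmod D * (1 + 4 * PI * PI / (x0 * x0))).
  assert (Hd : forall N, Cmod (HN (S N) 1 - HN (S N) 0) <= 2 * (K * eps N)).
  { intros N.
    apply (mean_value_le (HN (S N)) (fun t =>
      - (D * csum (lambert (g t)) (S N))
      + RtoC (4 * PI * PI) * (- D / (g t * g t)) * csum (lambert (w t)) (S N)
      - RtoC (PI * PI / 6) * (- D / (g t * g t)) + RtoC (/ 24) * D
      - RtoC (/ 2) * ((RtoC (/ (2 * PI)) * D) / (RtoC (/ (2 * PI)) * g t)))%C).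
    - intros t Ht. specialize (Hg t Ht). specialize (Hgn t Ht). specialize (Hw t Ht).
      assert (Dg : Cderiv g t D) by apply Cderiv_line.
      assert (Di : Cderiv (fun s => / g s)%C t (- D / (g t * g t))%C) by now apply Cderiv_inv.
      assert (Dw : Cderiv w t (RtoC (4 * PI * PI) * (- D / (g t * g t)))%C)
        by (unfold w; apply Cderiv_scal; exact Di).
      assert (Hi : 0 < / (2 * PI)) by (apply Rinv_0_lt_compat; lra).
      unfold HN. apply Cderiv_minus. apply Cderiv_plus. apply Cderiv_minus. apply Cderiv_plus.
      + rewrite <- csum_scal. apply Cderiv_opp.
        apply (Cderiv_csum (fun i s => logq (g s) i) (fun i => D * lambert (g t) i)%C).
        intros i _. apply Cderiv_logq; auto. lra.
      + rewrite <- csum_scal.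
        apply (Cderiv_csum (fun i s => logq (w s) i)
          (fun i => RtoC (4 * PI * PI) * (- D / (g t * g t)) * lambert (w t) i)%C).
        intros i _. apply Cderiv_logq; auto. lra.
      + unfold Cdiv at 1. apply Cderiv_scal. exact Di.
      + now apply Cderiv_scal.
      + apply Cderiv_scal. apply (Cderiv_log (fun s => RtoC (/ (2 * PI)) * g s)%C).
        now apply Cderiv_scal.
        replace (Re (RtoC (/ (2 * PI)) * g t)) with (/ (2 * PI) * Re (g t))
          by (unfold Re; simpl; ring). nra.
    - intros t Ht. assert (Hgt := Hg t Ht). assert (Hgnt := Hgn t Ht). assert (Hwt := Hw t Ht).
      assert (Pg : 0 < Re (g t)) by lra. assert (Pw : 0 < Re (w t)) by lra.
      assert (T := sigma_sum_transform (g t) Pg). fold (w t) in T.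
      destruct (sigma_sum_lambert (g t) Pg) as [_ C1].
      destruct (sigma_sum_lambert (w t) Pw) as [_ C2].
      assert (Xg : xs <= Re (g t)) by (apply Rle_trans with (2 := Hgt); apply Rmin_l).
      assert (Xw : xs <= Re (w t)) by (apply Rle_trans with (2 := Hwt); apply Rmin_r).
      assert (T1 := csum_tail_le _ _ b (S N) C1 (fun n => lambert_le _ _ n Hxs Xg) Hb).
      assert (T2 := csum_tail_le _ _ b (S N) C2 (fun n => lambert_le _ _ n Hxs Xw) Hb).
      fold (eps N) in T1, T2.
      set (c1 := csum (lambert (g t)) (S N)) in *. set (c2 := csum (lambert (w t)) (S N)) in *.
      set (s1 := sigma_sum (g t)) in *. set (s2 := sigma_sum (w t)) in *.
      assert (NP : RtoC (/ (2 * PI)) <> 0).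
      { apply RtoC_neq_0. apply Rinv_neq_0_compat. lra. }
      match goal with |- Cmod ?e <= _ => replace e with
        (D * ((s1 - c1) + RtoC (4 * PI * PI) / (g t * g t) * (s2 - c2)))%C end.
      + rewrite Cmod_mult. unfold K. rewrite (Rmult_assoc (Cmod D)). apply Rmult_le_compat_l. apply Cmod_ge_0.
        apply Rle_trans with (1 := Cmod_triangle _ _).
        assert (Hm : x0 <= Cmod (g t)) by (apply Rle_trans with (1 := Hgt); apply Re_le_Cmod).
        rewrite Cmod_mult, Cmod_div, Cmod_mult, Cmod_R, Rabs_pos_eq by (try apply Cmult_neq_0; auto; nra).
        rewrite Rmult_plus_distr_r, Rmult_1_l. apply Rplus_le_compat; auto.
        apply Rmult_le_compat; auto. 2: apply Cmod_ge_0.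
        * apply Rdiv_le_0_compat; nra.
        * apply Rmult_le_compat_l. nra. apply Rinv_le_contravar; nra.
      + rewrite T, (RtoC_inv 2) by lra. field. split; auto. }
  assert (H0 : forall N, HN N 0 = 0).
  { intros N. unfold HN.
    assert (Eg : g 0 = RtoC (2 * PI)) by (unfold g; ring).
    assert (Ew : w 0 = RtoC (2 * PI)).
    { unfold w. rewrite Eg. rewrite <- RtoC_div by lra. f_equal. field. lra. }
    rewrite Eg, Ew, <- (RtoC_mult (/ (2 * PI))), <- (RtoC_mult (/ 24)).
    replace (/ (2 * PI) * (2 * PI)) with 1 by (field; lra). rewrite Clog_1.
    rewrite <- RtoC_div by lra.
    replace (PI * PI / 6 / (2 * PI)) with (PI / 12) by (field; lra).
    replace (/ 24 * (2 * PI)) with (PI / 12) by field. ring. }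
  assert (Eg : g 1 = z) by (unfold g, D; ring).
  assert (L1 : Ccv (fun N => HN (S N) 1) 0).
  { apply Ccv_of_le with (fun N => 2 * K * eps N).
    - exists O. intros N _. specialize (Hd N). rewrite H0 in Hd. rewrite Rmult_assoc. exact Hd.
    - now apply is_lim_seq_scal0. }
  apply (Ccv_incr_1 (fun N => HN N 1)) in L1.
  assert (Pw : 0 < Re (w 1)) by (specialize (Hw 1 ltac:(lra)); lra).
  assert (L2 : Ccv (fun N => HN N 1) (Plog (g 1) - Plog (w 1) - RtoC (PI * PI / 6) / g 1
     + RtoC (/ 24) * g 1 - RtoC (/ 2) * Clog (RtoC (/ (2 * PI)) * g 1))%C).
  { unfold HN. apply Ccv_minus. 2: apply Ccv_const. apply Ccv_plus. 2: apply Ccv_const.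
    apply Ccv_minus. 2: apply Ccv_const.
    apply Ccv_ext with (fun N => - csum (logq (g 1)) N - - csum (logq (w 1)) N)%C.
    intros; ring. apply Ccv_minus; apply Plog_cv. rewrite Eg; auto. auto. }
  assert (E := Ccv_unique _ _ _ L1 L2).
  assert (Ew : w 1 = (RtoC (4 * PI * PI) / z)%C) by (unfold w; now rewrite Eg).
  rewrite Ew, Eg in E.
  set (p := Plog z) in *. set (p' := Plog (RtoC (4 * PI * PI) / z)) in *.
  set (a := (RtoC (PI * PI / 6) / z)%C) in *. set (l := Clog (RtoC (/ (2 * PI)) * z)) in *.
  transitivity ((p - p' - a + RtoC (/ 24) * z - RtoC (/ 2) * l) +
    (a + RtoC (/ 2) * l - RtoC (/ 24) * z + p'))%C. ring. rewrite <- E. ring.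
Qed.

(** * Integrals of complex functions and Fourier coefficients *)

Definition is_Cint (f : R -> C) (a b : R) (l : C) : Prop :=
  is_RInt (fun t => Re (f t)) a b (Re l) /\ is_RInt (fun t => Im (f t)) a b (Im l).

Lemma is_Cint_unique (f : R -> C) (a b : R) (l m : C) :
  is_Cint f a b l -> is_Cint f a b m -> l = m.
Proof.
  intros [H1 H2] [H3 H4]. apply Ceq.
  - rewrite <- (is_RInt_unique _ _ _ _ H1). apply is_RInt_unique. exact H3.
  - rewrite <- (is_RInt_unique _ _ _ _ H2). apply is_RInt_unique. exact H4.
Qed.

Lemma is_RInt_eq (f : R -> R) (a b l l' : R) : is_RInt f a b l -> l = l' -> is_RInt f a b l'.
Proof. intros H E. now rewrite <- E. Qed.

Lemma is_Cint_eq (f : R -> C) (a b : R) (l l' : C) : is_Cint f a b l -> l = l' -> is_Cint f a b l'.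
Proof. intros H E. now rewrite <- E. Qed.

Lemma is_Cint_ext (f g : R -> C) (a b : R) (l : C) : a <= b ->
  (forall t, a <= t <= b -> f t = g t) -> is_Cint f a b l -> is_Cint g a b l.
Proof.
  intros Hab H [H1 H2]. split.
  - apply is_RInt_ext with (2 := H1). intros t Ht.
    rewrite Rmin_left, Rmax_right in Ht by auto. rewrite H; auto; lra.
  - apply is_RInt_ext with (2 := H2). intros t Ht.
    rewrite Rmin_left, Rmax_right in Ht by auto. rewrite H; auto; lra.
Qed.

Lemma is_Cint_plus (f g : R -> C) (a b : R) (l m : C) :
  is_Cint f a b l -> is_Cint g a b m -> is_Cint (fun t => f t + g t)%C a b (l + m)%C.
Proof. intros [H1 H2] [H3 H4]. split; simpl; now apply (is_RInt_plus (V := R_NormedModule)). Qed.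

Lemma is_RInt_rscal (f : R -> R) (a b c l : R) :
  is_RInt f a b l -> is_RInt (fun t => c * f t) a b (c * l).
Proof. intros H. now apply (is_RInt_scal (V := R_NormedModule) f a b c l). Qed.

Lemma is_RInt_rminus (f g : R -> R) (a b l m : R) :
  is_RInt f a b l -> is_RInt g a b m -> is_RInt (fun t => f t - g t) a b (l - m).
Proof. intros H1 H2. now apply (is_RInt_minus (V := R_NormedModule)). Qed.

Lemma is_RInt_rplus (f g : R -> R) (a b l m : R) :
  is_RInt f a b l -> is_RInt g a b m -> is_RInt (fun t => f t + g t) a b (l + m).
Proof. intros H1 H2. now apply (is_RInt_plus (V := R_NormedModule)). Qed.

Lemma is_Cint_scal (c : C) (f : R -> C) (a b : R) (l : C) :
  is_Cint f a b l -> is_Cint (fun t => c * f t)%C a b (c * l)%C.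
Proof.
  intros [H1 H2]. split; simpl.
  - apply is_RInt_rminus; now apply is_RInt_rscal.
  - apply is_RInt_rplus; now apply is_RInt_rscal.
Qed.

Lemma is_Cint_minus (f g : R -> C) (a b : R) (l m : C) :
  is_Cint f a b l -> is_Cint g a b m -> is_Cint (fun t => f t - g t)%C a b (l - m)%C.
Proof.
  intros [H1 H2] [H3 H4]. split; simpl; now apply is_RInt_rminus.
Qed.

Lemma is_Cint_0 (a b : R) : is_Cint (fun _ => RtoC 0) a b 0.
Proof.
  split; simpl; (eapply is_RInt_eq; [apply (is_RInt_const (V := R_NormedModule))|]);
  change (scal (b - a) 0 : R) with ((b - a) * 0); ring.
Qed.

Lemma is_Cint_csum (f : nat -> R -> C) (l : nat -> C) (a b : R) (n : nat) :
  (forall i, (i < n)%nat -> is_Cint (f i) a b (l i)) ->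
  is_Cint (fun t => csum (fun i => f i t) n) a b (csum l n).
Proof.
  induction n as [|n IH]; intros H; simpl. apply is_Cint_0.
  apply is_Cint_plus. apply IH. intros; apply H; lia. apply H; lia.
Qed.

Lemma is_Cint_Chasles (f : R -> C) (a b c : R) (l m : C) :
  is_Cint f a b l -> is_Cint f b c m -> is_Cint f a c (l + m)%C.
Proof.
  intros [H1 H2] [H3 H4]. split; simpl.
  apply (is_RInt_Chasles (V := R_NormedModule)) with b; auto.
  apply (is_RInt_Chasles (V := R_NormedModule)) with b; auto.
Qed.

Lemma is_Cint_le (f : R -> C) (g : R -> R) (a b : R) (l : C) (I : R) : a <= b ->
  (forall t, a <= t <= b -> Cmod (f t) <= g t) ->
  is_Cint f a b l -> is_RInt g a b I -> Cmod l <= 2 * I.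
Proof.
  intros Hab Hg [H1 H2] HI. apply Rle_trans with (1 := Cmod_le_re_im l).
  assert (A1 : Rabs (Re l) <= I).
  { apply (norm_RInt_le (V := R_NormedModule) (fun t => Re (f t)) g a b (Re l) I Hab); auto.
    intros t Ht. apply Rle_trans with (2 := Hg t Ht). apply re_le_Cmod. }
  assert (A2 : Rabs (Im l) <= I).
  { apply (norm_RInt_le (V := R_NormedModule) (fun t => Im (f t)) g a b (Im l) I Hab); auto.
    intros t Ht. apply Rle_trans with (2 := Hg t Ht). apply im_le_Cmod. }
  lra.
Qed.

Lemma is_Cint_le_const (f : R -> C) (M : R) (a b : R) (l : C) : a <= b ->
  (forall t, a <= t <= b -> Cmod (f t) <= M) -> is_Cint f a b l -> Cmod l <= 2 * ((b - a) * M).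
Proof.
  intros Hab H Hl. apply (is_Cint_le f (fun _ => M) a b l ((b - a) * M) Hab H Hl).
  apply (is_RInt_const (V := R_NormedModule)).
Qed.

Definition Ccont (f : R -> C) (t : R) : Prop :=
  continuous (fun s => Re (f s)) t /\ continuous (fun s => Im (f s)) t.

Lemma Cderiv_Ccont (f : R -> C) (t : R) (l : C) : Cderiv f t l -> Ccont f t.
Proof.
  intros [H1 H2]. split.
  - apply (ex_derive_continuous (fun s => Re (f s))). eexists; eassumption.
  - apply (ex_derive_continuous (fun s => Im (f s))). eexists; eassumption.
Qed.

Lemma Ccont_ex_Cint (f : R -> C) (a b : R) : a <= b ->
  (forall t, a <= t <= b -> Ccont f t) -> exists l, is_Cint f a b l.
Proof.
  intros Hab H.
  destruct (ex_RInt_continuous (V := R_CompleteNormedModule) (fun t => Re (f t)) a b) as [l1 H1].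
  { intros t Ht. rewrite Rmin_left, Rmax_right in Ht by auto. apply H. lra. }
  destruct (ex_RInt_continuous (V := R_CompleteNormedModule) (fun t => Im (f t)) a b) as [l2 H2].
  { intros t Ht. rewrite Rmin_left, Rmax_right in Ht by auto. apply H. lra. }
  exists (l1, l2). split; assumption.
Qed.

Lemma is_Cint_sub (f : R -> C) (a b c d : R) (l : C) : a <= c -> c <= d -> d <= b ->
  is_Cint f a b l -> exists m, is_Cint f c d m.
Proof.
  intros H1 H2 H3 [Ha Hb].
  assert (E1 : ex_RInt (fun t => Re (f t)) c d).
  { apply (ex_RInt_Chasles_2 (V := R_CompleteNormedModule)) with a. lra.
    apply (ex_RInt_Chasles_1 (V := R_CompleteNormedModule)) with b. lra. eexists; eassumption. }
  assert (E2 : ex_RInt (fun t => Im (f t)) c d).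
  { apply (ex_RInt_Chasles_2 (V := R_CompleteNormedModule)) with a. lra.
    apply (ex_RInt_Chasles_1 (V := R_CompleteNormedModule)) with b. lra. eexists; eassumption. }
  destruct E1 as [l1 E1]. destruct E2 as [l2 E2]. exists (l1, l2). split; assumption.
Qed.

Lemma is_Cint_FTC (F f : R -> C) (a b : R) :
  (forall t, Cderiv F t (f t)) -> (forall t, Ccont f t) -> is_Cint f a b (F b - F a)%C.
Proof.
  intros HF Hf. split.
  - apply (is_RInt_derive (fun t => Re (F t)) (fun t => Re (f t))); intros; [apply HF | apply Hf].
  - apply (is_RInt_derive (fun t => Im (F t)) (fun t => Im (f t))); intros; [apply HF | apply Hf].
Qed.

Lemma is_Cint_comp_scal (f : R -> C) (u a b : R) (l : C) :
  is_Cint f (u * a) (u * b) l -> is_Cint (fun t => RtoC u * f (u * t)%R)%C a b l.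
Proof.
  intros [H1 H2]. split; simpl.
  - apply is_RInt_ext with (fun t => scal u (Re (f (u * t + 0)))).
    + intros t _. rewrite Rplus_0_r. unfold scal; simpl; unfold mult; simpl. unfold Re. ring.
    + apply (is_RInt_comp_lin (V := R_NormedModule) (fun t => Re (f t)) u 0).
      now rewrite !Rplus_0_r.
  - apply is_RInt_ext with (fun t => scal u (Im (f (u * t + 0)))).
    + intros t _. rewrite Rplus_0_r. unfold scal; simpl; unfold mult; simpl. unfold Im. ring.
    + apply (is_RInt_comp_lin (V := R_NormedModule) (fun t => Im (f t)) u 0).
      now rewrite !Rplus_0_r.
Qed.

(** The majorant holds for all real t and not only on [a, b], because [filterlim_RInt] asks for
    uniform convergence of functions on the whole line. *)
Lemma is_Cint_series (T : nat -> R -> C) (I : nat -> C) (bd : nat -> R) (a b : R) :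
  (forall j t, Cmod (T j t) <= bd j) -> ex_series bd ->
  (forall j, is_Cint (T j) a b (I j)) ->
  exists L, Ccv (csum I) L /\ is_Cint (fun t => CSeries (fun j => T j t)) a b L.
Proof.
  intros HT Hb HI.
  assert (Hu : forall eps : posreal, eventually (fun N => forall t,
    Cmod (csum (fun j => T j t) (S N) - CSeries (fun j => T j t)) < eps)).
  { intros eps. assert (Hl := Series_tail_lim bd Hb). apply is_lim_seq_spec in Hl.
    destruct (Hl eps) as [N HN]. exists N. intros n Hn t. specialize (HN n Hn).
    rewrite Rminus_0_r in HN. apply Rle_lt_trans with (2 := Rle_lt_trans _ _ _ (Rle_abs _) HN).
    assert (E := ex_series_Cmod_le _ _ (fun j => HT j t) Hb).
    rewrite (CSeries_split _ (S n) E).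
    set (s := csum _ _). set (r := CSeries _).
    replace (s - (s + r))%C with (- r)%C by ring. rewrite Cmod_opp.
    apply Cmod_CSeries_le. intros; apply HT. now apply ex_series_shift. }
  destruct (filterlim_RInt (V := R_CompleteNormedModule)
    (fun N t => Re (csum (fun j => T j t) (S N))) a b eventually _
    (fun t => Re (CSeries (fun j => T j t))) (fun N => Re (csum I (S N)))) as [L1 [A1 B1]].
  { intros N. exact (proj1 (is_Cint_csum T I a b (S N) (fun i _ => HI i))). }
  { apply filterlim_locally. intros eps. destruct (Hu eps) as [N HN]. exists N.
    intros n Hn t. apply Rle_lt_trans with (2 := HN n Hn t).
    apply Rle_trans with (2 := re_le_Cmod _). right. reflexivity. }
  destruct (filterlim_RInt (V := R_CompleteNormedModule)
    (fun N t => Im (csum (fun j => T j t) (S N))) a b eventually _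
    (fun t => Im (CSeries (fun j => T j t))) (fun N => Im (csum I (S N)))) as [L2 [A2 B2]].
  { intros N. exact (proj2 (is_Cint_csum T I a b (S N) (fun i _ => HI i))). }
  { apply filterlim_locally. intros eps. destruct (Hu eps) as [N HN]. exists N.
    intros n Hn t. apply Rle_lt_trans with (2 := HN n Hn t).
    apply Rle_trans with (2 := im_le_Cmod _). right. reflexivity. }
  exists (L1, L2). split.
  - apply Ccv_incr_1. apply Ccv_Re_Im; assumption.
  - split; assumption.
Qed.

Definition phase (p : Z) (t : R) : C := Cexp (RtoC (IZR p * t) * Ci).

Lemma phase_add (p p' : Z) (t : R) : phase (p + p') t = (phase p t * phase p' t)%C.
Proof.
  unfold phase. rewrite <- Cexp_plus. f_equal. rewrite plus_IZR, Rmult_plus_distr_r, RtoC_plus. ring.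
Qed.

Lemma Cmod_phase (p : Z) (t : R) : Cmod (phase p t) = 1.
Proof. unfold phase. rewrite Cmod_Cexp. rewrite <- exp_0. f_equal. simpl. ring. Qed.

Lemma phase_0 (t : R) : phase 0 t = 1.
Proof. unfold phase. rewrite Rmult_0_l, Cmult_0_l. apply Cexp_0. Qed.

Lemma phase_PI (p : Z) : phase p (- PI) = phase p PI.
Proof.
  unfold phase.
  replace (RtoC (IZR p * PI) * Ci)%C with (RtoC (IZR p * - PI) * Ci + RtoC (IZR p) * tpi)%C.
  2: { unfold tpi. apply Ceq; simpl; ring. }
  rewrite Cexp_plus.
  assert (E : Cexp (RtoC (IZR p) * tpi) = 1).
  { destruct (Z_le_gt_dec 0 p) as [H|H].
    - replace (IZR p) with (INR (Z.to_nat p)). apply Cexp_tpi_INR.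
      rewrite INR_IZR_INZ. f_equal. lia.
    - replace (RtoC (IZR p) * tpi)%C with (- (RtoC (INR (Z.to_nat (- p))) * tpi))%C.
      rewrite Cexp_opp, Cexp_tpi_INR. field.
      rewrite INR_IZR_INZ. rewrite Z2Nat.id by lia. rewrite opp_IZR, RtoC_opp. ring. }
  rewrite E. ring.
Qed.

Lemma Cderiv_phase (p : Z) (t : R) : Cderiv (phase p) t (RtoC (IZR p) * Ci * phase p t)%C.
Proof.
  unfold phase. apply (Cderiv_exp (fun s => RtoC (IZR p * s) * Ci)%C).
  apply Cderiv_ext with (fun s => 0 + RtoC s * (RtoC (IZR p) * Ci))%C.
  intros s. rewrite RtoC_mult. ring. apply Cderiv_line.
Qed.

Lemma phase_orthogonal (p : Z) :
  is_Cint (phase p) (- PI) PI (if Z.eqb p 0 then RtoC (2 * PI) else RtoC 0).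
Proof.
  destruct (Z.eqb_spec p 0) as [E|E].
  - subst p. apply is_Cint_eq with (RtoC PI - RtoC (- PI))%C.
    + apply (is_Cint_FTC (fun t => RtoC t)).
      * intros t. rewrite phase_0. apply Cderiv_id.
      * intros t. eapply Cderiv_Ccont. apply Cderiv_phase.
    + rewrite <- RtoC_minus. f_equal. ring.
  - assert (Hp : (RtoC (IZR p) * Ci)%C <> 0).
    { apply Cmult_neq_0. apply RtoC_neq_0. apply not_0_IZR. auto.
      intros E2. injection E2. lra. }
    eapply is_Cint_eq.
    + apply (is_Cint_FTC (fun t => / (RtoC (IZR p) * Ci) * phase p t)%C).
      * intros t. eapply Cderiv_eq. apply Cderiv_scal, Cderiv_phase. field.
        split. intros E2. injection E2. lra. apply RtoC_neq_0. apply not_0_IZR. auto.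
      * intros t. eapply Cderiv_Ccont. apply Cderiv_phase.
    + rewrite phase_PI. ring.
Qed.

Definition vline (x t : R) : C := (RtoC x + RtoC t * Ci)%C.

Lemma Re_vline (x t : R) : Re (vline x t) = x.
Proof. unfold vline, Re. simpl. ring. Qed.
Lemma Im_vline (x t : R) : Im (vline x t) = t.
Proof. unfold vline, Im. simpl. ring. Qed.

Lemma Cderiv_vline (x t : R) : Cderiv (vline x) t Ci.
Proof. apply Cderiv_line. Qed.

Lemma csum_single (f : nat -> C) (N M : nat) :
  (forall i, i <> N -> f i = 0) -> (N < M)%nat -> csum f M = f N.
Proof.
  intros H HM. assert (H0 : forall K, (K <= N)%nat -> csum f K = 0).
  { induction K as [|K IH]; intros HK; auto. rewrite csum_S, IH, H by lia. ring. }
  induction M as [|M IH]. lia. rewrite csum_S. destruct (Nat.eq_dec M N) as [E|E].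
  - subst M. rewrite H0 by lia. ring.
  - rewrite IH, (H M) by lia. ring.
Qed.

(** Cauchy's formula on the circle |q| = e^{-x}, parametrised by q = e^{-(x + i t)}: uniform
    convergence and orthogonality of the exponentials replace the contour integral. *)
Lemma power_series_coefficient (a : nat -> C) (x : R) (N : nat) :
  ex_series (fun n => Cmod (a n) * exp (- (INR n * x))) ->
  is_Cint (fun t => CSeries (fun n => a n * Cexp (- mul_nat n (vline x t)))
                    * Cexp (mul_nat N (vline x t)))%C (- PI) PI (RtoC (2 * PI) * a N)%C.
Proof.
  intros Ha. assert (HPI := PI_RGT_0).
  set (T := fun n t => (a n * Cexp (RtoC ((INR N - INR n) * x)) * phase (Z.of_nat N - Z.of_nat n) t)%C).
  assert (ET : forall n t, (Cexp (mul_nat N (vline x t)) *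
     (a n * Cexp (- mul_nat n (vline x t))))%C = T n t).
  { intros n t. unfold T, phase.
    replace (Cexp (mul_nat N (vline x t)) * (a n * Cexp (- mul_nat n (vline x t))))%C with
      (a n * (Cexp (mul_nat N (vline x t)) * Cexp (- mul_nat n (vline x t))))%C by ring.
    rewrite <- Cmult_assoc, <- !Cexp_plus. f_equal. f_equal.
    rewrite minus_IZR, <- !INR_IZR_INZ. unfold mul_nat, vline.
    rewrite !RtoC_mult, !RtoC_minus. ring. }
  assert (Hmod : forall n t, Cmod (a n * Cexp (- mul_nat n (vline x t))) =
    Cmod (a n) * exp (- (INR n * x))).
  { intros n t. now rewrite Cmod_mult, Cmod_Cexp_opp, Re_mul_nat, Re_vline. }
  destruct (is_Cint_series T (fun n => a n * Cexp (RtoC ((INR N - INR n) * x)) *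
     (if Z.eqb (Z.of_nat N - Z.of_nat n) 0 then RtoC (2 * PI) else RtoC 0))%C
     (fun n => exp (INR N * x) * (Cmod (a n) * exp (- (INR n * x)))) (- PI) PI) as [L [L1 L2]].
  - intros n t. rewrite <- ET, Cmod_mult, Hmod, Cmod_Cexp, Re_mul_nat, Re_vline. lra.
  - now apply ex_series_Rscal.
  - intros n. unfold T. apply is_Cint_scal. apply phase_orthogonal.
  - assert (EL : L = (RtoC (2 * PI) * a N)%C).
    { apply Ccv_unique with (1 := L1). apply Ccv_ext_loc with (fun _ => (RtoC (2 * PI) * a N)%C).
      2: apply Ccv_const.
      exists (S N). intros M HM. rewrite (csum_single _ N); try lia.
      - rewrite Z.sub_diag. simpl Z.eqb. replace ((INR N - INR N) * x) with 0 by ring.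
        rewrite Cexp_0. ring.
      - intros i Hi. replace (Z.eqb (Z.of_nat N - Z.of_nat i) 0) with false.
        ring. symmetry. apply Z.eqb_neq. lia. }
    rewrite <- EL. apply is_Cint_ext with (3 := L2). lra. intros t _.
    rewrite (CSeries_ext _ (fun n => Cexp (mul_nat N (vline x t)) *
       (a n * Cexp (- mul_nat n (vline x t))))%C).
    + rewrite CSeries_scal. ring. apply ex_series_ext with (2 := Ha). intros n. now rewrite Hmod.
    + intros n. now rewrite ET.
Qed.

(** * Laplace inversion of powers *)

(** The rising factorial al (al + 1) ... (al + n - 1) over n!, the coefficient of q^n in (1 -
    q)^{-al}. *)
Fixpoint bcoef (al : R) (n : nat) : R :=
  match n with
  | O => 1
  | S p => bcoef al p * (al + INR p) / INR (S p)
  end.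

Lemma bcoef_pos (al : R) (n : nat) : 0 < al -> 0 < bcoef al n.
Proof.
  intros Ha. induction n as [|n IH]; simpl bcoef. lra.
  apply Rdiv_lt_0_compat. 2: apply (INR_S_pos n). assert (0 <= INR n) by apply pos_INR. nra.
Qed.

Lemma bcoef_S (al : R) (n : nat) : INR (S n) * bcoef al (S n) = (al + INR n) * bcoef al n.
Proof.
  change (bcoef al (S n)) with (bcoef al n * (al + INR n) / INR (S n)).
  assert (H := INR_S_pos n). field. lra.
Qed.

Lemma ex_series_bcoef_deriv (al r : R) : 0 < al -> 0 < r < 1 ->
  ex_series (fun n => INR (S n) * bcoef al (S n) * r ^ S n).
Proof.
  intros Ha Hr. set (a := fun n => INR (S n) * bcoef al (S n) * r ^ S n).
  assert (Hp : forall n, 0 < a n).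
  { intros n. unfold a. apply Rmult_lt_0_compat. apply Rmult_lt_0_compat. apply INR_S_pos.
    now apply bcoef_pos. apply pow_lt; lra. }
  apply ex_series_ext with (fun n => Rabs (a n)).
  { intros n. apply Rabs_pos_eq. left. apply Hp. }
  apply (ex_series_DAlembert a r); try lra.
  - intros n. specialize (Hp n). lra.
  - apply is_lim_seq_ext with (fun n => (1 + al * / INR (S n)) * r).
    + intros n. rewrite Rabs_pos_eq.
      2: { left. apply Rdiv_lt_0_compat; apply Hp. }
      unfold a. rewrite (bcoef_S al (S n)).
      assert (H1 := INR_S_pos n). assert (H2 := bcoef_pos al (S n) Ha).
      assert (H3 : 0 < r ^ S n) by (apply pow_lt; lra).
      change (r ^ S (S n)) with (r * r ^ S n). field. repeat split; lra.
    + replace (Finite r) with (Finite ((1 + al * 0) * r)) by (f_equal; ring).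
      apply is_lim_seq_mult'. 2: apply is_lim_seq_const.
      apply is_lim_seq_plus'. apply is_lim_seq_const.
      apply is_lim_seq_mult'. apply is_lim_seq_const. apply INR_lim_inv.
Qed.

Lemma ex_series_bcoef (al r : R) : 0 < al -> 0 < r < 1 ->
  ex_series (fun n => bcoef al n * r ^ n).
Proof.
  intros Ha Hr. apply (ex_series_incr_1 (V := R_NormedModule)).
  apply ex_series_Rle with (2 := ex_series_bcoef_deriv al r Ha Hr). intros n.
  assert (H2 := bcoef_pos al (S n) Ha). assert (H3 : 0 < r ^ S n) by (apply pow_lt; lra).
  assert (H1 : 1 <= INR (S n)) by (rewrite S_INR; assert (H := pos_INR n); lra).
  split. nra. rewrite Rmult_assoc. assert (0 < bcoef al (S n) * r ^ S n) by nra. nra.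
Qed.

Lemma Cmod_lt_1_between (q : C) : Cmod q < 1 -> exists r, 0 < r < 1 /\ Cmod q <= r.
Proof.
  intros H. exists ((1 + Cmod q) / 2). assert (H0 := Cmod_ge_0 q). lra.
Qed.

Lemma ex_series_bcoef_C (al : R) (q : C) : 0 < al -> Cmod q < 1 ->
  ex_series (fun n => Cmod (RtoC (bcoef al n) * Cpow q n)).
Proof.
  intros Ha Hq. destruct (Cmod_lt_1_between q Hq) as [r [Hr Hqr]].
  apply ex_series_Cmod_le with (2 := ex_series_bcoef al r Ha Hr). intros n.
  assert (H := bcoef_pos al n Ha).
  rewrite Cmod_mult, Cmod_R, Rabs_pos_eq, Cmod_pow by lra.
  apply Rmult_le_compat_l. lra. apply pow_incr. split; auto. apply Cmod_ge_0.
Qed.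

Lemma Cpw_1 (a : R) : Cpw 1 a = 1.
Proof. unfold Cpw. rewrite Clog_1, Cmult_0_r. apply Cexp_0. Qed.

Lemma Rpower_le_neg (a b e : R) : 0 < a -> a <= b -> e <= 0 -> Rpower b e <= Rpower a e.
Proof.
  intros Ha Hab He. unfold Rpower. apply exp_le.
  assert (ln a <= ln b) by (apply ln_le; auto). nra.
Qed.

Lemma Rpower_le_pos (a b e : R) : 0 < a -> a <= b -> 0 <= e -> Rpower a e <= Rpower b e.
Proof. intros Ha Hab He. apply Rle_Rpower_l; auto. Qed.

(* Along the ray [t q] the derivative of (partial sum) * (1 - t q)^al reduces to one
   boundary term, because of the recurrence satisfied by the coefficients. *)
Lemma binomial_series (al : R) (q : C) : 1 <= al -> Cmod q < 1 ->
  CSeries (fun n => RtoC (bcoef al n) * Cpow q n)%C = Cpw (1 - q) (- al).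
Proof.
  intros Ha Hq. assert (Ha0 : 0 < al) by lra.
  set (S0 := fun (N : nat) (t : R) => csum (fun n => RtoC (bcoef al n) * Cpow (RtoC t * q) n)%C N).
  set (base := fun t : R => (1 + RtoC t * (- q))%C).
  assert (Hre : forall t, 0 <= t <= 1 -> 0 < Re (base t)).
  { intros t Ht. unfold base. replace (1 + RtoC t * - q)%C with (1 - RtoC t * q)%C by ring.
    apply Rlt_le_trans with (1 - Cmod q). lra. apply Re_1_minus_ge.
    rewrite Cmod_mult, Cmod_R, Rabs_pos_eq by lra. assert (H := Cmod_ge_0 q). nra. }
  assert (Hmod : forall t, 0 <= t <= 1 -> Cmod (base t) <= 2).
  { intros t Ht. unfold base. apply Rle_trans with (1 := Cmod_triangle _ _).
    rewrite Cmod_1, Cmod_mult, Cmod_opp, Cmod_R, Rabs_pos_eq by lra.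
    assert (H := Cmod_ge_0 q). nra. }
  assert (DS : forall N t, Cderiv (S0 (S N)) t
    (csum (fun n => RtoC (INR (S n) * bcoef al (S n)) * Cpow (RtoC t * q) n * q)%C N)).
  { induction N as [|N IH]; intros t.
    - unfold S0. simpl. apply Cderiv_const.
    - apply Cderiv_ext with (fun s => S0 (S N) s + RtoC (bcoef al (S N)) * Cpow (RtoC s * q) (S N))%C.
      reflexivity. rewrite csum_S. apply Cderiv_plus. apply IH.
      eapply Cderiv_eq. apply Cderiv_scal. apply Cderiv_pow_ray. rewrite RtoC_mult. ring. }
  assert (Key : forall N t, (base t * csum (fun n => RtoC (INR (S n) * bcoef al (S n)) * Cpow (RtoC t * q) n * q)%C N
      - RtoC al * q * S0 (S N) t)%C =
      (- (RtoC (INR (S N) * bcoef al (S N)) * Cpow (RtoC t * q) N * q))%C).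
  { intros N t. induction N as [|N IH].
    - unfold S0. simpl. rewrite !Rplus_0_r, Rmult_1_l. unfold Rdiv. rewrite Rinv_1, Rmult_1_r, Rmult_1_l.
      ring.
    - rewrite csum_S. unfold S0 in *. rewrite csum_S. rewrite (bcoef_S al (S N)).
      set (P := csum (fun n => RtoC (bcoef al n) * Cpow (RtoC t * q) n)%C (S N)) in *.
      set (Q := csum (fun n => RtoC (INR (S n) * bcoef al (S n)) * Cpow (RtoC t * q) n * q)%C N) in *.
      transitivity ((base t * Q - RtoC al * q * P) +
        (base t * (RtoC (INR (S N) * bcoef al (S N)) * Cpow (RtoC t * q) N * q)
         - RtoC al * q * (RtoC (bcoef al (S N)) * Cpow (RtoC t * q) (S N))))%C. ring.
      rewrite IH. unfold base. rewrite !Cpow_S, !RtoC_mult, RtoC_plus. ring. }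
  destruct (Cmod_lt_1_between q Hq) as [r [Hr Hqr]].
  set (K := Rpower 2 (al - 1)).
  assert (Bd : forall N, Cmod (S0 (S N) 1 * Cpw (base 1) al - S0 (S N) 0 * Cpw (base 0) al) <=
    2 * (K * (INR (S N) * bcoef al (S N) * r ^ S N))).
  { intros N. apply (mean_value_le (fun t => S0 (S N) t * Cpw (base t) al)%C
      (fun t => - (RtoC (INR (S N) * bcoef al (S N)) * Cpow (RtoC t * q) N * q) * Cpw (base t) (al - 1))%C).
    - intros t Ht. assert (Hb := Hre t Ht). assert (Hbn := Re_pos_neq_0 _ Hb).
      eapply Cderiv_eq. apply Cderiv_mult. apply DS.
      apply (Cderiv_pw base t (- q)). apply Cderiv_line. exact Hb.
      rewrite <- Key.
      replace (Cpw (base t) al) with (base t * Cpw (base t) (al - 1))%C.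
      + field. exact Hbn.
      + replace al with (1 + (al - 1)) at 2 by ring. rewrite Cpw_plus. f_equal.
        change 1 with (INR 1). rewrite Cpw_INR by auto. simpl. ring.
    - intros t Ht. rewrite Cmod_mult, Cmod_opp, Rmult_comm. apply Rmult_le_compat; try apply Cmod_ge_0.
      + rewrite Cmod_Cpw. apply Rpower_le_pos; try lra. 2: now apply Hmod.
        apply Cmod_gt_0. apply Re_pos_neq_0. auto.
      + assert (Hp : 0 <= INR (S N) * bcoef al (S N)).
        { apply Rmult_le_pos. apply pos_INR. left. now apply bcoef_pos. }
        rewrite <- Cmult_assoc, Cmod_mult, Cmod_R, Rabs_pos_eq by auto.
        apply Rmult_le_compat_l; auto.
        rewrite Cmod_mult, Cmod_pow, Cmod_mult, Cmod_R, Rabs_pos_eq by lra.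
        simpl pow. rewrite Rmult_comm. apply Rmult_le_compat; auto. apply Cmod_ge_0.
        apply pow_le. apply Rmult_le_pos. lra. apply Cmod_ge_0.
        apply pow_incr. assert (H := Cmod_ge_0 q). split; nra. }
  assert (L0 : Ccv (fun N => S0 (S N) 1 * Cpw (base 1) al)%C 1).
  { apply Ccv_of_le with (fun N => 2 * K * (INR (S N) * bcoef al (S N) * r ^ S N)).
    - exists O. intros N _. specialize (Bd N).
      assert (E : (S0 (S N) 0 * Cpw (base 0) al)%C = 1).
      { assert (E1 : S0 (S N) 0 = 1).
        { unfold S0. rewrite csum_S_l, (csum_ext _ (fun _ => 0 * 0)%C), csum_scal.
          simpl. ring. intros i _. rewrite Cpow_S. ring. }
        rewrite E1. unfold base. replace (1 + 0 * - q)%C with (RtoC 1) by ring. rewrite Cpw_1. ring. }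
      rewrite E in Bd. rewrite Rmult_assoc. exact Bd.
    - apply is_lim_seq_scal0. apply ex_series_lim_0. now apply ex_series_bcoef_deriv. }
  assert (L1 : Ccv (fun N => S0 (S N) 1) (CSeries (fun n => RtoC (bcoef al n) * Cpow q n)%C)).
  { apply (Ccv_incr_1 (fun N => S0 N 1)).
    apply Ccv_ext with (csum (fun n => RtoC (bcoef al n) * Cpow q n)%C).
    - intros N. unfold S0. apply csum_ext. intros i _. f_equal. f_equal. ring.
    - apply CSeries_cv. now apply ex_series_bcoef_C. }
  assert (E := Ccv_unique _ _ _ L0 (Ccv_mult _ _ _ _ L1 (Ccv_const (Cpw (base 1) al)))).
  assert (Eb : base 1 = (1 - q)%C) by (unfold base; ring). rewrite Eb in E.
  rewrite Cpw_opp.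
  assert (Hn : Cpw (1 - q) al <> 0) by apply Cexp_neq_0.
  transitivity (CSeries (fun n => RtoC (bcoef al n) * Cpow q n)%C * Cpw (1 - q) al / Cpw (1 - q) al)%C.
  field; auto. rewrite <- E. field; auto.
Qed.

Lemma is_RInt_inv_sq (a b : R) : a <= b -> (0 < a \/ b < 0) ->
  is_RInt (fun t => / (t * t)) a b (/ a - / b).
Proof.
  intros Hab H. eapply is_RInt_eq.
  - apply (is_RInt_derive (fun t => - / t) (fun t => / (t * t))).
    + intros t Ht. rewrite Rmin_left, Rmax_right in Ht by auto.
      assert (t <> 0) by lra. auto_derive; auto. field. auto.
    + intros t Ht. rewrite Rmin_left, Rmax_right in Ht by auto.
      assert (t <> 0) by lra. apply (ex_derive_continuous (fun t => / (t * t))). auto_derive. nra.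
  - unfold minus, plus, opp; simpl. ring.
Qed.

Lemma Cpw_lipschitz (a b : C) (e d : R) : 0 < d -> e <= 0 -> d <= Re a -> d <= Re b ->
  Cmod (Cpw a e - Cpw b e) <= 2 * (- e * Rpower d (e - 1)) * Cmod (a - b).
Proof.
  intros Hd He Ha Hb.
  replace a with (b + RtoC 1 * (a - b))%C at 1 by ring.
  replace (Cpw b e) with (Cpw (b + RtoC 0 * (a - b)) e) by (f_equal; ring).
  assert (Hre : forall t, 0 <= t <= 1 -> d <= Re (b + RtoC t * (a - b))%C).
  { intros t Ht. simpl. unfold Re in *. nra. }
  rewrite Rmult_assoc.
  apply (mean_value_le (fun t => Cpw (b + RtoC t * (a - b)) e)
    (fun t => RtoC e * ((a - b) / (b + RtoC t * (a - b))) * Cpw (b + RtoC t * (a - b)) e)%C).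
  - intros t Ht. apply Cderiv_pw. apply Cderiv_line. specialize (Hre t Ht). lra.
  - intros t Ht. specialize (Hre t Ht). set (w := (b + RtoC t * (a - b))%C) in *.
    assert (Hw : 0 < Re w) by lra. assert (Hn := Re_pos_neq_0 _ Hw).
    assert (Hdw : d <= Cmod w) by (apply Rle_trans with (1 := Hre); apply Re_le_Cmod).
    rewrite !Cmod_mult, Cmod_div, Cmod_Cpw, Cmod_R, Rabs_left1 by auto.
    replace (- e * (Cmod (a - b) / Cmod w) * Rpower (Cmod w) e) with
      (- e * (Rpower (Cmod w) e * / Cmod w) * Cmod (a - b)) by (field; lra).
    apply Rmult_le_compat_r. apply Cmod_ge_0. apply Rmult_le_compat_l. lra.
    rewrite <- (Rpower_1 (Cmod w)) at 2 by lra. rewrite <- Rpower_Ropp, <- Rpower_plus.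
    apply Rpower_le_neg; auto. lra.
Qed.

Definition laplace_kernel (al c t : R) : C :=
  (Cpw (vline c t) (- al) * Cexp (vline c t))%C.

(** The integrand of Cauchy's formula for the N-th coefficient of (1 - q)^{-al} at abscissa c/N,
    stretched by N: the base z of the Laplace kernel is replaced by N (1 - e^{-z/N}). *)
Definition discrete_kernel (al c : R) (N : nat) (t : R) : C :=
  (Cpw (dquot (/ INR N) (vline c t)) (- al) * Cexp (vline c t))%C.

(** Gauss's sequence for 1/Gamma(al) up to the factor 1 + al/N, in the normalisation that Cauchy's
    formula produces. *)
Definition gauss_seq (al : R) (N : nat) : R := Rpower (INR N) (1 - al) * bcoef al N.

Lemma Re_dquot_ge (h c t : R) : 0 < h -> 0 < c -> h * c <= 1 ->
  c / 2 <= Re (dquot h (vline c t)).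
Proof.
  intros Hh Hc Hhc.
  assert (E : Re (dquot h (vline c t)) = / h * Re (1 - Cexp (- (RtoC h * vline c t)))).
  { unfold dquot, Cdiv. rewrite <- RtoC_inv by lra. generalize (1 - Cexp (- (RtoC h * vline c t)))%C.
    intros y. unfold Re. simpl. ring. }
  rewrite E.
  assert (H : h * c / 2 <= Re (1 - Cexp (- (RtoC h * vline c t)))).
  { apply Rle_trans with (1 - exp (- (h * c))). apply one_minus_exp_ge. nra.
    apply Re_1_minus_ge. rewrite Cmod_Cexp_opp.
    replace (Re (RtoC h * vline c t)) with (h * c). lra. unfold vline, Re. simpl. ring. }
  apply Rmult_le_reg_l with h; auto. rewrite <- Rmult_assoc, Rinv_r, Rmult_1_l by lra. lra.
Qed.

Lemma discrete_kernel_integral (al c : R) (N : nat) : 1 <= al -> 0 < c -> (1 <= N)%nat ->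
  is_Cint (discrete_kernel al c N) (- (PI * INR N)) (PI * INR N)
    (RtoC (2 * PI * gauss_seq al N)).
Proof.
  intros Ha Hc HN. assert (HPI := PI_RGT_0).
  assert (Hn : 0 < INR N) by (apply lt_0_INR; lia).
  set (x := c / INR N). assert (Hx : 0 < x) by (apply Rdiv_lt_0_compat; auto).
  assert (Hq : forall t, Cmod (Cexp (- vline x t)) < 1).
  { intros t. rewrite Cmod_Cexp_opp, Re_vline. rewrite <- exp_0. apply exp_increasing. lra. }
  assert (P := power_series_coefficient (fun n => RtoC (bcoef al n)) x N).
  assert (Hs : ex_series (fun n => Cmod (RtoC (bcoef al n)) * exp (- (INR n * x)))).
  { apply ex_series_ext with (fun n => Cmod (RtoC (bcoef al n) * Cpow (Cexp (- vline x 0)) n)).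
    - intros n. rewrite Cmod_mult, <- Cexp_mul_nat, Cmod_Cexp_opp, Re_mul_nat, Re_vline. reflexivity.
    - apply ex_series_bcoef_C. lra. apply Hq. }
  specialize (P Hs).
  assert (P2 : is_Cint (fun t => Cpw (1 - Cexp (- vline x t)) (- al) * Cexp (mul_nat N (vline x t)))%C
    (/ INR N * (- (PI * INR N))) (/ INR N * (PI * INR N)) (RtoC (2 * PI) * RtoC (bcoef al N))%C).
  { replace (/ INR N * (- (PI * INR N))) with (- PI) by (field; lra).
    replace (/ INR N * (PI * INR N)) with PI by (field; lra).
    apply is_Cint_ext with (3 := P). lra. intros t _. f_equal.
    rewrite <- binomial_series by (auto; apply Hq).
    apply CSeries_ext. intros n. now rewrite Cexp_mul_nat. }
  apply is_Cint_comp_scal in P2.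
  apply (is_Cint_scal (RtoC (Rpower (INR N) (1 - al)))) in P2.
  eapply is_Cint_eq.
  - apply is_Cint_ext with (3 := P2). nra. intros t _. cbv beta.
    assert (E : vline x (/ INR N * t) = (RtoC (/ INR N) * vline c t)%C).
    { unfold vline, x, Rdiv. rewrite !RtoC_mult. ring. }
    unfold discrete_kernel. rewrite E.
    replace (mul_nat N (RtoC (/ INR N) * vline c t)) with (vline c t).
    2: { unfold mul_nat. rewrite Cmult_assoc, <- RtoC_mult, Rinv_r by lra. ring. }
    replace (dquot (/ INR N) (vline c t)) with
      (RtoC (INR N) * (1 - Cexp (- (RtoC (/ INR N) * vline c t))))%C.
    2: { unfold dquot. rewrite RtoC_inv by lra. field. apply RtoC_neq_0. lra. }
    rewrite Cpw_scal; auto.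
    + replace (1 - al) with (1 + - al) by ring. rewrite Rpower_plus, Rpower_1 by auto.
      rewrite RtoC_mult, RtoC_inv by lra. field. apply RtoC_neq_0. lra.
    + rewrite <- E. apply Rlt_le_trans with (1 - Cmod (Cexp (- vline x (/ INR N * t)))).
      specialize (Hq (/ INR N * t)). lra. apply Re_1_minus_ge. lra.
  - unfold gauss_seq. rewrite <- !RtoC_mult. f_equal. ring.
Qed.

Definition tail_const (al c Y : R) : R :=
  exp c * Rpower (Cmod (vline c Y) / 7) (2 - al) * 49.

Lemma tail_const_pos (al c Y : R) : 0 < tail_const al c Y.
Proof.
  unfold tail_const. apply Rmult_lt_0_compat. 2: lra. apply Rmult_lt_0_compat.
  apply exp_pos. apply exp_pos.
Qed.

Lemma Cmod_vline_sqr (c t : R) : Cmod (vline c t) * Cmod (vline c t) = c * c + t * t.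
Proof. now rewrite Cmod_sqr, Re_vline, Im_vline. Qed.

Lemma Cmod_vline_ge (c t : R) : c <= Cmod (vline c t) /\ Rabs t <= Cmod (vline c t).
Proof.
  split.
  - rewrite <- (Re_vline c t) at 1. apply Re_le_Cmod.
  - rewrite <- (Im_vline c t) at 1. apply im_le_Cmod.
Qed.

Lemma Cmod_vline_mono (c t Y : R) : 0 <= Y -> Y <= Rabs t -> Cmod (vline c Y) <= Cmod (vline c t).
Proof.
  intros HY Ht. apply Rsqr_incr_0_var. 2: apply Cmod_ge_0. unfold Rsqr. rewrite !Cmod_vline_sqr.
  assert (Y * Y <= t * t). 2: lra.
  replace (t * t) with (Rabs t * Rabs t). nra. rewrite <- Rabs_mult. apply Rabs_pos_eq. nra.
Qed.

(** Two of the al negative powers pay for the integrable 1/t^2, with 49 = 7^2; the exponent 2 - al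
    of the rest is nonpositive, so that factor is largest at |t| = Y. The range |t| <= PI N keeps
    the rescaled point in the box of the lower bound |u|/7. *)
Lemma discrete_kernel_tail (al c Y t : R) (N : nat) : 2 <= al -> 0 < c -> 0 < Y ->
  c <= INR N -> (1 <= N)%nat -> Y <= Rabs t -> Rabs t <= PI * INR N ->
  Cmod (discrete_kernel al c N t) <= tail_const al c Y * / (t * t).
Proof.
  intros Ha Hc HY HcN HN HYt Ht. assert (HPI := PI_RGT_0).
  assert (Hn : 0 < INR N) by (apply lt_0_INR; lia).
  assert (Hi : 0 < / INR N) by now apply Rinv_0_lt_compat.
  assert (Hr : in_range (/ INR N) (vline c t)).
  { split.
    - rewrite Re_vline. split. nra. apply Rmult_le_reg_l with (INR N); auto.
      rewrite <- Rmult_assoc, Rinv_r by lra. lra.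
    - rewrite Im_vline, Rabs_mult, Rabs_pos_eq by lra.
      apply Rle_trans with PI. 2: lra. apply Rmult_le_reg_l with (INR N); auto.
      rewrite <- Rmult_assoc, Rinv_r by lra. lra. }
  assert (H1 := Cmod_difference_quotient_ge _ _ Hi Hr). fold (dquot (/ INR N) (vline c t)) in H1.
  destruct (Cmod_vline_ge c t) as [G1 G2]. destruct (Cmod_vline_ge c Y) as [G3 _].
  assert (G4 := Cmod_vline_mono c t Y (Rlt_le _ _ HY) HYt).
  unfold discrete_kernel, tail_const.
  rewrite Cmod_mult, Cmod_Cpw, Cmod_Cexp, Re_vline.
  replace (exp c * Rpower (Cmod (vline c Y) / 7) (2 - al) * 49 * / (t * t)) with
    ((Rpower (Cmod (vline c Y) / 7) (2 - al) * (49 * / (t * t))) * exp c) by ring.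
  apply Rmult_le_compat_r. left; apply exp_pos.
  set (X := Cmod (vline c t) / 7) in *. assert (HX : 0 < X) by (unfold X; lra).
  apply Rle_trans with (Rpower X (- al)). apply Rpower_le_neg; auto; lra.
  replace (- al) with ((2 - al) + - (2)) by ring. rewrite Rpower_plus.
  apply Rmult_le_compat; try (left; apply exp_pos).
  - apply Rpower_le_neg; unfold X; lra.
  - rewrite Rpower_Ropp. change 2 with (INR 2). rewrite Rpower_pow by auto.
    assert (Ht0 : 0 < Rabs t) by lra.
    replace (t * t) with (Rabs t * Rabs t)
      by (rewrite <- Rabs_mult; apply Rabs_pos_eq; nra).
    replace (49 * / (Rabs t * Rabs t)) with (/ ((Rabs t / 7) * (Rabs t / 7))) by (field; lra).
    apply Rinv_le_contravar. nra. simpl. rewrite Rmult_1_r. unfold X. nra.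
Qed.

Lemma laplace_kernel_ex (al c Y : R) : 0 < c -> 0 < Y ->
  exists J, is_Cint (laplace_kernel al c) (- Y) Y J.
Proof.
  intros Hc HY. apply Ccont_ex_Cint. lra. intros t _. eapply Cderiv_Ccont.
  unfold laplace_kernel. apply Cderiv_mult.
  - apply Cderiv_pw. apply Cderiv_vline. now rewrite Re_vline.
  - apply (Cderiv_exp (vline c)). apply Cderiv_vline.
Qed.

(** One integral over a fixed window approximates all late terms of the sequence. This serves twice:
    for the existence of the limit, and for the error of inverting over a window. The term 4 T / Y
    is made of two tails of 2 T / Y each. *)
Lemma gauss_seq_near (al c Y : R) (J : C) : 2 <= al -> 0 < c -> 0 < Y ->
  is_Cint (laplace_kernel al c) (- Y) Y J ->
  exists K, 0 <= K /\ eventually (fun N =>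
    Cmod (RtoC (2 * PI * gauss_seq al N) - J) <= 4 * (tail_const al c Y / Y) + K * / INR N).
Proof.
  intros Ha Hc HY HJ. assert (HPI := PI_gt_3).
  set (M := c + Y).
  (* The Lipschitz constant of the power on Re >= c/2, times the distance 12 M^2 / N between
     difference quotient and limit; 12 is the 4 of [Cexp_taylor1_le] times the bound 3 for the
     exponential. *)
  set (L := 2 * (al * Rpower (c / 2) (- al - 1)) * (12 * (M * M)) * exp c).
  assert (HL : 0 <= L).
  { unfold L. apply Rmult_le_pos. 2: left; apply exp_pos. apply Rmult_le_pos. 2: nra.
    apply Rmult_le_pos. lra. apply Rmult_le_pos. lra. left; apply exp_pos. }
  exists (2 * (2 * Y * L)). split. nra.
  destruct (INR_unbounded (M + 1)) as [N0 HN0]. exists N0. intros N HN.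
  assert (HNM : M + 1 < INR N) by (apply Rlt_le_trans with (1 := HN0); now apply le_INR).
  assert (HN1 : (1 <= N)%nat).
  { apply INR_le. simpl. unfold M in HNM. lra. }
  assert (Hn : 0 < INR N) by (unfold M in HNM; lra).
  assert (Hi : 0 < / INR N) by now apply Rinv_0_lt_compat.
  assert (HYN : Y <= PI * INR N) by (unfold M in HNM; nra).
  assert (HI := discrete_kernel_integral al c N ltac:(lra) Hc HN1).
  destruct (is_Cint_sub (discrete_kernel al c N) (- (PI * INR N)) (PI * INR N)
    (- (PI * INR N)) (- Y) _ ltac:(lra) ltac:(lra) ltac:(lra) HI) as [A1 HA1].
  destruct (is_Cint_sub (discrete_kernel al c N) (- (PI * INR N)) (PI * INR N)
    (- Y) Y _ ltac:(lra) ltac:(lra) ltac:(lra) HI) as [A2 HA2].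
  destruct (is_Cint_sub (discrete_kernel al c N) (- (PI * INR N)) (PI * INR N)
    Y (PI * INR N) _ ltac:(lra) ltac:(lra) ltac:(lra) HI) as [A3 HA3].
  assert (E := is_Cint_unique _ _ _ _ _ HI
    (is_Cint_Chasles _ _ _ _ _ _ HA1 (is_Cint_Chasles _ _ _ _ _ _ HA2 HA3))).
  assert (HT := tail_const_pos al c Y).
  assert (Hc1 : c <= INR N) by (unfold M in HNM; lra).
  assert (B1 : Cmod A1 <= 2 * (tail_const al c Y * (/ Y))).
  { apply Rle_trans with (2 * (tail_const al c Y * (/ - (PI * INR N) - / - Y))).
    - eapply is_Cint_le. 3: exact HA1. lra.
      2: { apply is_RInt_rscal. apply is_RInt_inv_sq. lra. right. lra. }
      intros t Ht. assert (E1 : Rabs t = - t) by (apply Rabs_left; lra).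
      apply discrete_kernel_tail; auto; rewrite E1; lra.
    - apply Rmult_le_compat_l. lra. apply Rmult_le_compat_l. lra.
      rewrite !Rinv_opp. assert (0 < / (PI * INR N)) by (apply Rinv_0_lt_compat; nra). lra. }
  assert (B3 : Cmod A3 <= 2 * (tail_const al c Y * (/ Y))).
  { apply Rle_trans with (2 * (tail_const al c Y * (/ Y - / (PI * INR N)))).
    - eapply is_Cint_le. 3: exact HA3. lra.
      2: { apply is_RInt_rscal. apply is_RInt_inv_sq. lra. left. lra. }
      intros t Ht. assert (E1 : Rabs t = t) by (apply Rabs_pos_eq; lra).
      apply discrete_kernel_tail; auto; rewrite E1; lra.
    - apply Rmult_le_compat_l. lra. apply Rmult_le_compat_l. lra.
      assert (0 < / (PI * INR N)) by (apply Rinv_0_lt_compat; nra). lra. }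
  assert (B2 : Cmod (A2 - J) <= 2 * ((Y - - Y) * (L * / INR N))).
  { apply (is_Cint_le_const (fun t => discrete_kernel al c N t - laplace_kernel al c t)%C).
    lra. 2: now apply is_Cint_minus.
    intros t Ht. unfold discrete_kernel, laplace_kernel. set (w := vline c t).
    assert (Hw : Cmod w <= M).
    { unfold w, vline. apply Rle_trans with (1 := Cmod_triangle _ _).
      rewrite Cmod_mult, Cmod_Ci, !Cmod_R, (Rabs_pos_eq c) by lra.
      assert (Rabs t <= Y) by (apply Rabs_le; lra). unfold M. lra. }
    replace (Cpw (dquot (/ INR N) w) (- al) * Cexp w - Cpw w (- al) * Cexp w)%C with
      ((Cpw (dquot (/ INR N) w) (- al) - Cpw w (- al)) * Cexp w)%C by ring.
    rewrite Cmod_mult, Cmod_Cexp. replace (Re w) with c by (unfold w; now rewrite Re_vline).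
    unfold L. replace (2 * (al * Rpower (c / 2) (- al - 1)) * (12 * (M * M)) * exp c * / INR N) with
      (2 * (al * Rpower (c / 2) (- al - 1)) * (12 * (M * M) * / INR N) * exp c) by ring.
    apply Rmult_le_compat_r. left; apply exp_pos.
    apply Rle_trans with (2 * (- - al * Rpower (c / 2) (- al - 1)) * Cmod (dquot (/ INR N) w - w)).
    - apply Cpw_lipschitz; try lra. apply Re_dquot_ge; auto.
      apply Rmult_le_reg_l with (INR N); auto. rewrite <- Rmult_assoc, Rinv_r by lra. lra.
      unfold w. rewrite Re_vline. lra.
    - rewrite Ropp_involutive. apply Rmult_le_compat_l.
      { apply Rmult_le_pos. lra. apply Rmult_le_pos. lra. left; apply exp_pos. }
      set (hh := / INR N) in *.
      assert (Hh0 : RtoC hh <> 0) by (apply RtoC_neq_0; lra).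
      replace (dquot hh w - w)%C with
        (- (Cexp (- (RtoC hh * w)) - 1 - (- (RtoC hh * w))) / RtoC hh)%C
        by (unfold dquot; field; auto).
      rewrite Cmod_div, Cmod_opp, Cmod_R, Rabs_pos_eq by (auto; lra).
      assert (T := Cexp_taylor1_le (- (RtoC hh * w))).
      rewrite Cmod_opp, Cmod_mult, Cmod_R, (Rabs_pos_eq hh) in T by lra.
      assert (Hw0 := Cmod_ge_0 w).
      assert (Hhw : hh * Cmod w <= 1).
      { unfold hh. apply Rmult_le_reg_l with (INR N); auto.
        rewrite <- Rmult_assoc, Rinv_r by lra. lra. }
      assert (He : exp (hh * Cmod w) <= 3).
      { apply Rle_trans with (exp 1). now apply exp_le. apply exp_le_3. }
      apply Rmult_le_reg_r with hh; auto.
      replace (Cmod (Cexp (- (RtoC hh * w)) - 1 - - (RtoC hh * w)) / hh * hh) with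
        (Cmod (Cexp (- (RtoC hh * w)) - 1 - - (RtoC hh * w))) by (field; lra).
      apply Rle_trans with (1 := T).
      assert (Hsq : hh * Cmod w * (hh * Cmod w) <= hh * M * (hh * M)).
      { apply Rmult_le_compat; nra. }
      assert (0 <= hh * Cmod w * (hh * Cmod w)) by nra.
      apply Rle_trans with (4 * (hh * M * (hh * M) * 3)). 2: right; ring.
      apply Rmult_le_compat_l. lra. apply Rmult_le_compat; auto. left; apply exp_pos. }
  rewrite E. replace (A1 + (A2 + A3) - J)%C with (A1 + A3 + (A2 - J))%C by ring.
  apply Rle_trans with (1 := Cmod_triangle _ _).
  assert (T1 := Cmod_triangle A1 A3). unfold Rdiv.
  replace (2 * (2 * Y * L) * / INR N) with (2 * ((Y - - Y) * (L * / INR N))) by ring. lra.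
Qed.

Lemma gauss_seq_cv (al : R) : 2 <= al -> ex_finite_lim_seq (gauss_seq al).
Proof.
  intros Ha. apply ex_lim_seq_cauchy_corr. intros [eps He]. simpl.
  assert (HPI := PI_gt_3).
  (* A bound for [tail_const al 1 Y] independent of Y, as 2 - al <= 0 and |1 + i Y| >= 1. The window
     length Y below then makes 4 T / Y at most eps/4. *)
  set (T := exp 1 * Rpower (1 / 7) (2 - al) * 49).
  assert (HT : 0 < T).
  { unfold T. apply Rmult_lt_0_compat. 2: lra. apply Rmult_lt_0_compat; apply exp_pos. }
  set (Y := 16 * T / eps + 1).
  assert (HY : 0 < Y).
  { unfold Y. assert (0 < 16 * T / eps) by (apply Rdiv_lt_0_compat; lra). lra. }
  destruct (laplace_kernel_ex al 1 Y Rlt_0_1 HY) as [J HJ].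
  destruct (gauss_seq_near al 1 Y J Ha Rlt_0_1 HY HJ) as [K [HK [N0 HN0]]].
  assert (Hsmall : 4 * (tail_const al 1 Y / Y) <= eps / 4).
  { assert (HTT : tail_const al 1 Y <= T).
    { unfold tail_const, T. apply Rmult_le_compat_r. lra. apply Rmult_le_compat_l.
      left; apply exp_pos. destruct (Cmod_vline_ge 1 Y). apply Rpower_le_neg; lra. }
    apply Rmult_le_reg_r with Y; auto.
    replace (4 * (tail_const al 1 Y / Y) * Y) with (4 * tail_const al 1 Y) by (field; lra).
    assert (eps * Y = 16 * T + eps) by (unfold Y; field; lra). lra. }
  destruct (INR_unbounded (4 * K / eps + 1)) as [N1 HN1].
  assert (Hev : forall n, (max N0 N1 <= n)%nat ->
    Cmod (RtoC (2 * PI * gauss_seq al n) - J) <= eps / 2).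
  { intros n Hn. apply Rle_trans with (1 := HN0 n ltac:(lia)).
    assert (HNn : INR N1 <= INR n) by (apply le_INR; lia).
    assert (Hp : 0 <= 4 * K / eps) by (apply Rdiv_le_0_compat; lra).
    assert (K * / INR n <= eps / 4). 2: lra.
    apply Rmult_le_reg_r with (INR n). lra. rewrite Rmult_assoc, Rinv_l by lra.
    assert (eps * (4 * K / eps + 1) = 4 * K + eps) by (field; lra). nra. }
  exists (max N0 N1). intros n m Hn Hm.
  assert (H1 := Hev n Hn). assert (H2 := Hev m Hm).
  assert (H3 := Cmod_minus_triangle (RtoC (2 * PI * gauss_seq al n)) J (RtoC (2 * PI * gauss_seq al m))).
  rewrite (Cmod_minus_sym J) in H3. rewrite <- RtoC_minus, Cmod_R in H3.
  replace (2 * PI * gauss_seq al n - 2 * PI * gauss_seq al m) with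
    (2 * PI * (gauss_seq al n - gauss_seq al m)) in H3 by ring.
  rewrite Rabs_mult, (Rabs_pos_eq (2 * PI)) in H3 by lra.
  assert (H4 := Rabs_pos (gauss_seq al n - gauss_seq al m)). nra.
Qed.

Lemma prod_bcoef (al : R) (n : nat) :
  prod_f_R0 (fun i => al + INR i) n = bcoef al n * INR (fact n) * (al + INR n).
Proof.
  induction n as [|n IH].
  - simpl. ring.
  - change (prod_f_R0 (fun i => al + INR i) (S n)) with
      (prod_f_R0 (fun i => al + INR i) n * (al + INR (S n))).
    rewrite IH. f_equal. change (fact (S n)) with (S n * fact n)%nat. rewrite mult_INR.
    replace (bcoef al (S n) * (INR (S n) * INR (fact n))) with
      (INR (S n) * bcoef al (S n) * INR (fact n)) by ring.
    rewrite bcoef_S. ring.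
Qed.

(** [rGamma] reads off a total limit operator, so the convergence must be known before its value can
    be identified. *)
Lemma gauss_seq_rGamma (al : R) : 2 <= al -> is_lim_seq (gauss_seq al) (rGamma al).
Proof.
  intros Ha. destruct (gauss_seq_cv al Ha) as [l Hl].
  assert (H : is_lim_seq (fun n => prod_f_R0 (fun i => al + INR i) n /
    (INR (fact n) * Rpower (INR n) al)) l).
  { apply is_lim_seq_incr_1.
    apply is_lim_seq_ext with (fun n => gauss_seq al (S n) * (1 + al * / INR (S n))).
    - intros n. rewrite prod_bcoef. unfold gauss_seq. assert (Hn := INR_S_pos n).
      assert (Hf : INR (fact (S n)) <> 0) by apply INR_fact_neq_0.
      assert (Hr : 0 < Rpower (INR (S n)) al) by apply exp_pos.
      replace (1 - al) with (1 + - al) by ring. rewrite Rpower_plus, Rpower_1, Rpower_Ropp by auto.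
      field. repeat split; auto; lra.
    - replace (Finite l) with (Finite (l * (1 + al * 0))) by (f_equal; ring).
      apply is_lim_seq_mult'. now apply (is_lim_seq_incr_1 (gauss_seq al)).
      apply is_lim_seq_plus'. apply is_lim_seq_const.
      apply is_lim_seq_mult'. apply is_lim_seq_const. apply INR_lim_inv. }
  unfold rGamma. rewrite (is_lim_seq_unique _ _ H). exact Hl.
Qed.

Lemma laplace_inversion (al c Y : R) : 2 <= al -> 0 < c -> 0 < Y ->
  exists J, is_Cint (laplace_kernel al c) (- Y) Y J /\
    Cmod (J - RtoC (2 * PI * rGamma al)) <= 4 * (tail_const al c Y / Y).
Proof.
  intros Ha Hc HY. destruct (laplace_kernel_ex al c Y Hc HY) as [J HJ]. exists J. split; auto.
  destruct (gauss_seq_near al c Y J Ha Hc HY HJ) as [K [HK [N0 HN0]]].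
  rewrite Cmod_minus_sym.
  apply Rle_plus_epsilon. intros eps He.
  destruct (INR_unbounded (K / eps + 1)) as [N1 HN1].
  assert (Hp : 0 <= K / eps) by (apply Rdiv_le_0_compat; lra).
  apply (Ccv_Cmod_le (fun n => RtoC (2 * PI * gauss_seq al n) - J)%C).
  - exists (max N0 N1). intros n Hn. apply Rle_trans with (1 := HN0 n ltac:(lia)).
    assert (HNn : INR N1 <= INR n) by (apply le_INR; lia).
    apply Rplus_le_compat_l. apply Rmult_le_reg_r with (INR n). lra.
    rewrite Rmult_assoc, Rinv_l by lra.
    assert (eps * (K / eps + 1) = K + eps) by (field; lra). nra.
  - apply Ccv_minus. 2: apply Ccv_const. apply Ccv_RtoC.
    apply (is_lim_seq_scal_l _ (2 * PI) (rGamma al)). now apply gauss_seq_rGamma.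
Qed.

(** The dependence of the error on al is explicit, a pure power of |x + i y|/7, because these errors
    will be summed over al = j - s against A^j/j!. The constant 196 is 4 times 49. *)
Lemma laplace_inversion_scaled (al x y n : R) : 2 <= al -> 0 < x -> 0 < y -> 0 < n ->
  exists J, is_Cint (fun t => Cpw (vline x t) (- al) * Cexp (RtoC n * vline x t))%C (- y) y J /\
    Cmod (J - RtoC (2 * PI * (Rpower n (al - 1) * rGamma al))) <=
    196 * exp (n * x) * (Rpower (Cmod (vline x y) / 7) (2 - al) / y).
Proof.
  intros Ha Hx Hy Hn.
  assert (Hnx : 0 < n * x) by nra. assert (Hny : 0 < n * y) by nra.
  destruct (laplace_inversion al (n * x) (n * y) Ha Hnx Hny) as [J [HJ HB]].
  replace (- (n * y)) with (n * - y) in HJ by ring.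
  apply is_Cint_comp_scal in HJ.
  apply (is_Cint_scal (RtoC (Rpower n (al - 1)))) in HJ.
  assert (Ev : forall t, vline (n * x) (n * t) = (RtoC n * vline x t)%C).
  { intros t. unfold vline. rewrite !RtoC_mult. ring. }
  exists (RtoC (Rpower n (al - 1)) * J)%C. split.
  - apply is_Cint_ext with (3 := HJ). lra. intros t _. unfold laplace_kernel. cbv beta.
    rewrite Ev. rewrite Cpw_scal by (auto; rewrite Re_vline; auto).
    assert (E : (RtoC (Rpower n (al - 1)) * RtoC n * RtoC (Rpower n (- al)))%C = 1).
    { rewrite <- !RtoC_mult. f_equal. rewrite <- (Rpower_1 n Hn) at 2. rewrite <- !Rpower_plus.
      replace (al - 1 + 1 + - al) with 0 by ring. now apply Rpower_O. }
    replace (RtoC (Rpower n (al - 1)) * (RtoC n * (RtoC (Rpower n (- al)) * Cpw (vline x t) (- al) * Cexp (RtoC n * vline x t))))%C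
      with ((RtoC (Rpower n (al - 1)) * RtoC n * RtoC (Rpower n (- al))) * (Cpw (vline x t) (- al) * Cexp (RtoC n * vline x t)))%C by ring.
    rewrite E. ring.
  - replace (RtoC (Rpower n (al - 1)) * J - RtoC (2 * PI * (Rpower n (al - 1) * rGamma al)))%C with
      (RtoC (Rpower n (al - 1)) * (J - RtoC (2 * PI * rGamma al)))%C.
    2: { rewrite !RtoC_mult. ring. }
    assert (Hp : 0 < Rpower n (al - 1)) by apply exp_pos.
    rewrite Cmod_mult, Cmod_R, Rabs_pos_eq by lra.
    apply Rle_trans with (Rpower n (al - 1) * (4 * (tail_const al (n * x) (n * y) / (n * y)))).
    apply Rmult_le_compat_l; lra.
    right. unfold tail_const. rewrite Ev, Cmod_mult, Cmod_R, Rabs_pos_eq by lra.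
    assert (Hv : 0 < Cmod (vline x y)) by (destruct (Cmod_vline_ge x y); lra).
    replace (n * Cmod (vline x y) / 7) with (n * (Cmod (vline x y) / 7)) by field.
    rewrite <- Rpower_mult_distr by lra.
    assert (E : Rpower n (al - 1) * Rpower n (2 - al) = n).
    { rewrite <- Rpower_plus. replace (al - 1 + (2 - al)) with 1 by ring. now apply Rpower_1. }
    set (A := Rpower (Cmod (vline x y) / 7) (2 - al)).
    replace (Rpower n (al - 1) * (4 * (exp (n * x) * (Rpower n (2 - al) * A) * 49 / (n * y)))) with
      ((Rpower n (al - 1) * Rpower n (2 - al)) * (196 * exp (n * x) * A / (n * y))) by (field; lra).
    rewrite E. field. lra.
Qed.

(** * Bessel integrals *)

Lemma is_series_exp (r : R) : is_series (fun j => r ^ j / INR (fact j)) (exp r).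
Proof.
  assert (H := is_exp_Reals r). unfold is_pseries in H.
  apply is_series_ext with (2 := H). intros j.
  rewrite pow_n_pow. unfold scal; simpl; unfold mult; simpl. unfold Rdiv. ring.
Qed.

Lemma pow_fact_nonneg (r : R) (j : nat) : 0 <= r -> 0 <= r ^ j / INR (fact j).
Proof.
  intros H. apply Rdiv_le_0_compat. now apply pow_le. apply INR_fact_lt_0.
Qed.

Lemma pow_fact_le_exp (r : R) (j : nat) : 0 <= r -> r ^ j / INR (fact j) <= exp r.
Proof.
  intros Hr. rewrite <- (is_series_unique _ _ (is_series_exp r)).
  assert (E : ex_series (fun j => r ^ j / INR (fact j))) by (eexists; apply is_series_exp).
  apply Rle_trans with (sum_n (fun j => r ^ j / INR (fact j)) j).
  - destruct j. rewrite sum_O. lra. rewrite sum_Sn. unfold plus; simpl Hierarchy.AbelianMonoid.plus.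
    assert (0 <= sum_n (fun j => r ^ j / INR (fact j)) j).
    { clear E. induction j. rewrite sum_O. now apply pow_fact_nonneg.
      rewrite sum_Sn. apply Rplus_le_le_0_compat; auto. now apply pow_fact_nonneg. }
    change (r ^ S j / INR (fact (S j)) <=
      sum_n (fun j => r ^ j / INR (fact j)) j + r ^ S j / INR (fact (S j))). lra.
  - apply sum_n_le_Series; auto. intros; now apply pow_fact_nonneg.
Qed.

(** One term of the series of e^{v/a}. With a = 4, any fixed power of v costs only e^{v/4}. *)
Lemma pow_fact_scaled_le (v a : R) (j : nat) : 0 <= v -> 0 < a ->
  v ^ j / INR (fact j) <= a ^ j * exp (v / a).
Proof.
  intros Hv Ha. assert (H : (v / a) ^ j / INR (fact j) <= exp (v / a)).
  { apply pow_fact_le_exp. apply Rdiv_le_0_compat; auto. }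
  assert (Hp : 0 < a ^ j) by now apply pow_lt.
  apply Rmult_le_compat_l with (r := a ^ j) in H; [|lra].
  apply Rle_trans with (2 := H). right. unfold Rdiv. rewrite Rpow_mult_distr, pow_inv.
  assert (Hf := INR_fact_neq_0 j). field. split; auto. lra.
Qed.

Lemma Cmod_pow_fact (u : C) (j : nat) :
  Cmod (Cpow u j / RtoC (INR (fact j))) = Cmod u ^ j / INR (fact j).
Proof.
  assert (Hf := INR_fact_lt_0 j).
  rewrite Cmod_div, Cmod_pow, Cmod_R, Rabs_pos_eq by (try apply RtoC_neq_0; lra). reflexivity.
Qed.

Lemma ex_series_Cexp (u : C) : ex_series (fun j => Cmod (Cpow u j / RtoC (INR (fact j)))).
Proof.
  apply ex_series_ext with (fun j => Cmod u ^ j / INR (fact j)).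
  intros j. now rewrite Cmod_pow_fact. eexists. apply is_series_exp.
Qed.

(** Along the ray t u, the derivative of the partial sum times e^{-t u} reduces to the last term of
    the sum, which tends to 0 uniformly. *)
Lemma Cexp_series (u : C) : CSeries (fun j => Cpow u j / RtoC (INR (fact j)))%C = Cexp u.
Proof.
  set (S0 := fun (N : nat) (t : R) => csum (fun n => Cpow (RtoC t * u) n / RtoC (INR (fact n)))%C N).
  assert (DP : forall n t, Cderiv (fun s => Cpow (RtoC s * u) (S n) / RtoC (INR (fact (S n))))%C t
      (u * (Cpow (RtoC t * u) n / RtoC (INR (fact n))))%C).
  { intros n t. apply Cderiv_ext with (fun s => / RtoC (INR (fact (S n))) * Cpow (RtoC s * u) (S n))%C.
    intros; unfold Cdiv; ring. eapply Cderiv_eq. apply Cderiv_scal, Cderiv_pow_ray.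
    change (fact (S n)) with (S n * fact n)%nat. rewrite mult_INR, RtoC_mult.
    assert (RtoC (INR (S n)) <> 0) by (apply RtoC_neq_0, Rgt_not_eq, INR_S_pos).
    assert (RtoC (INR (fact n)) <> 0) by apply RtoC_neq_0, INR_fact_neq_0. field. auto. }
  assert (DS : forall N t, Cderiv (S0 (S N)) t (u * S0 N t)%C).
  { induction N as [|N IH]; intros t.
    - unfold S0. simpl. eapply Cderiv_eq. apply Cderiv_const. ring.
    - apply Cderiv_ext with (fun s => S0 (S N) s + Cpow (RtoC s * u) (S N) / RtoC (INR (fact (S N))))%C.
      reflexivity. eapply Cderiv_eq. apply Cderiv_plus. apply IH. apply DP.
      unfold S0. rewrite csum_S. ring. }
  set (K := Cmod u * exp (Cmod u)).
  assert (Bd : forall N, Cmod (S0 (S N) 1 * Cexp (0 + RtoC 1 * - u) - S0 (S N) 0 * Cexp (0 + RtoC 0 * - u)) <=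
     2 * (K * (Cmod u ^ N / INR (fact N)))).
  { intros N. apply (mean_value_le (fun t => S0 (S N) t * Cexp (0 + RtoC t * - u))%C
      (fun t => - u * Cexp (0 + RtoC t * - u) * (Cpow (RtoC t * u) N / RtoC (INR (fact N))))%C).
    - intros t Ht. eapply Cderiv_eq. apply Cderiv_mult. apply DS.
      apply (Cderiv_exp (fun t => 0 + RtoC t * - u)%C). apply Cderiv_line.
      unfold S0. rewrite csum_S. ring.
    - intros t Ht. assert (Hu := Cmod_ge_0 u).
      rewrite !Cmod_mult, Cmod_opp, Cmod_pow_fact. unfold K.
      assert (Ht1 : Cmod (RtoC t * u) <= Cmod u)
        by (rewrite Cmod_mult, Cmod_R, Rabs_pos_eq by lra; nra).
      apply Rmult_le_compat.
      apply Rmult_le_pos; apply Cmod_ge_0. apply pow_fact_nonneg, Cmod_ge_0.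
      + apply Rmult_le_compat_l; auto. apply Rle_trans with (1 := Cmod_Cexp_le _). apply exp_le.
        replace (0 + RtoC t * - u)%C with (- (RtoC t * u))%C by ring. now rewrite Cmod_opp.
      + apply Rmult_le_compat_r. left; apply Rinv_0_lt_compat, INR_fact_lt_0.
        apply pow_incr. split; auto. apply Cmod_ge_0. }
  assert (L0 : Ccv (fun N => S0 (S N) 1 * Cexp (- u))%C 1).
  { apply Ccv_of_le with (fun N => 2 * K * (Cmod u ^ N / INR (fact N))).
    - exists O. intros N _. specialize (Bd N).
      assert (E : (S0 (S N) 0 * Cexp (0 + RtoC 0 * - u))%C = 1).
      { assert (E1 : S0 (S N) 0 = 1).
        { unfold S0. rewrite csum_S_l, (csum_ext _ (fun _ => 0 * 0)%C), csum_scal.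
          simpl. field. intros i _. rewrite Cpow_S. unfold Cdiv. ring. }
        rewrite E1. replace (0 + 0 * - u)%C with (RtoC 0) by ring. rewrite Cexp_0. ring. }
      rewrite E in Bd. replace (0 + 1 * - u)%C with (- u)%C in Bd by ring. lra.
    - apply is_lim_seq_scal0. apply ex_series_lim_0. eexists. apply is_series_exp. }
  assert (L1 : Ccv (fun N => S0 (S N) 1) (CSeries (fun j => Cpow u j / RtoC (INR (fact j)))%C)).
  { apply (Ccv_incr_1 (fun N => S0 N 1)).
    apply Ccv_ext with (csum (fun j => Cpow u j / RtoC (INR (fact j)))%C).
    - intros N. unfold S0. apply csum_ext. intros i _. f_equal. f_equal. ring.
    - apply CSeries_cv, ex_series_Cexp. }
  assert (E := Ccv_unique _ _ _ L0 (Ccv_mult _ _ _ _ L1 (Ccv_const (Cexp (- u))))).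
  rewrite Cexp_opp in E. assert (Hn := Cexp_neq_0 u).
  set (X := CSeries _) in *. transitivity (X * / Cexp u * Cexp u)%C. field; auto.
  rewrite <- E. ring.
Qed.

(** A total integral, so that a whole sequence of integrals can be named without choosing
    witnesses. *)
Definition Cint (f : R -> C) (a b : R) : C :=
  (RInt (fun t => Re (f t)) a b, RInt (fun t => Im (f t)) a b).

Lemma is_Cint_Cint (f : R -> C) (a b : R) (l : C) : is_Cint f a b l -> Cint f a b = l.
Proof. intros [H1 H2]. apply Ceq; simpl; now apply is_RInt_unique. Qed.

Lemma CSeries_RtoC (b : nat -> R) : CSeries (fun j => RtoC (b j)) = RtoC (Series b).
Proof.
  apply Ceq; simpl. reflexivity. apply is_series_unique.
  apply filterlim_ext with (fun _ => 0). 2: apply filterlim_const.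
  intros n. induction n. now rewrite sum_O. rewrite sum_Sn, <- IHn. unfold plus; simpl. ring.
Qed.

(** The inverse Laplace transform at n of the j-th term A^j z^{s-j} / j! of z^s e^{A/z}. *)
Definition bterm (A s n : R) (j : nat) : R :=
  A ^ j / INR (fact j) * (Rpower n (INR j - s - 1) * rGamma (INR j - s)).

Lemma Cpw_minus_INR (z : C) (s : R) (j : nat) : 0 < Re z ->
  Cpw z (s - INR j) = (Cpw z s / Cpow z j)%C.
Proof.
  intros Hz. unfold Rminus. rewrite Cpw_plus, Cpw_opp, Cpw_INR by auto. reflexivity.
Qed.

Lemma Rpower_minus_INR (x s : R) (j : nat) : 0 < x ->
  Rpower x (s - INR j) = Rpower x s / x ^ j.
Proof. intros Hx. unfold Rminus. now rewrite Rpower_plus, Rpower_Ropp, Rpower_pow. Qed.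

Section BesselIntegral.

Variables (A s : R).
Hypothesis HA : 0 < A.
Hypothesis Hs : 0 <= s.

Let term (x n : R) (j : nat) (t : R) : C :=
  (RtoC (A ^ j / INR (fact j)) * (Cpw (vline x t) (s - INR j) * Cexp (RtoC n * vline x t)))%C.

Lemma Cmod_term (x n : R) (j : nat) (t : R) : 0 < x ->
  Cmod (term x n j t) = A ^ j / INR (fact j) * (Rpower (Cmod (vline x t)) (s - INR j) * exp (n * x)).
Proof.
  intros Hx. unfold term. rewrite !Cmod_mult, Cmod_Cpw, Cmod_Cexp, Cmod_R, Rabs_pos_eq
    by (apply pow_fact_nonneg; lra).
  replace (Re (RtoC n * vline x t)) with (n * x). reflexivity.
  unfold vline, Re. simpl. ring.
Qed.

Lemma integrand_series (x n t : R) : 0 < x ->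
  ex_series (fun j => Cmod (term x n j t)) /\
  CSeries (fun j => term x n j t) =
  (Cpw (vline x t) s * Cexp (RtoC A / vline x t + RtoC n * vline x t))%C.
Proof.
  intros Hx. set (z := vline x t). assert (Hz : 0 < Re z) by (unfold z; now rewrite Re_vline).
  assert (Nz := Re_pos_neq_0 _ Hz).
  assert (E : forall j, term x n j t = ((Cpw z s * Cexp (RtoC n * z)) *
    (Cpow (RtoC A / z) j / RtoC (INR (fact j))))%C).
  { intros j. unfold term. fold z. rewrite Cpw_minus_INR by auto.
    rewrite RtoC_div by apply INR_fact_neq_0. rewrite RtoC_pow. unfold Cdiv.
    rewrite Cpow_mult_l, Cpow_inv by auto. ring. }
  split.
  - apply ex_series_ext with (fun j => Cmod ((Cpw z s * Cexp (RtoC n * z)) *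
      (Cpow (RtoC A / z) j / RtoC (INR (fact j))))%C). intros; now rewrite E.
    apply ex_series_Cmod_scal, ex_series_Cexp.
  - rewrite (CSeries_ext _ _ E), CSeries_scal by apply ex_series_Cexp.
    rewrite Cexp_series, Cexp_plus. ring.
Qed.

(** The condition on A makes x the saddle point of A/z + n z, where both summands equal v = n x and
    the integrand has exponential size e^{2v}. The constant may depend on A and s, but not on n and
    x. *)
Lemma bessel_integral : exists B : R, forall n x : R, 1 <= n -> 0 < x -> A = n * x * x ->
  exists I : C,
    is_Cint (fun t => Cpw (vline x t) s * Cexp (RtoC A / vline x t + RtoC n * vline x t))%C
      (- (28 * x)) (28 * x) I /\
    Cmod (I - RtoC (2 * PI * Series (bterm A s n))) <= B * exp (5 / 4 * (n * x)) /\
    ex_series (bterm A s n).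
Proof.
  assert (HPI := PI_RGT_0).
  (* From index J on, the exponent j - s is at least 2, as [laplace_inversion_scaled] requires. *)
  destruct (INR_unbounded (s + 2)) as [J HJ].
  set (R0 := Rpower (29 * (A + 1)) s).
  set (R1 := 4 ^ J * R0).
  (* Since A n = v^2, A^j n^j equals v^{2j}, which is at most (2j)! 4^{2j} e^{v/4}. *)
  set (Gj := fun j => Rabs (rGamma (INR j - s)) * (16 ^ j * INR (fact (2 * j)))).
  set (R2 := sum_n Gj (pred J)).
  (* 35 is 196 * 5/28; the base comes from rho/7 <= 29 x / 7 <= 5 x, and x <= A + 1 because A = n
     x^2 >= x^2. *)
  set (R3 := 35 * Rpower (5 * (A + 1)) (1 + s)).
  exists (112 * (A + 1) * (INR J * R1) + 2 * PI * R2 + R3).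
  intros n x Hn Hx HAx.
  set (v := n * x). assert (Hv : 0 < v) by (unfold v; nra).
  assert (HxA : x <= A + 1) by nra.
  assert (HvA : A / x = v) by (unfold v; rewrite HAx; field; lra).
  set (e54 := exp (5 / 4 * v)). assert (He54 : 0 < e54) by apply exp_pos.
  assert (Ee : e54 = exp (v / 4) * exp v) by (unfold e54; rewrite <- exp_plus; f_equal; field).
  set (y := 28 * x). assert (Hy : 0 < y) by (unfold y; lra).
  assert (Dterm : forall j t, Ccont (term x n j) t).
  { intros j t. eapply Cderiv_Ccont. unfold term. apply Cderiv_scal. apply Cderiv_mult.
    apply Cderiv_pw. apply Cderiv_vline. now rewrite Re_vline.
    apply (Cderiv_exp (fun t => RtoC n * vline x t)%C). apply Cderiv_scal, Cderiv_vline. }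
  (* The first J terms of both sides are negligible against exp (2 v), so that Laplace
     inversion is only needed for exponents at least 2, where it converges absolutely. *)
  assert (H1 : exists I1, is_Cint (fun t => csum (fun j => term x n j t) J) (- y) y I1 /\
     Cmod I1 <= 112 * (A + 1) * (INR J * R1) * e54).
  { assert (Hex : forall j, exists l, is_Cint (term x n j) (- y) y l).
    { intros j. apply Ccont_ex_Cint. lra. intros; apply Dterm. }
    exists (csum (fun j => Cint (term x n j) (- y) y) J).
    assert (HI : is_Cint (fun t => csum (fun j => term x n j t) J) (- y) y
      (csum (fun j => Cint (term x n j) (- y) y) J)).
    { apply is_Cint_csum. intros j _. destruct (Hex j) as [l Hl].
      now rewrite (is_Cint_Cint _ _ _ _ Hl). }
    split; auto.
    apply Rle_trans with (2 * ((y - - y) * (INR J * (R1 * e54)))).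
    - apply (is_Cint_le_const (fun t => csum (fun j => term x n j t) J)); auto. lra.
      intros t Ht. apply Cmod_csum_le_const. intros j Hj. rewrite Cmod_term by auto.
      destruct (Cmod_vline_ge x t) as [G1 _].
      assert (G2 : Cmod (vline x t) <= 29 * x).
      { unfold vline. apply Rle_trans with (1 := Cmod_triangle _ _).
        rewrite Cmod_mult, Cmod_Ci, !Cmod_R, (Rabs_pos_eq x) by lra.
        assert (Rabs t <= y) by (apply Rabs_le; lra). unfold y in *. lra. }
      rewrite Rpower_minus_INR by lra. fold v.
      assert (P1 : Rpower (Cmod (vline x t)) s <= R0).
      { unfold R0. apply Rpower_le_pos; lra. }
      assert (P2 : A ^ j / INR (fact j) * / Cmod (vline x t) ^ j <= 4 ^ J * exp (v / 4)).
      { apply Rle_trans with (v ^ j / INR (fact j)).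
        - rewrite <- HvA. unfold Rdiv. rewrite Rpow_mult_distr, pow_inv.
          assert (Hf := INR_fact_lt_0 j). assert (0 < / INR (fact j)) by now apply Rinv_0_lt_compat.
          assert (0 < A ^ j) by now apply pow_lt.
          replace (A ^ j * / x ^ j * / INR (fact j)) with (A ^ j * / INR (fact j) * / x ^ j) by ring.
          apply Rmult_le_compat_l. nra. apply Rinv_le_contravar. now apply pow_lt.
          apply pow_incr. lra.
        - apply Rle_trans with (1 := pow_fact_scaled_le v 4 j (Rlt_le _ _ Hv) ltac:(lra)).
          apply Rmult_le_compat_r. left; apply exp_pos. apply Rle_pow. lra. lia. }
      unfold R1. rewrite Ee.
      replace (A ^ j / INR (fact j) * (Rpower (Cmod (vline x t)) s / Cmod (vline x t) ^ j * exp v))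
        with ((A ^ j / INR (fact j) * / Cmod (vline x t) ^ j) * Rpower (Cmod (vline x t)) s * exp v)
        by (unfold Rdiv; ring).
      replace (4 ^ J * R0 * (exp (v / 4) * exp v)) with (4 ^ J * exp (v / 4) * R0 * exp v) by ring.
      apply Rmult_le_compat_r. left; apply exp_pos.
      apply Rmult_le_compat; auto.
      + apply Rmult_le_pos. apply pow_fact_nonneg; lra. left. apply Rinv_0_lt_compat, pow_lt. lra.
      + left; apply exp_pos.
    - replace (2 * ((y - - y) * (INR J * (R1 * e54)))) with (112 * x * (INR J * R1) * e54)
        by (unfold y; ring).
      apply Rmult_le_compat_r. lra. apply Rmult_le_compat_r.
      apply Rmult_le_pos. apply pos_INR. unfold R1. apply Rmult_le_pos. apply pow_le; lra.
      left; apply exp_pos. lra. }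
  destruct H1 as [I1 [HI1 BI1]].
  set (w := fun i => A ^ (J + i) / INR (fact (J + i))).
  assert (Hw : forall i, 0 <= w i) by (intros i; unfold w; apply pow_fact_nonneg; lra).
  assert (Hal : forall i, 2 <= INR (J + i) - s).
  { intros i. rewrite plus_INR. assert (0 <= INR i) by apply pos_INR. lra. }
  set (rho := Cmod (vline x y)).
  assert (Hrho1 : 28 * x <= rho).
  { destruct (Cmod_vline_ge x y) as [_ G]. rewrite Rabs_pos_eq in G by lra. exact G. }
  assert (Hrho2 : rho <= 29 * x).
  { unfold rho, vline. apply Rle_trans with (1 := Cmod_triangle _ _).
    rewrite Cmod_mult, Cmod_Ci, !Cmod_R, !Rabs_pos_eq by lra. unfold y. lra. }
  set (ti := fun i => Cint (term x n (J + i)) (- y) y).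
  assert (Hti : forall i, is_Cint (term x n (J + i)) (- y) y (ti i) /\
    Cmod (ti i - RtoC (2 * PI * bterm A s n (J + i))) <=
    w i * (196 * exp v * (Rpower (rho / 7) (2 - (INR (J + i) - s)) / y))).
  { intros i. destruct (laplace_inversion_scaled (INR (J + i) - s) x y n (Hal i) Hx Hy ltac:(lra))
      as [l [Hl Bl]].
    apply (is_Cint_scal (RtoC (w i))) in Hl.
    assert (Hl2 : is_Cint (term x n (J + i)) (- y) y (RtoC (w i) * l)%C).
    { apply is_Cint_ext with (3 := Hl). lra. intros t _. unfold term, w. f_equal. f_equal. f_equal. ring. }
    unfold ti. rewrite (is_Cint_Cint _ _ _ _ Hl2). split; auto.
    replace (RtoC (w i) * l - RtoC (2 * PI * bterm A s n (J + i)))%C with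
      (RtoC (w i) * (l - RtoC (2 * PI * (Rpower n (INR (J + i) - s - 1) * rGamma (INR (J + i) - s)))))%C.
    - rewrite Cmod_mult, Cmod_R, Rabs_pos_eq by auto. apply Rmult_le_compat_l; auto.
    - unfold bterm. fold (w i). rewrite !RtoC_mult. ring. }
  assert (Ew : forall (r : R), 0 < r -> ex_series (fun i => w i * / r ^ (J + i)) /\
     Series (fun i => w i * / r ^ (J + i)) <= exp (A / r)).
  { intros r Hr.
    assert (Hg : forall j, 0 <= (A / r) ^ j / INR (fact j)).
    { intros j. apply pow_fact_nonneg. left; apply Rdiv_lt_0_compat; auto. }
    assert (E := is_series_exp (A / r)).
    assert (E2 : ex_series (fun j => (A / r) ^ j / INR (fact j))) by (eexists; exact E).
    assert (Ee2 : forall i, (A / r) ^ (J + i) / INR (fact (J + i)) = w i * / r ^ (J + i)).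
    { intros i. unfold w, Rdiv. rewrite Rpow_mult_distr, pow_inv. ring. }
    split.
    - apply ex_series_ext with (1 := Ee2).
      apply (ex_series_shift (fun j => (A / r) ^ j / INR (fact j)) J E2).
    - rewrite <- (Series_ext _ _ Ee2), <- (is_series_unique _ _ E).
      destruct J as [|J'].
      + simpl. apply Rle_refl.
      + rewrite (Series_incr_n (fun j => (A / r) ^ j / INR (fact j)) (S J')); auto; try lia.
        assert (0 <= sum_f_R0 (fun j => (A / r) ^ j / INR (fact j)) (pred (S J'))).
        { apply cond_pos_sum. auto. }
        lra. }
  (* For these indices s - j is negative, so the modulus is largest at t = 0; this bounds the terms
     on the whole line at once. *)
  destruct (is_Cint_series (fun i => term x n (J + i)) ti
    (fun i => Rpower x s * exp v * (w i * / x ^ (J + i))) (- y) y) as [L [L1 L2]].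
  { intros i t. rewrite Cmod_term by auto. fold (w i).
    destruct (Cmod_vline_ge x t) as [G1 _].
    replace (Rpower x s * exp v * (w i * / x ^ (J + i))) with
      (w i * (Rpower x (s - INR (J + i)) * exp v)) by (rewrite Rpower_minus_INR by auto; unfold Rdiv; ring).
    apply Rmult_le_compat_l; auto. fold v. apply Rmult_le_compat_r. left; apply exp_pos.
    specialize (Hal i). apply Rpower_le_neg; auto. lra. }
  { apply ex_series_Rscal. now apply Ew. }
  { intros i. apply Hti. }
  set (er := fun i => w i * (196 * exp v * (Rpower (rho / 7) (2 - (INR (J + i) - s)) / y))).
  assert (Hr7 : 0 < rho / 7) by lra.
  assert (Eer : forall i, er i = (196 * exp v * (Rpower (rho / 7) (2 + s) / y)) *
     (w i * / (rho / 7) ^ (J + i))).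
  { intros i. unfold er. replace (2 - (INR (J + i) - s)) with (2 + s - INR (J + i)) by ring.
    rewrite Rpower_minus_INR by auto. unfold Rdiv. ring. }
  destruct (Ew (rho / 7) Hr7) as [Ew1 Ew2].
  assert (Her : ex_series er).
  { apply ex_series_ext with (1 := fun i => eq_sym (Eer i)). now apply ex_series_Rscal. }
  (* Here the arc length 28 x pays off: rho/7 >= 4x, so the sum over j of A^j / j! (rho/7)^{-j} is
     at most e^{A/(4x)} = e^{v/4}. *)
  assert (HerS : Series er <= R3 * e54).
  { rewrite (Series_ext _ _ Eer), Series_scal_l.
    assert (Hexp : exp (A / (rho / 7)) <= exp (v / 4)).
    { apply exp_le. rewrite <- HvA. replace (A / (rho / 7)) with (7 * A * / rho) by (field; lra).
      replace (A / x / 4) with (7 * A * / (28 * x)) by (field; lra).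
      apply Rmult_le_compat_l. lra. apply Rinv_le_contravar; lra. }
    assert (Hrp : Rpower (rho / 7) (2 + s) / y <= 5 / 28 * Rpower (5 * (A + 1)) (1 + s)).
    { replace (2 + s) with (1 + (1 + s)) by ring. rewrite Rpower_plus, Rpower_1 by auto.
      apply Rmult_le_reg_r with y; auto.
      replace (rho / 7 * Rpower (rho / 7) (1 + s) / y * y) with
        (rho / 7 * Rpower (rho / 7) (1 + s)) by (field; lra).
      replace (5 / 28 * Rpower (5 * (A + 1)) (1 + s) * y) with
        (5 * x * Rpower (5 * (A + 1)) (1 + s)) by (unfold y; field).
      apply Rmult_le_compat; try lra. left; apply exp_pos. apply Rpower_le_pos; lra. }
    assert (Hev := exp_pos v).
    assert (Hp0 : 0 <= Rpower (rho / 7) (2 + s) / y)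
      by (apply Rdiv_le_0_compat; auto; left; apply exp_pos).
    replace (R3 * e54) with (196 * exp v * (5 / 28 * Rpower (5 * (A + 1)) (1 + s)) * exp (v / 4))
      by (rewrite Ee; unfold R3; field).
    apply Rmult_le_compat.
    - apply Rmult_le_pos; lra.
    - apply Rle_trans with (sum_n (fun i => w i * / (rho / 7) ^ (J + i)) 0).
      rewrite sum_O. apply Rmult_le_pos; auto. left; apply Rinv_0_lt_compat, pow_lt; auto.
      apply sum_n_le_Series; auto. intros i. apply Rmult_le_pos; auto.
      left; apply Rinv_0_lt_compat, pow_lt; auto.
    - apply Rmult_le_compat_l; lra.
    - lra. }
  (* Summability of the Bessel terms is inherited from the integrals that they approximate; no
     growth estimate for [rGamma] enters. *)
  assert (Hbt : forall i, Cmod (RtoC (2 * PI * bterm A s n (J + i))) <=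
     2 * ((y - - y) * (Rpower x s * exp v * (w i * / x ^ (J + i)))) + er i).
  { intros i. destruct (Hti i) as [T1 T2]. fold (er i) in T2.
    assert (T3 : Cmod (ti i) <= 2 * ((y - - y) * (Rpower x s * exp v * (w i * / x ^ (J + i))))).
    { apply (is_Cint_le_const (term x n (J + i))); auto. lra.
      intros t _. rewrite Cmod_term by auto. fold (w i). destruct (Cmod_vline_ge x t) as [G1 _].
      replace (Rpower x s * exp v * (w i * / x ^ (J + i))) with
        (w i * (Rpower x (s - INR (J + i)) * exp v)) by (rewrite Rpower_minus_INR by auto; unfold Rdiv; ring).
      apply Rmult_le_compat_l; auto. fold v. apply Rmult_le_compat_r. left; apply exp_pos.
      specialize (Hal i). apply Rpower_le_neg; auto. lra. }
    assert (T := Cmod_triangle (ti i) (- (ti i - RtoC (2 * PI * bterm A s n (J + i))))).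
    rewrite Cmod_opp in T.
    replace (ti i + - (ti i - RtoC (2 * PI * bterm A s n (J + i))))%C with
      (RtoC (2 * PI * bterm A s n (J + i))) in T by ring. lra. }
  assert (Ebt : ex_series (fun i => Cmod (RtoC (2 * PI * bterm A s n (J + i))))).
  { apply ex_series_Cmod_le with (1 := Hbt).
    apply (ex_series_plus (V := R_NormedModule)); auto.
    apply ex_series_Rscal. apply ex_series_Rscal. apply ex_series_Rscal. now apply Ew. }
  assert (Eb : ex_series (fun j => Cmod (RtoC (bterm A s n j)))).
  { apply (ex_series_incr_n (V := R_NormedModule) _ J).
    apply ex_series_ext with (fun i => / (2 * PI) * Cmod (RtoC (2 * PI * bterm A s n (J + i)))).
    - intros i. change (/ (2 * PI) * Cmod (RtoC (2 * PI * bterm A s n (J + i))) =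
        Cmod (RtoC (bterm A s n (J + i)))).
      rewrite RtoC_mult, Cmod_mult, (Cmod_R (2 * PI)), Rabs_pos_eq by lra. field. lra.
    - now apply ex_series_Rscal. }
  exists (I1 + L)%C. split; [|split].
  - apply is_Cint_ext with (3 := is_Cint_plus _ _ _ _ _ _ HI1 L2). lra.
    intros t _. destruct (integrand_series x n t Hx) as [S1 S2]. rewrite <- S2.
    now rewrite (CSeries_split _ J S1).
  - rewrite RtoC_mult, <- CSeries_RtoC, (CSeries_split _ J Eb).
    set (c1 := csum (fun j => RtoC (bterm A s n j)) J).
    set (c2 := CSeries (fun i => RtoC (bterm A s n (J + i)))).
    replace (I1 + L - RtoC (2 * PI) * (c1 + c2))%C with
      (I1 + - (RtoC (2 * PI) * c1) + (L - RtoC (2 * PI) * c2))%C by ring.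
    assert (Bc1 : Cmod c1 <= R2 * e54).
    { assert (HJ0 : J = S (pred J)).
      { destruct J as [|J']; auto. simpl in HJ. lra. }
      assert (Hbj : forall j, Cmod (RtoC (bterm A s n j)) <= Gj j * e54).
      { intros j. rewrite Cmod_R. unfold bterm, Gj. rewrite !Rabs_mult.
        rewrite (Rabs_pos_eq (A ^ j / INR (fact j))) by (apply pow_fact_nonneg; lra).
        rewrite (Rabs_pos_eq (Rpower n _)) by (left; apply exp_pos).
        assert (Hnj : Rpower n (INR j - s - 1) <= n ^ j).
        { rewrite <- Rpower_pow by lra. apply Rle_Rpower; lra. }
        assert (Hv2 : A ^ j * n ^ j = v ^ (2 * j)).
        { rewrite <- Rpow_mult_distr, pow_mult. f_equal. unfold v. rewrite HAx. ring. }
        assert (Hvb := pow_fact_scaled_le v 4 (2 * j) (Rlt_le _ _ Hv) ltac:(lra)).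
        assert (Hf2 := INR_fact_lt_0 (2 * j)). assert (Hf := INR_fact_lt_0 j).
        assert (Hf1 : 1 <= INR (fact j)).
        { assert (H := lt_O_fact j). apply (le_INR 1). lia. }
        assert (Hv3 : v ^ (2 * j) <= 16 ^ j * INR (fact (2 * j)) * exp (v / 4)).
        { replace (16 ^ j) with (4 ^ (2 * j)) by (rewrite pow_mult; replace (4 ^ 2) with 16 by ring; reflexivity).
          apply Rmult_le_compat_r with (r := INR (fact (2 * j))) in Hvb; [|lra].
          unfold Rdiv in Hvb at 1. rewrite Rmult_assoc, Rinv_l, Rmult_1_r in Hvb by lra. lra. }
        assert (HAj : A ^ j / INR (fact j) <= A ^ j).
        { assert (Hp : 0 < A ^ j) by now apply pow_lt.
          apply Rmult_le_reg_r with (INR (fact j)); auto.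
          unfold Rdiv. rewrite Rmult_assoc, Rinv_l, Rmult_1_r by lra. nra. }
        assert (He4 : exp (v / 4) <= e54) by (unfold e54; apply exp_le; lra).
        assert (Hg := Rabs_pos (rGamma (INR j - s))).
        replace (A ^ j / INR (fact j) * (Rpower n (INR j - s - 1) * Rabs (rGamma (INR j - s)))) with
          (Rabs (rGamma (INR j - s)) * (A ^ j / INR (fact j) * Rpower n (INR j - s - 1))) by ring.
        rewrite Rmult_assoc. apply Rmult_le_compat_l; auto.
        apply Rle_trans with (A ^ j * n ^ j).
        - apply Rmult_le_compat; auto. apply pow_fact_nonneg; lra. left; apply exp_pos.
        - rewrite Hv2. apply Rle_trans with (1 := Hv3). apply Rmult_le_compat_l; auto.
          apply Rmult_le_pos. apply pow_le; lra. lra. }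
      unfold c1, R2. rewrite HJ0 at 1.
      apply Rle_trans with (sum_n (fun j => Gj j * e54) (pred J)).
      - apply Cmod_csum_le. intros; apply Hbj.
      - right. apply (sum_n_mult_r (K := R_Ring) e54 Gj (pred J)). }
    assert (Bc2 : Cmod (L - RtoC (2 * PI) * c2) <= R3 * e54).
    { assert (E2 : ex_series (fun i => Cmod (RtoC (bterm A s n (J + i)))))
        by (apply (ex_series_shift _ J Eb)).
      assert (EL : (L - RtoC (2 * PI) * c2)%C =
        CSeries (fun i => ti i - RtoC (2 * PI * bterm A s n (J + i)))%C).
      { symmetry. apply Ccv_csum_CSeries.
        apply Ccv_ext with (fun N => csum ti N - RtoC (2 * PI) *
          csum (fun i => RtoC (bterm A s n (J + i))) N)%C.
        - intros N. rewrite <- csum_scal.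
          rewrite <- csum_minus. apply csum_ext. intros i _.
          now rewrite (RtoC_mult (2 * PI) (bterm A s n (J + i))).
        - apply Ccv_minus; auto. apply Ccv_scal. exact (CSeries_cv _ E2). }
      rewrite EL. apply Rle_trans with (2 := HerS). apply Cmod_CSeries_le; auto.
      intros i. apply Hti. }
    apply Rle_trans with (1 := Cmod_triangle _ _).
    assert (T := Cmod_triangle I1 (- (RtoC (2 * PI) * c1))).
    rewrite Cmod_opp, Cmod_mult, Cmod_R, Rabs_pos_eq in T by lra.
    fold v. fold e54. nra.
  - apply (ex_series_le (V := R_CompleteNormedModule)) with (2 := Eb). intros j. rewrite Cmod_R. apply Rle_refl.
Qed.

End BesselIntegral.

(** * The generating function of a row of coefficients *)

(* With tau = i z / (2 pi) and w = u / (2 pi i), the powers of q and zeta are exponentials. *)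
Lemma qpow_tau (al : R) (z : C) : qpow al (RtoC (/ (2 * PI)) * Ci * z) = Cexp (- (RtoC al * z)).
Proof.
  assert (HPI := PI_RGT_0). unfold qpow. f_equal. destruct z as [x y].
  apply Ceq; simpl; field; lra.
Qed.

Lemma qpow_w (al : R) (u : C) : qpow al (RtoC (/ (2 * PI)) * - Ci * u) = Cexp (RtoC al * u).
Proof.
  assert (HPI := PI_RGT_0). unfold qpow. f_equal. destruct u as [x y].
  apply Ceq; simpl; field; lra.
Qed.

Definition zmul (m : Z) (u : C) : C := (RtoC (IZR m) * u)%C.

Lemma Cpowz_Cexp (u : C) (m : Z) : Cpowz (Cexp u) m = Cexp (zmul m u).
Proof.
  unfold Cpowz, zmul. destruct (Z.leb_spec 0 m) as [H|H].
  - rewrite <- Cexp_INR. f_equal. f_equal. f_equal. rewrite INR_IZR_INZ. f_equal. lia.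
  - rewrite <- Cexp_INR, <- Cexp_opp. f_equal.
    rewrite INR_IZR_INZ, Z2Nat.id, opp_IZR, RtoC_opp by lia. ring.
Qed.

(** With zeta = e^u, [logsum z u] is the logarithm of the product of 1 - zeta q^n over n >= 1;
    additive notation makes quotients of such products linear expressions. *)
Definition logu (z u : C) (n : nat) : C := Clog (1 - Cexp (u - mul_nat (S n) z)).
Definition logsum (z u : C) : C := CSeries (logu z u).

Lemma logu_small (z u : C) (n : nat) : Re u < Re z -> 0 < Re z ->
  Cmod (Cexp (u - mul_nat (S n) z)) <= exp (- (Re z - Re u)) * exp (- (INR n * Re z)) /\
  Cmod (Cexp (u - mul_nat (S n) z)) <= exp (- (Re z - Re u)) /\ exp (- (Re z - Re u)) < 1.
Proof.
  intros Hu Hz. rewrite Cmod_Cexp.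
  assert (E : Re (u - mul_nat (S n) z) = - (Re z - Re u) + - (INR n * Re z)).
  { change (Re (u - mul_nat (S n) z)) with (Re u - Re (mul_nat (S n) z)).
    rewrite Re_mul_nat, S_INR. ring. }
  rewrite E, exp_plus. assert (Hn := pos_INR n).
  assert (H1 : exp (- (INR n * Re z)) <= 1) by (rewrite <- exp_0; apply exp_le; nra).
  assert (H2 := exp_pos (- (Re z - Re u))).
  assert (H3 : exp (- (Re z - Re u)) < 1)
    by (apply Rlt_le_trans with (exp 0); [apply exp_increasing; lra | rewrite exp_0; lra]).
  repeat split; try lra. nra.
Qed.

Lemma logu_le (z u : C) (n : nat) : Re u < Re z -> 0 < Re z ->
  Cmod (logu z u n) <= 2 / (1 - exp (- (Re z - Re u))) * exp (- (INR n * Re z)).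
Proof.
  intros Hu Hz. destruct (logu_small z u n Hu Hz) as [H1 [H2 H3]].
  unfold logu. apply Rle_trans with (1 := Clog_1_minus_le _ _ H3 H2).
  apply Rmult_le_compat_l. apply Rdiv_le_0_compat; lra.
  apply Rle_trans with (1 := H1). assert (H4 := exp_pos (- (INR n * Re z))). nra.
Qed.

Lemma logsum_cv (z u : C) : Re u < Re z -> 0 < Re z ->
  ex_series (fun n => Cmod (logu z u n)) /\ Ccv (csum (logu z u)) (logsum z u).
Proof.
  intros Hu Hz.
  assert (E : ex_series (fun n => Cmod (logu z u n))).
  { eapply ex_series_Cmod_le. intros n; now apply logu_le.
    apply ex_series_Rscal. now apply ex_series_exp_geom. }
  split; auto. now apply CSeries_cv.
Qed.

Lemma Cexp_logu (z u : C) (n : nat) : Re u < Re z -> 0 < Re z ->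
  Cexp (logu z u n) = (1 - Cexp (u - mul_nat (S n) z))%C.
Proof.
  intros Hu Hz. destruct (logu_small z u n Hu Hz) as [_ [H2 H3]].
  apply Cexp_Clog. assert (H := Re_1_minus_ge _ _ H2). lra.
Qed.

Lemma logsum_0 (z : C) : logsum z 0 = (- Plog z)%C.
Proof.
  unfold Plog. replace (- - CSeries (logq z))%C with (CSeries (logq z)) by ring.
  apply CSeries_ext. intros n. unfold logu, logq. f_equal. f_equal. f_equal. ring.
Qed.

Lemma Cprod_Cexp (f : nat -> C) (g : nat -> C) (N : nat) :
  (forall n, f (S n) = Cexp (g n)) -> Cprod f N = Cexp (csum g N).
Proof.
  intros H. induction N as [|N IH]; simpl. now rewrite Cexp_0.
  now rewrite IH, H, Cexp_plus.
Qed.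

Lemma Cexp_shift (u z : C) (n : nat) :
  Cexp (u - mul_nat n z) = (Cexp u * Cpow (Cexp (- z)) n)%C.
Proof. unfold Cminus. now rewrite Cexp_plus, Cexp_mul_nat. Qed.

Lemma eta_value (z : C) : 0 < Re z ->
  eta (RtoC (/ (2 * PI)) * Ci * z) = Cexp (- (RtoC (1 / 24) * z) + logsum z 0).
Proof.
  intros Hz. unfold eta. rewrite !qpow_tau, Cexp_plus. f_equal.
  apply Ccv_CLim_seq. destruct (logsum_cv z 0 Hz Hz) as [_ H].
  apply Ccv_ext with (fun N => Cexp (csum (logu z 0) N)). 2: now apply Ccv_Cexp.
  intros N. symmetry. apply Cprod_Cexp. intros n. rewrite Cexp_logu by auto.
  rewrite Cexp_shift, Cexp_0. replace (RtoC 1 * z)%C with z by ring. ring.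
Qed.

(** The third product starts at q^0. Its first factor 1 - 1/zeta need not lie in the right
    half-plane and carries the zero at zeta = 1, so it stays outside the exponential; hence its
    logarithms number one less than those of the other two products. *)
Lemma theta1_value (z u : C) : 0 < Re z -> Re u < Re z -> - Re u < Re z ->
  theta1 (RtoC (/ (2 * PI)) * - Ci * u) (RtoC (/ (2 * PI)) * Ci * z) =
  (Ci * Cexp (RtoC (1 / 2) * u) * Cexp (- (RtoC (1 / 8) * z)) *
   (Cexp (logsum z 0 + logsum z u + logsum z (- u)) * (1 - / Cexp u)))%C.
Proof.
  intros Hz Hu1 Hu2. unfold theta1. cbv zeta. rewrite !qpow_tau, !qpow_w. f_equal.
  replace (RtoC 1 * z)%C with z by ring. replace (RtoC 1 * u)%C with u by ring.
  assert (Hm : Re (- u) < Re z) by exact Hu2.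
  apply Ccv_CLim_seq. apply Ccv_incr_1.
  destruct (logsum_cv z 0 Hz Hz) as [_ H0]. destruct (logsum_cv z u Hu1 Hz) as [_ H1].
  destruct (logsum_cv z (- u) Hm Hz) as [_ H2].
  apply Ccv_ext with (fun N => Cexp (csum (logu z 0) (S N) + csum (logu z u) (S N)
     + csum (logu z (- u)) N) * (1 - / Cexp u))%C.
  - induction n as [|n IH].
    + simpl. rewrite !Cplus_0_l, Cplus_0_r, Cexp_plus, !Cexp_logu by auto.
      rewrite !Cexp_shift, Cexp_0. simpl. ring.
    + change (Cprod ?f (S (S n))) with (Cprod f (S n) * f (S (S n)))%C. cbv beta.
      rewrite <- IH. rewrite (csum_S (logu z 0) (S n)), (csum_S (logu z u) (S n)),
        (csum_S (logu z (- u)) n).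
      set (c0 := csum (logu z 0) (S n)). set (c1 := csum (logu z u) (S n)).
      set (c2 := csum (logu z (- u)) n).
      replace (c0 + logu z 0 (S n) + (c1 + logu z u (S n)) + (c2 + logu z (- u) n))%C with
        ((c0 + c1 + c2) + (logu z 0 (S n) + logu z u (S n) + logu z (- u) n))%C by ring.
      rewrite (Cexp_plus (c0 + c1 + c2)), (Cexp_plus (logu z 0 (S n) + logu z u (S n))),
        (Cexp_plus (logu z 0 (S n))), !Cexp_logu by auto.
      rewrite !Cexp_shift, Cexp_0, (Cexp_opp u).
      replace (S (S n) - 1)%nat with (S n) by lia. ring.
  - apply Ccv_mult. 2: apply Ccv_const. apply Ccv_Cexp. apply Ccv_plus; auto.
    apply Ccv_plus; now apply Ccv_incr_1.
Qed.

(** The powers of q cancel, k/24 = 1/8 + (k - 3)/24. The Euler product has exponent -1 - (k - 3) = 2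
    - k, split into (q)^{-k} and the factor (q)^2 that belongs to the zeta-dependent part. *)
Lemma expansion_value (k : nat) (z u : C) : 0 < Re z -> Re u < Re z -> - Re u < Re z ->
  Cexp u <> 1 ->
  (qpow (INR k / 24) (RtoC (/ (2 * PI)) * Ci * z) *
   (qpow (1 / 2) (RtoC (/ (2 * PI)) * - Ci * u) - qpow (- (1 / 2)) (RtoC (/ (2 * PI)) * - Ci * u)) *
   h k (RtoC (/ (2 * PI)) * - Ci * u) (RtoC (/ (2 * PI)) * Ci * z))%C =
  Cexp (RtoC (INR k) * Plog z + (RtoC 2 * logsum z 0 - logsum z u - logsum z (- u))).
Proof.
  intros Hz Hu1 Hu2 Hn. unfold h. rewrite theta1_value, eta_value, Cpowz_Cexp by auto.
  rewrite !qpow_w, qpow_tau.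
  set (L := (logsum z 0 + logsum z u + logsum z (- u))%C).
  assert (Nu := Cexp_neq_0 u).
  assert (N1 : (1 - / Cexp u)%C <> 0).
  { intros E. apply Hn. replace (Cexp u) with (Cexp u * (1 - / Cexp u) + 1)%C by (field; auto).
    rewrite E. ring. }
  replace (Cexp (RtoC (- (1 / 2)) * u)) with (Cexp (RtoC (1 / 2) * u) / Cexp u)%C.
  2: { rewrite <- Cexp_minus. f_equal. apply Ceq; simpl; field. }
  assert (Ni : Ci <> 0) by (intros E; injection E; lra).
  assert (Ne : forall y, Cexp y <> 0) by apply Cexp_neq_0.
  transitivity (Cexp (- (RtoC (INR k / 24) * z)) /
    (Cexp (- (RtoC (1 / 8) * z)) * Cexp L *
     Cexp (zmul (Z.of_nat k - 3) (- (RtoC (1 / 24) * z) + logsum z 0))))%C.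
  { field. repeat split; auto. replace (Cexp u - 1)%C with (Cexp u * (1 - / Cexp u))%C by (field; auto).
    now apply Cmult_neq_0. }
  rewrite <- !Cexp_plus, <- Cexp_minus. f_equal. unfold zmul, L.
  rewrite minus_IZR, <- INR_IZR_INZ, logsum_0. rewrite RtoC_minus.
  unfold Rdiv. rewrite !RtoC_mult, !(RtoC_inv 24), (RtoC_inv 8) by lra. field.
Qed.

(** * Regrouping the double series into a Laurent series in zeta *)

Section Pairs.

Context {G : AbelianMonoid}.

(** Folds a two-sided series at 0: symmetric sums over |m| <= N become partial sums of an ordinary
    series. It is generic so that it applies to moduli, to coefficients and to whole rows alike. *)
Definition zpair (g : Z -> G) (j : nat) : G :=
  match j with
  | O => g 0%Z
  | S i => plus (g (Z.of_nat (S i))) (g (- Z.of_nat (S i))%Z)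
  end.

Lemma sum_n_zpair (g : Z -> G) (N : nat) :
  sum_n (fun j => g (Z.of_nat j - Z.of_nat N)%Z) (2 * N) = sum_n (zpair g) N.
Proof.
  revert g. induction N as [|N IH]; intros g.
  - simpl. rewrite !sum_O. reflexivity.
  - replace (2 * S N)%nat with (S (S (2 * N))) by lia.
    rewrite sum_Sn, (sum_Sn (zpair g)). unfold sum_n at 1. rewrite sum_Sn_m by lia.
    rewrite <- (sum_n_m_S _ 0 (2 * N)).
    change (sum_n_m (fun n => g (Z.of_nat (S n) - Z.of_nat (S N))%Z) 0 (2 * N)) with
      (sum_n (fun n => g (Z.of_nat (S n) - Z.of_nat (S N))%Z) (2 * N)).
    rewrite (sum_n_ext _ (fun j => g (Z.of_nat j - Z.of_nat N)%Z)).
    2: { intros n. f_equal. lia. }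
    rewrite IH. unfold zpair at 2.
    replace (Z.of_nat 0 - Z.of_nat (S N))%Z with (- Z.of_nat (S N))%Z by lia.
    replace (Z.of_nat (S (S (2 * N))) - Z.of_nat (S N))%Z with (Z.of_nat (S N)) by lia.
    rewrite <- plus_assoc, plus_comm, <- plus_assoc. reflexivity.
Qed.

Lemma square_sum_zpair (f : Z -> nat -> G) (N : nat) :
  square_sum f N = sum_n (fun j => sum_n (fun n => zpair (fun m => f m n) j) N) N.
Proof.
  unfold square_sum.
  transitivity (sum_n (fun n => sum_n (fun j => zpair (fun m => f m n) j) N) N).
  - apply sum_n_ext. intros n. apply (sum_n_zpair (fun m => f m n)).
  - apply sum_n_switch.
Qed.

End Pairs.

Lemma filterlim_Ccv (u : nat -> C) (l : C) :
  filterlim u eventually (locally l) -> Ccv u l.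
Proof.
  intros H. apply Ccv_Re_Im; apply is_lim_seq_spec; intros eps.
  - destruct (proj1 (filterlim_locally (U := C_UniformSpace) u l) H eps) as [N HN].
    exists N. intros n Hn. apply (HN n Hn).
  - destruct (proj1 (filterlim_locally (U := C_UniformSpace) u l) H eps) as [N HN].
    exists N. intros n Hn. apply (HN n Hn).
Qed.

(** [square_sums_cv] is used twice on the folded array: with the moduli [Pc], to obtain absolute
    convergence of rows and of their sums, and with the terms [H] themselves, to identify the
    value. *)
Lemma double_sum_rows (f : Z -> nat -> C) (s : C) : is_double_sum f s ->
  (forall m, ex_series (fun n => Cmod (f m n))) /\
  ex_series (fun j => zpair (fun m => Series (fun n => Cmod (f m n))) j) /\
  CSeries (zpair (fun m => CSeries (f m))) = s.
Proof.
  intros [[B HB] Hl].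
  set (Pc := fun j n => zpair (fun m => Cmod (f m n)) j : R).
  assert (HPc : forall j n, 0 <= Pc j n).
  { intros [|i] n; unfold Pc, zpair. apply Cmod_ge_0.
    apply Rplus_le_le_0_compat; apply Cmod_ge_0. }
  assert (Hmod : forall j n, Cmod (RtoC (Pc j n)) = Pc j n)
    by (intros; rewrite Cmod_R; now apply Rabs_pos_eq).
  destruct (square_sums_cv (fun j n => RtoC (Pc j n)) B) as [A1 [A2 _]].
  { intros N. apply Rle_trans with (2 := HB N). rewrite square_sum_zpair. right.
    apply sum_n_ext. intros j. apply sum_n_ext. intros n. apply Hmod. }
  assert (A1' : forall j, ex_series (Pc j)).
  { intros j. apply ex_series_ext with (2 := A1 j). intros n. apply Hmod. }
  assert (R0 : forall m, ex_series (fun n => Cmod (f m n))).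
  { intros m. destruct (Z_lt_le_dec m 0) as [Hm|Hm].
    - apply ex_series_Cmod_le with (2 := A1' (Z.abs_nat m)). intros n.
      unfold Pc. destruct (Z.abs_nat m) as [|i] eqn:E. lia. unfold zpair.
      replace (- Z.of_nat (S i))%Z with m by lia.
      assert (H := Cmod_ge_0 (f (Z.of_nat (S i)) n)). match goal with |- context [plus ?a ?b] => change (plus a b) with (Rplus a b) end. lra.
    - apply ex_series_Cmod_le with (2 := A1' (Z.abs_nat m)). intros n.
      unfold Pc. destruct (Z.abs_nat m) as [|i] eqn:E; unfold zpair.
      replace 0%Z with m by lia. lra.
      replace (Z.of_nat (S i)) with m by lia.
      assert (H := Cmod_ge_0 (f (- m)%Z n)). match goal with |- context [plus ?a ?b] => change (plus a b) with (Rplus a b) end. lra. }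
  split; auto.
  assert (Esum : forall j, Series (Pc j) = zpair (fun m => Series (fun n => Cmod (f m n))) j).
  { intros [|i]; unfold Pc, zpair. reflexivity.
    apply Series_plus; apply R0. }
  split.
  - apply ex_series_ext with (2 := A2). intros j.
    rewrite <- Esum. apply Series_ext. intros n. apply Hmod.
  - set (H := fun j n => zpair (fun m => f m n) j : C).
    assert (HH : forall j n, Cmod (H j n) <= Pc j n).
    { intros [|i] n; unfold H, Pc, zpair. lra. apply Cmod_triangle. }
    assert (Hle : forall (u v : nat -> R) N, (forall i, u i <= v i) -> sum_n u N <= sum_n v N).
    { intros u v N Hu. induction N. rewrite !sum_O; auto. rewrite !sum_Sn. unfold plus; simpl.
      apply Rplus_le_compat; auto. }
    destruct (square_sums_cv H B) as [_ [_ A3]].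
    { intros N. apply Rle_trans with (2 := HB N). rewrite square_sum_zpair.
      apply Hle. intros j. apply Hle. intros n. apply HH. }
    apply Ccv_unique with (fun N => csum (fun m => csum (H m) (S N)) (S N)).
    + replace (CSeries (zpair (fun m => CSeries (f m)))) with (CSeries (fun j => CSeries (H j))); auto.
      apply CSeries_ext. intros [|i]; unfold H, zpair. reflexivity.
      apply CSeries_plus; apply R0.
    + apply filterlim_Ccv in Hl. apply Ccv_ext with (2 := Hl). intros N.
      rewrite square_sum_zpair. rewrite csum_sum_n. apply csum_ext. intros j _.
      now rewrite csum_sum_n.
Qed.

Definition row_sum (a : Z -> nat -> Z) (z : C) (m : Z) : C :=
  CSeries (fun n => RtoC (IZR (a m n)) * Cexp (- mul_nat n z))%C.

Lemma laurent_expansion (k : nat) (a : Z -> nat -> Z) (z u : C) :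
  is_expansion_coeffs k a -> 0 < Re z -> Re u < Re z -> - Re u < Re z -> Cexp u <> 1 ->
  (forall m, ex_series (fun n => Cmod (RtoC (IZR (a m n)) * Cexp (- mul_nat n z)))) /\
  ex_series (fun j => zpair (fun m => Cmod (row_sum a z m * Cexp (zmul m u))) j) /\
  CSeries (zpair (fun m => row_sum a z m * Cexp (zmul m u))%C) =
  Cexp (RtoC (INR k) * Plog z + (RtoC 2 * logsum z 0 - logsum z u - logsum z (- u))).
Proof.
  intros ha Hz Hu1 Hu2 Hn. assert (HPI := PI_RGT_0).
  assert (Hi : 0 < / (2 * PI)) by (apply Rinv_0_lt_compat; lra).
  assert (H1 : forall y : C, (RtoC 1 * y)%C = y) by (intros; ring).
  assert (D := ha (RtoC (/ (2 * PI)) * - Ci * u)%C (RtoC (/ (2 * PI)) * Ci * z)%C).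
  rewrite expansion_value in D by auto.
  rewrite !qpow_w, !qpow_tau, !H1 in D.
  specialize (D ltac:(simpl; unfold Re in Hz; nra)).
  rewrite <- Cexp_opp, <- !Cexp_plus, !Cmod_Cexp in D.
  change (Re (u + - z)%C) with (Re u + - Re z) in D.
  change (Re (- u + - z)%C) with (- Re u + - Re z) in D.
  assert (Hlt : forall y, y < 0 -> exp y < 1).
  { intros y Hy. rewrite <- exp_0. now apply exp_increasing. }
  specialize (D (Hlt (Re u + - Re z) ltac:(lra)) (Hlt (- Re u + - Re z) ltac:(lra)) Hn).
  assert (Ef : forall m n, (RtoC (IZR (a m n)) * Cpowz (Cexp u) m * Cpow (Cexp (- z)) n)%C =
    (Cexp (zmul m u) * (RtoC (IZR (a m n)) * Cexp (- mul_nat n z)))%C).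
  { intros m n. rewrite Cpowz_Cexp, Cexp_mul_nat. ring. }
  destruct (double_sum_rows _ _ D) as [A1 [A2 A3]].
  assert (B1 : forall m, ex_series (fun n => Cmod (RtoC (IZR (a m n)) * Cexp (- mul_nat n z)))).
  { intros m. apply ex_series_ext with (fun n => / Cmod (Cexp (zmul m u)) *
      Cmod (RtoC (IZR (a m n)) * Cpowz (Cexp u) m * Cpow (Cexp (- z)) n)).
    - intros n. rewrite Ef. rewrite (Cmod_mult (Cexp (zmul m u))). change (@eq R
        (/ Cmod (Cexp (zmul m u)) * (Cmod (Cexp (zmul m u)) * Cmod (RtoC (IZR (a m n)) * Cexp (- mul_nat n z))))
        (Cmod (RtoC (IZR (a m n)) * Cexp (- mul_nat n z)))).
      field. apply Rgt_not_eq. apply Cmod_gt_0. apply Cexp_neq_0.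
    - apply ex_series_Rscal. apply A1. }
  assert (Er : forall m, CSeries (fun n => RtoC (IZR (a m n)) * Cpowz (Cexp u) m * Cpow (Cexp (- z)) n)%C =
    (row_sum a z m * Cexp (zmul m u))%C).
  { intros m. rewrite (CSeries_ext _ _ (Ef m)), CSeries_scal by apply B1. unfold row_sum. ring. }
  split; auto. split.
  - apply ex_series_Rle with (2 := A2).
    assert (Hb : forall m, 0 <= Cmod (row_sum a z m * Cexp (zmul m u)) <=
      Series (fun n => Cmod (RtoC (IZR (a m n)) * Cpowz (Cexp u) m * Cpow (Cexp (- z)) n))).
    { intros m. split. apply Cmod_ge_0. rewrite <- Er. apply Cmod_CSeries_le. intros; lra. apply A1. }
    intros [|i]; unfold zpair. apply Hb.
    assert (X1 := Hb (Z.of_nat (S i))). assert (X2 := Hb (- Z.of_nat (S i))%Z).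
    repeat match goal with |- context [plus ?a ?b] => change (plus a b) with (Rplus a b) end. lra.
  - rewrite <- A3. apply CSeries_ext. intros [|i]; unfold zpair; now rewrite !Er.
Qed.

Lemma fourier_coefficient (X : Z -> C) (m : Z) :
  ex_series (zpair (fun m' => Cmod (X m'))) ->
  is_Cint (fun t => CSeries (zpair (fun m' => X m' * phase m' t)%C) * phase (- m) t)%C
    (- PI) PI (RtoC (2 * PI) * X m)%C.
Proof.
  intros HX. assert (HPI := PI_RGT_0).
  set (T := fun j t => (phase (- m) t * zpair (fun m' => X m' * phase m' t)%C j)%C).
  set (I := zpair (fun m' => X m' * (if Z.eqb (m' - m) 0 then RtoC (2 * PI) else RtoC 0))%C).
  assert (Hb : forall j t, Cmod (zpair (fun m' => X m' * phase m' t)%C j) <=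
    zpair (fun m' => Cmod (X m')) j).
  { intros [|i] t; unfold zpair. rewrite Cmod_mult, Cmod_phase. lra.
    eapply Rle_trans. apply Cmod_triangle. rewrite !Cmod_mult, !Cmod_phase, !Rmult_1_r. apply Rle_refl. }
  destruct (is_Cint_series T I (zpair (fun m' => Cmod (X m'))) (- PI) PI) as [L [L1 L2]]; auto.
  - intros j t. unfold T. rewrite Cmod_mult, Cmod_phase, Rmult_1_l. apply Hb.
  - assert (P : forall m', is_Cint (fun t => phase (- m) t * (X m' * phase m' t))%C (- PI) PI
      (X m' * (if Z.eqb (m' - m) 0 then RtoC (2 * PI) else RtoC 0))%C).
    { intros m'. apply is_Cint_ext with (fun t => X m' * phase (m' - m) t)%C. lra.
      - intros t _. unfold Z.sub. rewrite phase_add. ring.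
      - apply is_Cint_scal, phase_orthogonal. }
    intros [|i]; unfold T, I, zpair. apply P.
    apply is_Cint_ext with (fun t => phase (- m) t * (X (Z.of_nat (S i)) * phase (Z.of_nat (S i)) t) +
      phase (- m) t * (X (- Z.of_nat (S i))%Z * phase (- Z.of_nat (S i)) t))%C. lra.
    intros t _. change (@plus C_AbelianMonoid ?x ?y) with (x + y)%C. ring.
    apply is_Cint_plus; apply P.
  - assert (EL : L = (RtoC (2 * PI) * X m)%C).
    { apply Ccv_unique with (1 := L1). apply Ccv_ext_loc with (fun _ => (RtoC (2 * PI) * X m)%C).
      2: apply Ccv_const.
      exists (S (Z.abs_nat m)). intros M HM. rewrite (csum_single I (Z.abs_nat m)); try lia.
      - unfold I, zpair. destruct (Z.abs_nat m) as [|i] eqn:E.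
        + replace m with 0%Z by lia. simpl. ring.
        + change (@plus C_AbelianMonoid ?x ?y) with (x + y)%C.
          destruct (Z_lt_le_dec m 0) as [Hm|Hm].
          * replace (- Z.of_nat (S i) - m)%Z with 0%Z by lia.
            replace (Z.eqb (Z.of_nat (S i) - m) 0) with false by (symmetry; apply Z.eqb_neq; lia).
            replace (- Z.of_nat (S i))%Z with m by lia. rewrite Z.eqb_refl. ring.
          * replace (Z.eqb (- Z.of_nat (S i) - m) 0) with false by (symmetry; apply Z.eqb_neq; lia).
            replace (Z.of_nat (S i)) with m by lia. rewrite Z.sub_diag, Z.eqb_refl. ring.
      - intros i Hi. unfold I, zpair. destruct i as [|i].
        + replace (Z.eqb (0 - m) 0) with false by (symmetry; apply Z.eqb_neq; lia). ring.
        + change (@plus C_AbelianMonoid ?x ?y) with (x + y)%C.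
          replace (Z.eqb (Z.of_nat (S i) - m) 0) with false by (symmetry; apply Z.eqb_neq; lia).
          replace (Z.eqb (- Z.of_nat (S i) - m) 0) with false by (symmetry; apply Z.eqb_neq; lia).
          ring. }
    rewrite <- EL. apply is_Cint_ext with (3 := L2). lra. intros t _. unfold T.
    rewrite CSeries_scal. ring. now apply ex_series_Cmod_le with (1 := fun j => Hb j t).
Qed.

(** The crank generating function (q) / ((zeta q)(q/zeta)) times another (q), so that its value at
    zeta = 1 is 1. *)
Definition crank_fun (z u : C) : C :=
  Cexp (RtoC 2 * logsum z 0 - logsum z u - logsum z (- u)).

(** Under zeta -> zeta/q one product gains a factor and the other loses one. Both u and u - z lie in
    the annulus of convergence exactly for 0 < Re u < Re z. The denominators are multiplied out, so
    that the Laurent coefficients can be compared directly. *)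
Lemma crank_fun_shift (z u : C) : 0 < Re u -> Re u < Re z ->
  (crank_fun z (u - z) * (1 - Cexp (- u)))%C = ((1 - Cexp (u - z)) * crank_fun z u)%C.
Proof.
  intros Hu Huz. assert (Hz : 0 < Re z) by lra.
  assert (R1 : Re (u - z)%C = Re u - Re z) by reflexivity.
  assert (R2 : Re (- (u - z))%C = - (Re u - Re z)) by reflexivity.
  destruct (logsum_cv z u Huz Hz) as [E1 _].
  destruct (logsum_cv z (- (u - z))%C ltac:(rewrite R2; lra) Hz) as [E2 _].
  assert (M1 : mul_nat 1 z = z) by (unfold mul_nat; simpl; ring).
  assert (L1 : logsum z u = (Clog (1 - Cexp (u - z)) + logsum z (u - z))%C).
  { unfold logsum. rewrite (CSeries_S _ E1). f_equal.
    - unfold logu. now rewrite M1.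
    - apply CSeries_ext. intros n. unfold logu. f_equal. f_equal. f_equal.
      unfold mul_nat. rewrite (S_INR (S n)), RtoC_plus. ring. }
  assert (L2 : logsum z (- (u - z)) = (Clog (1 - Cexp (- u)) + logsum z (- u))%C).
  { unfold logsum. rewrite (CSeries_S _ E2). f_equal.
    - unfold logu. rewrite M1. f_equal. f_equal. f_equal. ring.
    - apply CSeries_ext. intros n. unfold logu. f_equal. f_equal. f_equal.
      unfold mul_nat. rewrite (S_INR (S n)), RtoC_plus. ring. }
  assert (P1 : Cexp (Clog (1 - Cexp (u - z))) = (1 - Cexp (u - z))%C).
  { apply Cexp_Clog. apply Rlt_le_trans with (1 - exp (Re (u - z))).
    assert (exp (Re (u - z)) < 1) by (rewrite <- exp_0; apply exp_increasing; rewrite R1; lra). lra.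
    apply Re_1_minus_ge. rewrite Cmod_Cexp. lra. }
  assert (P2 : Cexp (Clog (1 - Cexp (- u))) = (1 - Cexp (- u))%C).
  { apply Cexp_Clog. apply Rlt_le_trans with (1 - exp (- Re u)).
    assert (exp (- Re u) < 1) by (rewrite <- exp_0; apply exp_increasing; lra). lra.
    apply Re_1_minus_ge. rewrite Cmod_Cexp_opp. lra. }
  unfold crank_fun. rewrite L1, L2.
  set (A := Clog (1 - Cexp (u - z))) in *. set (B := Clog (1 - Cexp (- u))) in *.
  rewrite <- P1, <- P2, <- !Cexp_plus. f_equal. ring.
Qed.

Lemma zmul_1 (u : C) : zmul 1 u = u.
Proof. unfold zmul. ring. Qed.

Lemma zpair_ext {G : AbelianMonoid} (f g : Z -> G) (j : nat) :
  (forall m, f m = g m) -> zpair f j = zpair g j.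
Proof. intros H. destruct j; unfold zpair; now rewrite !H. Qed.

Section Laurent.

Variables (z : C) (c : Z -> C).
Hypothesis Hz : 0 < Re z.
Hypothesis c_summable : forall u : C, Re u < Re z -> - Re u < Re z -> Cexp u <> 1 ->
  ex_series (zpair (fun m => Cmod (c m * Cexp (zmul m u)))).
Hypothesis c_sum : forall u : C, Re u < Re z -> - Re u < Re z -> Cexp u <> 1 ->
  CSeries (zpair (fun m => c m * Cexp (zmul m u))%C) = crank_fun z u.

Lemma Cexp_neq_1_Re (u : C) : Re u <> 0 -> Cexp u <> 1.
Proof.
  intros H E. apply H. assert (M : Cmod (Cexp u) = 1) by (rewrite E; apply Cmod_1).
  rewrite Cmod_Cexp in M. apply exp_inv. now rewrite M, exp_0.
Qed.

(** The circle Re u = Re z / 2 and its translate Re u = - Re z / 2 both lie in the annulus, and the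
    same coefficients c serve on both. [X] and [Y] are the Fourier coefficients there; the m-th
    coefficient of the functional equation is the recurrence. *)
Lemma laurent_recurrence (m : Z) :
  (c m * (1 - Cexp (- zmul m z)))%C =
  (Cexp (- z) * c (m - 1)%Z - Cexp (- zmul (m + 1) z) * c (m + 1)%Z)%C.
Proof.
  set (r := Re z / 2). assert (Hr : 0 < r) by (unfold r; lra).
  assert (HPI := PI_RGT_0).
  set (X := fun m => (c m * Cexp (zmul m (RtoC r)))%C).
  set (Y := fun m => (c m * Cexp (zmul m (RtoC r - z)))%C).
  assert (Rz : forall t, Re (vline r t - z)%C = - r).
  { intros t. change (Re (vline r t - z)%C) with (Re (vline r t) - Re z). rewrite Re_vline. unfold r; lra. }
  assert (Eph : forall (m : Z) (v : C) t, (c m * Cexp (zmul m (v + RtoC t * Ci)))%C =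
     (c m * Cexp (zmul m v) * phase m t)%C).
  { intros m' v t. unfold phase. rewrite <- Cmult_assoc, <- Cexp_plus. f_equal. f_equal.
    unfold zmul. rewrite RtoC_mult. ring. }
  assert (SX : ex_series (zpair (fun m => Cmod (X m)))).
  { assert (H := c_summable (RtoC r)). apply H; simpl; unfold r in *; try lra.
    apply Cexp_neq_1_Re. simpl. lra. }
  assert (SY : ex_series (zpair (fun m => Cmod (Y m)))).
  { assert (H := c_summable (RtoC r - z)%C). apply H; simpl; unfold Re, r, Re in *; try lra.
    apply Cexp_neq_1_Re. simpl. unfold Re in *. lra. }
  assert (FX : forall t, CSeries (zpair (fun m => X m * phase m t)%C) = crank_fun z (vline r t)).
  { intros t. rewrite <- c_sum; try (rewrite Re_vline; unfold r in *; lra).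
    - apply CSeries_ext. intros j. apply zpair_ext. intros m'. unfold X, vline. now rewrite Eph.
    - apply Cexp_neq_1_Re. rewrite Re_vline. lra. }
  assert (FY : forall t, CSeries (zpair (fun m => Y m * phase m t)%C) = crank_fun z (vline r t - z)).
  { intros t. rewrite <- c_sum; try (rewrite Rz; unfold r in *; lra).
    - apply CSeries_ext. intros j. apply zpair_ext. intros m'. unfold Y.
      replace (vline r t - z)%C with ((RtoC r - z) + RtoC t * Ci)%C by (unfold vline; ring).
      now rewrite Eph.
    - apply Cexp_neq_1_Re. rewrite Rz. lra. }
  assert (I1 := fourier_coefficient Y m SY).
  assert (I2 := fourier_coefficient Y (m + 1) SY).
  assert (I3 := fourier_coefficient X m SX).
  assert (I4 := fourier_coefficient X (m - 1) SX).
  apply (is_Cint_scal (Cexp (- RtoC r))) in I2.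
  apply (is_Cint_scal (Cexp (RtoC r - z))) in I4.
  assert (I := is_Cint_plus _ _ _ _ _ _ (is_Cint_minus _ _ _ _ _ _ (is_Cint_minus _ _ _ _ _ _ I1 I2) I3) I4).
  cbv beta in I.
  assert (I0 : is_Cint (fun _ => RtoC 0) (- PI) PI
    (RtoC (2 * PI) * Y m - Cexp (- RtoC r) * (RtoC (2 * PI) * Y (m + 1)%Z)
     - RtoC (2 * PI) * X m + Cexp (RtoC r - z) * (RtoC (2 * PI) * X (m - 1)%Z))%C).
  { apply is_Cint_ext with (3 := I). lra. intros t _. rewrite FX, FY.
    assert (S0 := crank_fun_shift z (vline r t) ltac:(rewrite Re_vline; lra)
      ltac:(rewrite Re_vline; unfold r in *; lra)).
    assert (E1 : phase (- (m + 1)) t = (phase (- m) t * phase (-1) t)%C)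
      by (rewrite <- phase_add; f_equal; lia).
    assert (E2 : phase (- (m - 1)) t = (phase (- m) t * phase 1 t)%C)
      by (rewrite <- phase_add; f_equal; lia).
    assert (E3 : (Cexp (- RtoC r) * phase (-1) t)%C = Cexp (- vline r t)).
    { unfold phase, vline. rewrite <- Cexp_plus. f_equal. rewrite RtoC_mult. ring. }
    assert (E4 : (Cexp (RtoC r - z) * phase 1 t)%C = Cexp (vline r t - z)).
    { unfold phase, vline. rewrite <- Cexp_plus. f_equal. rewrite RtoC_mult. ring. }
    rewrite E1, E2.
    set (P := phase (- m) t). set (F1 := crank_fun z (vline r t - z)) in *.
    set (F2 := crank_fun z (vline r t)) in *.
    transitivity (P * (F1 * (1 - Cexp (- RtoC r) * phase (-1) t)
      - (1 - Cexp (RtoC r - z) * phase 1 t) * F2))%C. ring.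
    rewrite E3, E4, S0. ring. }
  assert (E := is_Cint_unique _ _ _ _ _ I0 (is_Cint_0 _ _)).
  assert (NP : RtoC (2 * PI) <> 0) by (apply RtoC_neq_0; lra).
  assert (E' : (Y m - Cexp (- RtoC r) * Y (m + 1)%Z - X m + Cexp (RtoC r - z) * X (m - 1)%Z)%C = 0).
  { transitivity (/ RtoC (2 * PI) * (RtoC (2 * PI) * Y m - Cexp (- RtoC r) * (RtoC (2 * PI) * Y (m + 1)%Z)
     - RtoC (2 * PI) * X m + Cexp (RtoC r - z) * (RtoC (2 * PI) * X (m - 1)%Z)))%C.
    field; auto. rewrite E. ring. }
  set (e := Cexp (zmul m (RtoC r))). assert (Ne : e <> 0) by apply Cexp_neq_0.
  assert (Y1 : Y m = (e * (c m * Cexp (- zmul m z)))%C).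
  { unfold Y. replace (zmul m (RtoC r - z)) with (zmul m (RtoC r) + - zmul m z)%C by (unfold zmul; ring).
    rewrite Cexp_plus. fold e. ring. }
  assert (Y2 : (Cexp (- RtoC r) * Y (m + 1)%Z)%C = (e * (c (m + 1)%Z * Cexp (- zmul (m + 1) z)))%C).
  { unfold Y. replace (zmul (m + 1) (RtoC r - z)) with (zmul m (RtoC r) + RtoC r + - zmul (m + 1) z)%C
      by (unfold zmul; rewrite plus_IZR, RtoC_plus; ring).
    rewrite !Cexp_plus. fold e. rewrite Cexp_opp. field. apply Cexp_neq_0. }
  assert (X1 : X m = (e * c m)%C) by (unfold X; fold e; ring).
  assert (X2 : (Cexp (RtoC r - z) * X (m - 1)%Z)%C = (e * (Cexp (- z) * c (m - 1)%Z))%C).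
  { unfold X. replace (zmul (m - 1) (RtoC r)) with (zmul m (RtoC r) - RtoC r)%C
      by (unfold zmul; rewrite minus_IZR, RtoC_minus; ring).
    unfold Cminus at 1. rewrite Cexp_plus, Cexp_minus. fold e. field. apply Cexp_neq_0. }
  rewrite Y1, Y2, X1, X2 in E'.
  set (q1 := Cexp (- zmul m z)) in *. set (q2 := Cexp (- zmul (m + 1) z)) in *. set (q := Cexp (- z)) in *.
  transitivity (q * c (m - 1)%Z - q2 * c (m + 1)%Z -
    / e * (e * (c m * q1) - e * (c (m + 1)%Z * q2) - e * c m + e * (q * c (m - 1)%Z)))%C.
  field; auto. rewrite E'. ring.
Qed.

(** zeta = 1 is excluded from the hypotheses, so it is approached along the unit circle, where
    |zeta^m| = 1 and the moduli of the coefficients dominate for all points at once. *)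
Lemma laurent_sum_1 : Ccv (csum (zpair c)) 1.
Proof.
  (* The angles lie in (0, 1], inside (0, PI), so the sine is positive and zeta = 1 is avoided. *)
  set (un := fun N : nat => (RtoC (/ INR (S N)) * Ci)%C).
  assert (Ru : forall N, Re (un N) = 0) by (intros; unfold un; simpl; ring).
  assert (Nu : forall N, Cexp (un N) <> 1).
  { intros N E. assert (HI : Im (Cexp (un N)) = 0) by (rewrite E; reflexivity).
    change (Im (Cexp (un N))) with (exp (Re (un N)) * sin (Im (un N))) in HI.
    rewrite Ru, exp_0 in HI.
    assert (Hs : 0 < sin (Im (un N))).
    { unfold un. replace (Im (RtoC (/ INR (S N)) * Ci)) with (/ INR (S N)) by (simpl; ring).
      assert (HP := PI_gt_3).
      assert (H1 : 1 <= INR (S N)) by (rewrite S_INR; assert (H := pos_INR N); lra).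
      assert (H2 : / INR (S N) <= 1) by (rewrite <- Rinv_1; apply Rinv_le_contravar; lra).
      apply sin_gt_0. apply Rinv_0_lt_compat; lra. lra. }
    lra. }
  assert (Cu : Ccv un 0).
  { unfold un. replace (RtoC 0) with (RtoC 0 * Ci)%C by ring. apply Ccv_mult. 2: apply Ccv_const.
    apply Ccv_RtoC. apply INR_lim_inv. }
  assert (Hmod : forall N m, Cmod (c m * Cexp (zmul m (un N))) = Cmod (c m)).
  { intros N m. rewrite Cmod_mult, Cmod_Cexp.
    replace (Re (zmul m (un N))) with 0. rewrite exp_0. ring. unfold zmul, un. simpl. ring. }
  assert (Hsum : ex_series (zpair (fun m => Cmod (c m)))).
  { apply ex_series_ext with (2 := c_summable (un O) ltac:(rewrite Ru; lra) ltac:(rewrite Ru; lra) (Nu O)).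
    intros j. apply zpair_ext. intros m. apply Hmod. }
  assert (L1 : Ccv (fun N => crank_fun z (un N)) (CSeries (zpair c))).
  { apply Ccv_ext with (fun N => CSeries (zpair (fun m => c m * Cexp (zmul m (un N)))%C)).
    - intros N. apply c_sum; auto; rewrite Ru; lra.
    - apply tannery with (b := zpair (fun m => Cmod (c m))); auto.
      + exists O. intros N _ [|i]; unfold zpair. rewrite Hmod. lra.
        eapply Rle_trans. apply Cmod_triangle. rewrite !Hmod. apply Rle_refl.
      + assert (Ct : forall m, Ccv (fun N => c m * Cexp (zmul m (un N)))%C (c m)).
        { intros m. replace (c m) with (c m * Cexp (zmul m 0))%C at 1.
          apply Ccv_scal. apply Ccv_Cexp. unfold zmul. now apply Ccv_scal.
          unfold zmul. rewrite Cmult_0_r, Cexp_0. ring. }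
        intros [|i]; unfold zpair. apply Ct. now apply Ccv_plus. }
  assert (Llog : forall s : R, s = 1 \/ s = -1 -> Ccv (fun N => logsum z (RtoC s * un N)) (logsum z 0)).
  { intros s Hs. assert (Rs : forall N, Re (RtoC s * un N) = 0) by (intros; unfold un; simpl; ring).
    unfold logsum. apply tannery with
      (b := fun n => 2 / (1 - exp (- Re z)) * exp (- (INR n * Re z))).
    - exists O. intros N _ n. assert (H := logu_le z (RtoC s * un N) n).
      rewrite Rs, Rminus_0_r in H. apply H; lra.
    - apply ex_series_Rscal. now apply ex_series_exp_geom.
    - intros n. unfold logu. apply (Ccv_Clog _ _ (1 - exp (- Re z))).
      + assert (exp (- Re z) < 1) by (rewrite <- exp_0; apply exp_increasing; lra). lra.
      + intros N. apply Re_1_minus_ge.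
        destruct (logu_small z (RtoC s * un N) n ltac:(rewrite Rs; lra) Hz) as [_ [H _]].
        rewrite Rs, Rminus_0_r in H. exact H.
      + apply Re_1_minus_ge. destruct (logu_small z 0 n Hz Hz) as [_ [H _]].
        simpl in H. rewrite Rminus_0_r in H. exact H.
      + apply Ccv_minus. apply Ccv_const. apply Ccv_Cexp. apply Ccv_minus. 2: apply Ccv_const.
        replace (RtoC 0) with (RtoC s * 0)%C by ring. now apply Ccv_scal. }
  assert (L2 : Ccv (fun N => crank_fun z (un N)) 1).
  { assert (E1 : RtoC 1 = Cexp (RtoC 2 * logsum z 0 - logsum z 0 - logsum z 0)).
    { rewrite <- Cexp_0. f_equal. ring. }
    rewrite E1. unfold crank_fun. apply Ccv_Cexp. apply Ccv_minus. apply Ccv_minus. apply Ccv_const.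
    - apply Ccv_ext with (fun N => logsum z (RtoC 1 * un N)). intros; f_equal; ring. apply Llog; auto.
    - apply Ccv_ext with (fun N => logsum z (RtoC (-1) * un N)). intros; f_equal; ring. apply Llog; auto. }
  rewrite <- (Ccv_unique _ _ _ L1 L2). apply CSeries_cv.
  apply ex_series_Cmod_le with (2 := Hsum). intros [|i]; unfold zpair. lra. apply Cmod_triangle.
Qed.

End Laurent.

(** * Bounded solutions of the three-term recurrence, and the false theta functions *)

Definition three_term (q : C) (x : nat -> C) : Prop :=
  forall p, ((1 - Cpow q (S p)) * x (S p))%C = (q * x p - Cpow q (S (S p)) * x (S (S p)))%C.

Lemma three_term_zero (q : C) (x : nat -> C) : q <> 0 -> three_term q x ->
  x O = 0 -> x 1%nat = 0 -> forall p, x p = 0.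
Proof.
  intros Hq Hx H0 H1.
  assert (H : forall p, x p = 0 /\ x (S p) = 0).
  { induction p as [|p [IH1 IH2]]; auto. split; auto.
    assert (E := Hx p). rewrite IH1, IH2 in E.
    assert (Hn : Cpow q (S (S p)) <> 0) by now apply Cpow_nz.
    transitivity (- / Cpow q (S (S p)) * (q * 0 - Cpow q (S (S p)) * x (S (S p))))%C.
    field; auto. rewrite <- E. ring. }
  intros p. apply H.
Qed.

Lemma three_term_comb (q a b : C) (x y : nat -> C) : three_term q x -> three_term q y ->
  three_term q (fun p => a * x p - b * y p)%C.
Proof.
  intros Hx Hy p. transitivity (a * ((1 - Cpow q (S p)) * x (S p)) - b * ((1 - Cpow q (S p)) * y (S p)))%C.
  ring. rewrite Hx, Hy. ring.
Qed.

(* The Casoratian satisfies w p = - q^(p+1) w (p+1), so boundedness forces it to vanish. *)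
Lemma three_term_casoratian (q : C) (x y : nat -> C) (B : R) : q <> 0 -> Cmod q < 1 ->
  three_term q x -> three_term q y ->
  (forall p, Cmod (x p) <= B) -> (forall p, Cmod (y p) <= B) ->
  (x O * y 1%nat)%C = (x 1%nat * y O)%C.
Proof.
  intros Hq Hq1 Hx Hy Bx By.
  set (w := fun p => (x p * y (S p) - x (S p) * y p)%C).
  assert (Hw : forall p, w p = (- (Cpow q (S p) * w (S p)))%C).
  { intros p. unfold w. assert (E1 := Hx p). assert (E2 := Hy p).
    transitivity (/ q * ((q * x p - Cpow q (S (S p)) * x (S (S p))) * y (S p)
      - (q * y p - Cpow q (S (S p)) * y (S (S p))) * x (S p)
      + Cpow q (S (S p)) * (x (S (S p)) * y (S p) - y (S (S p)) * x (S p))))%C.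
    field; auto. rewrite <- E1, <- E2, !Cpow_S. field; auto. }
  assert (H0 := Cmod_ge_0 q).
  assert (HB : 0 <= B) by (apply Rle_trans with (2 := Bx O); apply Cmod_ge_0).
  assert (Hb : forall p, Cmod (w p) <= 2 * (B * B)).
  { intros p. unfold w. apply Rle_trans with (1 := Cmod_triangle_minus _ _). rewrite !Cmod_mult.
    assert (Hm : forall a b, Cmod (x a) * Cmod (y b) <= B * B)
      by (intros; apply Rmult_le_compat; auto; apply Cmod_ge_0).
    assert (T1 := Hm p (S p)). assert (T2 := Hm (S p) p). lra. }
  assert (Hi : forall p, Cmod (w O) <= Cmod q ^ p * (2 * (B * B))).
  { intros p. apply Rle_trans with (Cmod q ^ p * Cmod (w p)).
    - induction p as [|p IH]. simpl. lra.
      apply Rle_trans with (1 := IH). rewrite (Hw p), Cmod_opp, Cmod_mult, Cmod_pow.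
      rewrite <- Rmult_assoc. apply Rmult_le_compat_r. apply Cmod_ge_0.
      assert (P1 : 0 <= Cmod q ^ S p) by (apply pow_le; auto).
      assert (P2 : Cmod q ^ p <= 1) by (rewrite <- (pow1 p); apply pow_incr; lra).
      assert (P3 : 0 <= Cmod q ^ p) by (apply pow_le; auto). nra.
    - apply Rmult_le_compat_l; auto. apply pow_le; auto. }
  assert (E : Cmod (w O) = 0).
  { apply Rle_antisym. 2: apply Cmod_ge_0.
    apply (is_lim_seq_le (fun _ => Cmod (w O)) (fun p => 2 * (B * B) * Cmod q ^ p) (Cmod (w O)) 0).
    - intros p. rewrite (Rmult_comm (2 * (B * B))). apply Hi.
    - apply is_lim_seq_const.
    - apply is_lim_seq_scal0. apply is_lim_seq_geom. rewrite Rabs_pos_eq; lra. }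
  apply Cmod_eq_0 in E. unfold w in E.
  transitivity ((x O * y 1%nat - x 1%nat * y O) + x 1%nat * y O)%C. ring. rewrite E. ring.
Qed.

(** The folded terms of a two-sided sum over an even sequence. *)
Definition dbl (x : nat -> C) (j : nat) : C :=
  match j with O => x O | S i => (RtoC 2 * x (S i))%C end.

Lemma csum_dbl_scal (a : C) (x : nat -> C) (N : nat) :
  csum (dbl (fun p => a * x p)%C) N = (a * csum (dbl x) N)%C.
Proof.
  rewrite <- csum_scal. apply csum_ext. intros [|i] _; simpl; ring.
Qed.

(** A second-order recurrence has a two-dimensional solution space; boundedness makes the two
    solutions proportional through the Casoratian, and the equal nonzero sums fix the ratio. *)
Lemma three_term_unique (q : C) (x y : nat -> C) (B : R) : q <> 0 -> Cmod q < 1 ->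
  three_term q x -> three_term q y ->
  (forall p, Cmod (x p) <= B) -> (forall p, Cmod (y p) <= B) ->
  Ccv (csum (dbl x)) 1 -> Ccv (csum (dbl y)) 1 -> forall p, x p = y p.
Proof.
  intros Hq Hq1 Hx Hy Bx By Sx Sy.
  assert (W := three_term_casoratian q x y B Hq Hq1 Hx Hy Bx By).
  assert (Z : forall i, (i <= 1)%nat -> y i = x i).
  { intros i Hi.
    assert (Hz : forall p, (y i * x p - x i * y p)%C = 0).
    { apply (three_term_zero q (fun p => y i * x p - x i * y p)%C Hq).
      - now apply three_term_comb.
      - destruct i as [|[|i]]; try lia. ring.
        transitivity (x O * y 1%nat - x 1%nat * y O)%C. ring. rewrite W. ring.
      - destruct i as [|[|i]]; try lia.
        transitivity (x 1%nat * y O - x O * y 1%nat)%C. ring. rewrite W. ring. ring. }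
    assert (L1 := Ccv_scal (y i) _ _ Sx). assert (L2 := Ccv_scal (x i) _ _ Sy).
    assert (E : (y i * 1)%C = (x i * 1)%C).
    { apply Ccv_unique with (1 := L1). apply Ccv_ext with (2 := L2). intros N.
      rewrite <- !csum_dbl_scal. apply csum_ext. intros j _.
      assert (Ep : forall p, (x i * y p)%C = (y i * x p)%C).
      { intros p. transitivity (y i * x p - (y i * x p - x i * y p))%C. ring. rewrite Hz. ring. }
      destruct j; simpl; now rewrite Ep. }
    rewrite !Cmult_1_r in E. exact E. }
  intros p.
  assert (H : (1 * x p - 1 * y p)%C = 0).
  { apply (three_term_zero q (fun p => 1 * x p - 1 * y p)%C Hq).
    - now apply three_term_comb.
    - rewrite (Z O) by lia. ring.
    - rewrite (Z 1%nat) by lia. ring. }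
  transitivity ((1 * x p - 1 * y p) + y p)%C. ring. rewrite H. ring.
Qed.

Section FalseTheta.

Variable q : C.
Hypothesis Hq0 : q <> 0.
Hypothesis Hq1 : Cmod q < 1.

Let term (p n : nat) : C := (RtoC ((-1) ^ n) * Cpow q (n * (n + 1) / 2 + n * p))%C.
Let S_ (p : nat) : C := CSeries (term p).

Lemma triangle_S (n : nat) : (S n * (S n + 1) / 2 = n * (n + 1) / 2 + S n)%nat.
Proof.
  replace (S n * (S n + 1))%nat with (n * (n + 1) + S n * 2)%nat by lia.
  now rewrite Nat.div_add by lia.
Qed.

Lemma Cmod_sign (n : nat) : Cmod (RtoC ((-1) ^ n)) = 1.
Proof. rewrite Cmod_R, <- RPow_abs, Rabs_left by lra. replace (- -1) with 1 by ring. apply pow1. Qed.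

Lemma theta_term_le (p n : nat) : Cmod (term p n) <= Cmod q ^ n.
Proof.
  unfold term. rewrite Cmod_mult, Cmod_sign, Rmult_1_l, Cmod_pow.
  assert (Hn : (n <= n * (n + 1) / 2 + n * p)%nat).
  { assert (n <= n * (n + 1) / 2)%nat. 2: lia.
    destruct n. lia. apply Nat.div_le_lower_bound; lia. }
  replace (n * (n + 1) / 2 + n * p)%nat with (n + (n * (n + 1) / 2 + n * p - n))%nat by lia.
  rewrite pow_add. assert (H0 := Cmod_ge_0 q).
  assert (0 <= Cmod q ^ n) by (apply pow_le; auto).
  assert (Cmod q ^ (n * (n + 1) / 2 + n * p - n) <= 1).
  { rewrite <- (pow1 (n * (n + 1) / 2 + n * p - n)). apply pow_incr. lra. }
  nra.
Qed.

Lemma ex_series_geom_q : ex_series (fun n => Cmod q ^ n).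
Proof. apply ex_series_geom. rewrite Rabs_pos_eq; auto. apply Cmod_ge_0. Qed.

Lemma theta_term_ex (p : nat) : ex_series (fun n => Cmod (term p n)).
Proof. apply ex_series_Cmod_le with (1 := theta_term_le p). apply ex_series_geom_q. Qed.

Lemma partial_theta_le (p : nat) : Cmod (S_ p) <= / (1 - Cmod q).
Proof.
  rewrite <- Series_geom by (rewrite Rabs_pos_eq; auto; apply Cmod_ge_0).
  apply Cmod_CSeries_le. apply theta_term_le. apply ex_series_geom_q.
Qed.

Lemma partial_theta_rec (p : nat) : S_ p = (1 - Cpow q (S p) * S_ (S p))%C.
Proof.
  unfold S_. rewrite (CSeries_S _ (theta_term_ex p)), <- CSeries_scal by apply theta_term_ex.
  assert (E0 : term p O = 1) by (unfold term; simpl; ring).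
  assert (E : forall n, term p (S n) = (-1 * (Cpow q (S p) * term (S p) n))%C).
  { intros n. unfold term. rewrite triangle_S.
    replace (n * (n + 1) / 2 + S n + S n * p)%nat with
      (S p + (n * (n + 1) / 2 + n * S p))%nat by lia.
    rewrite Cpow_add_r. replace ((-1) ^ S n) with (-1 * (-1) ^ n) by reflexivity.
    rewrite RtoC_mult. ring. }
  rewrite E0, (CSeries_ext _ _ E), CSeries_scal. ring.
  apply ex_series_Cmod_scal, theta_term_ex.
Qed.

Definition theta_seq (p : nat) : C := ((1 + Cpow q p) * S_ p - 1)%C.

(** With this form the doubled sum up to N collapses to 1 - 2 q^{N+1} S_{N+1}, which is the
    normalisation needed in [three_term_unique]. *)
Lemma theta_seq_telescope (p : nat) :
  theta_seq p = (Cpow q p * S_ p - Cpow q (S p) * S_ (S p))%C.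
Proof.
  unfold theta_seq. assert (E := partial_theta_rec p).
  transitivity (Cpow q p * S_ p + (1 - Cpow q (S p) * S_ (S p)) - 1)%C.
  rewrite <- E. ring. ring.
Qed.

(** The first-order recurrence of the partial theta functions expresses S_p and q^{p+2} S_{p+2}
    through S_{p+1}; the claim is then polynomial in q^p and S_{p+1}. *)
Lemma theta_seq_three_term : three_term q theta_seq.
Proof.
  intros p. unfold theta_seq.
  assert (Hn : Cpow q (S (S p)) <> 0) by now apply Cpow_nz.
  assert (E1 := partial_theta_rec p). assert (E2 := partial_theta_rec (S p)).
  assert (E3 : (Cpow q (S (S p)) * S_ (S (S p)))%C = (1 - S_ (S p))%C) by (rewrite E2; ring).
  clear E2. rewrite E1.
  transitivity (q * ((1 + Cpow q p) * (1 - Cpow q (S p) * S_ (S p)) - 1) -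
    ((1 + Cpow q (S (S p))) * (Cpow q (S (S p)) * S_ (S (S p))) - Cpow q (S (S p))))%C.
  2: ring. rewrite E3, !Cpow_S. ring.
Qed.

Lemma theta_seq_le (p : nat) : Cmod (theta_seq p) <= 2 * / (1 - Cmod q) + 1.
Proof.
  unfold theta_seq. apply Rle_trans with (1 := Cmod_triangle_minus _ _). rewrite Cmod_1.
  apply Rplus_le_compat_r. rewrite Cmod_mult. apply Rmult_le_compat; try apply Cmod_ge_0.
  - apply Rle_trans with (1 := Cmod_triangle _ _). rewrite Cmod_1, Cmod_pow.
    assert (Cmod q ^ p <= 1). { rewrite <- (pow1 p). apply pow_incr. split. apply Cmod_ge_0. lra. } lra.
  - apply partial_theta_le.
Qed.

Lemma theta_seq_sum : Ccv (csum (dbl theta_seq)) 1.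
Proof.
  apply Ccv_incr_1.
  apply Ccv_ext with (fun N => 1 - RtoC 2 * (Cpow q (S N) * S_ (S N)))%C.
  - induction n as [|n IH].
    + simpl csum. unfold dbl, theta_seq. rewrite (partial_theta_rec O). simpl. ring.
    + rewrite csum_S, <- IH. unfold dbl. rewrite theta_seq_telescope. ring.
  - match goal with |- Ccv ?f _ => replace (Ccv f 1) with (Ccv f (1 - RtoC 2 * 0)%C)
      by (f_equal; ring) end.
    apply Ccv_minus. apply Ccv_const. apply Ccv_scal.
    apply Ccv_of_le with (fun N => (Cmod q * / (1 - Cmod q)) * Cmod q ^ N).
    + exists O. intros N _.
      replace (Cpow q (S N) * S_ (S N) - 0)%C with (Cpow q (S N) * S_ (S N))%C by ring.
      rewrite Cmod_mult, Cmod_pow. simpl pow.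
      assert (H1 := partial_theta_le (S N)). assert (H0 := Cmod_ge_0 q).
      assert (0 <= Cmod q ^ N) by (apply pow_le; auto).
      replace (Cmod q * / (1 - Cmod q) * Cmod q ^ N) with (Cmod q * Cmod q ^ N * / (1 - Cmod q)) by ring.
      apply Rmult_le_compat_l; auto. nra.
    + apply is_lim_seq_scal0. apply is_lim_seq_geom. rewrite Rabs_pos_eq; auto. apply Cmod_ge_0.
Qed.

Lemma false_theta_seq (m : Z) : false_theta m q = theta_seq (Z.abs_nat m).
Proof. reflexivity. Qed.

Lemma false_theta_le (m : Z) : Cmod (false_theta m q) <= 2 * / (1 - Cmod q) + 1.
Proof. rewrite false_theta_seq. apply theta_seq_le. Qed.

End FalseTheta.

(** For fixed z the rows, divided by (q)^{-k}, are the Laurent coefficients of [crank_fun z]. They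
    are matched with the false theta functions by uniqueness, for each z separately and with no
    expansion in q. *)
Lemma generating_function (k : nat) (a : Z -> nat -> Z) (z : C) (m : Z) :
  is_expansion_coeffs k a -> 0 < Re z ->
  ex_series (fun n => Cmod (RtoC (IZR (a m n)) * Cexp (- mul_nat n z))) /\
  CSeries (fun n => RtoC (IZR (a m n)) * Cexp (- mul_nat n z))%C =
  (Cexp (RtoC (INR k) * Plog z) * false_theta m (Cexp (- z)))%C.
Proof.
  intros ha Hz. set (q := Cexp (- z)).
  assert (Hq0 : q <> 0) by apply Cexp_neq_0.
  assert (Hq1 : Cmod q < 1).
  { unfold q. rewrite Cmod_Cexp_opp, <- exp_0. apply exp_increasing. lra. }
  set (e := Cexp (- (RtoC (INR k) * Plog z))). assert (Ne : e <> 0) by apply Cexp_neq_0.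
  set (c := fun m => (e * row_sum a z m)%C).
  assert (Hc : forall u, Re u < Re z -> - Re u < Re z -> Cexp u <> 1 ->
    ex_series (zpair (fun m => Cmod (c m * Cexp (zmul m u)))) /\
    CSeries (zpair (fun m => c m * Cexp (zmul m u))%C) = crank_fun z u).
  { intros u H1 H2 H3. destruct (laurent_expansion k a z u ha Hz H1 H2 H3) as [_ [A2 A3]]. split.
    - apply ex_series_ext with (fun j => Cmod e * zpair (fun m => Cmod (row_sum a z m * Cexp (zmul m u))) j).
      + assert (E : forall m, Cmod (c m * Cexp (zmul m u)) = Cmod e * Cmod (row_sum a z m * Cexp (zmul m u))).
        { intros m'. unfold c. rewrite <- Cmod_mult. f_equal. ring. }
        intros [|i]; unfold zpair; rewrite !E. reflexivity.
        apply Rmult_plus_distr_l.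
      + now apply ex_series_Rscal.
    - rewrite (CSeries_ext _ (fun j => e * zpair (fun m => row_sum a z m * Cexp (zmul m u))%C j)%C).
      + rewrite CSeries_scal, A3.
        * unfold e, crank_fun. rewrite <- Cexp_plus. f_equal. ring.
        * apply ex_series_Cmod_le with (2 := A2). intros [|i]; unfold zpair. lra. apply Cmod_triangle.
      + intros [|i]; unfold zpair, c. ring.
        change (@plus C_AbelianMonoid ?x ?y) with (x + y)%C. ring. }
  assert (Rec := laurent_recurrence z c Hz (fun u H1 H2 H3 => proj1 (Hc u H1 H2 H3))
    (fun u H1 H2 H3 => proj2 (Hc u H1 H2 H3))).
  assert (Sum := laurent_sum_1 z c Hz (fun u H1 H2 H3 => proj1 (Hc u H1 H2 H3))
    (fun u H1 H2 H3 => proj2 (Hc u H1 H2 H3))).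
  assert (Epos : forall p, Cexp (- zmul (Z.of_nat p) z) = Cpow q p).
  { intros p. unfold q. rewrite <- Cexp_mul_nat. f_equal. unfold zmul, mul_nat.
    now rewrite <- INR_IZR_INZ. }
  assert (Eneg : forall p, Cexp (- zmul (- Z.of_nat p) z) = (/ Cpow q p)%C).
  { intros p. rewrite <- Epos, <- Cexp_opp. f_equal. unfold zmul. rewrite opp_IZR, RtoC_opp. ring. }
  set (x := fun p => c (Z.of_nat p)). set (y := fun p => c (- Z.of_nat p)%Z).
  assert (Tx : three_term q x).
  { intros p. assert (R := Rec (Z.of_nat (S p))).
    replace (Z.of_nat (S p) - 1)%Z with (Z.of_nat p) in R by lia.
    replace (Z.of_nat (S p) + 1)%Z with (Z.of_nat (S (S p))) in R by lia.
    rewrite !Epos in R. unfold x. fold q in R. rewrite <- R. ring. }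
  (* The recurrence at m = -(p + 1), multiplied by -q^{p+1}, is the one at p + 1 with the roles of
     the two neighbours exchanged. *)
  assert (Ty : three_term q y).
  { intros p. assert (R := Rec (- Z.of_nat (S p))%Z).
    replace (- Z.of_nat (S p) + 1)%Z with (- Z.of_nat p)%Z in R by lia.
    replace (- Z.of_nat (S p) - 1)%Z with (- Z.of_nat (S (S p)))%Z in R by lia.
    rewrite !Eneg in R. fold q in R. fold (y p) in R. fold (y (S p)) in R. fold (y (S (S p))) in R.
    assert (Np : Cpow q p <> 0) by now apply Cpow_nz.
    rewrite !Cpow_S in *.
    transitivity (- (q * Cpow q p) * (y (S p) * (1 - / (q * Cpow q p))))%C. field; auto.
    rewrite R. field; auto. }
  (* At m = 0 the left side of the recurrence vanishes, so c(1) = c(-1); with equal initial values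
     the coefficients are even in m, and the two-sided sum folds. *)
  assert (Exy : forall p, x p = y p).
  { assert (R := Rec (Z.of_nat 0)). rewrite (Epos O) in R. simpl in R.
    assert (E1 : x 1%nat = y 1%nat).
    { unfold x, y. simpl. fold q in R. rewrite zmul_1 in R. fold q in R.
      transitivity (- / q * (q * c (-1)%Z - q * c 1%Z) + c (-1)%Z)%C. field; auto.
      rewrite <- R. ring. }
    intros p. assert (H : (1 * x p - 1 * y p)%C = 0).
    { apply (three_term_zero q (fun p => 1 * x p - 1 * y p)%C Hq0).
      - now apply three_term_comb.
      - unfold x, y. simpl. ring.
      - rewrite E1. ring. }
    transitivity ((1 * x p - 1 * y p) + y p)%C. ring. rewrite H. ring. }
  assert (Sx : Ccv (csum (dbl x)) 1).
  { apply Ccv_ext with (2 := Sum). intros N. apply csum_ext. intros [|i] _; unfold zpair, dbl.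
    reflexivity. fold (x (S i)). fold (y (S i)). rewrite <- Exy.
    change (@plus C_AbelianMonoid ?x ?y) with (x + y)%C. ring. }
  (* Convergence at the real point zeta = e^{Re z / 2} > 1 bounds all coefficients of nonnegative
     index. *)
  assert (Bx : exists B, forall p, Cmod (x p) <= B).
  { set (u0 := RtoC (Re z / 2)).
    destruct (Hc u0) as [A _]; try (unfold u0; simpl; lra).
    { apply Cexp_neq_1_Re. unfold u0; simpl; lra. }
    exists (Series (zpair (fun m => Cmod (c m * Cexp (zmul m u0))))). intros p.
    assert (Hpos : forall j, 0 <= zpair (fun m => Cmod (c m * Cexp (zmul m u0))) j).
    { intros [|i]; unfold zpair. apply Cmod_ge_0. apply Rplus_le_le_0_compat; apply Cmod_ge_0. }
    apply Rle_trans with (zpair (fun m => Cmod (c m * Cexp (zmul m u0))) p).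
    - assert (H : Cmod (x p) <= Cmod (c (Z.of_nat p) * Cexp (zmul (Z.of_nat p) u0))).
      { unfold x. rewrite Cmod_mult, Cmod_Cexp.
        assert (1 <= exp (Re (zmul (Z.of_nat p) u0))).
        { rewrite <- exp_0. apply exp_le. unfold zmul, u0. simpl.
          rewrite <- INR_IZR_INZ. assert (0 <= INR p) by apply pos_INR. nra. }
        assert (H0 := Cmod_ge_0 (c (Z.of_nat p))). nra. }
      destruct p as [|i]; unfold zpair. exact H.
      assert (H2 := Cmod_ge_0 (c (- Z.of_nat (S i))%Z * Cexp (zmul (- Z.of_nat (S i)) u0))).
      match goal with |- context [plus ?a ?b] => change (plus a b) with (Rplus a b) end. lra.
    - apply Rle_trans with (sum_n (zpair (fun m => Cmod (c m * Cexp (zmul m u0)))) p).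
      + destruct p as [|i]. rewrite sum_O. lra. rewrite sum_Sn.
        assert (Hs : 0 <= sum_n (zpair (fun m => Cmod (c m * Cexp (zmul m u0)))) i).
        { clear A. induction i. rewrite sum_O. apply Hpos. rewrite sum_Sn. apply Rplus_le_le_0_compat; auto. }
        set (s := sum_n _ i) in *. set (zz := zpair _ (S i)).
        change (zz <= s + zz). lra.
      + apply sum_n_le_Series; auto. }
  destruct Bx as [B Bx].
  assert (Bt := theta_seq_le q Hq1).
  set (B' := Rmax B (2 * / (1 - Cmod q) + 1)).
  assert (U := three_term_unique q x (theta_seq q) B' Hq0 Hq1 Tx (theta_seq_three_term q Hq0 Hq1)
    (fun p => Rle_trans _ _ _ (Bx p) (Rmax_l _ _)) (fun p => Rle_trans _ _ _ (Bt p) (Rmax_r _ _))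
    Sx (theta_seq_sum q Hq1)).
  destruct (laurent_expansion k a z (RtoC (Re z / 2)) ha Hz) as [A1 _]; try (simpl; lra).
  { apply Cexp_neq_1_Re. simpl; lra. }
  split. apply A1.
  change (row_sum a z m = (Cexp (RtoC (INR k) * Plog z) * false_theta m q)%C).
  rewrite false_theta_seq, <- U.
  assert (Ecm : x (Z.abs_nat m) = c m).
  { destruct (Z_lt_le_dec m 0) as [Hm|Hm].
    - rewrite Exy. unfold y. f_equal. lia.
    - unfold x. f_equal. lia. }
  rewrite Ecm. unfold c. rewrite Cmult_assoc. unfold e. rewrite <- Cexp_plus.
  replace (RtoC (INR k) * Plog z + - (RtoC (INR k) * Plog z))%C with (RtoC 0) by ring.
  rewrite Cexp_0. ring.
Qed.

(** * The circle method *)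

(** Formally log(1 - w) + w is minus the sum of w^j / j over j >= 2, whose real part is smallest at
    w = |w|. The proof compares the derivatives along the rays s w and s |w|, namely -s w^2 / (1 - s
    w) and its value at |w|. *)
Lemma Re_log_1_minus_ge (w : C) : Cmod w < 1 ->
  ln (1 - Cmod w) + Cmod w <= Re (Clog (1 - w)) + Re w.
Proof.
  intros Hw. set (r := Cmod w). assert (Hr := Cmod_ge_0 w). fold r in Hw, Hr.
  set (f := fun s : R => Re (Clog (1 + RtoC s * - w) + RtoC s * w)%C -
                         Re (Clog (1 + RtoC s * - RtoC r) + RtoC s * RtoC r)%C).
  set (f' := fun s : R => Re ((- w) / (1 + RtoC s * - w) + w)%C -
                          Re ((- RtoC r) / (1 + RtoC s * - RtoC r) + RtoC r)%C).
  assert (Hre : forall (y : C) s, Cmod y <= r -> 0 <= s <= 1 -> 1 - s * r <= Re (1 + RtoC s * - y)%C).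
  { intros y s Hy Hs. replace (1 + RtoC s * - y)%C with (1 - RtoC s * y)%C by ring.
    apply Re_1_minus_ge. rewrite Cmod_mult, Cmod_R, Rabs_pos_eq by lra. nra. }
  assert (Hrr : Cmod (RtoC r) <= r) by (rewrite Cmod_R, Rabs_pos_eq; lra).
  assert (D : forall (y : C) s, Cmod y <= r -> 0 <= s <= 1 ->
    Cderiv (fun s => Clog (1 + RtoC s * - y) + RtoC s * y)%C s ((- y) / (1 + RtoC s * - y) + y)%C).
  { intros y s Hy Hs. apply Cderiv_plus.
    - apply (Cderiv_log (fun s => 1 + RtoC s * - y)%C). apply Cderiv_line.
      specialize (Hre y s Hy Hs). nra.
    - apply Cderiv_ext with (fun s => 0 + RtoC s * y)%C. intros; ring. apply Cderiv_line. }
  assert (Hpos : forall s, 0 <= s <= 1 -> 0 <= f' s).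
  { intros s Hs. assert (H1 := Hre w s (Rle_refl _) Hs). assert (H2 := Hre (RtoC r) s Hrr Hs).
    assert (Hp : 0 < 1 - s * r) by nra.
    assert (N1 : (1 + RtoC s * - w)%C <> 0) by (apply Re_pos_neq_0; lra).
    unfold f'.
    replace (- w / (1 + RtoC s * - w) + w)%C with (- (RtoC s * (w * w) / (1 + RtoC s * - w)))%C
      by (field; auto).
    assert (E2 : Re (- RtoC r / (1 + RtoC s * - RtoC r) + RtoC r)%C = - (s * (r * r) / (1 - s * r))).
    { replace (1 + RtoC s * - RtoC r)%C with (RtoC (1 - s * r)) by (rewrite RtoC_minus, RtoC_mult; ring).
      rewrite <- RtoC_opp, <- RtoC_div, <- RtoC_plus by lra. simpl. field. lra. }
    rewrite E2.
    assert (H3 : Re (RtoC s * (w * w) / (1 + RtoC s * - w))%C <= s * (r * r) / (1 - s * r)).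
    { apply Rle_trans with (1 := Re_le_Cmod _). rewrite Cmod_div, !Cmod_mult, Cmod_R, Rabs_pos_eq by (auto; lra).
      fold r. apply Rmult_le_compat_l. apply Rmult_le_pos; nra. apply Rinv_le_contravar; auto.
      apply Rle_trans with (1 := H1). apply Re_le_Cmod. }
    change (Re (- (RtoC s * (w * w) / (1 + RtoC s * - w)))%C) with
      (- Re (RtoC s * (w * w) / (1 + RtoC s * - w))%C). lra. }
  assert (Df : forall s, 0 <= s <= 1 -> is_derive f s (f' s)).
  { intros s Hs. destruct (D w s (Rle_refl _) Hs) as [D1 _].
    destruct (D (RtoC r) s Hrr Hs) as [D2 _]. exact (is_derive_rminus _ _ _ _ _ D1 D2). }
  destruct (MVT_gen f 0 1 f') as [s [Hs E]].
  { rewrite Rmin_left, Rmax_right by lra. intros s Hs. apply Df. lra. }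
  { rewrite Rmin_left, Rmax_right by lra. intros s Hs. apply continuity_pt_filterlim.
    apply (ex_derive_continuous f). eexists. now apply Df. }
  rewrite Rmin_left, Rmax_right in Hs by lra. specialize (Hpos s Hs).
  assert (F0 : f 0 = 0).
  { unfold f. replace (1 + RtoC 0 * - w)%C with (RtoC 1) by ring.
    replace (1 + RtoC 0 * - RtoC r)%C with (RtoC 1) by ring. rewrite Clog_1. simpl. ring. }
  assert (F1 : f 1 = (Re (Clog (1 - w)) + Re w) - (ln (1 - r) + r)).
  { unfold f. replace (1 + RtoC 1 * - w)%C with (1 - w)%C by ring.
    replace (1 + RtoC 1 * - RtoC r)%C with (RtoC (1 - r)) by (rewrite RtoC_minus; ring).
    rewrite Clog_RtoC by lra.
    replace (RtoC 1 * w)%C with w by ring. replace (RtoC 1 * RtoC r)%C with (RtoC r) by ring.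
    reflexivity. }
  rewrite F0, F1 in E. lra.
Qed.

(** Of each logarithm only the linear term keeps its phase; all higher terms are replaced by their
    values on the real axis. The linear terms form two geometric series, and their difference is the
    whole saving off the real axis. *)
Lemma Re_Plog_le (x t : R) : 0 < x ->
  Re (Plog (vline x t)) <= Re (Plog (RtoC x)) - exp (- x) / (1 - exp (- x))
    + Re (Cexp (- vline x t) / (1 - Cexp (- vline x t)))%C.
Proof.
  intros Hx. set (z := vline x t). assert (Hz : Re z = x) by apply Re_vline.
  assert (Pz := Plog_cv z ltac:(lra)). assert (Px := Plog_cv (RtoC x) Hx).
  assert (He : exp (- x) < 1) by (rewrite <- exp_0; apply exp_increasing; lra).
  assert (Gz := Cgeom_S_cv (Cexp (- z)) ltac:(rewrite Cmod_Cexp_opp, Hz; lra)).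
  assert (Gx := Cgeom_S_cv (RtoC (exp (- x)))
    ltac:(rewrite Cmod_R, Rabs_pos_eq; [lra | left; apply exp_pos])).
  assert (L1 := Ccv_Re _ _ Pz).
  assert (L2 := Ccv_Re _ _ (Ccv_plus _ _ _ _ (Ccv_minus _ _ _ _ Px Gx) Gz)).
  assert (E : Re (Plog (RtoC x) - RtoC (exp (- x)) / (1 - RtoC (exp (- x)))
      + Cexp (- z) / (1 - Cexp (- z)))%C =
    Re (Plog (RtoC x)) - exp (- x) / (1 - exp (- x)) + Re (Cexp (- z) / (1 - Cexp (- z)))%C).
  { rewrite <- RtoC_minus, <- RtoC_div by lra. reflexivity. }
  rewrite E in L2.
  refine (is_lim_seq_le _ _ (Finite _) (Finite _) _ L1 L2). cbv beta.
  intros N. induction N as [|N IH].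
  - simpl. lra.
  - rewrite !csum_S.
    assert (T : Re (- logq z N)%C <= Re (- logq (RtoC x) N - Cpow (RtoC (exp (- x))) (S N) + Cpow (Cexp (- z)) (S N))%C).
    { set (w := Cexp (- mul_nat (S N) z)).
      assert (Mw : Cmod w = exp (- (INR (S N) * x))) by (unfold w; rewrite Cmod_Cexp_opp, Re_mul_nat, Hz; reflexivity).
      assert (Hn := INR_S_pos N).
      assert (Mw1 : Cmod w < 1) by (rewrite Mw, <- exp_0; apply exp_increasing; nra).
      assert (H := Re_log_1_minus_ge w Mw1).
      assert (Ex : Cexp (- mul_nat (S N) (RtoC x)) = RtoC (Cmod w)).
      { rewrite Mw, <- Cexp_RtoC. f_equal. unfold mul_nat. rewrite <- RtoC_mult, <- RtoC_opp. reflexivity. }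
      assert (E1 : logq (RtoC x) N = RtoC (ln (1 - Cmod w))).
      { unfold logq. rewrite Ex, <- RtoC_minus, Clog_RtoC by lra. reflexivity. }
      assert (E2 : Cpow (RtoC (exp (- x))) (S N) = RtoC (Cmod w)).
      { rewrite <- Ex, Cexp_mul_nat. f_equal. rewrite <- Cexp_RtoC. f_equal. now rewrite RtoC_opp. }
      assert (E3 : Cpow (Cexp (- z)) (S N) = w) by (unfold w; now rewrite Cexp_mul_nat).
      rewrite E1, E2, E3. unfold logq. fold w.
      change (- Re (Clog (1 - w)) <= - ln (1 - Cmod w) - Cmod w + Re w). lra. }
    set (c1 := csum (logq z) N) in *. set (c2 := csum (logq (RtoC x)) N) in *.
    set (c3 := csum (fun n => Cpow (RtoC (exp (- x))) (S n)) N) in *.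
    set (c4 := csum (fun n => Cpow (Cexp (- z)) (S n)) N) in *.
    change (Re (- c1)%C <= Re (- c2 - c3 + c4)%C) in IH.
    replace (Re (- (c1 + logq z N))%C) with (Re (- c1)%C + Re (- logq z N)%C) by (simpl; ring).
    match goal with |- _ <= ?r => replace r with (Re (- c2 - c3 + c4)%C +
      Re (- logq (RtoC x) N - Cpow (RtoC (exp (- x))) (S N) + Cpow (Cexp (- z)) (S N))%C)
      by (generalize (Cpow (RtoC (exp (- x))) (S N)) (Cpow (Cexp (- z)) (S N)); intros; simpl; ring) end.
    lra.
Qed.

Lemma Re_Plog_real_le : exists K, 0 < K /\
  forall x, 0 < x <= 1 -> Re (Plog (RtoC x)) <= PI * PI / 6 / x + K.
Proof.
  destruct Plog_small as [K [HK HP]]. exists K. split; auto. intros x Hx.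
  assert (HPI := PI_gt_3).
  rewrite Plog_transform by (simpl; lra).
  rewrite <- RtoC_div, <- !RtoC_mult, Clog_RtoC by (try (apply Rmult_lt_0_compat; [apply Rinv_0_lt_compat|]); lra).
  set (w := (RtoC (4 * PI * PI) / RtoC x)%C).
  assert (Ew : w = RtoC (4 * PI * PI / x)) by (unfold w; rewrite RtoC_div; auto; lra).
  assert (Hw : 1 <= 4 * PI * PI / x).
  { apply Rmult_le_reg_r with x. lra. replace (4 * PI * PI / x * x) with (4 * PI * PI) by (field; lra). nra. }
  assert (Hb : Re (Plog w) <= K).
  { apply Rle_trans with (1 := Re_le_Cmod _). apply Rle_trans with (1 := HP w ltac:(rewrite Ew; simpl; lra)).
    assert (exp (- Re w) <= 1) by (rewrite <- exp_0; apply exp_le; rewrite Ew; simpl; lra). nra. }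
  assert (Hln : ln (/ (2 * PI) * x) <= 0).
  { rewrite <- ln_1. apply ln_le. apply Rmult_lt_0_compat. apply Rinv_0_lt_compat. lra. lra.
    apply Rmult_le_reg_l with (2 * PI). lra. rewrite <- Rmult_assoc, Rinv_r by lra. lra. }
  replace (Re _) with (PI * PI / 6 / x + / 2 * ln (/ (2 * PI) * x) - / 24 * x + Re (Plog w)).
  lra. simpl. ring.
Qed.

(** From |z| >= 28 x follows |1 - q| >= 4x, so q/(1 - q) is at most 1/(4x) in modulus, against at
    least 1/x - 1 for its value on the real axis: a saving of 3/(4x) per factor of (q)^{-k}. The
    false theta function is at most 2/(1 - |q|) + 1 <= 5/x. *)
Lemma minor_arc (k : nat) (m : Z) : exists C0, 0 < C0 /\
  forall x t, 0 < x <= 1 -> 28 * x <= Rabs t -> Rabs t <= PI ->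
  Cmod (Cexp (RtoC (INR k) * Plog (vline x t)) * false_theta m (Cexp (- vline x t))) <=
  C0 / x * exp ((INR k * (PI * PI / 6) - 3 / 4 * INR k) / x).
Proof.
  destruct Re_Plog_real_le as [K [HK HP]].
  exists (5 * exp (INR k * (K + 1))). split.
  { apply Rmult_lt_0_compat. lra. apply exp_pos. }
  intros x t Hx Ht1 Ht2. set (z := vline x t). assert (Hz : Re z = x) by apply Re_vline.
  assert (HPI := PI_gt_3).
  assert (He : exp (- x) < 1) by (rewrite <- exp_0; apply exp_increasing; lra).
  assert (Hq : Cmod (Cexp (- z)) = exp (- x)) by (rewrite Cmod_Cexp_opp, Hz; reflexivity).
  assert (H1e := one_minus_exp_ge x ltac:(lra)).
  assert (Hth : Cmod (false_theta m (Cexp (- z))) <= 5 / x).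
  { apply Rle_trans with (1 := false_theta_le _ ltac:(rewrite Hq; lra) m). rewrite Hq.
    assert (/ (1 - exp (- x)) <= / (x / 2)) by (apply Rinv_le_contravar; lra).
    replace (/ (x / 2)) with (2 / x) in H by (field; lra).
    assert (1 <= 1 / x). { apply Rmult_le_reg_r with x. lra. unfold Rdiv. rewrite Rmult_assoc, Rinv_l; lra. }
    unfold Rdiv in *. lra. }
  assert (Hge := Cmod_1_minus_Cexp_ge z ltac:(lra) ltac:(unfold z; rewrite Im_vline; lra)).
  destruct (Cmod_vline_ge x t) as [_ Hzt]. fold z in Hzt.
  assert (Hfrac : Re (Cexp (- z) / (1 - Cexp (- z)))%C <= / (4 * x)).
  { apply Rle_trans with (1 := Re_le_Cmod _). rewrite Cmod_div, Hq by (apply Cmod_gt_0; lra).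
    apply Rle_trans with (1 * / (4 * x)). 2: lra.
    apply Rmult_le_compat; try lra. left; apply exp_pos. left; apply Rinv_0_lt_compat; lra.
    apply Rinv_le_contravar; lra. }
  assert (Hexp : 1 / x - 1 <= exp (- x) / (1 - exp (- x))).
  { assert (Hl : 1 + - x <= exp (- x)) by apply exp_ineq1_le.
    apply Rle_trans with ((1 - x) / x). right; field; lra.
    apply Rmult_le_compat; try lra. left; apply Rinv_0_lt_compat; lra.
    apply Rinv_le_contravar; lra. }
  assert (HR := Re_Plog_le x t ltac:(lra)). fold z in HR. specialize (HP x Hx).
  assert (Hk := pos_INR k).
  assert (Hre : INR k * Re (Plog z) <=
    (INR k * (PI * PI / 6) - 3 / 4 * INR k) / x + INR k * (K + 1)).
  { replace ((INR k * (PI * PI / 6) - 3 / 4 * INR k) / x + INR k * (K + 1)) with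
      (INR k * (PI * PI / 6 / x + K - (1 / x - 1) + / (4 * x))) by (field; lra).
    apply Rmult_le_compat_l; lra. }
  rewrite Cmod_mult, Cmod_Cexp.
  replace (Re (RtoC (INR k) * Plog z)) with (INR k * Re (Plog z)) by (unfold Re; simpl; ring).
  replace (5 * exp (INR k * (K + 1)) / x * exp ((INR k * (PI * PI / 6) - 3 / 4 * INR k) / x)) with
    (exp ((INR k * (PI * PI / 6) - 3 / 4 * INR k) / x + INR k * (K + 1)) * (5 / x))
    by (rewrite exp_plus; field; lra).
  apply Rmult_le_compat; auto. left; apply exp_pos. apply Cmod_ge_0. now apply exp_le.
Qed.

Lemma sum_n_m_csum (f : nat -> C) (N : nat) :
  sum_n_m f 1 N = csum (fun i => f (S i)) N.
Proof.
  induction N as [|N IH]. rewrite sum_n_m_zero by lia. reflexivity.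
  rewrite sum_n_Sm by lia. rewrite IH. reflexivity.
Qed.

(** One term of the exponential series of c/x; it turns an exponential saving into any prescribed
    power of x. *)
Lemma exp_inv_le_pow (c : R) (M : nat) : 0 < c -> exists K, 0 < K /\
  forall x, 0 < x -> exp (- (c / x)) <= K * x ^ M.
Proof.
  intros Hc. exists (INR (fact M) * / c ^ M). split.
  { apply Rmult_lt_0_compat. apply INR_fact_lt_0. apply Rinv_0_lt_compat. now apply pow_lt. }
  intros x Hx. assert (Hcx : 0 < c / x) by now apply Rdiv_lt_0_compat.
  assert (H := pow_fact_le_exp (c / x) M (Rlt_le _ _ Hcx)).
  assert (Hf := INR_fact_lt_0 M).
  assert (Hp : 0 < (c / x) ^ M / INR (fact M)) by (apply Rdiv_lt_0_compat; auto; now apply pow_lt).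
  rewrite exp_Ropp. apply Rle_trans with (/ ((c / x) ^ M / INR (fact M))).
  - now apply Rinv_le_contravar.
  - right. unfold Rdiv. rewrite Rpow_mult_distr, pow_inv.
    assert (0 < c ^ M) by now apply pow_lt. assert (0 < x ^ M) by now apply pow_lt.
    field. repeat split; lra.
Qed.

Definition main_factor (k : nat) (z : C) : C :=
  (RtoC (Rpower (2 * PI) (- (INR k / 2))) * Cpw z (INR k / 2) *
   Cexp (RtoC (INR k * (PI * PI / 6)) / z))%C.

Lemma Cexp_Plog_factor (k : nat) (z : C) : 0 < Re z ->
  Cexp (RtoC (INR k) * Plog z) =
  (main_factor k z * Cexp (- (RtoC (INR k / 24) * z)) *
   Cexp (RtoC (INR k) * Plog (RtoC (4 * PI * PI) / z)))%C.
Proof.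
  intros Hz. assert (HPI := PI_RGT_0). assert (Nz := Re_pos_neq_0 _ Hz).
  rewrite (Plog_transform z Hz). unfold main_factor.
  assert (Hi : 0 < / (2 * PI)) by (apply Rinv_0_lt_compat; lra).
  assert (E : (RtoC (Rpower (2 * PI) (- (INR k / 2))) * Cpw z (INR k / 2))%C =
    Cexp (RtoC (INR k / 2) * Clog (RtoC (/ (2 * PI)) * z))).
  { change (Cexp (RtoC (INR k / 2) * Clog (RtoC (/ (2 * PI)) * z))) with
      (Cpw (RtoC (/ (2 * PI)) * z) (INR k / 2)).
    rewrite Cpw_scal by auto. f_equal. f_equal. unfold Rpower. rewrite ln_Rinv by lra. f_equal. ring. }
  rewrite E, <- !Cexp_plus. f_equal.
  set (l := Clog _). set (p := Plog _). unfold Rdiv. rewrite !RtoC_mult, (RtoC_inv 24), (RtoC_inv 2) by lra.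
  field. auto.
Qed.

(** On the arc x^2 + t^2 <= 785 x^2, and 4 PI^2 >= 36; finally 36/785 > 1/24. *)
Lemma Re_dual_ge (x t : R) : 0 < x -> Rabs t <= 28 * x ->
  / (24 * x) <= Re (RtoC (4 * PI * PI) / vline x t)%C.
Proof.
  intros Hx Ht. assert (HPI := PI_gt_3).
  assert (E : Re (RtoC (4 * PI * PI) / vline x t)%C = 4 * PI * PI * x / (x * x + t * t)).
  { unfold vline, Re. simpl. field. nra. }
  rewrite E.
  assert (Ht2 : t * t <= 784 * (x * x)).
  { replace (t * t) with (Rabs t * Rabs t). assert (H := Rabs_pos t). nra.
    rewrite <- Rabs_mult. apply Rabs_pos_eq. nra. }
  apply Rle_trans with (36 * x / (785 * (x * x))).
  - apply Rmult_le_reg_r with (24 * x * 785). lra.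
    replace (/ (24 * x) * (24 * x * 785)) with 785 by (field; lra).
    replace (36 * x / (785 * (x * x)) * (24 * x * 785)) with (36 * 24) by (field; lra). lra.
  - assert (HPP : 9 <= PI * PI) by nra. assert (Hxx : 0 < x * x) by nra.
    assert (Htt : 0 <= t * t) by nra.
    apply Rmult_le_compat. lra. left; apply Rinv_0_lt_compat; lra.
    replace (4 * PI * PI * x) with (4 * (PI * PI) * x) by ring. nra.
    apply Rinv_le_contravar; lra.
Qed.

Lemma Re_inv_vline_le (A x t : R) : 0 < A -> 0 < x -> Re (RtoC A / vline x t)%C <= A / x.
Proof.
  intros HA Hx.
  assert (E : Re (RtoC A / vline x t)%C = A * x / (x * x + t * t)).
  { unfold vline, Re. simpl. field. nra. }
  rewrite E. apply Rmult_le_reg_r with (x * (x * x + t * t)).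
  apply Rmult_lt_0_compat; nra.
  replace (A * x / (x * x + t * t) * (x * (x * x + t * t))) with (A * x * x) by (field; nra).
  replace (A / x * (x * (x * x + t * t))) with (A * (x * x + t * t)) by (field; lra).
  rewrite Rmult_assoc. apply Rmult_le_compat_l; nra.
Qed.

(** On the arc |z| is comparable to x, so the asymptotic expansion in a fixed sector is an estimate
    in x, while the dual Euler product differs from 1 by an amount exponentially small in 1/x. *)
Lemma major_arc (k : nat) (m : Z) (d : nat -> C) (N : nat) : (1 <= k)%nat -> (1 <= N)%nat ->
  is_asymptotic_coeffs m k d ->
  exists C0 x0, 0 < C0 /\ 0 < x0 /\ forall x t, 0 < x <= x0 -> Rabs t <= 28 * x ->
    let z := vline x t in
    Cmod (Cexp (RtoC (INR k) * Plog z) * false_theta m (Cexp (- z)) -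
          main_factor k z * csum (fun i => d (S i) * Cpow z (S i))%C N) <=
    C0 * (Rpower x (INR k / 2) * x ^ (N + 1)) * exp (INR k * (PI * PI / 6) / x).
Proof.
  intros Hk HN hd. assert (HPI := PI_gt_3).
  destruct (hd N 28 HN) as [B [delta [Hdel Hhd]]].
  destruct Plog_small as [K [HK HP]].
  assert (H24 : 0 < / 24) by lra.
  destruct (exp_inv_le_pow (/ 24) (N + 1) H24) as [K2 [HK2 HE]].
  assert (Hk0 : 0 <= INR k) by apply pos_INR.
  set (SD := sum_n (fun i => Cmod (d (S i))) (pred N)).
  assert (HSD : 0 <= SD).
  { unfold SD. generalize (pred N). intros M. induction M. rewrite sum_O. apply Cmod_ge_0.
    rewrite sum_Sn. apply Rplus_le_le_0_compat; auto. apply Cmod_ge_0. }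
  set (C1 := Rabs B + SD).
  assert (HB := Rabs_pos B).
  set (C2 := 2 * (INR k * K * exp (INR k * K))).
  assert (HC2 : 0 <= C2).
  { unfold C2. apply Rmult_le_pos. lra. apply Rmult_le_pos. nra. left; apply exp_pos. }
  set (C3 := Rabs B * 29 ^ (N + 1) + C1 * (C2 * K2)).
  set (P0 := Rpower (2 * PI) (- (INR k / 2))). assert (HP0 : 0 < P0) by apply exp_pos.
  set (P1 := Rpower 29 (INR k / 2)). assert (HP1 : 0 < P1) by apply exp_pos.
  (* |z| <= 29 x: the first bound on x keeps |z| <= 1 and the dual real part 1/(24 x) at least 1,
     the second keeps |z| below [delta]. The summand 1 only makes the constant positive. *)
  exists (P0 * P1 * (C3 + 1)), (Rmin (/ 29) (delta / 30)).
  assert (H29 : 0 < 29 ^ (N + 1)) by (apply pow_lt; lra).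
  assert (HC3 : 0 <= C3).
  { unfold C3, C1. apply Rplus_le_le_0_compat. nra. apply Rmult_le_pos. lra. nra. }
  split; [|split].
  { apply Rmult_lt_0_compat. nra. lra. }
  { apply Rmin_glb_lt; lra. }
  intros x t [Hx Hx0] Ht z.
  assert (Hx1 : x <= / 29) by (apply Rle_trans with (1 := Hx0); apply Rmin_l).
  assert (Hx2 : x <= delta / 30) by (apply Rle_trans with (1 := Hx0); apply Rmin_r).
  assert (Rz : Re z = x) by apply Re_vline. assert (Iz : Im z = t) by apply Im_vline.
  destruct (Cmod_vline_ge x t) as [Gz _]. fold z in Gz.
  assert (Gz2 : Cmod z <= 29 * x).
  { unfold z, vline. apply Rle_trans with (1 := Cmod_triangle _ _).
    rewrite Cmod_mult, Cmod_Ci, !Cmod_R, (Rabs_pos_eq x) by lra. lra. }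
  assert (Gz1 : Cmod z <= 1) by lra.
  set (Th := (Cexp (- (RtoC (INR k / 24) * z)) * false_theta m (Cexp (- z)))%C).
  set (D := csum (fun i => d (S i) * Cpow z (S i))%C N).
  assert (HT : Cmod (Th - D) <= Rabs B * Cmod z ^ (N + 1)).
  { assert (H := Hhd z ltac:(lra) ltac:(rewrite Iz, Rz; lra) ltac:(lra)).
    rewrite sum_n_m_csum in H. fold Th in H. fold D in H. apply Rle_trans with (1 := H).
    apply Rmult_le_compat_r. apply pow_le, Cmod_ge_0. apply Rle_abs. }
  assert (HD : Cmod D <= SD).
  { unfold D, SD. replace N with (S (pred N)) at 1 by lia. apply Cmod_csum_le. intros i _.
    rewrite Cmod_mult, Cmod_pow.
    assert (Cmod z ^ S i <= 1).
    { rewrite <- (pow1 (S i)). apply pow_incr. split; auto. apply Cmod_ge_0. }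
    assert (H0 := Cmod_ge_0 (d (S i))). nra. }
  assert (HTh : Cmod Th <= C1).
  { replace Th with ((Th - D) + D)%C by ring. apply Rle_trans with (1 := Cmod_triangle _ _).
    unfold C1. apply Rplus_le_compat; auto. apply Rle_trans with (1 := HT).
    assert (Cmod z ^ (N + 1) <= 1).
    { rewrite <- (pow1 (N + 1)). apply pow_incr. split; auto. apply Cmod_ge_0. } nra. }
  set (w := (RtoC (4 * PI * PI) / z)%C).
  assert (Rw : / (24 * x) <= Re w) by (apply Re_dual_ge; auto).
  assert (Rw1 : 1 <= Re w).
  { apply Rle_trans with (2 := Rw). rewrite <- Rinv_1. apply Rinv_le_contravar; lra. }
  assert (HPw := HP w Rw1).
  assert (Hew : exp (- Re w) <= K2 * x ^ (N + 1)).
  { apply Rle_trans with (2 := HE x Hx). apply exp_le.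
    replace (/ 24 / x) with (/ (24 * x)) by (field; lra). lra. }
  assert (Hew1 : exp (- Re w) <= 1) by (rewrite <- exp_0; apply exp_le; lra).
  assert (Hew0 := exp_pos (- Re w)).
  set (W := Cexp (RtoC (INR k) * Plog w)).
  assert (HW : Cmod (W - 1) <= C2 * (K2 * x ^ (N + 1))).
  { apply Rle_trans with (1 := Cexp_minus_1_le _). rewrite Cmod_mult, Cmod_R, Rabs_pos_eq by auto.
    unfold C2. assert (Hp := Cmod_ge_0 (Plog w)).
    assert (Hkp : INR k * Cmod (Plog w) <= INR k * K * exp (- Re w))
      by (rewrite Rmult_assoc; now apply Rmult_le_compat_l).
    assert (Hkp1 : INR k * Cmod (Plog w) <= INR k * K).
    { apply Rmult_le_compat_l; auto. apply Rle_trans with (1 := HPw). nra. }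
    assert (He := exp_le _ _ Hkp1).
    rewrite (Rmult_assoc 2). apply Rmult_le_compat_l. lra.
    apply Rle_trans with (INR k * K * exp (- Re w) * exp (INR k * K)).
    - apply Rmult_le_compat; auto. nra. left; apply exp_pos.
    - assert (0 <= INR k * K * exp (INR k * K)).
      { apply Rmult_le_pos. nra. left; apply exp_pos. } nra. }
  assert (Hx0' : 0 <= x ^ (N + 1)) by (apply pow_le; lra).
  (* The two errors are separated: truncation of the expansion, and the dual factor [W] against
     1. *)
  assert (HF : Cmod (Th * W - D) <= C3 * x ^ (N + 1)).
  { replace (Th * W - D)%C with ((Th - D) + Th * (W - 1))%C by ring.
    apply Rle_trans with (1 := Cmod_triangle _ _). rewrite Cmod_mult. unfold C3.
    rewrite Rmult_plus_distr_r. apply Rplus_le_compat.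
    - apply Rle_trans with (1 := HT). rewrite Rmult_assoc. apply Rmult_le_compat_l; auto.
      rewrite <- Rpow_mult_distr. apply pow_incr. split; auto. apply Cmod_ge_0.
    - rewrite !Rmult_assoc. apply Rmult_le_compat; try apply Cmod_ge_0; auto. }
  rewrite (Cexp_Plog_factor k z) by lra. fold w. fold W.
  replace (main_factor k z * Cexp (- (RtoC (INR k / 24) * z)) * W * false_theta m (Cexp (- z)) -
    main_factor k z * D)%C with (main_factor k z * (Th * W - D))%C by (unfold Th; ring).
  rewrite Cmod_mult. unfold main_factor.
  rewrite !Cmod_mult, Cmod_R, Cmod_Cpw, Cmod_Cexp, Rabs_pos_eq by (left; exact HP0).
  fold P0.
  assert (HA : 0 < INR k * (PI * PI / 6)).
  { apply Rmult_lt_0_compat. apply lt_0_INR; lia. nra. }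
  assert (M1 : Rpower (Cmod z) (INR k / 2) <= P1 * Rpower x (INR k / 2)).
  { unfold P1. rewrite Rpower_mult_distr by lra. apply Rpower_le_pos; lra. }
  assert (M2 : exp (Re (RtoC (INR k * (PI * PI / 6)) / z)) <= exp (INR k * (PI * PI / 6) / x)).
  { apply exp_le. now apply Re_inv_vline_le. }
  assert (HR := exp_pos (INR k / 2 * ln x)). fold (Rpower x (INR k / 2)) in HR.
  assert (HE0 := exp_pos (INR k * (PI * PI / 6) / x)).
  set (e2 := exp (INR k * (PI * PI / 6) / x)) in *. set (rp := Rpower x (INR k / 2)) in *.
  apply Rle_trans with (P0 * (P1 * rp) * e2 * (C3 * x ^ (N + 1))).
  - apply Rmult_le_compat; auto; try apply Cmod_ge_0.
    + apply Rmult_le_pos. apply Rmult_le_pos. lra. left; apply exp_pos. left; apply exp_pos.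
    + apply Rmult_le_compat; auto.
      apply Rmult_le_pos. lra. left; apply exp_pos. left; apply exp_pos.
      apply Rmult_le_compat_l; auto. lra.
  - replace (P0 * P1 * (C3 + 1) * (rp * x ^ (N + 1)) * e2) with
      (P0 * (P1 * rp) * e2 * ((C3 + 1) * x ^ (N + 1))) by ring.
    apply Rmult_le_compat_l. apply Rmult_le_pos. apply Rmult_le_pos; nra. lra. nra.
Qed.

(** With b = PI sqrt(k/6), A is b^2 and half the Bessel argument is b sqrt n. The index is -1 - s
    for s = k/2 + l, so j + nu + 1 = j - s, and the prefactors complete the power of b to b^{2j} =
    A^j. *)
Lemma bterm_BesselI (k n l : nat) : (1 <= k)%nat -> (1 <= n)%nat ->
  Series (bterm (INR k * (PI * PI / 6)) (INR k / 2 + INR l) (INR n)) =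
  Rpower (INR n) (- ((2 + 2 * INR l + INR k) / 4)) *
  Rpower (PI * sqrt (INR k / 6)) (1 + INR l + INR k / 2) *
  BesselI (-1 - INR l - INR k / 2) (PI * sqrt (2 * INR k * INR n / 3)).
Proof.
  intros Hk Hn. assert (HPI := PI_RGT_0).
  assert (Hkr : 0 < INR k) by (apply lt_0_INR; lia).
  assert (Hnr : 0 < INR n) by (apply lt_0_INR; lia).
  set (b := PI * sqrt (INR k / 6)).
  assert (Hsk : 0 < sqrt (INR k / 6)) by (apply sqrt_lt_R0; lra).
  assert (Hb : 0 < b) by (unfold b; nra).
  assert (Hsn : 0 < sqrt (INR n)) by now apply sqrt_lt_R0.
  assert (Hb2 : b * b = INR k * (PI * PI / 6)).
  { unfold b. replace (PI * sqrt (INR k / 6) * (PI * sqrt (INR k / 6))) with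
      (PI * PI * (sqrt (INR k / 6) * sqrt (INR k / 6))) by ring.
    rewrite sqrt_sqrt by lra. field. }
  assert (Hhalf : PI * sqrt (2 * INR k * INR n / 3) / 2 = b * sqrt (INR n)).
  { replace (2 * INR k * INR n / 3) with (2 * 2 * ((INR k / 6) * INR n)) by field.
    rewrite sqrt_mult_alt by lra. rewrite sqrt_square by lra.
    rewrite sqrt_mult_alt by lra. unfold b. field. }
  unfold BesselI. rewrite Hhalf, <- Series_scal_l. apply Series_ext. intros j.
  unfold bterm.
  replace (INR j + (-1 - INR l - INR k / 2) + 1) with (INR j - (INR k / 2 + INR l)) by ring.
  set (s := INR k / 2 + INR l). set (g := rGamma (INR j - s)).
  assert (Hf := INR_fact_neq_0 j).
  assert (E : Rpower (INR n) (- ((2 + 2 * INR l + INR k) / 4)) * Rpower b (1 + INR l + INR k / 2) *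
    Rpower (b * sqrt (INR n)) (2 * INR j + (-1 - INR l - INR k / 2)) =
    (INR k * (PI * PI / 6)) ^ j * Rpower (INR n) (INR j - s - 1)).
  { rewrite <- Rpower_mult_distr by auto. rewrite <- (Rpower_sqrt (INR n)) by auto.
    rewrite Rpower_mult.
    replace (Rpower (INR n) (- ((2 + 2 * INR l + INR k) / 4)) * Rpower b (1 + INR l + INR k / 2) *
      (Rpower b (2 * INR j + (-1 - INR l - INR k / 2)) *
       Rpower (INR n) (/ 2 * (2 * INR j + (-1 - INR l - INR k / 2))))) with
     ((Rpower b (1 + INR l + INR k / 2) * Rpower b (2 * INR j + (-1 - INR l - INR k / 2))) *
      (Rpower (INR n) (- ((2 + 2 * INR l + INR k) / 4)) *
       Rpower (INR n) (/ 2 * (2 * INR j + (-1 - INR l - INR k / 2))))) by ring.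
    rewrite <- !Rpower_plus. f_equal.
    - replace (1 + INR l + INR k / 2 + (2 * INR j + (-1 - INR l - INR k / 2))) with (INR (2 * j))
        by (rewrite mult_INR; simpl; ring).
      rewrite Rpower_pow by auto. rewrite pow_mult. f_equal. rewrite <- Hb2. ring.
    - f_equal. unfold s. field. }
  transitivity ((INR k * (PI * PI / 6)) ^ j * Rpower (INR n) (INR j - s - 1) * / INR (fact j) * g).
  unfold Rdiv; ring. rewrite <- E. unfold Rdiv; ring.
Qed.

Lemma bessel_integral_upto (A s : R) (N : nat) : 0 < A -> 0 <= s ->
  exists B, 0 <= B /\ forall i, (i < N)%nat -> forall n x : R, 1 <= n -> 0 < x -> A = n * x * x ->
  exists I : C,
    is_Cint (fun t => Cpw (vline x t) (s + INR (S i)) *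
                      Cexp (RtoC A / vline x t + RtoC n * vline x t))%C (- (28 * x)) (28 * x) I /\
    Cmod (I - RtoC (2 * PI * Series (bterm A (s + INR (S i)) n))) <= B * exp (5 / 4 * (n * x)).
Proof.
  intros HA Hs. induction N as [|N [B [HB IH]]].
  - exists 0. split. lra. intros i Hi. lia.
  - assert (Hn := pos_INR (S N)).
    destruct (bessel_integral A (s + INR (S N)) HA ltac:(lra)) as [B2 H2].
    exists (Rmax B (Rabs B2)). split. apply Rle_trans with (1 := HB). apply Rmax_l.
    intros i Hi n x H1 Hx HAx. assert (He := exp_pos (5 / 4 * (n * x))).
    destruct (Nat.eq_dec i N) as [E|E].
    + subst i. destruct (H2 n x H1 Hx HAx) as [I [P1 [P2 _]]]. exists I. split; auto.
      apply Rle_trans with (1 := P2). apply Rmult_le_compat_r. lra.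
      apply Rle_trans with (Rabs B2). apply Rle_abs. apply Rmax_r.
    + destruct (IH i ltac:(lia) n x H1 Hx HAx) as [I [P1 P2]]. exists I. split; auto.
      apply Rle_trans with (1 := P2). apply Rmult_le_compat_r. lra. apply Rmax_l.
Qed.

Lemma Rpower_ge_pow (x e : R) (M : nat) : 0 < x <= 1 -> e <= INR M -> x ^ M <= Rpower x e.
Proof.
  intros Hx He. rewrite <- Rpower_pow by lra. unfold Rpower. apply exp_le.
  assert (ln x <= 0) by (rewrite <- ln_1; apply ln_le; lra). nra.
Qed.

Theorem theorem1p1 (k : nat) (m : Z) (a : Z -> nat -> Z) (d : nat -> C)
  (hk : (1 <= k)%nat)
  (ha : is_expansion_coeffs k a)
  (hd : is_asymptotic_coeffs m k d)
  (N : nat) (hN : (1 <= N)%nat) :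
  exists (B : R) (n0 : nat), forall n : nat, (n0 <= n)%nat ->
    Cmod (RtoC (IZR (a m n))
          - RtoC (Rpower (2 * PI) (- (INR k / 2))) *
            sum_n_m (fun l : nat =>
              d l
              * RtoC (Rpower (INR n) (- ((2 + 2 * INR l + INR k) / 4)))
              * RtoC (Rpower (PI * sqrt (INR k / 6)) (1 + INR l + INR k / 2))
              * RtoC (BesselI (-1 - INR l - INR k / 2)
                              (PI * sqrt (2 * INR k * INR n / 3)))) 1 N)%C
    <= B * (Rpower (INR n) (-1 - INR N / 2 - INR k / 4)
            * exp (PI * sqrt (2 * INR k * INR n / 3))).
Proof.
  assert (HPI := PI_gt_3).
  assert (Hk : 1 <= INR k) by (apply (le_INR 1); auto).
  set (A := INR k * (PI * PI / 6)). assert (HA : 0 < A) by (unfold A; nra).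
  set (P0 := Rpower (2 * PI) (- (INR k / 2))). assert (HP0 : 0 < P0) by apply exp_pos.
  destruct (minor_arc k m) as [Cm [HCm Hminor]]. fold A in Hminor.
  destruct (major_arc k m d N hk hN hd) as [CM [x0 [HCM [Hx0 Hmajor]]]]. fold A in Hmajor.
  destruct (bessel_integral_upto A (INR k / 2) N HA ltac:(lra)) as [BB [HBB Hbes]].
  (* The error has size x^e: x^{N+1} from the expansion, x^{k/2} from the main factor, one more x
     from the length of the arc. As x is of order n^{-1/2}, this is n^{-1-N/2-k/4}. [M] is an
     integer above e for the exponentially small errors. *)
  set (e := INR N + 2 + INR k / 2). set (M := (N + 2 + k)%nat).
  assert (HeM : e <= INR M) by (unfold e, M; rewrite !plus_INR; simpl; lra).
  (* The additional power absorbs the factor 1/x of the minor arcs. The saving 3A/(4x) in the next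
     line is 2A/x minus the 5A/(4x) of the Bessel error. *)
  destruct (exp_inv_le_pow (3 / 4 * INR k) (M + 1) ltac:(lra)) as [K1 [HK1 HE1]].
  destruct (exp_inv_le_pow (3 / 4 * A) M ltac:(lra)) as [K2 [HK2 HE2]].
  set (SD := sum_n (fun i => Cmod (d (S i))) (pred N)).
  assert (HSD : 0 <= SD).
  { unfold SD. generalize (pred N). intros j. induction j. rewrite sum_O. apply Cmod_ge_0.
    rewrite sum_Sn. apply Rplus_le_le_0_compat; auto. apply Cmod_ge_0. }
  set (Ctot := / (2 * PI) * (4 * PI * Cm * K1 + 112 * CM + P0 * (SD * (BB * K2)))).
  (* x <= 1/10 gives 28 x < 3 < PI, so the major arc fits into one period. *)
  set (x1 := Rmin x0 (/ 10)). assert (Hx1 : 0 < x1) by (apply Rmin_glb_lt; lra).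
  destruct (INR_unbounded (A / (x1 * x1) + 1)) as [n0 Hn0].
  exists (Ctot * Rpower A (e / 2)), n0. intros n Hn.
  assert (HAx : 0 < A / (x1 * x1)) by (apply Rdiv_lt_0_compat; nra).
  assert (Hnr : A / (x1 * x1) + 1 < INR n) by (apply Rlt_le_trans with (1 := Hn0); now apply le_INR).
  assert (Hn1 : 1 <= INR n) by lra.
  assert (Hn1' : (1 <= n)%nat) by (apply INR_le; simpl; lra).
  set (x := sqrt (A / INR n)).
  assert (HAn : 0 < A / INR n) by (apply Rdiv_lt_0_compat; lra).
  assert (Hx : 0 < x) by now apply sqrt_lt_R0.
  assert (Hxx : x * x = A / INR n) by (apply sqrt_sqrt; lra).
  assert (EA : A = INR n * x * x) by (rewrite Rmult_assoc, Hxx; field; lra).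
  assert (Ev : A / x = INR n * x) by (rewrite EA; field; lra).
  assert (Hxx1 : x <= x1).
  { apply Rsqr_incr_0_var; [unfold Rsqr | lra]. rewrite Hxx.
    apply Rmult_le_reg_r with (INR n). lra.
    replace (A / INR n * INR n) with A by (field; lra).
    assert (A = x1 * x1 * (A / (x1 * x1))) by (field; lra). assert (0 < x1 * x1) by nra. nra. }
  assert (Hxa : x <= x0) by (apply Rle_trans with (1 := Hxx1); apply Rmin_l).
  assert (Hxb : x <= / 10) by (apply Rle_trans with (1 := Hxx1); apply Rmin_r).
  set (y := 28 * x). assert (Hy : 0 < y < PI) by (unfold y; lra).
  (* At the saddle point e^{nx} and e^{A/x} coincide; their product [E2] is the exponential of the
     statement. *)
  set (E2 := exp (2 * (A / x))). assert (HE2p : 0 < E2) by apply exp_pos.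
  set (X := Rpower x e). assert (HX : 0 < X) by apply exp_pos.
  assert (HxM : x ^ M <= X) by (apply Rpower_ge_pow; auto; lra).
  set (F := fun t => (Cexp (RtoC (INR k) * Plog (vline x t)) * false_theta m (Cexp (- vline x t)) *
                      Cexp (RtoC (INR n) * vline x t))%C).
  assert (Mn : forall t, Cmod (Cexp (RtoC (INR n) * vline x t)) = exp (A / x)).
  { intros t. rewrite Cmod_Cexp, Ev. f_equal. unfold vline, Re. simpl. ring. }
  assert (HF : is_Cint F (- PI) PI (RtoC (2 * PI) * RtoC (IZR (a m n)))%C).
  { assert (Hs : ex_series (fun j => Cmod (RtoC (IZR (a m j))) * exp (- (INR j * x)))).
    { destruct (generating_function k a (vline x 0) m ha ltac:(rewrite Re_vline; lra)) as [S1 _].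
      apply ex_series_ext with (2 := S1). intros j.
      rewrite Cmod_mult, Cmod_Cexp_opp, Re_mul_nat, Re_vline. reflexivity. }
    assert (P := power_series_coefficient (fun j => RtoC (IZR (a m j))) x n Hs).
    apply is_Cint_ext with (3 := P). lra. intros t _. unfold F.
    destruct (generating_function k a (vline x t) m ha ltac:(rewrite Re_vline; lra)) as [_ S2].
    rewrite S2. reflexivity. }
  destruct (is_Cint_sub F (- PI) PI (- PI) (- y) _ ltac:(lra) ltac:(lra) ltac:(lra) HF) as [A1 HA1].
  destruct (is_Cint_sub F (- PI) PI (- y) y _ ltac:(lra) ltac:(lra) ltac:(lra) HF) as [A2 HA2].
  destruct (is_Cint_sub F (- PI) PI y PI _ ltac:(lra) ltac:(lra) ltac:(lra) HF) as [A3 HA3].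
  assert (Esplit := is_Cint_unique _ _ _ _ _ HF
    (is_Cint_Chasles _ _ _ _ _ _ HA1 (is_Cint_Chasles _ _ _ _ _ _ HA2 HA3))).
  assert (Bmin : forall t, y <= Rabs t -> Rabs t <= PI -> Cmod (F t) <= Cm * K1 * X * E2).
  { intros t Ht1 Ht2. unfold F. rewrite Cmod_mult, Mn.
    apply Rle_trans with (Cm / x * exp ((A - 3 / 4 * INR k) / x) * exp (A / x)).
    - apply Rmult_le_compat_r. left; apply exp_pos. apply Hminor; auto. lra.
    - replace (Cm / x * exp ((A - 3 / 4 * INR k) / x) * exp (A / x)) with
        (Cm / x * exp (- (3 / 4 * INR k / x)) * E2).
      2: { unfold E2. rewrite !Rmult_assoc, <- !exp_plus. f_equal. f_equal. field. lra. }
      apply Rmult_le_compat_r. lra.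
      apply Rle_trans with (Cm / x * (K1 * x ^ (M + 1))).
      + apply Rmult_le_compat_l. left; apply Rdiv_lt_0_compat; lra. apply HE1; auto.
      + rewrite pow_add, pow_1. replace (Cm / x * (K1 * (x ^ M * x))) with (Cm * K1 * x ^ M) by (field; lra).
        apply Rmult_le_compat_l; auto. left; now apply Rmult_lt_0_compat. }
  assert (HG : 0 <= Cm * K1 * X * E2).
  { left. repeat apply Rmult_lt_0_compat; auto. }
  assert (B1 : Cmod A1 <= 2 * (PI * (Cm * K1 * X * E2))).
  { apply Rle_trans with (2 * ((- y - - PI) * (Cm * K1 * X * E2))).
    - apply (is_Cint_le_const F); auto. lra. intros t Ht.
      apply Bmin; rewrite Rabs_left by lra; lra.
    - apply Rmult_le_compat_l. lra. apply Rmult_le_compat_r; lra. }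
  assert (B3 : Cmod A3 <= 2 * (PI * (Cm * K1 * X * E2))).
  { apply Rle_trans with (2 * ((PI - y) * (Cm * K1 * X * E2))).
    - apply (is_Cint_le_const F); auto. lra. intros t Ht.
      apply Bmin; rewrite Rabs_pos_eq by lra; lra.
    - apply Rmult_le_compat_l. lra. apply Rmult_le_compat_r; lra. }
  set (kern := fun i t => (Cpw (vline x t) (INR k / 2 + INR (S i)) *
                      Cexp (RtoC A / vline x t + RtoC (INR n) * vline x t))%C).
  set (I := fun i => Cint (kern i) (- y) y).
  set (beta := fun i => Series (bterm A (INR k / 2 + INR (S i)) (INR n))).
  assert (HI : forall i, (i < N)%nat -> is_Cint (kern i) (- y) y (I i) /\
    Cmod (I i - RtoC (2 * PI * beta i)) <= BB * (K2 * X * E2)).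
  { intros i Hi. destruct (Hbes i Hi (INR n) x Hn1 Hx EA) as [l [P1 P2]].
    unfold I. change (is_Cint (kern i) (- y) y l) in P1. rewrite (is_Cint_Cint _ _ _ _ P1).
    split; auto. apply Rle_trans with (1 := P2). apply Rmult_le_compat_l; auto.
    rewrite <- Ev. replace (exp (5 / 4 * (A / x))) with (exp (- (3 / 4 * A / x)) * E2).
    2: { unfold E2. rewrite <- exp_plus. f_equal. field. lra. }
    apply Rmult_le_compat_r. lra. apply Rle_trans with (1 := HE2 x Hx).
    apply Rmult_le_compat_l; lra. }
  set (MI := csum (fun i => RtoC P0 * d (S i) * I i)%C N).
  set (Mt := fun t => csum (fun i => RtoC P0 * d (S i) * kern i t)%C N).
  assert (HMI : is_Cint Mt (- y) y MI).
  { apply is_Cint_csum. intros i Hi. apply is_Cint_scal. now apply HI. }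
  assert (EMt : forall t, Mt t = (main_factor k (vline x t) *
     csum (fun i => d (S i) * Cpow (vline x t) (S i)) N * Cexp (RtoC (INR n) * vline x t))%C).
  { intros t. set (z := vline x t). assert (Rz : 0 < Re z) by (unfold z; rewrite Re_vline; lra).
    transitivity ((main_factor k z * Cexp (RtoC (INR n) * z)) *
      csum (fun i => d (S i) * Cpow z (S i)) N)%C. 2: ring.
    rewrite <- csum_scal. apply csum_ext. intros i _. unfold kern. fold z.
    rewrite Cpw_plus, Cpw_INR, Cexp_plus by auto. unfold main_factor. fold P0. fold A. ring. }
  assert (B2 : Cmod (A2 - MI) <= 112 * CM * X * E2).
  { apply Rle_trans with (2 * ((y - - y) * (CM * (Rpower x (INR k / 2) * x ^ (N + 1)) * E2))).
    - apply (is_Cint_le_const (fun t => F t - Mt t)%C). lra. 2: now apply is_Cint_minus.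
      intros t Ht. rewrite EMt. unfold F.
      match goal with |- Cmod (?u * ?w - ?v * ?w) <= _ =>
        replace (u * w - v * w)%C with ((u - v) * w)%C by ring end.
      rewrite Cmod_mult, Mn.
      replace (CM * (Rpower x (INR k / 2) * x ^ (N + 1)) * E2) with
        (CM * (Rpower x (INR k / 2) * x ^ (N + 1)) * exp (A / x) * exp (A / x)).
      2: { unfold E2. rewrite Rmult_assoc, <- exp_plus. f_equal. f_equal. ring. }
      apply Rmult_le_compat_r. left; apply exp_pos.
      apply (Hmajor x t). lra. apply Rabs_le. unfold y in Ht. lra.
    - right. unfold y, X, e.
      replace (INR N + 2 + INR k / 2) with (INR k / 2 + INR (N + 2)) by (rewrite plus_INR; simpl; ring).
      rewrite Rpower_plus, Rpower_pow by auto. rewrite !pow_add. simpl. ring. }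
  assert (B4 : Cmod (MI - RtoC (2 * PI) * (RtoC P0 * csum (fun i => d (S i) * RtoC (beta i))%C N)) <=
    P0 * (SD * (BB * K2)) * X * E2).
  { replace (MI - RtoC (2 * PI) * (RtoC P0 * csum (fun i => d (S i) * RtoC (beta i))%C N))%C with
      (RtoC P0 * csum (fun i => d (S i) * (I i - RtoC (2 * PI * beta i)))%C N)%C.
    - rewrite Cmod_mult, Cmod_R, Rabs_pos_eq by lra. rewrite !(Rmult_assoc P0).
      apply Rmult_le_compat_l. lra.
      apply Rle_trans with (sum_n (fun i => Cmod (d (S i)) * (BB * (K2 * X * E2))) (pred N)).
      + replace N with (S (pred N)) at 1 by lia. apply Cmod_csum_le. intros i Hi.
        rewrite Cmod_mult. apply Rmult_le_compat_l. apply Cmod_ge_0. apply HI. lia.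
      + right. transitivity (SD * (BB * (K2 * X * E2))). 2: ring.
        apply (sum_n_mult_r (K := R_Ring) (BB * (K2 * X * E2)) (fun i => Cmod (d (S i))) (pred N)).
    - unfold MI. rewrite <- !csum_scal, <- csum_minus. apply csum_ext. intros i _.
      rewrite (RtoC_mult (2 * PI) (beta i)). ring. }
  (* The index l from 1 to N of the statement is [S i] with i < N in the sums over the arc. *)
  assert (Esum : sum_n_m (fun l : nat =>
              d l
              * RtoC (Rpower (INR n) (- ((2 + 2 * INR l + INR k) / 4)))
              * RtoC (Rpower (PI * sqrt (INR k / 6)) (1 + INR l + INR k / 2))
              * RtoC (BesselI (-1 - INR l - INR k / 2)
                              (PI * sqrt (2 * INR k * INR n / 3))))%C 1 N =
     csum (fun i => d (S i) * RtoC (beta i))%C N).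
  { rewrite sum_n_m_csum. apply csum_ext. intros i _. unfold beta, A.
    rewrite bterm_BesselI by auto. rewrite !RtoC_mult. ring. }
  rewrite Esum. set (Bs := csum (fun i => d (S i) * RtoC (beta i))%C N) in *.
  assert (Eexp : exp (PI * sqrt (2 * INR k * INR n / 3)) = E2).
  { unfold E2. f_equal. rewrite Ev. symmetry. unfold x.
    replace (INR n) with (sqrt (INR n * INR n)) at 1 by (apply sqrt_square; lra).
    rewrite <- sqrt_mult_alt by nra.
    replace (INR n * INR n * (A / INR n)) with (PI * PI * (INR k * INR n / 6)) by (unfold A; field; lra).
    rewrite sqrt_mult_alt by nra. rewrite sqrt_square by lra.
    replace (2 * INR k * INR n / 3) with (2 * 2 * (INR k * INR n / 6)) by field.
    rewrite sqrt_mult_alt by lra. rewrite sqrt_square by lra. ring. }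
  assert (EX : X = Rpower A (e / 2) * Rpower (INR n) (-1 - INR N / 2 - INR k / 4)).
  { unfold X, x. rewrite <- Rpower_sqrt by auto. rewrite Rpower_mult.
    unfold Rdiv at 1. rewrite <- Rpower_mult_distr by (auto; apply Rinv_0_lt_compat; lra).
    replace (/ 2 * e) with (e / 2) by field. f_equal.
    unfold Rpower. rewrite ln_Rinv by lra. f_equal. unfold e. field. }
  rewrite Eexp.
  replace (Ctot * Rpower A (e / 2) * (Rpower (INR n) (-1 - INR N / 2 - INR k / 4) * E2)) with
    (Ctot * X * E2) by (rewrite EX; ring).
  set (an := RtoC (IZR (a m n))) in *.
  assert (N2 : RtoC (2 * PI) <> 0) by (apply RtoC_neq_0; lra).
  replace (an - RtoC P0 * Bs)%C with
    (/ RtoC (2 * PI) * (A1 + A3 + ((A2 - MI) + (MI - RtoC (2 * PI) * (RtoC P0 * Bs)))))%C.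
  2: { transitivity (/ RtoC (2 * PI) * ((A1 + (A2 + A3)) - RtoC (2 * PI) * (RtoC P0 * Bs)))%C. ring.
       rewrite <- Esplit. field. auto. }
  rewrite Cmod_mult, Cmod_inv, Cmod_R, Rabs_pos_eq by (auto; lra).
  unfold Ctot. rewrite !(Rmult_assoc (/ (2 * PI))). apply Rmult_le_compat_l.
  left; apply Rinv_0_lt_compat; lra.
  apply Rle_trans with (1 := Cmod_triangle _ _).
  assert (T1 := Cmod_triangle A1 A3).
  assert (T2 := Cmod_triangle (A2 - MI) (MI - RtoC (2 * PI) * (RtoC P0 * Bs))).
  replace ((4 * PI * Cm * K1 + 112 * CM + P0 * (SD * (BB * K2))) * X * E2) with
    (2 * (PI * (Cm * K1 * X * E2)) + 2 * (PI * (Cm * K1 * X * E2)) + 112 * CM * X * E2 +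
     P0 * (SD * (BB * K2)) * X * E2) by ring.
  lra.
Qed.
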